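(* Let $\mathcal A$ be a Fell bundle over an étale groupoid $G$ with a locally compact Hausdorff unit space $X$. Put $A=C_0(X,\mathcal A|_X)$ and let $B$ be a $C^*$-algebra with surjective $*$-homomorphisms $C^*(G,\mathcal A)\twoheadrightarrow B\twoheadrightarrow C^*_{\mathrm r}(G,\mathcal A)$ that compose to the quotient map $C^*(G,\mathcal A)\twoheadrightarrow C^*_{\mathrm r}(G,\mathcal A)$. (1) A pure state $f\in P(A)$ belongs to $P_1(A\uparrow B)$ if and only if (the class of) the GNS representation of $f$ has trivial isotropy in the dual groupoid $\widehat A\rtimes G$. (2) The inclusion $A\hookrightarrow B$ has the extension property if and only if the dual groupoid $\widehat A\rtimes G$ is principal. (3) The inclusion $A\hookrightarrow B$ has the almost extension property if and only if the dual groupoid $\widehat A\rtimes G$ is topologically principal.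
   Context: Ideals are closed and two-sided. A topological groupoid $G$ is étale if its range and source maps $r,s$ are local homeomorphisms. A bisection is an open subset $U\subseteq G$ on which $r$ and $s$ are injective. A Fell bundle over $G$ is an upper-semicontinuous bundle $\mathcal A=(A_\gamma)_{\gamma\in G}$ of Banach spaces with a continuous bilinear associative multiplication $A_\gamma\times A_\eta\to A_{\gamma\eta}$ for composable $(\gamma,\eta)$ and a continuous conjugate-linear involution $A_\gamma\to A_{\gamma^{-1}}$ with $(ab)^*=b^*a^*$, $\|ab\|\le\|a\|\|b\|$, $\|a^*a\|=\|a\|^2$ and $a^*a\ge0$ in the $C^*$-algebra $A_{s(\gamma)}$ for $a\in A_\gamma$ (not necessarily saturated). For a bisection $U$, $C_0(U,\mathcal A|_U)$ is a Hilbert $A$-bimodule with the multiplication of $\mathcal A$ and inner products $\langle x\mid y\rangle=x^*y$, $\langle\!\langle x\mid y\rangle\!\rangle=xy^*$. (A Hilbert $A$-bimodule $\mathcal E$ is an $A$-bimodule that is a right and a left Hilbert $A$-module with $\langle\!\langle x\mid y\rangle\!\rangle z=x\langle y\mid z\rangle$; $s(\mathcal E)$, $r(\mathcal E)$ denote the closed ideals generated by the right and left inner products.) Let $S$ be the set of all Hilbert $A$-subbimodules of $C_0(U,\mathcal A|_U)$ for all bisections $U$ (viewed as spaces of sections of $\mathcal A$); it is a unital inverse semigroup under the closed linear span of products, with unit $A$, and natural partial order $v\le t$ iff $v\subseteq t$. For $t\in S$ put $\mathcal E_t=t$; with the multiplication $\mu_{t,u}\colon\mathcal E_t\otimes_A\mathcal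 E_u\to\mathcal E_{tu}$ of $\mathcal A$ this is an action of $S$ on $A$ by Hilbert bimodules. The section $C^*$-algebras are $C^*(G,\mathcal A)\cong A\rtimes S$ and $C^*_{\mathrm r}(G,\mathcal A)\cong A\rtimes_{\mathrm r}S$, where: $A\rtimes S$ is the universal $C^*$-algebra generated by the images of linear maps $\pi_t\colon\mathcal E_t\to A\rtimes S$ with $\pi_t(x)\pi_u(y)=\pi_{tu}(xy)$, $\pi_t(x)^*\pi_t(y)=\pi_1(\langle x\mid y\rangle)$, $\pi_t(x)\pi_t(y)^*=\pi_1(\langle\!\langle x\mid y\rangle\!\rangle)$; with $I_{1,t}=\overline{\sum_{v\le t,1}s(\mathcal E_v)}$ one has $\mathcal E_t\cdot I_{1,t}= I_{1,t}\subseteq A$ as spaces of sections, there is a unique completely positive contraction $E_{\mathrm r}\colon A\rtimes S\to A''$ with $E_{\mathrm r}(\pi_t(x))=\text{weak-}*\lim xu_i$ for an approximate unit $(u_i)$ of $I_{1,t}$, and $A\rtimes_{\mathrm r}S$ is the quotient of $A\rtimes S$ by the largest two-sided ideal contained in $\ker E_{\mathrm r}$. $A$ embeds into these algebras and into $B$. Dual groupoid. $\widehat A$ is the space of unitary equivalence classes of irreducible representations of $A$, with open subsets $\widehat J=\{[\varrho]:\varrho|_J\ne0\}$ for ideals $J$. A Hilbert $A$-bimodule $\mathcal E$ induces a homeomorphism $\widehat{\mathcal E}\colon\widehat{s(\mathcal E)}\to\widehat{r(\mathcal E)}$, $[\varrho]\mapsto[\mathcal E\otimes_\varrho\mathcal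 H]$. The dual groupoid $\widehat A\rtimes G\cong\widehat A\rtimes S$ has as arrows the germs $[t,[\varrho]]$ with $t\in S$, $[\varrho]\in\widehat{s(\mathcal E_t)}$, where $[t,[\varrho]]=[u,[\varrho']]$ iff $[\varrho]=[\varrho']$ and there is $v\le t,u$ with $[\varrho]\in\widehat{s(\mathcal E_v)}$; source $[\varrho]$, range $\widehat{\mathcal E_t}[\varrho]$, product $[t,\widehat{\mathcal E_u}[\varrho]]\cdot[u,[\varrho]]=[tu,[\varrho]]$; the sets $\{[t,[\varrho]]:[\varrho]\in V\}$, $V\subseteq\widehat{s(\mathcal E_t)}$ open, form a basis of its topology; the unit space is $\widehat A$. (It is the transformation groupoid of the action of $G$ on $\widehat A$ induced by the Hilbert bimodules $A_\gamma$.) A unit has trivial isotropy if the only arrow with source and range that unit is the unit arrow. A groupoid is principal if all units have trivial isotropy, and a topological groupoid is topologically principal if the set of units with trivial isotropy is dense in the unit space. Extension properties. $P(A)$ is the set of pure states of $A$, and $P_1(A\uparrow B)$ is the set of pure states on $A$ that extend uniquely to a state on $B$. $A\subseteq B$ has the almost extension property if $P_1(A\uparrow B)$ is weak-$*$-dense in $P(A)$, and the extension property if $P_1(A\uparrow B)=P(A)$. *)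

(* Defs.v *)
From HB Require Import structures.
From mathcomp Require Import all_boot all_order all_algebra.
From mathcomp Require Import complex.
From mathcomp Require Import all_classical all_reals all_analysis.

Set Implicit Arguments.
Unset Strict Implicit.
Unset Printing Implicit Defensive.

Import Order.TTheory GRing.Theory Num.Theory.
Import numFieldNormedType.Exports.

Local Open Scope classical_set_scope.
Local Open Scope ring_scope.
Local Open Scope complex_scope.

(* MathComp rings are unital, so the multiplication is part of the record.
   Norms take values in R[i]; `0 <= z` and `x <= y` there force z and y - x to
   be real. *)
Record cstarAlg (R : realType) := CStarAlg {
  cs_sort :> completeNormedModType R[i];
  cmul : cs_sort -> cs_sort -> cs_sort;
  cstar : cs_sort -> cs_sort;
  _ : forall a b c, cmul a (cmul b c) = cmul (cmul a b) c;
  _ : forall k a b c, cmul (k *: a + b) c = k *: cmul a c + cmul b c;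
  _ : forall k a b c, cmul a (k *: b + c) = k *: cmul a b + cmul a c;
  _ : forall k a b, cstar (k *: a + b) = k^* *: cstar a + cstar b;
  _ : forall a b, cstar (cmul a b) = cmul (cstar b) (cstar a);
  _ : forall a, cstar (cstar a) = a;
  _ : forall a b, `|cmul a b| <= `|a| * `|b|;
  _ : forall a, `|cmul (cstar a) a| = `|a| ^+ 2
}.

Section CStar.
Variable R : realType.
Local Notation C := (R[i]^o).
Implicit Types A B U : cstarAlg R.

Definition star_hom A B (h : A -> B) : Prop :=
  [/\ linear h, (forall a b, h (cmul a b) = cmul (h a) (h b)) &
      (forall a, h (cstar a) = cstar (h a))].

Definition cs_positive A (a : A) : Prop := exists b : A, a = cmul (cstar b) b.

Definition positive_functional A (f : A -> C) : Prop :=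
  linear f /\ forall a, 0 <= f (cmul (cstar a) a).

(* The last two clauses say that the norm of f is 1. *)
Definition state A (f : A -> C) : Prop :=
  [/\ positive_functional f, (forall a, `|f a| <= `|a|) &
      (forall M : R[i], (forall a, `|f a| <= M * `|a|) -> 1 <= M)].

Definition pure_states A : set (A -> C) :=
  [set f | state f /\
    forall g : A -> C, positive_functional g ->
      positive_functional (fun a => f a - g a) ->
      exists k : R[i], 0 <= k <= 1 /\ forall a, g a = k * f a].

Definition uniquely_extendible A B (j : A -> B) : set (A -> C) :=
  [set f | pure_states f /\
    exists! psi : B -> C, state psi /\ forall a, psi (j a) = f a].

Definition extension_property A B (j : A -> B) : Prop :=
  uniquely_extendible j = @pure_states A.

Definition almost_extension_property A B (j : A -> B) : Prop :=
  @pure_states A `<=` closure (uniquely_extendible j : set {ptws A -> C}).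

Definition closed_subspace (V : normedModType R[i]) (L : set V) : Prop :=
  [/\ L 0, (forall k x y, L x -> L y -> L (k *: x + y)) & closed L].

Definition closed_span (V : normedModType R[i]) (X : set V) : set V :=
  [set x | forall L, closed_subspace L -> X `<=` L -> L x].

Definition closed_ideal A (J : set A) : Prop :=
  [/\ closed_subspace J, (forall a x, J x -> J (cmul a x)) &
      (forall a x, J x -> J (cmul x a))].

Definition ideal_generated A (X : set A) : set A :=
  [set x | forall J, closed_ideal J -> X `<=` J -> J x].

Definition closed_star_subalgebra A (L : set A) : Prop :=
  [/\ closed_subspace L, (forall a b, L a -> L b -> L (cmul a b)) &
      (forall a, L a -> L (cstar a))].

(* Filters on A play the role of nets. *)
Definition approximate_unit A (I : set A) (F : set_system A) : Prop :=
  [/\ ProperFilter F,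
      F [set u | [/\ I u, cs_positive u & `|u| <= 1]] &
      forall a, I a ->
        (cmul a u @[u --> F] --> a) /\ (cmul u a @[u --> F] --> a)].

Definition bounded_functional A (phi : A -> C) : Prop :=
  linear phi /\ continuous phi.

(* Maps from U into the bidual A'' are maps E : U -> (A -> C) -> C, of which
   only the values E b phi at bounded functionals phi are relevant. *)
Definition bidual_linear A U (E : U -> (A -> C) -> C) : Prop :=
  (forall b k phi psi, bounded_functional phi -> bounded_functional psi ->
     E b (k *: phi + psi) = k * E b phi + E b psi) /\
  (forall k b c phi, bounded_functional phi ->
     E (k *: b + c) phi = k * E b phi + E c phi).

Definition bidual_contractive A U (E : U -> (A -> C) -> C) : Prop :=
  forall b phi (M : R[i]), bounded_functional phi -> 0 <= M ->
    (forall a, `|phi a| <= M * `|a|) -> `|E b phi| <= M * `|b|.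

(* M_n(A'') is the bidual of M_n(A), and an element of the bidual of a
   C*-algebra is positive iff its values at all positive functionals are.
   A functional on M_n(A) is a matrix phi of functionals on A; the entries of
   c^* c are \sum_k c_ki^* c_kj. *)
Definition completely_positive A U (E : U -> (A -> C) -> C) : Prop :=
  forall (n : nat) (c : 'I_n -> 'I_n -> U) (phi : 'I_n -> 'I_n -> A -> C),
    (forall i j, bounded_functional (phi i j)) ->
    (forall a : 'I_n -> 'I_n -> A,
       0 <= \sum_i \sum_j phi i j (\sum_k cmul (cstar (a k i)) (a k j))) ->
    0 <= \sum_i \sum_j E (\sum_k cmul (cstar (c k i)) (c k j)) (phi i j).

Definition bidual_kernel A U (E : U -> (A -> C) -> C) : set U :=
  [set b | forall phi, bounded_functional phi -> E b phi = 0].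

End CStar.

(* The inner product is linear in the second variable. *)
Record hilbert (R : realType) := Hilbert {
  hs_sort :> completeNormedModType R[i];
  ip : hs_sort -> hs_sort -> R[i];
  _ : forall k x y z, ip x (k *: y + z) = k * ip x y + ip x z;
  _ : forall x y, ip y x = (ip x y)^*;
  _ : forall x, ip x x = `|x| ^+ 2
}.

Record rep (R : realType) (A : cstarAlg R) := Rep {
  rep_space : hilbert R;
  rep_act :> A -> rep_space -> rep_space;
  _ : forall k a b h,
        rep_act (k *: a + b) h = k *: rep_act a h + rep_act b h;
  _ : forall k a h h',
        rep_act a (k *: h + h') = k *: rep_act a h + rep_act a h';
  _ : forall a b h, rep_act (cmul a b) h = rep_act a (rep_act b h);
  _ : forall a h h', ip (rep_act a h) h' = ip h (rep_act (cstar a) h');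
  _ : forall a, exists M : R[i], forall h, `|rep_act a h| <= M * `|h|
}.

Section Spectrum.
Variables (R : realType) (A : cstarAlg R).
Implicit Types rho sigma : rep A.

Definition irreducible rho : Prop :=
  (exists a h, rho a h <> 0) /\
  forall L : set (rep_space rho), closed_subspace L ->
    (forall a h, L h -> L (rho a h)) -> L = [set 0] \/ L = setT.

Definition unitarily_equivalent rho sigma : Prop :=
  exists V : rep_space rho -> rep_space sigma,
    [/\ linear V, (forall h h', ip (V h) (V h') = ip h h'),
        (forall k, exists h, V h = k) & forall a h, V (rho a h) = sigma a (V h)].

Definition nonzero_on rho (J : set A) : Prop :=
  exists a h, J a /\ rho a h <> 0.

(* The type of all representations is too large for the library's `set` and
   `topologicalType`; subsets of the spectrum are therefore plain predicates,
   and its topology is given by the predicate `spectrum_open`. *)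
Definition spectrum : Type :=
  {c : rep A -> Prop | exists rho, irreducible rho /\ c = unitarily_equivalent rho}.

Definition in_class (x : spectrum) rho : Prop := proj1_sig x rho.

Definition hat (J : set A) (x : spectrum) : Prop :=
  exists rho, in_class x rho /\ nonzero_on rho J.

Definition spectrum_open (O : spectrum -> Prop) : Prop :=
  exists J, closed_ideal J /\ forall x, O x <-> hat J x.

Definition spectrum_dense (D : spectrum -> Prop) : Prop :=
  forall O, spectrum_open O -> (exists x, O x) -> exists x, O x /\ D x.

Definition gns_rep (f : A -> R[i]^o) rho : Prop :=
  exists xi : rep_space rho,
    (forall a, f a = ip xi (rho a xi)) /\
    closed_span (range (fun a => rho a xi)) = setT.

Definition gns_class (f : A -> R[i]^o) (x : spectrum) : Prop :=
  exists rho, in_class x rho /\ gns_rep f rho.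

End Spectrum.

Definition local_homeomorphism (S T : topologicalType) (f : S -> T) : Prop :=
  forall x, exists U : set S,
    [/\ open U, U x, set_inj U f, {within U, continuous f} &
        forall V, open V -> V `<=` U -> open (f @` V)].

(* gmul is a total function, which is only relevant on composable pairs. The
   inclusion of the unit space is the map gone. *)
Record etale_groupoid := EtaleGroupoid {
  gunits : topologicalType;
  garrows :> topologicalType;
  gsrc : garrows -> gunits;
  grng : garrows -> gunits;
  gone : gunits -> garrows;
  gmul : garrows -> garrows -> garrows;
  ginv : garrows -> garrows;
  _ : forall x, gsrc (gone x) = x;
  _ : forall x, grng (gone x) = x;
  _ : forall g h, gsrc g = grng h -> gsrc (gmul g h) = gsrc h;
  _ : forall g h, gsrc g = grng h -> grng (gmul g h) = grng g;
  _ : forall g h k, gsrc g = grng h -> gsrc h = grng k ->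
        gmul g (gmul h k) = gmul (gmul g h) k;
  _ : forall g, gmul (gone (grng g)) g = g;
  _ : forall g, gmul g (gone (gsrc g)) = g;
  _ : forall g, gsrc (ginv g) = grng g;
  _ : forall g, grng (ginv g) = gsrc g;
  _ : forall g, gmul (ginv g) g = gone (gsrc g);
  _ : forall g, gmul g (ginv g) = gone (grng g);
  _ : continuous gone;
  _ : continuous ginv;
  _ : {within [set p : garrows * garrows | gsrc p.1 = grng p.2],
        continuous (fun p : garrows * garrows => gmul p.1 p.2)};
  _ : local_homeomorphism gsrc;
  _ : local_homeomorphism grng
}.

Definition bisection (G : etale_groupoid) (U : set G) : Prop :=
  [/\ open U, set_inj U (@gsrc G) & set_inj U (@grng G)].

(* Transport between fibres of a family over equal indices; zero if the indices
   differ. *)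
Definition fibre_cast (R : realType) (G : Type)
    (fib : G -> completeNormedModType R[i]) (g h : G) (a : fib g) : fib h :=
  match pselect (g = h) with
  | left e => eq_rect g (fun k => fib k : Type) a h e
  | right _ => 0
  end.

(* The total space is a topological space in bijection with {g & fib g}. (The
   canonical topology of the library on {g & fib g} is that of the disjoint
   union, which is not the one meant here.) *)
Record usc_bundle (R : realType) (G : topologicalType) := UscBundle {
  fib : G -> completeNormedModType R[i];
  total : topologicalType;
  total_pt : {g : G & fib g} -> total;
  total_val : total -> {g : G & fib g};
  pt := fun (g : G) (a : fib g) => total_pt (existT _ g a);
  pr := fun e : total => projT1 (total_val e);
  el := fun e : total => projT2 (total_val e) : fib (pr e);
  _ : cancel total_pt total_val;
  _ : cancel total_val total_pt;
  _ : continuous pr;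
  _ : forall W, open W -> open (pr @` W);
  _ : forall eps : R[i], 0 < eps -> open [set e | `|el e| < eps];
  _ : {within [set p : total * total | pr p.1 = pr p.2],
        continuous (fun p : total * total =>
          pt (el p.1 + fibre_cast (pr p.1) (el p.2)))};
  _ : continuous (fun p : R[i]^o * total => pt (p.1 *: el p.2));
  _ : forall (g : G) (W : set total), open W -> W (pt (0 : fib g)) ->
        exists (V : set G) (eps : R[i]), [/\ open V, V g, 0 < eps &
          [set e | V (pr e) /\ `|el e| < eps] `<=` W]
}.

(* Identities between elements of fibres over propositionally equal arrows are
   stated in the total space. *)
Record fell_bundle (R : realType) (G : etale_groupoid) := FellBundle {
  fb_bundle :> usc_bundle R G;
  fmul : forall g h : G,
    fib fb_bundle g -> fib fb_bundle h -> fib fb_bundle (gmul g h);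
  fstar : forall g : G, fib fb_bundle g -> fib fb_bundle (ginv g);
  _ : forall (g h : G) k (a b : fib fb_bundle g) (c : fib fb_bundle h),
        gsrc g = grng h -> fmul (k *: a + b) c = k *: fmul a c + fmul b c;
  _ : forall (g h : G) k (a : fib fb_bundle g) (b c : fib fb_bundle h),
        gsrc g = grng h -> fmul a (k *: b + c) = k *: fmul a b + fmul a c;
  _ : forall (g h l : G) (a : fib fb_bundle g) (b : fib fb_bundle h)
        (c : fib fb_bundle l), gsrc g = grng h -> gsrc h = grng l ->
        pt (fmul a (fmul b c)) = pt (fmul (fmul a b) c);
  _ : forall (g : G) k (a b : fib fb_bundle g),
        fstar (k *: a + b) = k^* *: fstar a + fstar b;
  _ : forall (g : G) (a : fib fb_bundle g), pt (fstar (fstar a)) = pt a;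
  _ : forall (g h : G) (a : fib fb_bundle g) (b : fib fb_bundle h),
        gsrc g = grng h -> pt (fstar (fmul a b)) = pt (fmul (fstar b) (fstar a));
  _ : forall (g h : G) (a : fib fb_bundle g) (b : fib fb_bundle h),
        gsrc g = grng h -> `|fmul a b| <= `|a| * `|b|;
  _ : forall (g : G) (a : fib fb_bundle g), `|fmul (fstar a) a| = `|a| ^+ 2;
  (* a^* a is positive in the C*-algebra that is the fibre over s(g) *)
  _ : forall (g : G) (a : fib fb_bundle g),
        exists b : fib fb_bundle (gone (gsrc g)),
          pt (fmul (fstar a) a) = pt (fmul (fstar b) b);
  _ : {within [set p : total fb_bundle * total fb_bundle |
                 gsrc (pr p.1) = grng (pr p.2)],
        continuous (fun p : total fb_bundle * total fb_bundle =>
          pt (fmul (el p.1) (el p.2)))};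
  _ : continuous (fun e : total fb_bundle => pt (fstar (el e)))
}.

Section Sections.
Variables (R : realType) (G : etale_groupoid) (F : fell_bundle R G).

Definition section : Type := forall g : G, fib F g.

Definition sec0 : section := fun g => 0.
Definition sec_lin (k : R[i]) (x y : section) : section :=
  fun g => k *: x g + y g.

(* (x y)(g) = \sum_{r(h) = r(g)} x(h) y(h^-1 g); at most one summand is nonzero
   if x is supported on a bisection. *)
Definition conv (x y : section) : section := fun g =>
  \sum_(h \in [set h : G | grng h = grng g])
    fibre_cast g (fmul (x h) (y (gmul (ginv h) g))).

Definition sec_star (x : section) : section :=
  fun g => fibre_cast g (fstar (x (ginv g))).

(* C_0(U, F|_U), extended by zero outside the bisection U *)
Definition C0 (U : set G) : set section :=
  [set x | [/\ (forall g, ~ U g -> x g = 0),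
               {within U, continuous (fun g => pt (x g))} &
               forall eps : R[i], 0 < eps -> exists K : set G,
                 [/\ compact K, K `<=` U & forall g, ~ K g -> `|x g| < eps]]].

Definition unit_sections : set section := C0 (range (@gone G)).

Definition uclosed_subspace (L : set section) : Prop :=
  [/\ L sec0, (forall k x y, L x -> L y -> L (sec_lin k x y)) &
      forall x, (forall eps : R[i], 0 < eps ->
                   exists2 y, L y & forall g, `|x g - y g| <= eps) -> L x].

Definition uclosed_span (X : set section) : set section :=
  [set x | forall L, uclosed_subspace L -> X `<=` L -> L x].

(* The elements of the inverse semigroup S. The inner products of a Hilbert
   subbimodule are x^* y and x y^*. *)
Definition in_S (t : set section) : Prop :=
  (exists2 U : set G, bisection U & t `<=` C0 U) /\
  [/\ uclosed_subspace t,
      (forall a x, unit_sections a -> t x -> t (conv a x)) &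
      (forall a x, unit_sections a -> t x -> t (conv x a))].

Definition S_mul (t u : set section) : set section :=
  uclosed_span [set z | exists x y, [/\ t x, u y & z = conv x y]].

End Sections.

(* A = C_0(X, F|_X) with the sup norm: a C*-algebra with an identification of
   its elements with the sections in C_0(X, F|_X). *)
Record unit_algebra (R : realType) (G : etale_groupoid) (F : fell_bundle R G) :=
  UnitAlgebra {
  ua_alg :> cstarAlg R;
  sec : ua_alg -> section F;
  _ : injective sec;
  _ : range sec = unit_sections (F := F);
  _ : forall k a b, sec (k *: a + b) = sec_lin k (sec a) (sec b);
  _ : forall a b, sec (cmul a b) = conv (sec a) (sec b);
  _ : forall a, sec (cstar a) = sec_star (sec a);
  _ : forall a (M : R[i]), 0 <= M ->
        (`|a| <= M <-> forall g, `|sec a g| <= M)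
}.

Section CrossedProducts.
Variables (R : realType) (G : etale_groupoid) (F : fell_bundle R G).
Variable A : unit_algebra F.
Local Notation C := (R[i]^o).
Local Notation one_S := (unit_sections (F := F)).

(* Only relevant on unit_sections, where it inverts sec. *)
Definition to_A (z : section F) : A := xget 0 [set a : A | sec a = z].

Definition s_ideal (t : set (section F)) : set A :=
  ideal_generated
    [set a : A | exists x y, [/\ t x, t y & sec a = conv (sec_star x) y]].

Definition I1 (t : set (section F)) : set A :=
  closed_span [set a : A | exists v,
    [/\ in_S v, v `<=` t, v `<=` one_S & s_ideal v a]].

Definition bimodule_rep (D : cstarAlg R)
    (p : set (section F) -> section F -> D) : Prop :=
  [/\ (forall t k x y, in_S t -> t x -> t y ->
         p t (sec_lin k x y) = k *: p t x + p t y),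
      (forall t u x y, in_S t -> in_S u -> t x -> u y ->
         cmul (p t x) (p u y) = p (S_mul t u) (conv x y)),
      (forall t x y, in_S t -> t x -> t y ->
         cmul (cstar (p t x)) (p t y) = p one_S (conv (sec_star x) y)) &
      (forall t x y, in_S t -> t x -> t y ->
         cmul (p t x) (cstar (p t y)) = p one_S (conv x (sec_star y)))].

(* (U, p) is the full crossed product of A by S, that is, C*(G, F) *)
Definition full_crossed_product (U : cstarAlg R)
    (p : set (section F) -> section F -> U) : Prop :=
  [/\ bimodule_rep p,
      (forall L : set U, closed_star_subalgebra L ->
         (forall t x, in_S t -> t x -> L (p t x)) -> L = setT) &
      (forall (D : cstarAlg R) (q : set (section F) -> section F -> D),
         bimodule_rep q ->
         exists h : U -> D, star_hom h /\
           forall t x, in_S t -> t x -> h (p t x) = q t x)].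

(* E is the completely positive contraction E_r : U -> A'' *)
Definition canonical_expectation (U : cstarAlg R)
    (p : set (section F) -> section F -> U) (E : U -> (A -> C) -> C) : Prop :=
  [/\ bidual_linear E, bidual_contractive E, completely_positive E &
      forall t x (W : set_system A) phi,
        in_S t -> t x -> approximate_unit (I1 t) W -> bounded_functional phi ->
        phi (to_A (conv x (sec u))) @[u --> W] --> E (p t x) phi].

(* L : U -> Cr is the quotient map onto the reduced crossed product *)
Definition reduced_quotient (U Cr : cstarAlg R) (E : U -> (A -> C) -> C)
    (L : U -> Cr) : Prop :=
  [/\ star_hom L, set_surj setT setT L,
      [set b | L b = 0] `<=` bidual_kernel E &
      forall J : set U, closed_ideal J -> J `<=` bidual_kernel E ->
        J `<=` [set b | L b = 0]].

(* sigma is (up to unitary equivalence) the representation of A on the tensor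
   product of E_t and the space of rho, with T x h the elementary tensor of x
   and h: this is the Hilbert space densely spanned by elementary tensors with
   (x (x) h | y (x) k) = (h | rho(x^* y) k). *)
Definition induced_rep (t : set (section F)) (rho sigma : rep A) : Prop :=
  exists T : section F -> rep_space rho -> rep_space sigma,
    [/\ (forall k x y h, t x -> t y ->
           T (sec_lin k x y) h = k *: T x h + T y h),
        (forall k x h h', t x -> T x (k *: h + h') = k *: T x h + T x h'),
        (forall x y h h', t x -> t y ->
           ip (T x h) (T y h') = ip h (rho (to_A (conv (sec_star x) y)) h')),
        closed_span [set w | exists x h, t x /\ w = T x h] = setT &
        (forall a x h, t x -> sigma a (T x h) = T (conv (sec a) x) h)].

Definition germ (x : spectrum A) (t : set (section F)) : set (set (section F)) :=
  [set u | [/\ in_S u, hat (s_ideal u) x &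
     exists v, [/\ in_S v, v `<=` t, v `<=` u & hat (s_ideal v) x]]].

(* An arrow [t, x] is encoded by its source x and the set of all u with
   [u, x] = [t, x]. The unit arrow at x is [1, x], where the unit 1 of the
   inverse semigroup is unit_sections. Isotropy only involves sources, ranges
   and units, so the product of arrows is not needed. *)
Record dual_arrow := DualArrow {
  dual_source : spectrum A;
  dual_germ : set (set (section F));
  _ : exists t, [/\ in_S t, hat (s_ideal t) dual_source &
                    dual_germ = germ dual_source t]
}.

(* The range as a functional relation: the tensor product Hilbert space is only
   determined up to unitary equivalence. *)
Definition dual_range (g : dual_arrow) (y : spectrum A) : Prop :=
  exists t rho sigma,
    [/\ dual_germ g t, in_class (dual_source g) rho, in_class y sigma &
        induced_rep t rho sigma].

Definition dual_unit (x : spectrum A) (g : dual_arrow) : Prop :=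
  dual_source g = x /\ dual_germ g = germ x one_S.

Definition trivial_isotropy (x : spectrum A) : Prop :=
  forall g, dual_source g = x -> dual_range g x -> dual_unit x g.

Definition dual_principal : Prop := forall x, trivial_isotropy x.

Definition dual_topologically_principal : Prop :=
  spectrum_dense trivial_isotropy.

End CrossedProducts.

(* Main.v *)
From HB Require Import structures.
Require Import Defs.
From mathcomp Require Import all_boot all_order all_algebra.
From mathcomp Require Import complex.
From mathcomp Require Import all_classical all_reals all_analysis.
From mathcomp Require Import ring lra.

(** Let f be a pure state of A with GNS representation (rho, xi). Evaluating the
    conditional expectation at f gives one extension of f to B, and it vanishes on
    a bimodule t unless the germ of t at [rho] is a unit. An isotropy arrow at [rho]
    is a bimodule t with a unitary from E_t (x) rho to rho. If it is not a unit, then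
    elements x_n of t with x_n (x) xi close to xi move the GNS vector of this extension
    to vectors converging to an orthogonal one that induces f on A as well, and
    superposing the two vectors gives further extensions of f. Conversely, for an
    arbitrary extension psi of f, the compression of t in the GNS representation of
    psi to the space of rho is zero or a multiple of a unitary E_t (x) rho -> rho,
    because f is pure and rho is irreducible. So if [rho] has trivial isotropy, then
    f determines psi on every t.

    For the almost extension property, it remains to see that the vector states of
    irreducible representations in a dense subset of the spectrum are weakly dense
    in the pure states. If f were not in their closure Q, then finitely many
    half-spaces not containing f would cover Q. The theorem of Hahn and Banach
    decomposes f along these half-spaces, the summands are multiples of f because f
    is pure, and so one of the half-spaces would contain f. *)

Set Implicit Arguments.
Unset Strict Implicit.
Unset Printing Implicit Defensive.

Import Order.TTheory GRing.Theory Num.Theory.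
Import numFieldNormedType.Exports.
Import Defs.

Local Open Scope classical_set_scope.
Local Open Scope ring_scope.
Local Open Scope complex_scope.

Local Notation Re := complex.Re.
Local Notation Im := complex.Im.
Local Notation cj := Num.conj.

(** * Real-valued norms and sequences *)

(** The algebras need not be unital, and no functional calculus is set up. What usually rests on it
    (contractivity of homomorphisms and actions, approximate units, positive parts, Schur's lemma)
    comes from two devices: the iteration $y\mapsto(x+y^2)/2$, which produces $1-\sqrt{1-x}$, and
    the remark that commuting self-adjoint $\alpha,\beta$ with $\alpha^2+\beta^2=1$ are contractive
    because $\alpha\pm i\beta$ are unitary. The maps $\pi_t$ are linked only through products. That
    $\pi_v=\pi_1$ on ideals $v\subseteq A$ is therefore derived. It is what makes a unit germ
    useful: for $v\subseteq t\cap A$ and $c\in v$ the product $\pi_t(x)\pi_1(c)$ lies in the image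
    of $A$, and irreducibility provides such $c$ with $c\xi\approx\xi$. Without a unit, the GNS
    vectors $\zeta$ of an extension and $\xi$ of $f$ might differ in length. That both functionals
    have norm 1 gives $\|\zeta\|\le1\le\|\xi\|$, which suffices to identify the two vectors and to
    bound $\|\zeta-c\zeta\|$ by $\|\xi-c\xi\|$. *)

Lemma divS_gt0 (R : realType) (e M : R) : 0 < e -> 0 <= M -> 0 < e / (M + 1).
Proof. by move=> e0 M0; apply: divr_gt0; lra. Qed.

Lemma mul_divS_lt (R : realType) (e M d : R) : 0 <= M -> 0 <= d -> d < e / (M + 1) -> M * d < e.
Proof. by move=> M0 d0; rewrite ltr_pdivlMr; nra. Qed.

Lemma divS_mul_le (R : realType) (e M : R) : 0 < e -> 0 <= M -> e / (M + 1) * M <= e.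
Proof. by move=> e0 M0; rewrite mulrAC ler_pdivrMr; nra. Qed.

Lemma sqr_le_mul (R : realType) (x y : R) : 0 <= x -> 0 <= y -> x ^+ 2 <= y * x -> x ^+ 2 <= y ^+ 2.
Proof. by move=> x0 y0 h; have [//|yx] := leP (x ^+ 2) (y ^+ 2); nra. Qed.

(** Norms take values in the partially ordered field [R[i]]; passing to real parts opens them to
    linear and nonlinear real arithmetic. *)
Definition cn (R : realType) (z : R[i]) : R := Re `|z|.
Definition nr (R : realType) (V : normedModType R[i]) (x : V) : R := Re `|x|.

Lemma le_sqr_le (R : realType) (a b : R) : 0 <= b -> a ^+ 2 <= b ^+ 2 -> a <= b.
Proof. by move=> b0 h; have [//|ba] := leP a b; nra. Qed.

Lemma inv_small (R : realType) (e : R) : 0 < e ->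
  exists N, forall n, (N <= n)%N -> n.+1%:R^-1 < e.
Proof.
move=> e0; exists (Num.truncn e^-1) => n Nn.
rewrite invf_plt ?posrE//; apply: lt_le_trans (truncnS_gt _) _.
by rewrite ler_nat ltnS.
Qed.

Section Norms.
Variable R : realType.
Implicit Types (V : normedModType R[i]) (z w k : R[i]) (r s e : R).

Lemma ge0C z : 0 <= z -> z = (Re z)%:C.
Proof. by case: z => a b; rewrite lecE /= => /andP[/eqP -> _]. Qed.

Lemma cnE z : `|z| = (cn z)%:C.
Proof. exact: ge0C. Qed.

Lemma cn_ge0 z : 0 <= cn z.
Proof. by rewrite -ler0c -cnE. Qed.

Lemma cnM z w : cn (z * w) = cn z * cn w.
Proof. by rewrite /cn normrM !cnE -rmorphM. Qed.

Lemma cnD z w : cn (z + w) <= cn z + cn w.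
Proof. by rewrite -lecR rmorphD /= -!cnE ler_normD. Qed.

Lemma cnN z : cn (- z) = cn z. Proof. by rewrite /cn normrN. Qed.

Lemma cnB z w : cn (z - w) = cn (w - z).
Proof. by rewrite -cnN opprB. Qed.

Lemma cn0 : cn (0 : R[i]) = 0. Proof. by rewrite /cn normr0. Qed.
Lemma cn1 : cn (1 : R[i]) = 1. Proof. by rewrite /cn normr1. Qed.

Lemma cn_eq0 z : cn z = 0 -> z = 0.
Proof. by move=> h; apply/normr0_eq0; rewrite cnE h. Qed.

Lemma cn_sq z : cn z ^+ 2 = Re z ^+ 2 + Im z ^+ 2.
Proof. by apply: complexI; rewrite add_Re2_Im2 cnE rmorphXn. Qed.

Lemma cn_conj z : cn (cj z) = cn z.
Proof.
apply/eqP; rewrite -(eqrXn2 (n := 2)) ?cn_ge0//; apply/eqP.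
by rewrite !cn_sq; case: z => a b /=; rewrite sqrrN.
Qed.

Lemma cnR r : cn r%:C = `|r|.
Proof.
apply/eqP; rewrite -(eqrXn2 (n := 2)) ?cn_ge0//; apply/eqP.
by rewrite cn_sq /= expr0n addr0 real_normK // num_real.
Qed.

Lemma cn_Re z : `|Re z| <= cn z.
Proof.
apply: le_sqr_le (cn_ge0 _) _; rewrite cn_sq.
by rewrite real_normK ?num_real// lerDl sqr_ge0.
Qed.

Lemma cn_Im z : `|Im z| <= cn z.
Proof.
apply: le_sqr_le (cn_ge0 _) _; rewrite cn_sq.
by rewrite real_normK ?num_real// lerDr sqr_ge0.
Qed.

Lemma cn_le z : cn z <= `|Re z| + `|Im z|.
Proof.
apply: le_sqr_le; first by rewrite addr_ge0.
by rewrite cn_sq sqrrD !real_normK ?num_real//; have := mulr_ge0 (normr_ge0 (Re z)) (normr_ge0 (Im z)); lra.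
Qed.

Lemma nrE V (x : V) : `|x| = (nr x)%:C.
Proof. exact: ge0C. Qed.

Lemma nr_ge0 V (x : V) : 0 <= nr x.
Proof. by rewrite -ler0c -nrE. Qed.

Lemma nrD V (x y : V) : nr (x + y) <= nr x + nr y.
Proof. by rewrite -lecR rmorphD /= -!nrE ler_normD. Qed.

Lemma nrZ V k (x : V) : nr (k *: x) = cn k * nr x.
Proof. by rewrite /nr normrZ cnE nrE -rmorphM. Qed.

Lemma nrN V (x : V) : nr (- x) = nr x. Proof. by rewrite /nr normrN. Qed.

Lemma nrB V (x y : V) : nr (x - y) = nr (y - x).
Proof. by rewrite -nrN opprB. Qed.

Lemma nr0 V : nr (0 : V) = 0. Proof. by rewrite /nr normr0. Qed.

Lemma nr_eq0 V (x : V) : nr x = 0 -> x = 0.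
Proof. by move=> h; apply/normr0_eq0; rewrite nrE h. Qed.

Lemma nr_tri V (y x z : V) : nr (x - z) <= nr (x - y) + nr (y - z).
Proof. by rewrite (_ : x - z = (x - y) + (y - z)) ?nrD// addrA subrK. Qed.

Lemma nr_le V (x y : V) : nr x <= nr (x - y) + nr y.
Proof. by rewrite -{1}(subrK y x) nrD. Qed.

Lemma nr_small V (x : V) : (forall e, 0 < e -> nr x <= e) -> x = 0.
Proof.
move=> h; apply: nr_eq0; apply/eqP; rewrite eq_le nr_ge0 andbT.
by apply/ler_addgt0Pr => e e0; rewrite add0r h.
Qed.

Lemma cn_small z : (forall e, 0 < e -> cn z <= e) -> z = 0.
Proof.
move=> h; apply: cn_eq0; apply/eqP; rewrite eq_le cn_ge0 andbT.
by apply/ler_addgt0Pr => e e0; rewrite add0r h.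
Qed.

Lemma nr_near V (x : V) (P : set V) :
  (\near x, P x) <-> exists2 e : R, 0 < e & forall y, nr (x - y) < e -> P y.
Proof.
split=> [/nbhs_ballP[e /= e0 h]|[e e0 h]].
  exists (Re e) => [|y xy]; first by move: e0; rewrite ltcE => /andP[].
  apply: h; rewrite -ball_normE /= nrE [e]ge0C ?ltcR //; exact: ltW.
apply/nbhs_ballP; exists e%:C => /=; first by rewrite ltcR.
by move=> y; rewrite -ball_normE /= nrE ltcR => /h.
Qed.

Lemma closed_epsP V (L : set V) : closed L <->
  forall x, (forall e, 0 < e -> exists2 y, L y & nr (x - y) < e) -> L x.
Proof.
split=> h x hx.
  apply: h => U /(nr_near _ U)[e e0 hU].
  by have [y Ly xy] := hx e e0; exists y; split=> //; apply: hU.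
apply: h => e e0.
have [|y [Ly xy]] := hx [set y | nr (x - y) < e].
  by apply/(nr_near _ [set y | nr (x - y) < e]); exists e.
by exists y.
Qed.

Definition tends V (u : nat -> V) (l : V) : Prop :=
  forall e, 0 < e -> exists N, forall n, (N <= n)%N -> nr (u n - l) < e.

Definition ctends (u : nat -> R[i]) (l : R[i]) : Prop :=
  forall e, 0 < e -> exists N, forall n, (N <= n)%N -> cn (u n - l) < e.

Definition rcauchy V (u : nat -> V) : Prop :=
  forall e, 0 < e -> exists N, forall m n, (N <= m)%N -> (N <= n)%N ->
    nr (u m - u n) < e.

Lemma rcauchy_tends (V : completeNormedModType R[i]) (u : nat -> V) :
  rcauchy u -> exists l, tends u l.
Proof.
move=> cu.
have /cauchy_cvg/cvg_ex[l ul] : cauchy (u @ \oo).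
  apply/cauchy_ballP => eps e0.
  have [N hN] := cu (Re eps) (proj2 (andP (etrans (esym (ltcE _ _)) e0))).
  rewrite near_map2; near=> m n; rewrite -ball_normE /= nrE [eps]ge0C ?(ltW e0)//.
  rewrite ltcR; apply: hN; [near: m|near: n]; exact: nbhs_infty_ge.
exists l => e e0.
have /(_ [set y | nr (l - y) < e]) := ul.
case; first by apply/(nr_near _ [set y | nr (l - y) < e]); exists e.
by move=> N _ h; exists N => n /h /=; rewrite nrB.
Unshelve. all: by end_near. Qed.

Lemma tends_uniq V (u : nat -> V) l l' : tends u l -> tends u l' -> l = l'.
Proof.
move=> h h'; apply/eqP; rewrite -subr_eq0; apply/eqP/nr_small => e e0.
have e2 : 0 < e / 2 by lra.
have [N hN] := h _ e2; have [N' hN'] := h' _ e2.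
have := nr_tri (u (maxn N N')) l l'.
have := hN (maxn N N') (leq_maxl _ _); have := hN' (maxn N N') (leq_maxr _ _).
by rewrite (nrB l (u _)); lra.
Qed.

Lemma tends_ge V (u : nat -> V) l (P : R) : tends u l ->
  (forall n, nr (u n) <= P) -> nr l <= P.
Proof.
move=> ul h; apply/ler_addgt0Pr => e e0; have [N hN] := ul _ e0.
by have := nr_le l (u N); rewrite nrB; have := hN N (leqnn _); have := h N; lra.
Qed.

Lemma tends_cauchy V (u : nat -> V) l : tends u l -> rcauchy u.
Proof.
move=> ul e e0; have [N hN] := ul (e / 2) ltac:(lra); exists N => m n hm hn.
by have := nr_tri l (u m) (u n); rewrite (nrB l); have := hN _ hm; have := hN _ hn; lra.
Qed.

Lemma tends_closed V (L : set V) u l : closed L -> (forall n, L (u n)) ->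
  tends u l -> L l.
Proof.
move=> /closed_epsP cL Lu ul; apply: cL => e e0; have [N hN] := ul e e0.
by exists (u N) => //; rewrite nrB; apply: hN.
Qed.

Lemma monotone_cauchy (r : nat -> R) M : (forall n, r n <= r n.+1) ->
  (forall n, r n <= M) -> forall e, 0 < e ->
  exists N, forall m n, (N <= m)%N -> (N <= n)%N -> `|r m - r n| < e.
Proof.
move=> inc bd e e0.
have mono m n : (m <= n)%N -> r m <= r n.
  elim: n => [|n IH]; first by rewrite leqn0 => /eqP ->.
  by rewrite leq_eqVlt => /orP[/eqP ->//|/IH h]; exact: le_trans h (inc n).
have hs : has_sup (range r).
  by split; [exists (r 0%N), 0%N|exists M => _ [n _ <-]].
have [_ [N _ <-] hN] := sup_adherent e0 hs.
exists N => m n /mono hm /mono hn.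
have ub (k : nat) : r k <= sup (range r) by apply: ub_le_sup; [case: hs|exists k].
by rewrite ltr_norml; apply/andP; split; have := ub m; have := ub n; lra.
Qed.

(** The sequence [r] is a majorant: it is monotone and bounded, hence Cauchy, and its differences
    dominate the distances between the terms of [u]. *)
Lemma increments_tends (V : completeNormedModType R[i]) (u : nat -> V)
    (r : nat -> R) M :
  (forall n, nr (u n.+1 - u n) <= r n.+1 - r n) -> (forall n, r n <= M) ->
  exists l, tends u l.
Proof.
move=> h bd.
have inc n : r n <= r n.+1 by have := h n; have := nr_ge0 (u n.+1 - u n); lra.
have du m n : (m <= n)%N -> nr (u n - u m) <= r n - r m.
  elim: n => [|n IH]; first by rewrite leqn0 => /eqP ->; rewrite !subrr nr0.
  rewrite leq_eqVlt => /orP[/eqP ->|/IH hn]; first by rewrite !subrr nr0.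
  by have := nr_tri (u n) (u n.+1) (u m); have := h n; lra.
apply: rcauchy_tends => e e0; have [N hN] := monotone_cauchy inc bd e0.
exists N => m n hm hn; have := hN m n hm hn.
by have [/du mn|/ltnW/du mn] := leqP m n; first rewrite nrB;
  rewrite ltr_norml => /andP[]; lra.
Qed.

Lemma ccauchy_tends (u : nat -> R[i]) :
  (forall e, 0 < e -> exists N, forall m n, (N <= m)%N -> (N <= n)%N ->
    cn (u m - u n) < e) -> exists l, ctends u l.
Proof.
move=> cu.
have key (f : R[i] -> R) : (forall z w, f (z - w) = f z - f w) ->
    (forall z, `|f z| <= cn z) -> exists l : R, forall e, 0 < e ->
    exists N, forall n, (N <= n)%N -> `|f (u n) - l| < e.
  move=> fB fle.
  have /cauchy_cvg/cvg_ex[l ul] : cauchy ((f \o u) @ \oo).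
    apply/cauchy_ballP => eps e0; have [N hN] := cu eps e0.
    rewrite near_map2; near=> m n; rewrite -ball_normE /= -fB.
    apply: le_lt_trans (fle _) _; apply: hN; [near: m|near: n]; exact: nbhs_infty_ge.
  exists l => e e0; have /cvgrPdist_lt/(_ e e0)[N _ h] := ul.
  by exists N => n /h /=; rewrite distrC.
have [a ha] := key (@Re R) ltac:(by case=> ? ? [? ?]) cn_Re.
have [b hb] := key (@Im R) ltac:(by case=> ? ? [? ?]) cn_Im.
exists (a +i* b) => e e0.
have [N hN] := ha (e / 2) ltac:(lra); have [N' hN'] := hb (e / 2) ltac:(lra).
exists (maxn N N') => n; rewrite geq_max => /andP[/hN h /hN' h'].
apply: le_lt_trans (cn_le _) _; move: h h'.
by case: (u n) => ? ? /=; lra.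
Unshelve. all: by end_near. Qed.

Lemma ctends_uniq (u : nat -> R[i]) l l' : ctends u l -> ctends u l' -> l = l'.
Proof. exact: (@tends_uniq R[i]^o). Qed.

Lemma ctends_ext (u v : nat -> R[i]) l : u =1 v -> ctends u l -> ctends v l.
Proof. by move=> /funext ->. Qed.

Lemma ctends_cst z : ctends (fun=> z) z.
Proof. by move=> e e0; exists 0%N => n _; rewrite subrr cn0. Qed.

Lemma ctendsD u v a b : ctends u a -> ctends v b ->
  ctends (fun n => u n + v n) (a + b).
Proof.
move=> h h' e e0.
have [N hN] := h (e / 2) ltac:(lra); have [N' hN'] := h' (e / 2) ltac:(lra).
exists (maxn N N') => n; rewrite geq_max => /andP[/hN H /hN' H'].
by rewrite opprD addrACA; have := cnD (u n - a) (v n - b); lra.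
Qed.

Lemma ctendsZ k u a : ctends u a -> ctends (fun n => k * u n) (k * a).
Proof.
move=> h e e0.
have k0 := cn_ge0 k.
have [N hN] := h (e / (cn k + 1)) ltac:(apply: divr_gt0; lra).
exists N => n /hN; rewrite -mulrBr cnM ltr_pdivlMr; last lra.
by have := cn_ge0 (u n - a); nra.
Qed.

Lemma ctends_ge0 u a : ctends u a -> (forall n, 0 <= u n) -> 0 <= a.
Proof.
move=> h u0; rewrite lecE /=; apply/andP; split.
  apply/eqP/eqP; rewrite -normr_eq0; apply/eqP/le_anti; rewrite normr_ge0 andbT.
  apply/ler_addgt0Pr => e e0; have [N /(_ N (leqnn _)) hN] := h e e0.
  have := cn_Im (u N - a); rewrite [u N]ge0C ?u0//= in hN *.
  by case: a hN {h} => a b /=; rewrite sub0r normrN; lra.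
apply/ler_addgt0Pr => e e0; have [N /(_ N (leqnn _)) hN] := h e e0.
have := cn_Re (u N - a); have := u0 N; rewrite [u N]ge0C ?u0//= ler0c in hN *.
by case: a hN {h} => a b /=; rewrite ler_norml => ? ? /andP[]; lra.
Qed.

End Norms.

(** * Linear identities in modules *)

Section Lmod.
Variables (K : comNzRingType) (V : lmodType K).

(** Reflection of linear expressions: an identity over a list of atoms reduces to one identity of
    coefficients per atom, which [ring] or [field] then proves. *)
Inductive lexp := LAtom of nat | LZero | LAdd of lexp & lexp | LOpp of lexp
  | LScale of K & lexp.

Fixpoint lval (env : seq V) (e : lexp) : V :=
  match e with
  | LAtom n => nth 0 env n
  | LZero => 0
  | LAdd e f => lval env e + lval env f
  | LOpp e => - lval env e
  | LScale k e => k *: lval env e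
  end.

Fixpoint lcoef (e : lexp) (i : nat) : K :=
  match e with
  | LAtom n => if n == i then 1 else 0
  | LZero => 0
  | LAdd e f => lcoef e i + lcoef f i
  | LOpp e => - lcoef e i
  | LScale k e => k * lcoef e i
  end.

Lemma lvalE env e :
  lval env e = \sum_(i < size env) lcoef e i *: nth 0 env i.
Proof.
elim: e => [n| |e IHe f IHf|e IH|k e IH] /=.
- have [ltn|gen] := ltnP n (size env).
    rewrite (bigD1 (Ordinal ltn)) //= eqxx scale1r big1 ?addr0// => i /eqP ni.
    by case: eqP => [ni'|]; rewrite ?scale0r//; case: ni; apply: val_inj.
  rewrite nth_default// big1// => i _; case: eqP => [ni|]; rewrite ?scale0r//.
  by move: (ltn_ord i); rewrite -ni ltnNge gen.
- by rewrite big1// => i _; rewrite scale0r.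
- by rewrite IHe IHf -big_split; apply: eq_bigr => i _; rewrite scalerDl.
- by rewrite IH -sumrN; apply: eq_bigr => i _; rewrite scaleNr.
- by rewrite IH scaler_sumr; apply: eq_bigr => i _; rewrite scalerA.
Qed.

Fixpoint lcheck (e f : lexp) (i n : nat) : Prop :=
  if n is m.+1 then lcoef e i = lcoef f i /\ lcheck e f i.+1 m else True.

Lemma lmod_eq env e f : lcheck e f 0 (size env) -> lval env e = lval env f.
Proof.
move=> h; rewrite !lvalE; apply: eq_bigr => i _; congr (_ *: _).
have: forall n j, lcheck e f j n -> forall k, (j <= k < j + n)%N ->
    lcoef e k = lcoef f k.
  elim=> [|n IH] j /=; first by move=> _ k; rewrite addn0; case: leqP.
  case=> hj /IH{}IH k /andP[]; rewrite leq_eqVlt => /orP[/eqP <- //|jk].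
  by rewrite -addSnnS => kn; apply: IH; rewrite jk.
by move/(_ _ _ h i); apply; rewrite ltn_ord.
Qed.
End Lmod.

Ltac lmod_mem x l :=
  lazymatch l with
  | nil => constr:(false)
  | cons x _ => constr:(true)
  | cons _ ?t => lmod_mem x t
  end.
Ltac lmod_idx x l :=
  lazymatch l with
  | cons x _ => constr:(0%N)
  | cons _ ?t => let n := lmod_idx x t in constr:(S n)
  end.
Ltac lmod_atoms t l :=
  lazymatch t with
  | GRing.zero => constr:(l)
  | GRing.add ?a ?b => let l' := lmod_atoms a l in lmod_atoms b l'
  | GRing.opp ?a => lmod_atoms a l
  | GRing.scale _ ?a => lmod_atoms a l
  | _ => let b := lmod_mem t l in
         lazymatch b with true => constr:(l) | false => constr:(cons t l) end
  end.
Ltac lmod_reify K t l :=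
  lazymatch t with
  | GRing.zero => constr:(@LZero K)
  | GRing.add ?a ?b => let a' := lmod_reify K a l in let b' := lmod_reify K b l in
      constr:(@LAdd K a' b')
  | GRing.opp ?a => let a' := lmod_reify K a l in constr:(@LOpp K a')
  | GRing.scale ?k ?a => let a' := lmod_reify K a l in constr:(@LScale K k a')
  | _ => let n := lmod_idx t l in constr:(@LAtom K n)
  end.
Ltac lmod_setup :=
  lazymatch goal with
  | |- @eq ?T ?a ?b =>
    let V := constr:([the lmodType _ of T]) in
    lazymatch type of V with
    | GRing.Lmodule.type ?K0 =>
      let S := eval hnf in (GRing.PzRing.sort K0) in
      let K := constr:([the comNzRingType of S]) in
      let l := lmod_atoms a (@nil T) in
      let l := lmod_atoms b l in
      let e := lmod_reify K a l in
      let f := lmod_reify K b l in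
      change (@lval K V l e = @lval K V l f);
      apply: lmod_eq => /=
    end
  end.
Ltac lmod := lmod_setup; repeat split; try by [ring|field].

(** * C*-algebras without spectral theory *)

Section CstarBasics.
Variables (R : realType) (A : cstarAlg R).
Implicit Types (a b c x y : A) (k : R[i]).

Lemma cmulA a b c : cmul a (cmul b c) = cmul (cmul a b) c.
Proof. by case: A a b c. Qed.
Lemma cmul_linl k a b c : cmul (k *: a + b) c = k *: cmul a c + cmul b c.
Proof. by case: A a b c. Qed.
Lemma cmul_linr k a b c : cmul a (k *: b + c) = k *: cmul a b + cmul a c.
Proof. by case: A a b c. Qed.
Lemma cstar_lin k a b : cstar (k *: a + b) = cj k *: cstar a + cstar b.
Proof. by case: A a b. Qed.
Lemma cstarM a b : cstar (cmul a b) = cmul (cstar b) (cstar a).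
Proof. by case: A a b. Qed.
Lemma cstarK a : cstar (cstar a) = a.
Proof. by case: A a. Qed.
Lemma cnormM a b : nr (cmul a b) <= nr a * nr b.
Proof.
have h : `|cmul a b| <= `|a| * `|b| by case: A a b.
by move: h; rewrite !nrE -rmorphM lecR.
Qed.
Lemma cnorm_sq a : nr (cmul (cstar a) a) = nr a ^+ 2.
Proof.
have h : `|cmul (cstar a) a| = `|a| ^+ 2 by case: A a.
by apply: complexI; rewrite -nrE h nrE rmorphXn.
Qed.

Lemma cmul0l a : cmul 0 a = 0.
Proof. by have := cmul_linl (-1) 0 0 a; rewrite scaler0 addr0 scaleN1r addNr. Qed.
Lemma cmul0r a : cmul a 0 = 0.
Proof. by have := cmul_linr (-1) a 0 0; rewrite scaler0 addr0 scaleN1r addNr. Qed.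
Lemma cmulDl a b c : cmul (a + b) c = cmul a c + cmul b c.
Proof. by have := cmul_linl 1 a b c; rewrite !scale1r. Qed.
Lemma cmulDr a b c : cmul a (b + c) = cmul a b + cmul a c.
Proof. by have := cmul_linr 1 a b c; rewrite !scale1r. Qed.
Lemma cmulZl k a c : cmul (k *: a) c = k *: cmul a c.
Proof. by have := cmul_linl k a 0 c; rewrite cmul0l !addr0. Qed.
Lemma cmulZr k a c : cmul a (k *: c) = k *: cmul a c.
Proof. by have := cmul_linr k a c 0; rewrite cmul0r !addr0. Qed.
Lemma cmulNl a c : cmul (- a) c = - cmul a c.
Proof. by rewrite -scaleN1r cmulZl scaleN1r. Qed.
Lemma cmulNr a c : cmul a (- c) = - cmul a c.
Proof. by rewrite -scaleN1r cmulZr scaleN1r. Qed.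
Lemma cstar0 : cstar 0 = 0 :> A.
Proof.
have := cstar_lin (-1) (0 : A) 0.
by rewrite scaler0 addr0 rmorphN rmorph1 scaleN1r addNr.
Qed.
Lemma cstarD a b : cstar (a + b) = cstar a + cstar b.
Proof. by have := cstar_lin 1 a b; rewrite rmorph1 !scale1r. Qed.
Lemma cstarZ k a : cstar (k *: a) = cj k *: cstar a.
Proof. by have := cstar_lin k a 0; rewrite cstar0 !addr0. Qed.
Lemma cstarN a : cstar (- a) = - cstar a.
Proof. by rewrite -scaleN1r cstarZ rmorphN rmorph1 scaleN1r. Qed.

Definition cmulE := (cmulDl, cmulDr, cmulNl, cmulNr, cmulZl, cmulZr, cmulA,
  cmul0l, cmul0r).
Definition cstarE := (cstarD, cstarN, cstarZ, cstarM, cstarK, cstar0).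

Lemma nr_cstar a : nr (cstar a) = nr a.
Proof.
have h b : nr b <= nr (cstar b).
  have := cnormM (cstar b) b; rewrite cnorm_sq expr2.
  have := nr_ge0 b; rewrite le_eqVlt => /orP[/eqP <- _|b0]; first exact: nr_ge0.
  by rewrite ler_pM2r.
by apply/le_anti; rewrite h andbT -{2}(cstarK a) h.
Qed.

Lemma nr_op_le a (t : R) : 0 <= t -> (forall x, nr (cmul a x) <= t * nr x) ->
  nr a <= t.
Proof.
move=> t0 h; have := h (cstar a).
have := cnorm_sq (cstar a); rewrite cstarK nr_cstar => ->.
have := nr_ge0 a; rewrite le_eqVlt => /orP[/eqP <- //|a0].
by rewrite expr2 ler_pM2r.
Qed.

Lemma tendsD (V : normedModType R[i]) (u v : nat -> V) (a b : V) :
  tends u a -> tends v b -> tends (fun n => u n + v n) (a + b).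
Proof.
move=> h h' e e0.
have [N hN] := h (e / 2) ltac:(lra); have [N' hN'] := h' (e / 2) ltac:(lra).
exists (maxn N N') => n; rewrite geq_max => /andP[/hN H /hN' H'].
by rewrite opprD addrACA; have := nrD (u n - a) (v n - b); lra.
Qed.

Lemma tends_lip (V W : normedModType R[i]) (f : V -> W) (M : R) u (a : V) :
  (forall x y : V, nr (f x - f y) <= M * nr (x - y)) ->
  tends u a -> tends (f \o u) (f a).
Proof.
move=> fM h e e0; have M0 : 0 < `|M| + 1 by have := normr_ge0 M; lra.
have [N hN] := h (e / (`|M| + 1)) ltac:(exact: divr_gt0).
exists N => n /hN; rewrite ltr_pdivlMr// => H /=; apply: le_lt_trans (fM _ _) _.
by have := nr_ge0 (u n - a); have := ler_norm M; nra.
Qed.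

Lemma tendsZ (V : normedModType R[i]) k (u : nat -> V) (a : V) :
  tends u a -> tends (fun n => k *: u n) (k *: a).
Proof.
move=> h; apply: (@tends_lip V V ( *:%R k) (cn k) u a _ h) => x y.
by rewrite -scalerBr nrZ.
Qed.

Lemma tends_cst (V : normedModType R[i]) (a : V) : tends (fun=> a) a.
Proof. by move=> e e0; exists 0%N => n _; rewrite subrr nr0. Qed.

Lemma tends_shift (V : normedModType R[i]) (u : nat -> V) (a : V) :
  tends u a -> tends (fun n => u n.+1) a.
Proof. by move=> h e /h[N hN]; exists N => n /leqW/hN. Qed.

Lemma tends_mull b u a : tends u a -> tends (fun n => cmul b (u n)) (cmul b a).
Proof.
move=> h; apply: (@tends_lip A A (cmul b) (nr b) u a _ h) => x y.
by rewrite -cmulNr -cmulDr cnormM.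
Qed.

Lemma tends_mulr b u a : tends u a -> tends (fun n => cmul (u n) b) (cmul a b).
Proof.
move=> h; apply: (@tends_lip A A (fun x => cmul x b) (nr b) u a _ h) => x y.
by rewrite -cmulNl -cmulDl mulrC cnormM.
Qed.

Lemma tends_star (u : nat -> A) a : tends u a ->
  tends (fun n => cstar (u n)) (cstar a).
Proof.
move=> h; apply: (@tends_lip A A (@cstar _ A) 1 u a _ h) => x y.
by rewrite -cstarN -cstarD nr_cstar mul1r.
Qed.

Lemma tends_sqr (u : nat -> A) a : tends u a ->
  tends (fun n => cmul (u n) (u n)) (cmul a a).
Proof.
move=> h.
have -> : (fun n => cmul (u n) (u n)) = (fun n => cmul (u n - a) (u n - a) +
    (cmul (u n) a + (cmul a (u n) + - cmul a a))).
  by apply: funext => n; rewrite !cmulE; lmod.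
suff h0 : tends (fun n => cmul (u n - a) (u n - a)) 0.
  have := tendsD h0 (tendsD (tends_mulr a h) (tendsD (tends_mull a h)
    (tends_cst (- cmul a a)))).
  by rewrite subrr addr0 add0r.
move=> e e0; have [N hN] := h (Num.min e 1) ltac:(rewrite lt_min e0; lra).
exists N => n /hN; rewrite lt_min subr0 => /andP[H1 H2].
have := cnormM (u n - a) (u n - a); have := nr_ge0 (u n - a); nra.
Qed.

Definition subalg (L : set A) : Prop :=
  closed_subspace L /\ forall a b, L a -> L b -> L (cmul a b).

End CstarBasics.

(** * Contractions from the circle equation *)

Section Iso.
Variables (R : realType) (A : cstarAlg R).
Implicit Types (a b c x y : A) (k : R[i]).

Lemma cjR (r : R) : cj r%:C = r%:C.
Proof. exact: conjc_real. Qed.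

Lemma cji : cj ('i : R[i]) = - 'i.
Proof. by apply/eqP; rewrite eq_complex /= oppr0 !eqxx. Qed.

Lemma mulii : ('i : R[i]) * 'i = -1.
Proof. by rewrite -expr2 sqr_i. Qed.

Definition self_adjoint a : Prop := cstar a = a.

(** In the unitization the last hypothesis says $(l+a)^2+(m+b)^2=1$, so that $(l+a)+i(m+b)$ is
    unitary. Letting it act on [x] avoids adjoining a unit. *)
Lemma isometry_aux (l m : R) a b x : self_adjoint a -> self_adjoint b ->
  cmul a b = cmul b a -> l ^+ 2 + m ^+ 2 = 1 ->
  (2 * l)%:C *: a + cmul a a + (2 * m)%:C *: b + cmul b b = 0 ->
  nr ((l%:C *: x + cmul a x) + 'i *: (m%:C *: x + cmul b x)) = nr x.
Proof.
move=> sa sb ab lm rel.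
set al := _ + cmul a x; set be := _ + cmul b x.
have e1 : cmul (cstar al) al + cmul (cstar be) be = cmul (cstar x) x.
  have : cmul (cmul (cstar x) ((2 * l)%:C *: a + cmul a a + (2 * m)%:C *: b + cmul b b)) x = 0.
    by rewrite rel cmul0r cmul0l.
  rewrite /al /be !cstarE !cjR sa sb !cmulE => rel'.
  rewrite -[RHS]addr0 -[X in _ = _ + X]rel' -[X in _ = X + _]scale1r.
  rewrite (_ : 1 = (l ^+ 2 + m ^+ 2)%:C); last by rewrite lm.
  by lmod.
have e2 : cmul (cstar al) be = cmul (cstar be) al.
  rewrite /al /be !cstarE !cjR sa sb !cmulE.
  by rewrite -[cmul (cmul (cstar x) a) b]cmulA ab !cmulE; lmod.
clearbody al be; apply/eqP; rewrite -(eqrXn2 (n := 2)) ?nr_ge0//; apply/eqP.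
rewrite -!cnorm_sq -e1; congr nr.
rewrite !cstarD !cstarZ cji !cmulE e2 !scalerA mulNr mulii opprK.
by rewrite scale1r; lmod.
Qed.

(** $l+a$ is the average of the two unitaries $(l+a)\pm i(m+b)$. *)
Lemma contraction_of_circle (l m : R) a b x : self_adjoint a -> self_adjoint b ->
  cmul a b = cmul b a -> l ^+ 2 + m ^+ 2 = 1 ->
  (2 * l)%:C *: a + cmul a a + (2 * m)%:C *: b + cmul b b = 0 ->
  nr (l%:C *: x + cmul a x) <= nr x.
Proof.
move=> sa sb ab lm rel.
have h1 := isometry_aux x sa sb ab lm rel.
have sNb : self_adjoint (- b) by rewrite /self_adjoint cstarN sb.
have h2 : nr ((l%:C *: x + cmul a x) + 'i *: ((- m)%:C *: x + cmul (- b) x)) = nr x.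
  apply: isometry_aux => //; first by rewrite !cmulE ab.
    by rewrite sqrrN.
  by rewrite -rel !cmulE; lmod.
set al := _ + cmul a x in h1 h2 *; clearbody al.
have e : 2 *: al = (al + 'i *: (m%:C *: x + cmul b x)) +
    (al + 'i *: ((- m)%:C *: x + cmul (- b) x)).
  by rewrite cmulE; lmod.
have := nrD (al + 'i *: (m%:C *: x + cmul b x))
    (al + 'i *: ((- m)%:C *: x + cmul (- b) x)).
rewrite -e h1 h2 nrZ (_ : cn 2 = 2); first by lra.
by rewrite (_ : 2 = (2 : R)%:C) ?cnR ?ger0_norm// rmorphD.
Qed.
End Iso.

(** * Square roots by iteration *)

Section SqrtIter.
Variables (R : realType).

(* The scalar case of the iteration below; it majorizes all others. *)
Fixpoint sqr_it (n : nat) : R :=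
  if n is m.+1 then (1 + sqr_it m ^+ 2) / 2 else 0.

Lemma sqr_it_bd n : 0 <= sqr_it n <= 1.
Proof. by elim: n => [|n /andP[h1 h2]] /=; [lra|apply/andP; split; nra]. Qed.

Lemma sqr_it_tends e : 0 < e -> exists N, forall n, (N <= n)%N -> 1 - sqr_it n < e.
Proof.
move=> e0.
have inc n : sqr_it n <= sqr_it n.+1.
  by rewrite /=; have := sqr_ge0 (1 - sqr_it n); lra.
(* The increment of the iteration at $r$ is $(1-r)^2/2$, whence the threshold [e ^+ 2 / 2]. *)
have [N hN] := monotone_cauchy inc (fun n => proj2 (andP (sqr_it_bd n)))
  (e := e ^+ 2 / 2) ltac:(by nra).
exists N => n Nn; have := hN n.+1 n (leqW Nn) Nn.
by move=> /ltr_normlW /=; have /andP[] := sqr_it_bd n; nra.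
Qed.

Variables (V : normedModType R[i]) (X : V -> V).
Hypothesis Xlin : forall k x y, X (k *: x + y) = k *: X x + X y.
Hypothesis Xle : forall x, nr (X x) <= nr x.

(** Iteration for $2Y=X+Y^2$, that is, $(1-Y)^2=1-X$; its limit is $1-\sqrt{1-X}$. All coefficients
    are positive, so the case $X=1$, which is [sqr_it], bounds the general one. *)
Fixpoint sq_op (n : nat) (v : V) : V :=
  if n is m.+1 then (2^-1 : R)%:C *: (X v + sq_op m (sq_op m v)) else 0.

Lemma sq_op_lin n k x y : sq_op n (k *: x + y) = k *: sq_op n x + sq_op n y.
Proof.
elim: n x y => [|n IH] x y /=; first by rewrite scaler0 addr0.
by rewrite Xlin !IH; lmod.
Qed.

Lemma sq_op_bd n v : nr (sq_op n v) <= sqr_it n * nr v.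
Proof.
elim: n v => [|n IH] v /=; first by rewrite nr0 mul0r.
rewrite nrZ cnR ger0_norm ?invr_ge0//.
have := nrD (X v) (sq_op n (sq_op n v)); have := Xle v.
have := IH (sq_op n v); have := IH v; have /andP[] := sqr_it_bd n.
by have := nr_ge0 v; nra.
Qed.

(** The difference of consecutive iterates satisfies
    $2(Y_{n+2}-Y_{n+1})=Y_{n+1}(Y_{n+1}-Y_n)+(Y_{n+1}-Y_n)Y_n$, and the scalar increments satisfy
    the same recursion. *)
Lemma sq_op_inc n v :
  nr (sq_op n.+1 v - sq_op n v) <= (sqr_it n.+1 - sqr_it n) * nr v.
Proof.
elim: n v => [|n IH] v.
  rewrite /= addr0 subr0 subr0 nrZ cnR ger0_norm ?invr_ge0//.
  by have := Xle v; rewrite expr0n addr0 mul1r; nra.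
have -> : sq_op n.+2 v - sq_op n.+1 v = (2^-1 : R)%:C *:
    (sq_op n.+1 (sq_op n.+1 v - sq_op n v) + (sq_op n.+1 (sq_op n v) - sq_op n (sq_op n v))).
  have -> : sq_op n.+1 (sq_op n.+1 v - sq_op n v) =
      sq_op n.+1 (sq_op n.+1 v) - sq_op n.+1 (sq_op n v).
    by rewrite addrC -scaleN1r sq_op_lin scaleN1r addrC.
  transitivity ((2^-1 : R)%:C *: (X v + sq_op n.+1 (sq_op n.+1 v)) -
    (2^-1 : R)%:C *: (X v + sq_op n (sq_op n v))) => //.
  by lmod.
rewrite nrZ cnR ger0_norm ?invr_ge0//.
have := nrD (sq_op n.+1 (sq_op n.+1 v - sq_op n v))
  (sq_op n.+1 (sq_op n v) - sq_op n (sq_op n v)).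
have := sq_op_bd n.+1 (sq_op n.+1 v - sq_op n v).
have := IH (sq_op n v); have := IH v; have := sq_op_bd n v.
have /andP[a0 a1] := sqr_it_bd n; have /andP[b0 b1] := sqr_it_bd n.+1.
have := nr_ge0 v.
have -> : sqr_it n.+2 = (1 + sqr_it n.+1 ^+ 2) / 2 by [].
have e : sqr_it n.+1 = (1 + sqr_it n ^+ 2) / 2 by [].
have le : sqr_it n <= sqr_it n.+1 by rewrite e; have := sqr_ge0 (1 - sqr_it n); lra.
move: (sqr_it n.+1) (sqr_it n) a0 a1 b0 b1 le e => s r.
move=> r0 r1 s0 s1 rs e; set nv := nr v.
set y1 := nr (sq_op n v); set y2 := nr (_ - sq_op n v); set y3 := nr (_ - sq_op n (sq_op n v)).
set y4 := nr (sq_op n.+1 (_ - _)); set y5 := nr (_ + _).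
move=> v0 H1 H2 H3 H4 H5.
have h3 : y3 <= (s - r) * (r * nv) by apply: le_trans H3 _; apply: ler_wpM2l => //; lra.
have h4 : y4 <= s * ((s - r) * nv) by apply: le_trans H4 _; apply: ler_wpM2l.
have -> : ((1 + s ^+ 2) / 2 - s) * nv = ((s - r) * (r * nv) + s * ((s - r) * nv)) / 2.
  by rewrite {2}e; field.
by lra.
Qed.
End SqrtIter.

Section CstarSqrt.
Variables (R : realType) (A : cstarAlg R).
Implicit Types (a b c x y : A) (k : R[i]).

(** [s] is the scalar part in the unitization: for $X=s+x$ and $Y=s+w$ the relation for [w] is
    $2Y=X+Y^2$, because $s^2=s$. The last clause holds since [w] is a limit of polynomials in [x]
    without constant term. *)
Lemma sqrt_unitization (s : bool) x :
  self_adjoint x -> (forall v, nr ((s%:R : R)%:C *: v + cmul x v) <= nr v) ->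
  exists w, [/\ self_adjoint w, 2 *: w = x + (2 * s%:R) *: w + cmul w w,
    (forall v, nr ((s%:R : R)%:C *: v + cmul w v) <= nr v) &
    forall L, subalg L -> L x -> L w].
Proof.
move=> sx Xle; set X := fun v => (s%:R : R)%:C *: v + cmul x v.
have Xlin k u v : X (k *: u + v) = k *: X u + X v by rewrite /X !cmulE; lmod.
(* [sg n] and [w n] are the scalar part and the part in [A] of the n-th iterate [sq_op X n]. *)
pose sg n : R := s%:R * sqr_it R n.
pose w := fix w n := if n is m.+1 then
  (2^-1 : R)%:C *: (x + (2 * sg m)%:C *: w m + cmul (w m) (w m)) else 0.
have ssr : s%:R * s%:R = s%:R :> R by case: (s); rewrite ?mulr1 ?mulr0.
have wE n v : sq_op X n v = (sg n)%:C *: v + cmul (w n) v.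
  elim: n v => [|n IH] v /=; first by rewrite /sg mulr0 scale0r cmul0l addr0.
  rewrite !IH !cmulE /X.
  have -> : (sg n.+1)%:C = (2^-1)%:C * ((s%:R)%:C + (sg n)%:C ^+ 2) :> R[i].
    rewrite -!rmorphXn -!rmorphD -rmorphM /=; congr (_%:C).
    rewrite /sg [LHS]/= (_ : (s%:R * _) ^+ 2 = (s%:R * s%:R) * sqr_it R n ^+ 2); last by ring.
    by rewrite ssr; field.
  by lmod.
have winc n : nr (w n.+1 - w n) <= 2 * sqr_it R n.+1 - 2 * sqr_it R n.
  have i0 : sqr_it R n <= sqr_it R n.+1.
    by rewrite /=; have := sqr_ge0 (1 - sqr_it R n); lra.
  apply: nr_op_le => [|v]; first by lra.
  have -> : cmul (w n.+1 - w n) v = (sq_op X n.+1 v - sq_op X n v) -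
      (sg n.+1 - sg n)%:C *: v.
    by rewrite !wE rmorphB /= !cmulE; lmod.
  have := nrD (sq_op X n.+1 v - sq_op X n v) (- ((sg n.+1 - sg n)%:C *: v)).
  rewrite nrN nrZ cnR -mulrBr ger0_norm; last by rewrite mulr_ge0 ?ler0n// subr_ge0.
  have := sq_op_inc Xlin Xle n v.
  have s1 : (s%:R : R) <= 1 by case: (s).
  have sd : s%:R * (sqr_it R n.+1 - sqr_it R n) <= sqr_it R n.+1 - sqr_it R n.
    by apply: ler_piMl; rewrite ?subr_ge0.
  by have := ler_wpM2r (nr_ge0 v) sd; lra.
have [|wl wlim] := increments_tends (M := 2) winc.
  by move=> n; have /andP[] := sqr_it_bd R n; lra.
have sw n : self_adjoint (w n).
  elim: n => [|n IH]; rewrite /self_adjoint ?cstar0//= !cstarE !cjR.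
  by rewrite sx IH.
exists wl; split.
- apply: tends_uniq (tends_star wlim) _.
  by rewrite (_ : (fun n => cstar (w n)) = w)//; apply: funext => n; exact: sw.
- apply: tends_uniq (tendsZ 2 (tends_shift wlim)) _.
  suff h : tends (fun n => (2 * sg n)%:C *: w n) ((2 * s%:R) *: wl).
    have := tendsD (tendsD (tends_cst x) h) (tends_sqr wlim).
    rewrite (_ : (fun n => x + _ + _) = (fun n => 2 *: w n.+1))//.
    by apply: funext => n /=; lmod.
  have -> : (2 * s%:R) *: wl = (2 * s%:R) *: wl + 0 by rewrite addr0.
  have -> : (fun n => (2 * sg n)%:C *: w n) = (fun n => (2 * s%:R) *: w n +
      (2 * sg n - 2 * s%:R)%:C *: w n).
    have sC : (s%:R : R[i]) = (s%:R : R)%:C by rewrite rmorph_nat.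
    by apply: funext => n; rewrite sC; lmod.
  apply: tendsD; first exact: tendsZ.
  have [N0 hN0] := tends_cauchy wlim (e := 1) ltac:(lra).
  move=> e e0; set M := nr (w N0) + 1.
  have M0 : 0 < M by rewrite /M; have := nr_ge0 (w N0); lra.
  have [N hN] := sqr_it_tends (R := R) (e := e / (2 * M)) ltac:(apply: divr_gt0; lra).
  exists (maxn N N0) => n; rewrite geq_max => /andP[/hN h1 /hN0/(_ (leqnn _)) h2].
  rewrite subr0 nrZ cnR /sg -mulrBr normrM ger0_norm//.
  have -> : s%:R * sqr_it R n - s%:R = s%:R * (sqr_it R n - 1) by ring.
  have /andP[b0 b1] := sqr_it_bd R n.
  rewrite normrM ger0_norm ?ler0n// ler0_norm ?subr_le0//.
  move: h1; rewrite ltr_pdivlMr; last lra.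
  have := nr_le (w n) (w N0); have : (s%:R : R) <= 1 by case: (s).
  have : 0 <= (s%:R : R) by rewrite ler0n.
  have := nr_ge0 (w n); rewrite -/M => W0 S0 S1 W1.
  have W2 : nr (w n) <= M by rewrite /M; lra.
  move: (sqr_it R n) b0 b1 => r b0 b1 H.
  have : s%:R * - (r - 1) <= 1 - r by nra.
  by nra.
- move=> v; apply: (@tends_ge _ _ (fun n => (sg n)%:C *: v + cmul (w n) v)).
    apply: tendsD; last exact: tends_mulr.
    move=> e e0; have v0 := nr_ge0 v.
    have [N hN] := sqr_it_tends (R := R) (e := e / (nr v + 1)) ltac:(apply: divr_gt0; lra).
    exists N => n /hN; rewrite ltr_pdivlMr; last lra.
    rewrite -scalerBl -rmorphB nrZ cnR /sg.
    have -> : s%:R * sqr_it R n - s%:R = s%:R * (sqr_it R n - 1) by ring.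
    have /andP[b0 b1] := sqr_it_bd R n.
    rewrite normrM ger0_norm ?ler0n// ler0_norm ?subr_le0//.
    have : (s%:R : R) <= 1 by case: (s).
    have : 0 <= (s%:R : R) by rewrite ler0n.
    move=> S0 S1 H; have : s%:R * - (sqr_it R n - 1) <= 1 - sqr_it R n by nra.
    by nra.
  move=> n; rewrite -wE; have := sq_op_bd Xle n v; have /andP[] := sqr_it_bd R n.
  by have := nr_ge0 v; nra.
- move=> L [[L0 Ll cL] LM] Lx; apply: (tends_closed cL) wlim => n.
  have LZ k a : L a -> L (k *: a) by move=> La; rewrite -[_ *: _]addr0; apply: Ll.
  have LD a b : L a -> L b -> L (a + b) by move=> La Lb; rewrite -[a]scale1r; apply: Ll.
  by elim: n => [//|n IH] /=; apply/LZ/LD; [apply/LD => //; exact: LZ|exact: LM].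
Qed.

Lemma nrZR (V : normedModType R[i]) (r : R) (v : V) : 0 <= r -> nr (r%:C *: v) = r * nr v.
Proof. by move=> r0; rewrite nrZ cnR ger0_norm. Qed.

Lemma commutant_subalg c : subalg [set x | cmul x c = cmul c x].
Proof.
split; last by move=> a b /= ha hb; rewrite -cmulA hb cmulA ha cmulA.
split=> /=; first by rewrite cmul0l cmul0r.
  by move=> k x y /= hx hy; rewrite !cmulE hx hy.
apply/closed_epsP => x hx /=; apply/eqP; rewrite -subr_eq0; apply/eqP/nr_small => e e0.
have c0 := nr_ge0 c.
have [y /= yc xy] := hx (e / (2 * (nr c + 1))) ltac:(apply: divr_gt0; lra).
have -> : cmul x c - cmul c x = cmul (x - y) c - cmul c (x - y).
  by rewrite !cmulE yc; lmod.
have := nrD (cmul (x - y) c) (- cmul c (x - y)); rewrite nrN.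
have := cnormM (x - y) c; have := cnormM c (x - y).
move: xy; rewrite ltr_pdivlMr; last lra.
by have := nr_ge0 (x - y); nra.
Qed.

(* [1 - e] is the square root of [1 - c^2] *)
Lemma exists_cosine c : self_adjoint c -> nr c <= 1 ->
  exists e, [/\ self_adjoint e, cmul e c = cmul c e & 2 *: e = cmul c c + cmul e e].
Proof.
move=> sc c1; have [||w [sw we _ wL]] := @sqrt_unitization false (cmul c c).
- by rewrite /self_adjoint cstarM sc.
- move=> v; rewrite /= scale0r add0r -cmulA.
  apply: le_trans (cnormM _ _) _; have := cnormM c v.
  by have := nr_ge0 c; have := nr_ge0 v; have := nr_ge0 (cmul c v); nra.
exists w; split=> //; last by rewrite we mulr0 scale0r addr0.
by apply: (wL _ (commutant_subalg c)); rewrite /= cmulA.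
Qed.

(** $1-c^2=(1-e)^2$, and $1-e$ is contractive because $(1-e)^2+c^2=1$. *)
Lemma contraction_one_minus_sqr c v : self_adjoint c -> nr c <= 1 ->
  nr (v - cmul (cmul c c) v) <= nr v.
Proof.
move=> sc c1; have [e [se ec e2]] := exists_cosine sc c1.
have h x : nr (x - cmul e x) <= nr x.
  have -> : x - cmul e x = (1 : R)%:C *: x + cmul (- e) x by rewrite cmulNl; lmod.
  apply: (@contraction_of_circle R A 1 0 (- e) c) => //.
  - by rewrite /self_adjoint cstarN se.
  - by rewrite !cmulE ec.
  - by rewrite expr1n expr0n addr0.
  - rewrite mulr1 mulr0 scale0r addr0 !cmulE opprK scalerN rmorph_nat e2; lmod.
have -> : v - cmul (cmul c c) v = (v - cmul e v) - cmul e (v - cmul e v).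
  have -> : cmul c c = 2 *: e - cmul e e by rewrite e2; lmod.
  by rewrite !cmulE; lmod.
by apply: le_trans (h _) (h _).
Qed.

(** The absolute value $|y|=\sqrt{1-X}$ for $X=1-y^2$, which is contractive. That $1-k$ is
    contractive stands in for positivity of [k]; it is the form in which square roots are taken
    afterwards. *)
Lemma exists_abs y : self_adjoint y -> nr y <= 1 ->
  exists k : A, [/\ self_adjoint k, cmul k k = cmul y y,
    (forall v : A, nr (v - cmul k v) <= nr v) &
    forall L : set A, subalg L -> L y -> L k].
Proof.
move=> sy y1; have [||w [sw we wc wL]] := @sqrt_unitization true (- cmul y y).
- by rewrite /self_adjoint cstarN cstarM sy.
- by move=> v; rewrite /= scale1r cmulNl; apply: contraction_one_minus_sqr.
exists (- w); split.
- by rewrite /self_adjoint cstarN sw.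
- rewrite !cmulE opprK; move: we; rewrite /= mulr1 => we.
  have -> : cmul w w = (- cmul y y + 2 *: w + cmul w w) - (- cmul y y + 2 *: w) by lmod.
  by rewrite -we; lmod.
- by move=> v; have := wc v; rewrite /= scale1r cmulNl opprK.
- move=> L sL Ly; have [[L0 Ll cL] LM] := sL.
  have LN a : L a -> L (- a) by move=> La; rewrite -[- a]addr0 -scaleN1r; apply: Ll.
  by apply: (LN); apply: (wL L) => //; apply: LN; exact: LM.
Qed.

(** Contractivity of $1-k$ replaces positivity of [k]: the iteration for $X=1-k$ ends at $1-\sqrt
    k$, so the witness is $-\sqrt k$. *)
Lemma exists_sqrt (k : A) : self_adjoint k -> (forall v, nr (v - cmul k v) <= nr v) ->
  exists2 r, self_adjoint r & cmul r r = k.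
Proof.
move=> sk hk; have [||w [sw we _ _]] := @sqrt_unitization true (- k).
- by rewrite /self_adjoint cstarN sk.
- by move=> v; rewrite /= scale1r cmulNl.
exists w => //; move: we; rewrite /= mulr1 => we.
have -> : cmul w w = (- k + 2 *: w + cmul w w) - (- k + 2 *: w) by lmod.
by rewrite -we; lmod.
Qed.
End CstarSqrt.

(** * Semi-inner products and contractivity *)

Section SemiInner.
Variables (R : realType) (V : lmodType R[i]) (s : V -> V -> R[i]).
Implicit Types (x y z : V) (k : R[i]).

Definition semi_inner : Prop :=
  [/\ forall k x y z, s x (k *: y + z) = k * s x y + s x z,
      forall k x y z, s (k *: y + z) x = cj k * s y x + s z x &
      forall x, 0 <= s x x].

Hypothesis s_si : semi_inner.

Lemma si0r x : s x 0 = 0.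
Proof.
by case: s_si => h _ _; have := h (-1) x 0 0; rewrite scaler0 addr0 mulN1r addNr.
Qed.
Lemma siDr x y z : s x (y + z) = s x y + s x z.
Proof. by case: s_si => h _ _; have := h 1 x y z; rewrite scale1r mul1r. Qed.
Lemma siZr k x y : s x (k *: y) = k * s x y.
Proof. by case: s_si => h _ _; have := h k x y 0; rewrite si0r !addr0. Qed.
Lemma siNr x y : s x (- y) = - s x y.
Proof. by rewrite -scaleN1r siZr mulN1r. Qed.
Lemma si0l x : s 0 x = 0.
Proof.
case: s_si => _ h _; have := h (-1) x 0 0.
by rewrite scaler0 addr0 rmorphN rmorph1 mulN1r addNr.
Qed.
Lemma siDl x y z : s (y + z) x = s y x + s z x.
Proof. by case: s_si => _ h _; have := h 1 x y z; rewrite scale1r rmorph1 mul1r. Qed.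
Lemma siZl k x y : s (k *: y) x = cj k * s y x.
Proof. by case: s_si => _ h _; have := h k x y 0; rewrite si0l !addr0. Qed.
Lemma siNl x y : s (- y) x = - s y x.
Proof. by rewrite -scaleN1r siZl rmorphN rmorph1 mulN1r. Qed.
Lemma si_ge0 x : 0 <= s x x.
Proof. by case: s_si. Qed.

Definition siE := (siDr, siZr, siNr, siDl, siZl, siNl, si0r, si0l).

Definition sq x : R := Re (s x x).

Lemma sqE x : s x x = (sq x)%:C.
Proof. exact: ge0C (si_ge0 x). Qed.
Lemma sq_ge0 x : 0 <= sq x.
Proof. by rewrite -ler0c -sqE si_ge0. Qed.

Lemma si_herm x y : s y x = cj (s x y).
Proof.
have im0 z : Im (s z z) = 0 by rewrite sqE.
have h1 := im0 (x + y); have h2 := im0 (x + 'i *: y); move: h1 h2.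
rewrite !siE !sqE cji; case: (s x y) => a b; case: (s y x) => c d /=.
rewrite ?(mul0r, mul1r, mulr0, mulr1, oppr0, add0r, addr0, mulN1r, sub0r) => h1 h2.
by apply/eqP; rewrite eq_complex /=; apply/andP; split; apply/eqP; lra.
Qed.

Lemma sqZ k x : sq (k *: x) = cn k ^+ 2 * sq x.
Proof.
rewrite /sq siZl siZr sqE mulrA (mulrC (cj k)) -normCK cnE -rmorphXn -rmorphM.
by [].
Qed.

Lemma sqD x y : sq (x + y) = sq x + sq y + 2 * Re (s x y).
Proof.
rewrite /sq !siE (si_herm x y) !sqE; case: (s x y) => a b /=; lra.
Qed.

Lemma sqN x : sq (- x) = sq x.
Proof. by rewrite /sq siNl siNr opprK. Qed.

Lemma parallelogram x y : sq (x + y) + sq (x - y) = 2 * sq x + 2 * sq y.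
Proof. by rewrite !sqD sqN siNr; case: (s x y) => a b /=; lra. Qed.

Lemma cauchy_schwarz x y : cn (s x y) ^+ 2 <= sq x * sq y.
Proof.
have key t : 0 <= sq x - 2 * t * cn (s x y) ^+ 2 + t ^+ 2 * cn (s x y) ^+ 2 * sq y.
  have := sq_ge0 (x - (t%:C * s y x) *: y).
  rewrite sqD sqN sqZ cnM cnR siNr siZr (si_herm x y) cn_conj -mulrA.
  have -> : cj (s x y) * s x y = (cn (s x y) ^+ 2)%:C.
    by rewrite mulrC -normCK cnE -rmorphXn.
  rewrite -rmorphM -rmorphN /= exprMn real_normK ?num_real//; lra.
have c0 := sqr_ge0 (cn (s x y)); have p0 := sq_ge0 x.
have := sq_ge0 y; rewrite le_eqVlt => /orP[/eqP r0|r0].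
  rewrite -r0 mulr0; case: (lerP (cn (s x y) ^+ 2) 0) => // c1.
  (* With [sq y = 0] the inequality is affine in [t]; this [t] makes the right-hand side $-1$. *)
  have := key ((sq x + 1) / (2 * cn (s x y) ^+ 2)); rewrite -r0 mulr0 addr0.
  move: (cn (s x y)) c1 => c c1; rewrite (_ : 2 * _ * _ = sq x + 1); first by lra.
  by field; apply/eqP => h0; rewrite h0 expr0n ltxx in c1.
have := key (sq y)^-1.
rewrite (_ : _ + _ = sq x - cn (s x y) ^+ 2 / sq y).
  by rewrite subr_ge0 ler_pdivrMr.
by field; rewrite gt_eqF.
Qed.

Lemma sq_eq0_l x y : sq x = 0 -> s x y = 0.
Proof.
move=> h; have := cauchy_schwarz x y; rewrite h mul0r => c.
by apply: cn_eq0; apply/eqP; rewrite -sqrf_eq0; apply/eqP/le_anti; rewrite c sqr_ge0.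
Qed.

Variable A : cstarAlg R.
Variable m : A -> V -> V.

Definition star_action : Prop :=
  [/\ forall k a b v, m (k *: a + b) v = k *: m a v + m b v,
      forall k a v w, m a (k *: v + w) = k *: m a v + m a w,
      forall a b v, m (cmul a b) v = m a (m b v) &
      forall a v w, s (m a v) w = s v (m (cstar a) w)].

Hypothesis m_act : star_action.

Lemma actDl a b v : m (a + b) v = m a v + m b v.
Proof. by case: m_act => h _ _ _; have := h 1 a b v; rewrite !scale1r. Qed.
Lemma act0l v : m 0 v = 0.
Proof.
by case: m_act => h _ _ _; have := h (-1) 0 0 v; rewrite scaler0 addr0 scaleN1r addNr.
Qed.
Lemma actZl k a v : m (k *: a) v = k *: m a v.
Proof. by case: m_act => h _ _ _; have := h k a 0 v; rewrite act0l !addr0. Qed.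
Lemma actNl a v : m (- a) v = - m a v.
Proof. by rewrite -(scaleN1r a) actZl scaleN1r. Qed.
Lemma actDr a v w : m a (v + w) = m a v + m a w.
Proof. by case: m_act => _ h _ _; have := h 1 a v w; rewrite !scale1r. Qed.
Lemma act0r a : m a 0 = 0.
Proof.
by case: m_act => _ h _ _; have := h (-1) a 0 0; rewrite scaler0 addr0 scaleN1r addNr.
Qed.
Lemma actZr k a v : m a (k *: v) = k *: m a v.
Proof. by case: m_act => _ h _ _; have := h k a v 0; rewrite act0r !addr0. Qed.
Lemma actNr a v : m a (- v) = - m a v.
Proof. by rewrite -(scaleN1r v) actZr scaleN1r. Qed.
Lemma actM a b v : m (cmul a b) v = m a (m b v).
Proof. by case: m_act. Qed.
Lemma act_adj a v w : s (m a v) w = s v (m (cstar a) w).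
Proof. by case: m_act. Qed.

Definition actE := (actDl, actZl, actNl, act0l, actDr, actZr, actNr, act0r, actM).

(** With the cosine $1-e$ of [c] one has $c^2+(1-e)^2=1$, hence $\|cv\|^2+\|(1-e)v\|^2=\|v\|^2$ for
    the semi-norm of [s]. *)
Lemma sa_action_contraction c v : self_adjoint c -> nr c <= 1 ->
  sq (m c v) <= sq v.
Proof.
move=> sc c1; have [e [se _ e2]] := exists_cosine sc c1.
have h : s (m c v) (m c v) + s (v - m e v) (v - m e v) = s v v.
  have -> : s (m c v) (m c v) = s v (m (2 *: e - cmul e e) v).
    by rewrite act_adj sc -actM e2 addrK.
  have -> : s (v - m e v) (v - m e v) = s v (v - 2 *: m e v + m e (m e v)).
    by rewrite !siE !(act_adj e) se; ring.
  by rewrite !actE -siDr; congr (s v _); lmod.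
have : sq (m c v) + sq (v - m e v) = sq v.
  by apply: complexI; rewrite rmorphD /= -!sqE.
by have := sq_ge0 (v - m e v); lra.
Qed.

(** Automatic continuity of the action: the Cauchy-Schwarz inequality for $v$ and $a^*av$ reduces it
    to the self-adjoint element $a^*a$. *)
Lemma action_contraction a v : sq (m a v) <= nr a ^+ 2 * sq v.
Proof.
have v0 := sq_ge0 v.
have sa c w : self_adjoint c -> sq (m c w) <= nr c ^+ 2 * sq w.
  move=> sc; have := nr_ge0 c; rewrite le_eqVlt => /orP[/eqP c0|c0].
    have -> : c = 0 by apply: nr_eq0.
    by rewrite act0l /sq si0l mulr_ge0 ?sqr_ge0 ?sq_ge0.
  have n1 : (nr c)%:C != 0 :> R[i] by rewrite eq_complex /= eqxx andbT gt_eqF.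
  pose c' := (nr c)^-1%:C *: c.
  have ce : c = (nr c)%:C *: c'.
    by rewrite scalerA -rmorphM /= mulfV ?gt_eqF// scale1r.
  rewrite {1}ce actZl sqZ cnR ger0_norm ?(ltW c0)//.
  apply: ler_wpM2l; first exact: sqr_ge0.
  apply: sa_action_contraction; first by rewrite /self_adjoint cstarZ cjR sc.
  by rewrite nrZR ?invr_ge0 ?(ltW c0)// mulVf ?gt_eqF.
have h := cauchy_schwarz v (m (cmul (cstar a) a) v).
have := sa (cmul (cstar a) a) v; rewrite /self_adjoint cstarM cstarK => /(_ erefl).
rewrite cnorm_sq; move: h; rewrite actM -act_adj.
have := sq_ge0 (m a v); have := sq_ge0 (m (cstar a) (m a v)).
rewrite sqE cnR ger0_norm ?sq_ge0//; move: (sq (m (cstar a) _)) (sq (m a v)) => u w u0 w0 h1 h2.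
have n0 := nr_ge0 a; apply: le_sqr_le; first by rewrite mulr_ge0 ?sqr_ge0.
apply: le_trans h1 (le_trans (ler_wpM2l v0 h2) _).
by rewrite le_eqVlt; apply/orP; left; apply/eqP; ring.
Qed.
End SemiInner.

Section StarHom.
Variables (R : realType) (A B : cstarAlg R) (h : A -> B).
Hypothesis hh : star_hom h.

Lemma hom_linear k a b : h (k *: a + b) = k *: h a + h b.
Proof. by case: hh => l _ _; apply: l. Qed.
Lemma hom0 : h 0 = 0.
Proof. by have := hom_linear (-1) 0 0; rewrite scaler0 addr0 scaleN1r addNr. Qed.
Lemma homD a b : h (a + b) = h a + h b.
Proof. by have := hom_linear 1 a b; rewrite !scale1r. Qed.
Lemma homZ k a : h (k *: a) = k *: h a.
Proof. by have := hom_linear k a 0; rewrite hom0 !addr0. Qed.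
Lemma homN a : h (- a) = - h a.
Proof. by rewrite -scaleN1r homZ scaleN1r. Qed.
Lemma homM a b : h (cmul a b) = cmul (h a) (h b).
Proof. by case: hh. Qed.
Lemma homS a : h (cstar a) = cstar (h a).
Proof. by case: hh. Qed.

(** The relation $c^2+(1-e)^2=1$ is algebraic, so the homomorphism transports it to [B], where it
    bounds [h c]. *)
Lemma hom_sa_contraction c : self_adjoint c -> nr c <= 1 -> nr (h c) <= 1.
Proof.
move=> sc c1; have [e [se ec e2]] := exists_cosine sc c1.
apply: nr_op_le => // v; rewrite mul1r.
have -> : cmul (h c) v = (0 : R)%:C *: v + cmul (h c) v by rewrite scale0r add0r.
apply: (@contraction_of_circle R B 0 1 (h c) (- h e)) => //.
- by rewrite /self_adjoint -homS sc.
- by rewrite /self_adjoint cstarN -homS se.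
- by rewrite !cmulE -!homM ec.
- by rewrite expr1n expr0n add0r.
- have := congr1 h e2; rewrite homZ homD !homM => e2'.
  have -> : (2 * 1)%:C *: - h e = - (2 *: h e) by lmod.
  by rewrite e2' !cmulE; lmod.
Qed.

Lemma hom_contraction a : nr (h a) <= nr a.
Proof.
apply: le_sqr_le (nr_ge0 a) _; rewrite -!cnorm_sq -homS -homM.
set c := cmul (cstar a) a.
have sc : self_adjoint c by rewrite /self_adjoint cstarM cstarK.
have := nr_ge0 c; rewrite le_eqVlt => /orP[/eqP/esym/nr_eq0 ->|c0].
  by rewrite hom0 !nr0.
have := @hom_sa_contraction ((nr c)^-1%:C *: c).
rewrite homZ !nrZR ?invr_ge0 ?(ltW c0)// mulVf ?gt_eqF// mulrC ler_pdivrMr// mul1r.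
by apply => //; rewrite /self_adjoint cstarZ cjR sc.
Qed.
End StarHom.

(** * Approximate units *)

Section Approx.
Variables (R : realType) (A : cstarAlg R).
Implicit Types (a b c x y : A) (k : R[i]) (L I : set A).

Lemma subspaceZ (V : normedModType R[i]) (L : set V) k (x : V) :
  closed_subspace L -> L x -> L (k *: x).
Proof. by move=> [L0 Ll _] Lx; rewrite -[_ *: _]addr0; apply: Ll. Qed.
Lemma subspaceD (V : normedModType R[i]) (L : set V) (x y : V) :
  closed_subspace L -> L x -> L y -> L (x + y).
Proof. by move=> [L0 Ll _] Lx Ly; rewrite -[x]scale1r; apply: Ll. Qed.
Lemma subspaceN (V : normedModType R[i]) (L : set V) (x : V) :
  closed_subspace L -> L x -> L (- x).
Proof. by move=> cL Lx; rewrite -scaleN1r; apply: subspaceZ. Qed.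
Lemma subspaceB (V : normedModType R[i]) (L : set V) (x y : V) :
  closed_subspace L -> L x -> L y -> L (x - y).
Proof. by move=> cL Lx Ly; apply: subspaceD => //; apply: subspaceN. Qed.

(* The solution [v] of [(d + h^2) v = h^2] as a fixed point *)
Lemma exists_resolvent (d : R) h : 0 < d -> self_adjoint h -> nr h <= 1 ->
  exists v, [/\ self_adjoint v, cmul v h = cmul h v,
    d%:C *: v = cmul h h - cmul (cmul h h) v &
    forall L, subalg L -> L h -> L v].
Proof.
(* The equation reads $(1+d)v=h^2+(1-h^2)v$. Since $1-h^2$ is contractive, iterating it contracts by
   $t=1/(1+d)$. *)
move=> d0 sh h1; pose t : R := (1 + d)^-1.
have t0 : 0 < t by rewrite invr_gt0; lra.
have t1 : t < 1 by rewrite invf_lt1; lra.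
pose v := fix v n := if n is m.+1 then
  t%:C *: (cmul h h + v m - cmul (cmul h h) (v m)) else 0.
pose M := nr (v 1%N).
have M0 : 0 <= M by apply: nr_ge0.
have tE n : v n.+2 - v n.+1 =
    t%:C *: ((v n.+1 - v n) - cmul (cmul h h) (v n.+1 - v n)).
  transitivity (t%:C *: (cmul h h + v n.+1 - cmul (cmul h h) (v n.+1)) -
     t%:C *: (cmul h h + v n - cmul (cmul h h) (v n))) => //.
  by rewrite !cmulE; lmod.
have tn n : 0 <= t ^+ n by rewrite exprn_ge0 ?ltW.
have vinc n : nr (v n.+1 - v n) <= M * t ^+ n.
  elim: n => [|n IH]; first by rewrite [v 0%N]/= subr0 mulr1.
  rewrite tE nrZR ?(ltW t0)// exprS mulrCA; apply: ler_wpM2l; first exact: ltW.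
  by apply: le_trans IH; apply: contraction_one_minus_sqr.
pose r n : R := M / (1 - t) * (1 - t ^+ n).
have rE n : r n.+1 - r n = M * t ^+ n.
  by rewrite /r exprS; field; rewrite gt_eqF//; lra.
have [||vl vlim] := @increments_tends R A v r (M / (1 - t)).
- by move=> n; rewrite rE; exact: vinc.
- move=> n; rewrite /r ler_piMr//; first by rewrite divr_ge0//; lra.
  by have := tn n; lra.
have vL L : subalg L -> L h -> L vl.
  move=> [sL LM] Lh; apply: (tends_closed (let: And3 _ _ c := sL in c)) vlim.
  elim=> [|n IH] /=; first by case: sL.
  apply: subspaceZ => //; apply: subspaceB => //; last by apply/LM => //; apply: LM.
  by apply: subspaceD => //; apply: LM.
exists vl; split=> //.
- apply: tends_uniq (tends_star vlim) _.
  suff sv n : self_adjoint (v n) /\ cmul (v n) h = cmul h (v n).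
    by rewrite (_ : (fun n => cstar (v n)) = v)//; apply: funext => n; case: (sv n).
  elim: n => [|n [IH1 IH2]] /=; first by rewrite /self_adjoint cstar0 cmul0l cmul0r.
  split; last by rewrite !cmulE IH2 -[cmul (cmul _ (v n)) h]cmulA IH2 !cmulE.
  rewrite /self_adjoint !cstarE !sh IH1 cjR; congr (_ *: (_ - _)).
  by rewrite cmulA IH2 -cmulA IH2 cmulA.
- exact: (vL _ (commutant_subalg h)).
- have e : vl = t%:C *: (cmul h h + vl - cmul (cmul h h) vl).
    apply: tends_uniq (tends_shift vlim) _; apply: tendsZ; apply: tendsD.
      by apply: tendsD => //; exact: tends_cst.
    have := tendsZ (-1) (tends_mull (cmul h h) vlim); rewrite scaleN1r.
    by under eq_fun do rewrite scaleN1r.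
  have := congr1 (fun z => (1 + d)%:C *: z) e.
  rewrite /= scalerA -rmorphM /= mulfV ?gt_eqF//; last by lra.
  rewrite scale1r => e'.
  have -> : d%:C *: vl = (1 + d)%:C *: vl - vl by lmod.
  by rewrite e'; lmod.
Qed.

Lemma approx_unit1 a (e : R) : 0 < e -> nr a <= 1 ->
  exists v, [/\ self_adjoint v, nr v <= 1, nr (a - cmul a v) < e &
    forall L, subalg L -> L (cmul (cstar a) a) -> L v].
Proof.
move=> e0 a1; have [h hE] : exists h, h = cmul (cstar a) a by eexists.
have sh : self_adjoint h by rewrite hE /self_adjoint cstarM cstarK.
have h1 : nr h <= 1 by rewrite hE cnorm_sq expr_le1// nr_ge0.
pose g0 : R := e / 2.
have g00 : 0 < g0 by rewrite /g0; lra.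
pose q : R := g0 ^+ 2 / 2; pose dd := q ^+ 2.
have q0 : 0 < q by rewrite /q divr_gt0// exprn_gt0.
have dd0 : 0 < dd by rewrite exprn_gt0.
have [v [sv vh vE vL]] := exists_resolvent dd0 sh h1.
rewrite -hE.
(* As $v=h^2/(q^2+h^2)$, this is $g=2qh/(q^2+h^2)$, while $1-2v=(q^2-h^2)/(q^2+h^2)$. These are the
   coordinates of the rational parametrization of the circle, so both are contractive. In particular
   $\|h-hv\|\le q/2$. *)
have [g gE] : exists g, g = (2 / q)%:C *: (h - cmul h v) by eexists.
have sg : self_adjoint g.
  by rewrite /self_adjoint gE !cstarE sh sv cjR vh.
have vg : cmul v (h - cmul h v) = cmul (h - cmul h v) v by rewrite !cmulE vh.
have qC : q%:C != 0 :> R[i] by rewrite eq_complex /= eqxx andbT gt_eqF.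
have ddC : dd%:C != 0 :> R[i] by rewrite eq_complex /= eqxx andbT gt_eqF.
have gg : cmul g g = 4 *: (v - cmul v v).
  have -> : cmul g g = (4 / dd)%:C *: cmul (h - cmul h v) (h - cmul h v).
    rewrite gE !cmulE /dd; lmod; field; exact: qC.
  have -> : cmul (h - cmul h v) (h - cmul h v) =
      (cmul h h - cmul (cmul h h) v) - cmul (cmul h h - cmul (cmul h h) v) v.
    have hvh : cmul (cmul h v) h = cmul (cmul h h) v by rewrite -cmulA vh cmulA.
    by rewrite !cmulE !hvh; lmod.
  by rewrite -vE cmulZl; lmod; field; exact: ddC.
have rel1 : (2 * 1)%:C *: (- (2 *: v)) + cmul (- (2 *: v)) (- (2 *: v)) +
    (2 * 0 : R)%:C *: g + cmul g g = 0.
  by rewrite gg !cmulE; lmod.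
have com : cmul (- (2 *: v)) g = cmul g (- (2 *: v)).
  by rewrite gE cmulNl cmulNr !cmulZl !cmulZr vg; lmod.
have s2v : self_adjoint (- (2 *: v)).
  by rewrite /self_adjoint !cstarE sv rmorph_nat.
have c1 x : nr (x - 2 *: cmul v x) <= nr x.
  have -> : x - 2 *: cmul v x = (1 : R)%:C *: x + cmul (- (2 *: v)) x.
    by rewrite !cmulE; lmod.
  apply: (@contraction_of_circle R A 1 0 _ g) => //.
  by rewrite expr1n expr0n addr0.
have c2 x : nr (cmul g x) <= nr x.
  have -> : cmul g x = (0 : R)%:C *: x + cmul g x by rewrite scale0r add0r.
  apply: (@contraction_of_circle R A 0 1 _ (- (2 *: v))) => //.
    by rewrite expr1n expr0n add0r.
  by rewrite -rel1; lmod.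
have c3 x : nr (cmul v x) <= nr x.
  have -> : cmul v x = (2^-1 : R)%:C *: (x - (x - 2 *: cmul v x)) by lmod.
  rewrite nrZR ?invr_ge0//; have := nrD x (- (x - 2 *: cmul v x)).
  by rewrite nrN; have := c1 x; clear; lra.
have v1 : nr v <= 1 by apply: nr_op_le => // x; rewrite mul1r.
have g1 : nr g <= 1 by apply: nr_op_le => // x; rewrite mul1r.
exists v; split=> //.
have hv : nr (h - cmul h v) <= q / 2.
  have -> : h - cmul h v = (q / 2)%:C *: g.
    rewrite gE scalerA -rmorphM /= (_ : q / 2 * (2 / q) = 1) ?scale1r//.
    by field; rewrite gt_eqF.
  have q2 : 0 <= q / 2 by rewrite divr_ge0 ?(ltW q0).
  by rewrite nrZR// ler_piMr.
have : nr (a - cmul a v) ^+ 2 <= q.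
  rewrite -cnorm_sq.
  have -> : cmul (cstar (a - cmul a v)) (a - cmul a v) =
      (h - cmul h v) - cmul v (h - cmul h v).
    by rewrite !cstarE sv !cmulE hE !cmulE; lmod.
  have := nrD (h - cmul h v) (- cmul v (h - cmul h v)); rewrite nrN.
  have := cnormM v (h - cmul h v); have := nr_ge0 (h - cmul h v).
  by move: hv v1; clear; nra.
by rewrite /q /g0; move: (nr_ge0 (a - cmul a v)) e0; clear; nra.
Qed.

Lemma ideal_subalg I : closed_ideal I -> subalg I.
Proof. by move=> [cI Il Ir]; split=> // a b _; apply: Il. Qed.

Lemma approx_right I a (e : R) : closed_ideal I -> I a -> 0 < e ->
  exists v, [/\ I v, self_adjoint v, nr v <= 1 & nr (a - cmul a v) < e].
Proof.
move=> cI Ia e0; have n0 := nr_ge0 a.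
have [sI Il Ir] := cI; set t := (nr a + 1)^-1.
have t0 : 0 < t by rewrite invr_gt0; lra.
have [||v [sv v1 av vL]] := @approx_unit1 (t%:C *: a) (t * e).
- exact: mulr_gt0.
- by rewrite nrZR ?(ltW t0)// mulrC ler_pdivrMr; lra.
exists v; split=> //; first by apply: (vL I (ideal_subalg cI)); apply: Il; apply: subspaceZ.
by move: av; rewrite cmulZl -scalerBr nrZR ?(ltW t0)// ltr_pM2l.
Qed.

(** $va^*=(av)^*$ lies in [I] and approximates $a^*$ when $v=v^*\in I$ and $av\approx a$. *)
Lemma ideal_star I a : closed_ideal I -> I a -> I (cstar a).
Proof.
move=> cI Ia; have [[I0 _ cl] _ Ir] := cI.
move/closed_epsP: cl; apply=> e e0.
have [v [Iv sv _ av]] := approx_right cI Ia e0.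
exists (cmul v (cstar a)); first exact: Ir.
by rewrite -sv -cstarM -cstarN -cstarD nr_cstar.
Qed.

(** Products of factors $1-v$ make $a-aw$ small for all [a] in the list, but the resulting [w] has
    no norm bound. One contraction [v] with $wv\approx w$ then serves every [a], because $av\approx
    awv\approx aw\approx a$. *)
Lemma approx_right_seq I (l : seq A) (e : R) : closed_ideal I ->
  (forall a, a \in l -> I a) -> 0 < e ->
  exists v, [/\ I v, self_adjoint v, nr v <= 1 &
    forall a, a \in l -> nr (a - cmul a v) < e].
Proof.
move=> cI Il e0; have [sI IL IR] := cI.
have [M [M0 hM]] : exists M : R, 0 <= M /\ forall a, a \in l -> nr a <= M.
  elim: l {Il} => [|b l [M [M0 hM]]]; first by exists 0.
  exists (M + nr b); have b0 := nr_ge0 b; split; first by lra.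
  by move=> a; rewrite in_cons => /orP[/eqP ->|/hM]; lra.
have [w Iw hw] : exists2 w, I w & forall a, a \in l -> nr (a - cmul a w) < e / 4.
  have : 0 < e / 4 by lra.
  elim: l (e / 4) Il {hM} => [|b l IH] d Il d0.
    by exists 0 => //; case: sI.
  have [a al|w Iw hw] := IH (d / 2) _ ltac:(lra).
    by apply: Il; rewrite in_cons al orbT.
  have Ib : I (b - cmul b w) by apply: subspaceB => //; [apply: Il; rewrite mem_head|exact: IL].
  have [v [Iv sv v1 bv]] := approx_right cI Ib d0.
  exists (w + v - cmul w v) => [|a].
    by apply: subspaceB => //; [exact: subspaceD|exact: IL].
  have -> : a - cmul a (w + v - cmul w v) =
      (a - cmul a w) - cmul (a - cmul a w) v by rewrite !cmulE; lmod.
  rewrite in_cons => /orP[/eqP -> //|/hw aw].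
  have := nrD (a - cmul a w) (- cmul (a - cmul a w) v); rewrite nrN.
  have := cnormM (a - cmul a w) v; have := nr_ge0 (a - cmul a w); have := nr_ge0 v.
  by nra.
have [v [Iv sv v1 wv]] := approx_right cI Iw (e := e / (4 * (M + 1))) ltac:(apply: divr_gt0; lra).
exists v; split=> // a al.
have -> : a - cmul a v = (a - cmul a w) + (cmul a (w - cmul w v) - cmul (a - cmul a w) v).
  by rewrite !cmulE; lmod.
have := nrD (a - cmul a w) (cmul a (w - cmul w v) - cmul (a - cmul a w) v).
have := nrD (cmul a (w - cmul w v)) (- cmul (a - cmul a w) v); rewrite nrN.
have := cnormM a (w - cmul w v); have := cnormM (a - cmul a w) v.
have H : nr a * nr (w - cmul w v) <= e / 4.
  move: wv; rewrite ltr_pdivlMr; last by lra.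
  by have := hM a al; have := nr_ge0 a; have := nr_ge0 (w - cmul w v); nra.
by have := hw a al; have := nr_ge0 (a - cmul a w); have := nr_ge0 v; nra.
Qed.

Lemma nr_cn_star_sub a u : self_adjoint u ->
  nr (a - cmul u a) = nr (cstar a - cmul (cstar a) u).
Proof. by move=> su; rewrite -nr_cstar !cstarE su. Qed.

Lemma full_ideal : closed_ideal [set: A].
Proof. by split=> //; split=> //; apply: closedT. Qed.

Lemma exists_approximate_unit I : closed_ideal I ->
  exists F, approximate_unit I F.
Proof.
move=> cI; have [sI IL IR] := cI.
pose B (p : seq A * R) := [set u | [/\ I u, cs_positive u, `|u| <= 1 &
  forall a, a \in p.1 -> nr (a - cmul a u) < p.2 /\ nr (a - cmul u a) < p.2]].
pose D := [set p : seq A * R | (forall a, a \in p.1 -> I a) /\ 0 < p.2].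
have B0 p : D p -> B p !=set0.
  move=> [pI p0].
  have [|v [Iv sv v1 hv]] := @approx_right_seq I (p.1 ++ map (@cstar _ A) p.1) (p.2 / 2) cI _ ltac:(lra).
    move=> a; rewrite mem_cat => /orP[/pI //|/mapP[b /pI Ib ->]].
    exact: ideal_star.
  (* [cs_positive] asks for the form $b^*b$, hence the square of [v]; it doubles the error, which is
     why [v] was chosen for [p.2 / 2]. *)
  exists (cmul v v); split.
  - exact: IL.
  - by exists v; rewrite sv.
  - rewrite nrE -(rmorph1 (real_complex R)) lecR.
    by apply: le_trans (cnormM _ _) _; have := nr_ge0 v; nra.
  move=> a ap.
  have h b : nr (b - cmul b v) < p.2 / 2 -> nr (b - cmul b (cmul v v)) < p.2.
    have -> : b - cmul b (cmul v v) = (b - cmul b v) + cmul (b - cmul b v) v.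
      by rewrite !cmulE; lmod.
    have := nrD (b - cmul b v) (cmul (b - cmul b v) v).
    have := cnormM (b - cmul b v) v; have := nr_ge0 (b - cmul b v).
    by have := nr_ge0 v; nra.
  split; first by apply/h/hv; rewrite mem_cat ap.
  rewrite nr_cn_star_sub; last by rewrite /self_adjoint cstarM sv.
  by apply/h/hv; rewrite mem_cat map_f ?orbT.
have DI : forall i j, D i -> D j -> exists2 k, D k & B k `<=` B i `&` B j.
  move=> i j [iI i0] [jI j0]; exists (i.1 ++ j.1, Num.min i.2 j.2).
    split=> /= [a|]; last by rewrite lt_min i0.
    by rewrite mem_cat => /orP[/iI|/jI].
  move=> u [Iu pu u1 hu]; split; split=> // a ha;
  have [|] := hu a; rewrite /= ?mem_cat ?ha ?orbT// !lt_min;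
  by move=> /andP[? ?] /andP[? ?].
exists (filter_from D B); split.
- by apply: filter_from_proper => //; apply: filter_from_filter => //; exists ([::], 1).
- by exists ([::], 1) => [|u [Iu pu u1 _]].
move=> a Ia; split; move=> W /(nr_near a W)[e e0 hW];
  (exists ([:: a], e); first by split=> // b; rewrite inE => /eqP ->);
  by move=> u [_ _ _ /(_ a)/(_ (mem_head _ _))[h1 h2]]; apply: hW.
Qed.
End Approx.

(** * Self-adjoint elements are differences of squares *)

Section Squares.
Variable R : realType.

(** If $a_0<a_1$, then log-convexity forces geometric growth with some ratio $1+d$. By Bernoulli,
    $(1+d)^{2n}\ge(nd)^2$, which outgrows every linear bound. *)
Lemma logconvex_linear (a : nat -> R) (M C : R) : (forall n, 0 <= a n) ->
  (forall n, a n.+1 ^+ 2 <= a n * a n.+2) -> (forall n, a n <= M + n%:R * C) ->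
  a 1%N <= a 0%N.
Proof.
move=> a0 lc bd; case: (lerP (a 1%N) (a 0%N)) => // a10; exfalso.
have p0 : 0 < a 0%N.
  rewrite lt_def a0 andbT; apply/eqP => z; have := lc 0%N; rewrite z mul0r in a10 *.
  by nra.
pose d := (a 1%N - a 0%N) / a 0%N.
have d0 : 0 < d by rewrite divr_gt0 ?subr_gt0.
have growth n : 0 < a n /\ (1 + d) * a n <= a n.+1.
  elim: n => [|n [pn IH]].
    by split=> //; rewrite /d mulrDl mul1r divfK ?gt_eqF//; lra.
  have pn1 : 0 < a n.+1 by apply: lt_le_trans IH; rewrite mulr_gt0//; lra.
  split=> //; rewrite -(ler_pM2l pn); apply: le_trans (lc n).
  by rewrite mulrCA; have := ler_wpM2r (ltW pn1) IH; nra.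
have geo n : a 0%N * (1 + d) ^+ n <= a n.
  elim: n => [|n IH]; first by rewrite expr0 mulr1.
  have [_ g] := growth n; apply: le_trans g; rewrite exprS mulrCA.
  by apply: ler_wpM2l => //; lra.
have bern n : 1 + n%:R * d <= (1 + d) ^+ n.
  elim: n => [|n IH]; first by rewrite mul0r addr0 expr0.
  rewrite exprS -natr1; have : 0 <= n%:R * d by apply: mulr_ge0; rewrite ?ler0n// ltW.
  by nra.
pose K := (`|M| + 2 * `|C|) / (a 0%N * d ^+ 2).
have k0 : 0 < a 0%N * d ^+ 2 by rewrite mulr_gt0 ?exprn_gt0.
have : K < (Num.truncn K).+1%:R by exact: truncnS_gt.
apply/negP; rewrite -leNgt /K ler_pdivlMr//.
set n := (Num.truncn _).+1; have n1 : 1 <= n%:R :> R by rewrite ler1n.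
have h : n%:R ^+ 2 * (a 0%N * d ^+ 2) <= M + (n + n)%:R * C.
  apply: le_trans (bd _); apply: le_trans (geo _); rewrite exprD mulrCA.
  apply: ler_wpM2l; first exact: ltW.
  have nd : 0 <= n%:R * d by apply: mulr_ge0; [lra|exact: ltW].
  by rewrite -exprMn -expr2; apply: lerXn2r; rewrite ?nnegrE//; have := bern n; lra.
have hM := ler_norm M; have hC := ler_norm C; have C0 := normr_ge0 C; have M0 := normr_ge0 M.
rewrite natrD in h; rewrite -(ler_pM2l (x := n%:R)); last by lra.
rewrite mulrA -expr2; apply: le_trans h _.
have : n%:R * C <= n%:R * `|C| by apply: ler_wpM2l => //; lra.
have : `|M| <= n%:R * `|M| by rewrite ler_peMl.
by nra.
Qed.

Variable A : cstarAlg R.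
Implicit Types (h k r v : A).

(** The positive part $p=(k+h)/2$ satisfies $pk=p^2$, hence $p(1-p)^n=p(1-k)^n$ stays bounded and
    $\|(1-p)^nv\|$ grows at most linearly in $n$. By the C*-identity this sequence is log-convex, so
    it cannot increase in its first step. *)
Lemma positive_part_contraction h k : self_adjoint h -> self_adjoint k ->
  cmul k k = cmul h h -> cmul k h = cmul h k ->
  (forall v, nr (v - cmul k v) <= nr v) ->
  forall v, nr (v - cmul ((2^-1 : R)%:C *: (k + h)) v) <= nr v.
Proof.
move=> sh sk kk kh kc v.
have [p pE] : exists p, p = (2^-1 : R)%:C *: (k + h) by eexists.
have sp : self_adjoint p by rewrite /self_adjoint pE !cstarE sk sh cjR.
have pk : cmul p k = cmul p p.
  by rewrite pE !cmulE kh kk; lmod.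
rewrite -pE.
pose T w := w - cmul p w.
pose S w := w - cmul k w.
have ST w : S (T w) = T (S w).
  have kp : cmul k p = cmul p k by rewrite pE !cmulE kh.
  by rewrite /S /T !cmulE kp; lmod.
have com n w : iter n S (T w) = T (iter n S w).
  by elim: n => [//|n IH]; rewrite !iterS IH ST.
have pT n w : cmul p (iter n T w) = cmul p (iter n S w).
  elim: n w => [//|n IH] w; rewrite iterSr IH com iterS.
  by rewrite /T /S !cmulE pk.
have iterk n w : nr (iter n S w) <= nr w.
  by elim: n => [//|n IH]; rewrite iterS; apply: le_trans (kc _) IH.
pose a n := nr (iter n T v).
have sT w : cmul (cstar (T w)) (T w) = cmul (cstar w) (T (T w)).
  by rewrite /T !cstarE sp !cmulE; lmod.
apply: (@logconvex_linear a (nr v) (nr p * nr v)) => n.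
- exact: nr_ge0.
- rewrite /a !iterS -cnorm_sq sT; apply: le_trans (cnormM _ _) _.
  by rewrite nr_cstar.
rewrite /a; elim: n => [|n IH] /=; first by rewrite mul0r addr0.
rewrite -natr1 mulrDl mul1r addrA.
have := nrD (iter n T v) (- cmul p (iter n T v)); rewrite nrN pT.
have := cnormM p (iter n S v).
have := iterk n v; have := nr_ge0 p; rewrite -[T (iter n T v)]/(iter n T v - cmul p (iter n T v)) pT.
by nra.
Qed.

(** [r] and [s] are square roots of the positive and the negative part $(|h|\pm h)/2$, whose product
    is $(|h|^2-h^2)/4=0$. *)
Lemma sa_jordan h : self_adjoint h -> exists r s,
  [/\ self_adjoint r, self_adjoint s, h = cmul r r - cmul s s &
      cmul (cmul r r) (cmul s s) = 0].
Proof.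
move=> sh; wlog h1 : h sh / nr h <= 1.
  move=> H; have n0 := nr_ge0 h; set t := nr h + 1.
  have t0 : 0 < t by rewrite /t; lra.
  have [||r [s [sr ss hE rs]]] := H (t^-1%:C *: h).
  - by rewrite /self_adjoint cstarZ cjR sh.
  - by rewrite nrZR ?invr_ge0 ?(ltW t0)// mulrC ler_pdivrMr//; rewrite /t; lra.
  pose q := (Num.sqrt t)%:C : R[i].
  have qq : q * q = t%:C by rewrite -rmorphM -expr2 sqr_sqrtr// ltW.
  exists (q *: r), (q *: s); split.
  - by rewrite /self_adjoint cstarZ cjR sr.
  - by rewrite /self_adjoint cstarZ cjR ss.
  - rewrite !cmulE !scalerA qq -scalerBr -hE scalerA -rmorphM /= mulfV ?gt_eqF//.
    by rewrite scale1r.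
  - by rewrite !(cmulZl, cmulZr) rs !scaler0.
have [k [sk kk kc kL]] := exists_abs sh h1.
have kh : cmul k h = cmul h k by apply: (kL _ (commutant_subalg h)).
have sqrt_of h' : self_adjoint h' -> cmul k k = cmul h' h' -> cmul k h' = cmul h' k ->
    exists2 r, self_adjoint r & cmul r r = (2^-1 : R)%:C *: (k + h').
  move=> sh' kk' kh'; apply: exists_sqrt.
    by rewrite /self_adjoint !cstarE sk sh' cjR.
  exact: positive_part_contraction.
have [r sr rr] := sqrt_of h sh kk kh.
have [||| s ss ss'] := sqrt_of (- h).
- by rewrite /self_adjoint cstarN sh.
- by rewrite !cmulE opprK.
- by rewrite !cmulE kh.
exists r, s; split=> //; rewrite rr ss'; first by lmod; field.
by rewrite !cmulE kk kh; lmod.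
Qed.
End Squares.

(** * Hilbert spaces *)

Section Hilbert.
Variables (R : realType) (H : hilbert R).
Implicit Types (x y z h w : H) (k : R[i]) (L : set H).

Lemma ip_si : semi_inner (@ip R H).
Proof.
have lin k x y z : ip x (k *: y + z) = k * ip x y + ip x z by case: H x y z.
have herm x y : ip y x = cj (ip x y) by case: H x y.
split=> //; first by move=> k x y z; rewrite herm lin rmorphD rmorphM /= -!herm.
move=> x; have -> : ip x x = `|x| ^+ 2 by case: H x.
by rewrite exprn_ge0.
Qed.

Lemma ip_herm x y : ip y x = cj (ip x y).
Proof. exact: si_herm ip_si _ _. Qed.

Lemma ip_sq x : sq (@ip R H) x = nr x ^+ 2.
Proof.
have e : ip x x = `|x| ^+ 2 by case: H x.
by apply: complexI; rewrite -(sqE ip_si) e nrE rmorphXn.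
Qed.

Lemma ip_norm x : ip x x = (nr x ^+ 2)%:C.
Proof. by rewrite (sqE ip_si) ip_sq. Qed.

Lemma ip_cs x y : cn (ip x y) <= nr x * nr y.
Proof.
apply: le_sqr_le; first by rewrite mulr_ge0 ?nr_ge0.
by rewrite exprMn -!ip_sq; apply: cauchy_schwarz ip_si _ _.
Qed.

Lemma ip_tendsr x (u : nat -> H) y : tends u y -> ctends (fun n => ip x (u n)) (ip x y).
Proof.
move=> uy e e0; have x0 := nr_ge0 x.
have [N hN] := uy (e / (nr x + 1)) ltac:(apply: divr_gt0; lra).
exists N => n /hN; rewrite ltr_pdivlMr; last by lra.
rewrite -(siNr ip_si) -(siDr ip_si); have := ip_cs x (u n - y).
by have := nr_ge0 (u n - y); nra.
Qed.

Lemma ip_ext x y : (forall z, ip x z = ip y z) -> x = y.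
Proof.
move=> h; apply/eqP; rewrite -subr_eq0; apply/eqP/nr_eq0.
have : ip (x - y) (x - y) = 0.
  by rewrite {1}(siDl ip_si) (siNl ip_si) h addrN.
rewrite ip_norm => /complexI/eqP; rewrite sqrf_eq0 => /eqP //.
Qed.

(** [w] is the limit of a minimizing sequence for [J], which is Cauchy by the parallelogram law. The
    functional lives on a subset [D] of a module with a map [iota] to [H], so that the same lemma
    yields projections, adjoints and cyclic vectors. *)
Lemma riesz (V : lmodType R[i]) (D : set V) (iota : V -> H) (phi : V -> R[i])
    (C : R) :
  D 0 -> (forall k (x y : V), D x -> D y -> D (k *: x + y)) ->
  (forall k (x y : V), D x -> D y -> iota (k *: x + y) = k *: iota x + iota y) ->
  (forall k (x y : V), D x -> D y -> phi (k *: x + y) = k * phi x + phi y) ->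
  0 <= C -> (forall x : V, D x -> cn (phi x) <= C * nr (iota x)) ->
  exists w : H, [/\ forall x : V, D x -> phi x = ip w (iota x), nr w <= C &
    forall e, 0 < e -> exists2 x : V, D x & nr (w - iota x) < e].
Proof.
move=> D0 Dlin ilin plin C0 pC.
pose J (x : V) := nr (iota x) ^+ 2 - 2 * Re (phi x).
have JC (x : V) : D x -> - C ^+ 2 <= J x.
  move=> Dx; have := pC x Dx; have := cn_Re (phi x); have := ler_norm (Re (phi x)).
  by rewrite /J; have := sqr_ge0 (nr (iota x) - C); nra.
have hi : has_inf [set J x | x in D].
  by split; [exists (J 0), 0|exists (- C ^+ 2) => _ [x Dx <-]; exact: JC].
set m := inf [set J x | x in D].
have mJ (x : V) : D x -> m <= J x by move=> Dx; apply: ge_inf; [case: hi|exists x].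
have approx n : {x : V | D x /\ J x < m + n.+1%:R^-1}.
  have e0 : 0 < n.+1%:R^-1 :> R by rewrite invr_gt0 ltr0n.
  apply: cid; have [_ [x Dx <-] h] := inf_adherent e0 hi.
  by exists x.
pose d n := sval (approx n).
have dD n : D (d n) by rewrite /d; case: (approx n) => x [].
have dJ n : J (d n) < m + n.+1%:R^-1 by rewrite /d; case: (approx n) => x [].
have small := @inv_small R.
have JD (x y : V) : D x -> D y -> J (x + y) = J x + nr (iota y) ^+ 2 +
    2 * Re (ip (iota x) (iota y) - phi y).
  move=> Dx Dy; have := ilin 1 x y Dx Dy; have := plin 1 x y Dx Dy.
  rewrite !scale1r mul1r /J => -> ->; rewrite -!ip_sq (sqD ip_si).
  by case: (phi x) => ? ?; case: (phi y) => ? ?; case: (ip _ _) => ? ? /=; lra.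
have cauchy_d : rcauchy (iota \o d).
  move=> e e0; have [N hN] := small (e ^+ 2 / 4) ltac:(nra).
  exists N => a b /hN ha /hN hb /=.
  have half (x : V) : D x -> D ((2^-1 : R)%:C *: x) by move=> Dx; rewrite -[_ *: _]addr0; apply: Dlin.
  have im (x : V) : D x -> iota ((2^-1 : R)%:C *: x) = (2^-1 : R)%:C *: iota x.
    move=> Dx; have := ilin (2^-1 : R)%:C x 0 Dx D0; rewrite addr0 => ->.
    by have := ilin (-1) 0 0 D0 D0; rewrite scaler0 addr0 scaleN1r addNr => ->; rewrite addr0.
  have pm (x : V) : D x -> phi ((2^-1 : R)%:C *: x) = (2^-1 : R)%:C * phi x.
    move=> Dx; have := plin (2^-1 : R)%:C x 0 Dx D0; rewrite addr0 => ->.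
    by have := plin (-1) 0 0 D0 D0; rewrite scaler0 addr0 mulN1r addNr => ->; rewrite addr0.
  have := mJ ((2^-1 : R)%:C *: d a + (2^-1 : R)%:C *: d b) ltac:(exact: Dlin (dD a) (half _ (dD b))).
  have DD : forall n, D (d n) := dD.
  rewrite {1}/J ilin ?plin; [|exact: dD|exact: half|exact: dD|exact: half].
  rewrite im ?pm//.
  have := dJ a; have := dJ b; rewrite /J.
  have := parallelogram ip_si (iota (d a)) (iota (d b)).
  rewrite -(scalerDr (2^-1 : R)%:C) nrZR ?invr_ge0// !ip_sq.
  case: (phi (d a)) => ? ?; case: (phi (d b)) => ? ? /=.
  rewrite !mul0r !subr0 => h1 h2 h3 h4.
  have := nr_ge0 (iota (d a) - iota (d b)) => h5.
  have h6 : nr (iota (d a) - iota (d b)) ^+ 2 < e ^+ 2.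
    move: ha hb h1 h2 h3 h4; rewrite exprMn (_ : 2^-1 ^+ 2 = 4^-1 :> R); last by field.
    move: (a.+1%:R^-1) (b.+1%:R^-1) (nr (iota (d a) + iota (d b)) ^+ 2) (nr (iota (d a) - iota (d b)) ^+ 2) (nr (iota (d a)) ^+ 2) (nr (iota (d b)) ^+ 2) (e ^+ 2) => p1 p2 p3 p4 p5 p6 p7; clear; lra.
  by move: h5 h6 e0; clear; nra.
have [w wlim] := rcauchy_tends cauchy_d.
(* The first variation: [J (d n + x)] is at least the infimum and [J (d n)] tends to it. *)
have var (x : V) : D x -> 0 <= nr (iota x) ^+ 2 + 2 * Re (ip w (iota x) - phi x).
  move=> Dx; apply/ler_addgt0Pr => e e0.
  have l1 := ip_tendsr (iota x) wlim.
  have [N hN] := l1 (e / 4) ltac:(lra); have [N' hN'] := small (e / 4) ltac:(lra).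
  have c1 := hN _ (leq_maxl N N'); have p1 := hN' _ (leq_maxr N N').
  set n := maxn N N' in c1 p1.
  have Ddx : D (d n + x) by rewrite -[d n]scale1r; apply: Dlin.
  have h1 := mJ _ Ddx; rewrite JD// in h1; have h2 := dJ n.
  have ReB (z1 z2 : R[i]) : Re (z1 - z2) = Re z1 - Re z2 by case: z1; case: z2.
  have ReJ (z1 : R[i]) : Re (cj z1) = Re z1 by case: z1.
  have := le_lt_trans (cn_Re _) c1; rewrite ltr_norml => /andP[].
  rewrite !ReB (ip_herm (iota (d n))) ReJ in h1 *; rewrite (ip_herm w) ReJ /=.
  by move: (n.+1%:R^-1) p1 h1 h2 => p; clear; lra.
have wphi (x : V) : D x -> phi x = ip w (iota x).
  move=> Dx; apply/esym/eqP; rewrite -subr_eq0; apply/eqP; set g := _ - _.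
  apply: cn_eq0; apply/eqP; rewrite -sqrf_eq0; apply/eqP/le_anti; rewrite sqr_ge0 andbT.
  (* Inserting $kx$ with $k=-t\bar g$ into [var] gives $t|g|^2(t\|\iota x\|^2-2)\ge0$, which
     together with $t\|\iota x\|^2\le1$ forces $g=0$. *)
  pose t := (nr (iota x) ^+ 2 + 1)^-1.
  have N0 := sqr_ge0 (nr (iota x)).
  have t0 : 0 < t by rewrite invr_gt0; lra.
  pose k := - (t%:C * cj g).
  have Dkx : D (k *: x) by rewrite -[_ *: _]addr0; apply: Dlin.
  have ik : iota (k *: x) = k *: iota x.
    have := ilin k x 0 Dx D0; rewrite addr0 => ->.
    by have := ilin (-1) 0 0 D0 D0; rewrite scaler0 addr0 scaleN1r addNr => ->; rewrite addr0.
  have pk : phi (k *: x) = k * phi x.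
    have := plin k x 0 Dx D0; rewrite addr0 => ->.
    by have := plin (-1) 0 0 D0 D0; rewrite scaler0 addr0 mulN1r addNr => ->; rewrite addr0.
  have := var _ Dkx; rewrite ik pk (siZr ip_si) -mulrBr -/g nrZ {1}/k cnN cnM cn_conj cnR ger0_norm ?(ltW t0)//.
  have -> : k * g = - (t * cn g ^+ 2)%:C.
    by rewrite /k mulNr -mulrA (mulrC (cj g)) -normCK cnE -rmorphXn -rmorphM.
  rewrite /= => hh.
  have tN : t * nr (iota x) ^+ 2 <= 1 by rewrite /t mulrC ler_pdivrMr; lra.
  rewrite leNgt; apply/negP => g0.
  have : t * cn g ^+ 2 * (t * nr (iota x) ^+ 2 - 2) >= 0.
    rewrite !exprMn in hh; lra.
  rewrite (pmulr_rge0 _ (mulr_gt0 t0 g0)); move: tN; move: (t * _) => y; clear; lra.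
have wapp e : 0 < e -> exists2 x : V, D x & nr (w - iota x) < e.
  by move=> e0; have [N /(_ N (leqnn _)) h] := wlim e e0; exists (d N) => //; rewrite nrB.
exists w; split=> //.
have nw := nr_ge0 w.
have key e : 0 < e -> nr w ^+ 2 <= C * (nr w + e) + nr w * e.
  move=> e0; have [x Dx xe] := wapp e e0.
  have e1 : ip w w = phi x + ip w (w - iota x).
    by rewrite wphi// (siDr ip_si) (siNr ip_si) addrC subrK.
  have : nr w ^+ 2 <= cn (ip w w).
    by rewrite ip_norm cnR ler_norm.
  rewrite e1; have := cnD (phi x) (ip w (w - iota x)).
  have := pC x Dx; have := ip_cs w (w - iota x).
  have := nr_le (iota x) w; rewrite (nrB (iota x)) => h1 h2 h3 h4 h5.
  have : C * nr (iota x) <= C * (nr w + e).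
    by apply: ler_wpM2l => //; move: h1 xe; clear; lra.
  have : nr w * nr (w - iota x) <= nr w * e by apply: ler_wpM2l => //; exact: ltW.
  by move: h2 h3 h4 h5; clear; lra.
rewrite leNgt; apply/negP => Cw.
have := key ((nr w - C) * nr w / (2 * (C + nr w))) ltac:(apply: divr_gt0; nra).
have : (C + nr w) * ((nr w - C) * nr w / (2 * (C + nr w))) = (nr w - C) * nr w / 2.
  by field; rewrite gt_eqF//; lra.
by set E := _ / _; nra.
Qed.

Lemma exists_projection L : closed_subspace L -> exists P : H -> H,
  [/\ forall k x y, P (k *: x + y) = k *: P x + P y, forall x, L (P x) &
      forall x y, L y -> ip (P x) y = ip x y].
Proof.
move=> [L0 Llin Lc].
have ex x : {w | L w /\ forall y, L y -> ip w y = ip x y}.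
  apply: cid; have [||||w [h _ wa]] := @riesz H L id (ip x) (nr x) L0 Llin.
  - by [].
  - by move=> k y z _ _; rewrite (siDr ip_si) (siZr ip_si).
  - exact: nr_ge0.
  - by move=> y _; exact: ip_cs.
  exists w; split; last by move=> y /h.
  by move/closed_epsP: Lc; apply.
pose P x := sval (ex x).
have PL x : L (P x) by rewrite /P; case: (ex x) => ? [].
have Pip x y : L y -> ip (P x) y = ip x y by rewrite /P; case: (ex x) => ? [? h] Ly; apply: h.
exists P; split=> // k x y.
set p := P _; set p' := _ + P y.
have Lp' : L p' by apply: Llin.
have Lp : L p by apply: PL.
have LB : L (p - p') by rewrite addrC -scaleN1r; apply: Llin.
apply/eqP; rewrite -subr_eq0; apply/eqP/nr_eq0.
have : ip (p - p') (p - p') = 0.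
  rewrite {1}(siDl ip_si) (siNl ip_si) Pip// /p' !(siDl ip_si) !(siZl ip_si) !Pip//.
  by rewrite subrr.
by rewrite ip_norm => /complexI/eqP; rewrite sqrf_eq0 => /eqP.
Qed.
End Hilbert.

(** * Completion of a semi-inner product space *)

Lemma sequences_complete (R : realType) (V : normedModType R[i]) :
  (forall u : nat -> V, rcauchy u -> exists l, tends u l) ->
  forall F : set_system V, ProperFilter F -> cauchy F -> cvg F.
Proof.
move=> h F FF cF.
have ex n : {x | F [set y | nr (x - y) < n.+1%:R^-1]}.
  apply: cid; have e0 : 0 < (n.+1%:R^-1 : R)%:C :> R[i] by rewrite ltcR invr_gt0 ltr0n.
  have /cauchyP/(_ _ e0)[x hx] := cF.
  exists x; apply: filterS hx => y.
  by rewrite -ball_normE /= nrE ltcR.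
pose u n := sval (ex n).
have uF n : F [set y | nr (u n - y) < n.+1%:R^-1] by rewrite /u; case: (ex n).
have small := @inv_small R.
have [|l ul] := h u.
  move=> e e0; have [N hN] := small (e / 2) ltac:(lra); exists N => m n /hN hm /hN hn.
  have [y [/= h1 h2]] := filter_ex (filterI (uF m) (uF n)).
  have := nr_tri y (u m) (u n); rewrite (nrB y).
  by move: h1 h2 hm hn; move: (m.+1%:R^-1) (n.+1%:R^-1) => p q; lra.
apply/cvg_ex; exists l => W /(nr_near l W)[e e0 hW].
have [N hN] := ul (e / 2) ltac:(lra); have [N' hN'] := small (e / 2) ltac:(lra).
apply: filterS (uF (maxn N N')) => y /= hy; apply: hW.
have := nr_tri (u (maxn N N')) l y; rewrite (nrB l (u _)).
move: hy (hN _ (leq_maxl N N')) (hN' _ (leq_maxr N N')).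
by move: (_.+1%:R^-1) => p; lra.
Qed.

Section Completion.
Variables (R : realType) (V : lmodType R[i]) (s : V -> V -> R[i]).
Hypothesis s_si : semi_inner s.
Local Notation q := (sq s).
Implicit Types (u v w : nat -> V) (phi psi : V -> R[i]^o).

Definition sqrtq (x : V) : R := Num.sqrt (q x).

Lemma sqrtq_ge0 x : 0 <= sqrtq x. Proof. exact: sqrtr_ge0. Qed.

Lemma sqrtq_sq x : sqrtq x ^+ 2 = q x.
Proof. by rewrite sqr_sqrtr// (sq_ge0 s_si). Qed.

Lemma sqrtq_cs x y : cn (s x y) <= sqrtq x * sqrtq y.
Proof.
apply: le_sqr_le; first by rewrite mulr_ge0 ?sqrtq_ge0.
by rewrite exprMn !sqrtq_sq; apply: cauchy_schwarz s_si _ _.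
Qed.

Lemma sqrtqD x y : sqrtq (x + y) <= sqrtq x + sqrtq y.
Proof.
have x0 := sqrtq_ge0 x; have y0 := sqrtq_ge0 y.
apply: le_sqr_le; first by rewrite addr_ge0.
rewrite sqrrD !sqrtq_sq (sqD s_si).
have := sqrtq_cs x y; have := cn_Re (s x y); have := ler_norm (Re (s x y)).
by rewrite mulr2n; lra.
Qed.

Lemma sqrtqZ k x : sqrtq (k *: x) = cn k * sqrtq x.
Proof.
by rewrite /sqrtq (sqZ s_si) sqrtrM ?sqr_ge0// sqrtr_sqr ger0_norm// cn_ge0.
Qed.

Definition scauchy u : Prop := forall e : R, 0 < e ->
  exists N, forall m n, (N <= m)%N -> (N <= n)%N -> sqrtq (u m - u n) < e.

Definition represents u phi : Prop :=
  scauchy u /\ forall b, ctends (fun n => s b (u n)) (phi b).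

Lemma scauchy_lin k u v : scauchy u -> scauchy v ->
  scauchy (fun n => k *: u n + v n).
Proof.
move=> cu cv e e0; have k0 := cn_ge0 k.
have [N hN] := cu (e / (2 * (cn k + 1))) ltac:(apply: divr_gt0; lra).
have [N' hN'] := cv (e / 2) ltac:(lra).
exists (maxn N N') => m n; rewrite !geq_max => /andP[m1 m2] /andP[n1 n2].
have -> : k *: u m + v m - (k *: u n + v n) = k *: (u m - u n) + (v m - v n) by lmod.
have := sqrtqD (k *: (u m - u n)) (v m - v n); rewrite sqrtqZ.
have := hN' m n m2 n2; have := hN m n m1 n1; rewrite ltr_pdivlMr; last by lra.
by have := sqrtq_ge0 (u m - u n); nra.
Qed.

Lemma represents_lin k u v phi psi : represents u phi -> represents v psi ->
  represents (fun n => k *: u n + v n) (k *: phi + psi).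
Proof.
move=> [cu hu] [cv hv]; split; first exact: scauchy_lin.
move=> b; apply: (@ctends_ext _ (fun n => k * s b (u n) + s b (v n))).
  by move=> n; rewrite (siDr s_si) (siZr s_si).
by apply: ctendsD => //; apply: ctendsZ.
Qed.

Lemma scauchy_bounded u : scauchy u -> exists2 M : R, 0 < M &
  exists N, forall n, (N <= n)%N -> sqrtq (u n) <= M.
Proof.
move=> cu; have [N hN] := cu 1 ltac:(lra).
have u0 := sqrtq_ge0 (u N); exists (sqrtq (u N) + 1); first by lra.
exists N => n Nn; have := hN n N Nn (leqnn _).
by have := sqrtqD (u n - u N) (u N); rewrite subrK; lra.
Qed.

(** Weak convergence to zero gives norm convergence by $\|u_n\|^2=\langle u_n-u_m|u_n\rangle+\langle
    u_m|u_n\rangle$. Hence a Cauchy sequence is determined up to null sequences by the functional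
    that it represents. *)
Lemma scauchy_null u : scauchy u ->
  (forall b, ctends (fun n => s b (u n)) 0) ->
  forall e : R, 0 < e -> exists N, forall n, (N <= n)%N -> sqrtq (u n) < e.
Proof.
move=> cu u0 e e0; have [M M0 [N0 hM]] := scauchy_bounded cu.
have [N1 h1] := cu (e ^+ 2 / (2 * M)) ltac:(apply: divr_gt0; nra).
set m := maxn N0 N1; have [N2 h2] := u0 (u m) (e ^+ 2 / 2) ltac:(nra).
exists (maxn m N2) => n; rewrite geq_max => /andP[mn /h2]; rewrite subr0 => h3.
have n0 : (N0 <= n)%N by apply: leq_trans mn; exact: leq_maxl.
have n1 : (N1 <= n)%N by apply: leq_trans mn; exact: leq_maxr.
have := h1 n m n1 (leq_maxr _ _); rewrite ltr_pdivlMr; last by lra.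
have := hM n n0; have := sqrtq_cs (u n - u m) (u n).
have e2 : sqrtq (u n) ^+ 2 <= cn (s (u n - u m) (u n)) + cn (s (u m) (u n)).
  rewrite sqrtq_sq; apply: le_trans (cnD _ _).
  rewrite -(siDl s_si) subrK (sqE s_si) cnR ger0_norm//; exact: sq_ge0 s_si _.
have := sqrtq_ge0 (u n - u m); have := sqrtq_ge0 (u n).
move: (sqrtq (u n)) (sqrtq (u n - u m)) e2 h3 => a b; nra.
Qed.

Lemma represents_sip u v phi psi u' v' : represents u phi -> represents v psi ->
  represents u' phi -> represents v' psi ->
  forall e : R, 0 < e -> exists N, forall n, (N <= n)%N ->
    cn (s (u n) (v n) - s (u' n) (v' n)) < e.
Proof.
move=> ru rv ru' rv' e e0.
have null w w' chi : represents w chi -> represents w' chi ->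
    forall e : R, 0 < e -> exists N, forall n, (N <= n)%N -> sqrtq (w' n - w n) < e.
  move=> rw rw'; have [c h] := represents_lin (-1) rw rw'.
  have /scauchy_null := c => /(_ _) H d d0; have [|N hN] := H _ d d0.
    by move=> b; have := h b; rewrite scaleN1r addNr.
  by exists N => n /hN; rewrite scaleN1r addrC.
have [M M0 [N0 hM]] := scauchy_bounded (proj1 rv).
have [M' M0' [N0' hM']] := scauchy_bounded (proj1 ru').
have [N1 h1] := null u' u phi ru' ru (e / (2 * M)) ltac:(apply: divr_gt0; lra).
have [N2 h2] := null v' v psi rv' rv (e / (2 * M')) ltac:(apply: divr_gt0; lra).
exists (maxn (maxn N0 N0') (maxn N1 N2)) => n.
rewrite !geq_max => /andP[/andP[/hM a1 /hM' a2] /andP[/h1 a3 /h2 a4]].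
have -> : s (u n) (v n) - s (u' n) (v' n) =
    s (u n - u' n) (v n) + s (u' n) (v n - v' n).
  by rewrite (siDl s_si) (siNl s_si) (siDr s_si) (siNr s_si); ring.
have := cnD (s (u n - u' n) (v n)) (s (u' n) (v n - v' n)).
have := sqrtq_cs (u n - u' n) (v n); have := sqrtq_cs (u' n) (v n - v' n).
move: a3 a4; rewrite ltr_pdivlMr ?ltr_pdivlMr; [|lra|lra].
have := sqrtq_ge0 (u n - u' n); have := sqrtq_ge0 (v n - v' n).
have := sqrtq_ge0 (u' n); have := sqrtq_ge0 (v n).
by nra.
Qed.

Lemma sip_cauchy u v : scauchy u -> scauchy v ->
  exists l, ctends (fun n => s (u n) (v n)) l.
Proof.
move=> cu cv; apply: ccauchy_tends => e e0.
have [M M0 [N0 hM]] := scauchy_bounded cu.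
have [M' M0' [N0' hM']] := scauchy_bounded cv.
have [N1 h1] := cu (e / (2 * M')) ltac:(apply: divr_gt0; lra).
have [N2 h2] := cv (e / (2 * M)) ltac:(apply: divr_gt0; lra).
exists (maxn (maxn N0 N0') (maxn N1 N2)) => m n.
rewrite !geq_max => /andP[/andP[m1 m2] /andP[m3 m4]] /andP[/andP[n1 n2] /andP[n3 n4]].
have -> : s (u m) (v m) - s (u n) (v n) =
    s (u m - u n) (v m) + s (u n) (v m - v n).
  by rewrite (siDl s_si) (siNl s_si) (siDr s_si) (siNr s_si); ring.
have := cnD (s (u m - u n) (v m)) (s (u n) (v m - v n)).
have := sqrtq_cs (u m - u n) (v m); have := sqrtq_cs (u n) (v m - v n).
move: (h1 m n m3 n3) (h2 m n m4 n4); rewrite ltr_pdivlMr ?ltr_pdivlMr; [|lra|lra].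
have := hM n n1; have := hM' m m2.
have := sqrtq_ge0 (u m - u n); have := sqrtq_ge0 (v m - v n).
have := sqrtq_ge0 (u n); have := sqrtq_ge0 (v m).
by nra.
Qed.

(** The completion is realized as the space of functionals $b\mapsto\lim s(b,u_n)$ for Cauchy
    sequences [u]. Vectors of length zero and null sequences disappear in this way without forming a
    quotient. *)
Definition completion_pred : {pred V -> R[i]^o} :=
  fun phi => `[< exists u, represents u phi >].

Fact completion_submod : submod_closed completion_pred.
Proof.
split.
  apply/asboolP; exists (fun=> 0); split.
    move=> e e0; exists 0%N => m n _ _.
    by rewrite subrr /sqrtq /sq (si0l s_si) sqrtr0.
  by move=> b e e0; exists 0%N => n _; rewrite (si0r s_si) subr0 cn0.
move=> k phi psi /asboolP[u ru] /asboolP[v rv]; apply/asboolP.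
by exists (fun n => k *: u n + v n); apply: represents_lin.
Qed.
HB.instance Definition _ := GRing.isSubmodClosed.Build _ _ completion_pred
  completion_submod.

Record completion := Completion {
  cval :> V -> R[i]^o; cvalP : cval \in completion_pred }.
HB.instance Definition _ := [isSub for cval].
HB.instance Definition _ := [Choice of completion by <:].
HB.instance Definition _ := [SubChoice_isSubLmodule of completion by <:].

Lemma cval_lin k (x y : completion) : cval (k *: x + y) = k *: cval x + cval y.
Proof. by []. Qed.

Lemma completion_ex (x : completion) : {u | represents u (cval x)}.
Proof. by apply: cid; apply/asboolP; exact: cvalP. Qed.

Definition cseq (x : completion) : nat -> V := sval (completion_ex x).
Lemma cseqP x : represents (cseq x) (cval x).
Proof. by rewrite /cseq; case: completion_ex. Qed.

Lemma cip_ex x y : {l | ctends (fun n => s (cseq x n) (cseq y n)) l}.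
Proof. by apply/cid/sip_cauchy; [case: (cseqP x)|case: (cseqP y)]. Qed.

Definition cip (x y : completion) : R[i] := sval (cip_ex x y).

Lemma cip_lim x y u v : represents u (cval x) -> represents v (cval y) ->
  ctends (fun n => s (u n) (v n)) (cip x y).
Proof.
move=> ru rv e e0; rewrite /cip; case: (cip_ex x y) => l /= hl.
have [N hN] := hl (e / 2) ltac:(lra).
have [N' hN'] := represents_sip ru rv (cseqP x) (cseqP y) (e := e / 2) ltac:(lra).
exists (maxn N N') => n; rewrite geq_max => /andP[/hN h1 /hN' h2].
have := cnD (s (u n) (v n) - s (cseq x n) (cseq y n)) (s (cseq x n) (cseq y n) - l).
by rewrite addrA subrK; lra.
Qed.

Lemma cseq_lin k x y :
  represents (fun n => k *: cseq x n + cseq y n) (cval (k *: x + y)).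
Proof. by rewrite cval_lin; apply: represents_lin; exact: cseqP. Qed.

Lemma cip_si : semi_inner cip.
Proof.
split.
- move=> k x y z; have h := cip_lim (cseqP x) (cseq_lin k y z).
  apply: (ctends_uniq h).
  apply: (@ctends_ext _ (fun n => k * s (cseq x n) (cseq y n) + s (cseq x n) (cseq z n))).
    by move=> n; rewrite (siDr s_si) (siZr s_si).
  by apply: ctendsD; [apply: ctendsZ|]; apply: cip_lim; exact: cseqP.
- move=> k x y z; have h := cip_lim (cseq_lin k y z) (cseqP x).
  apply: (ctends_uniq h).
  apply: (@ctends_ext _ (fun n => cj k * s (cseq y n) (cseq x n) + s (cseq z n) (cseq x n))).
    by move=> n; rewrite (siDl s_si) (siZl s_si).
  by apply: ctendsD; [apply: ctendsZ|]; apply: cip_lim; exact: cseqP.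
- move=> x; have h := cip_lim (cseqP x) (cseqP x).
  by apply: (ctends_ge0 h) => n; exact: si_ge0 s_si _.
Qed.

(** The Cauchy-Schwarz inequality in the limit. It makes [cip] definite, because an element of the
    completion is its functional. *)
Lemma cval_bound x b : cn (cval x b) ^+ 2 <= q b * sq cip x.
Proof.
have h := proj2 (cseqP x) b; have h' := cip_lim (cseqP x) (cseqP x).
apply/ler_addgt0Pr => e e0.
set c := cn (cval x b); have c0 : 0 <= c := cn_ge0 _.
have b0 := sq_ge0 s_si b.
have [N hN] := h (Num.min 1 (e / (2 * (2 * c + 1)))) ltac:(rewrite lt_min ltr01 divr_gt0//; lra).
have [N' hN'] := h' (e / (2 * (q b + 1))) ltac:(apply: divr_gt0; lra).
have := hN _ (leq_maxl N N'); have := hN' _ (leq_maxr N N').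
move: (maxn N N') => n; rewrite lt_min => h1 /andP[h2 h3].
have := cauchy_schwarz s_si b (cseq x n).
have := cnD (s b (cseq x n)) (cval x b - s b (cseq x n)).
rewrite addrC subrK -/c cnB.
move: h1 h3; rewrite ltr_pdivlMr ?ltr_pdivlMr; [|lra|lra].
have := cn_Re (s (cseq x n) (cseq x n) - cip x x).
have ReB (z1 z2 : R[i]) : Re (z1 - z2) = Re z1 - Re z2 by case: z1; case: z2.
rewrite ReB -[Re (s _ _)]/(q (cseq x n)) -[Re (cip x x)]/(sq cip x) ler_norml => /andP[g1 g2].
set t := cn (s b _ - cval x b) in h2 *; set r := cn (s b _).
set w := cn (_ - cip x x) in g1 g2 *.
have t0 : 0 <= t := cn_ge0 _; have r0 : 0 <= r := cn_ge0 _; have w0 : 0 <= w := cn_ge0 _.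
move=> h1 h3 h4 h5.
have : c ^+ 2 <= r ^+ 2 + (2 * c + 1) * t by have [ct|tc] := lerP c t; nra.
have : q b * q (cseq x n) <= q b * (sq cip x + w) by apply: ler_wpM2l => //; lra.
by nra.
Qed.

Lemma cip_eq0 x : sq cip x = 0 -> x = 0.
Proof.
move=> x0; apply: val_inj; apply: funext => b /=.
have := cval_bound x b; rewrite x0 mulr0 => h.
by apply: cn_eq0; apply/eqP; rewrite -sqrf_eq0; apply/eqP/le_anti; rewrite h sqr_ge0.
Qed.

Definition cnorm (x : completion) : R[i] := (Num.sqrt (sq cip x))%:C.

Fact cnormD x y : cnorm (x + y) <= cnorm x + cnorm y.
Proof.
rewrite /cnorm -rmorphD lecR.
have sx := sqrtr_ge0 (sq cip x); have sy := sqrtr_ge0 (sq cip y).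
apply: le_sqr_le; first by rewrite addr_ge0.
rewrite sqrrD !sqr_sqrtr ?(sq_ge0 cip_si)// (sqD cip_si).
have : cn (cip x y) <= Num.sqrt (sq cip x) * Num.sqrt (sq cip y).
  apply: le_sqr_le; first by rewrite mulr_ge0.
  by rewrite exprMn !sqr_sqrtr ?(sq_ge0 cip_si)//; apply: cauchy_schwarz cip_si _ _.
have := cn_Re (cip x y); have := ler_norm (Re (cip x y)).
by rewrite mulr2n; lra.
Qed.

Fact cnormZ k x : cnorm (k *: x) = `|k| * cnorm x.
Proof.
rewrite /cnorm (sqZ cip_si) sqrtrM ?sqr_ge0// sqrtr_sqr ger0_norm ?cn_ge0//.
by rewrite cnE -rmorphM.
Qed.

Fact cnorm_eq0 x : cnorm x = 0 -> x = 0.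
Proof.
move=> /complexI/eqP; rewrite sqrtr_eq0 => h; apply: cip_eq0.
by apply/le_anti; rewrite h (sq_ge0 cip_si).
Qed.

HB.instance Definition _ := Lmodule_isNormed.Build R[i] completion
  cnormD cnormZ cnorm_eq0.

Lemma completion_nr (x : completion) : nr x ^+ 2 = sq cip x.
Proof. by rewrite /nr /Num.norm /= sqr_sqrtr// (sq_ge0 cip_si). Qed.

Fact embed_pred (v : V) : (fun b => s b v) \in completion_pred.
Proof.
apply/asboolP; exists (fun=> v); split.
  by move=> e e0; exists 0%N => m n _ _; rewrite subrr /sqrtq /sq (si0l s_si) sqrtr0.
by move=> b; apply: ctends_cst.
Qed.
Definition embed (v : V) : completion := Completion (embed_pred v).

Lemma embed_represents (v : V) : represents (fun=> v) (cval (embed v)).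
Proof.
split; last by move=> b; apply: ctends_cst.
by move=> e e0; exists 0%N => m n _ _; rewrite subrr /sqrtq /sq (si0l s_si) sqrtr0.
Qed.

Lemma embed_lin k (v w : V) : embed (k *: v + w) = k *: embed v + embed w.
Proof.
by apply: val_inj; apply: funext => b /=; rewrite (siDr s_si) (siZr s_si).
Qed.

Lemma cip_embed (v w : V) : cip (embed v) (embed w) = s v w.
Proof.
by apply: ctends_uniq (cip_lim (embed_represents v) (embed_represents w)) _; apply: ctends_cst.
Qed.

Lemma embedB_nr (v w : V) : nr (embed v - embed w) = sqrtq (v - w).
Proof.
have -> : embed v - embed w = embed (v - w).
  by rewrite -[- embed w]scaleN1r addrC -embed_lin scaleN1r addrC.
rewrite /sqrtq; apply/eqP; rewrite -(eqrXn2 (n := 2)) ?nr_ge0 ?sqrtr_ge0//; apply/eqP.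
by rewrite completion_nr sqr_sqrtr ?(sq_ge0 s_si)// /sq cip_embed.
Qed.

Lemma embed_tends u (x : completion) : represents u (cval x) -> tends (embed \o u) x.
Proof.
move=> ru e e0; have [N hN] := proj1 ru (e / 2) ltac:(lra).
exists N => n Nn /=.
suff : nr (embed (u n) - x) <= e / 2 by lra.
apply: le_sqr_le; first by lra.
rewrite completion_nr.
have rw : represents (fun k => (-1) *: u k + u n) (cval (embed (u n) - x)).
  have -> : embed (u n) - x = (-1) *: x + embed (u n) by rewrite scaleN1r addrC.
  by rewrite cval_lin; apply: represents_lin => //; exact: embed_represents.
have h := cip_lim rw rw.
rewrite -[sq cip _]ger0_norm ?(sq_ge0 cip_si)//.
have -> : `|sq cip (embed (u n) - x)| = cn (cip (embed (u n) - x) (embed (u n) - x)).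
  by rewrite (sqE cip_si) cnR.
apply/ler_addgt0Pr => d d0; have [N' hN'] := h d d0.
set k := maxn N N'; have := hN' k (leq_maxr _ _); have := hN n k Nn (leq_maxl _ _).
rewrite scaleN1r (addrC (- u k)) (sqE s_si) -sqrtq_sq.
have := sqrtq_ge0 (u n - u k); set z := cip _ _; set t := sqrtq _ => t0 t1.
have := cnD (z - (t ^+ 2)%:C) (t ^+ 2)%:C.
by rewrite subrK cnB cnR ger0_norm ?sqr_ge0//; nra.
Qed.

Lemma embed_dense (x : completion) (e : R) : 0 < e -> exists v : V, nr (x - embed v) < e.
Proof.
move=> e0; have [N /(_ N (leqnn _)) h] := embed_tends (cseqP x) e0.
by exists (cseq x N); rewrite nrB.
Qed.

Fact completion_complete (F : set_system completion) :
  ProperFilter F -> cauchy F -> cvg F.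
Proof.
apply: sequences_complete => x cx {F}.
have ex n : {v : V | nr (x n - embed v) < n.+1%:R^-1}.
  by apply/cid/embed_dense; rewrite invr_gt0 ltr0n.
pose u n := sval (ex n).
have hu n : nr (x n - embed (u n)) < n.+1%:R^-1 by rewrite /u; case: (ex n).
have small := @inv_small R.
have cu : scauchy u.
  move=> e e0; have [N hN] := small (e / 3) ltac:(lra).
  have [N' hN'] := cx (e / 3) ltac:(lra).
  exists (maxn N N') => m n; rewrite !geq_max => /andP[/hN m1 m2] /andP[/hN n1 n2].
  have aux (a b c d f p r e' : R) : a <= b + c -> c <= d + f -> b < p -> d < e' / 3 ->
    f < r -> p < e' / 3 -> r < e' / 3 -> a < e' by lra.
  rewrite -embedB_nr; apply: (aux _ _ _ _ _ _ _ _ (nr_tri (x m) _ _)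
    (nr_tri (x n) _ _) _ (hN' m n m2 n2) (hu n) m1 n1).
  by rewrite nrB; exact: hu.
have lim b : {l | ctends (fun n => s b (u n)) l}.
  apply: cid; apply: ccauchy_tends => e e0; have b0 := sqrtq_ge0 b.
  have [N hN] := cu (e / (sqrtq b + 1)) ltac:(apply: divr_gt0; lra).
  exists N => m n hm hn; rewrite -(siNr s_si) -(siDr s_si).
  have := sqrtq_cs b (u m - u n); have := hN m n hm hn.
  by rewrite ltr_pdivlMr; [have := sqrtq_ge0 (u m - u n); nra|lra].
have rl : represents u (fun b => sval (lim b)).
  by split=> // b; case: (lim b).
have yP : (fun b => sval (lim b)) \in completion_pred by apply/asboolP; exists u.
exists (Completion yP) => e e0.
have [N hN] := embed_tends (x := Completion yP) rl (e := e / 2) ltac:(lra).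
have [N' hN'] := small (e / 2) ltac:(lra).
exists (maxn N N') => n; rewrite geq_max => /andP[/hN h1 /hN' h2].
have aux (a b c p e' : R) : a <= b + c -> b < p -> c < e' / 2 -> p < e' / 2 ->
  a < e' by lra.
exact: aux (nr_tri (embed (u n)) (x n) (Completion yP)) (hu n) h1 h2.
Qed.

HB.instance Definition _ := Uniform_isComplete.Build completion completion_complete.

Fact completion_ip_lin k (x y z : completion) :
  cip x (k *: y + z) = k * cip x y + cip x z.
Proof. by case: cip_si. Qed.
Fact completion_ip_herm (x y : completion) : cip y x = cj (cip x y).
Proof. exact: si_herm cip_si _ _. Qed.
Fact completion_ip_sq (x : completion) : cip x x = `|x| ^+ 2.
Proof. by rewrite (sqE cip_si) -completion_nr nrE rmorphXn. Qed.

Definition completion_hilbert : hilbert R :=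
  @Hilbert R completion cip completion_ip_lin completion_ip_herm completion_ip_sq.

End Completion.

(** * Representations and states *)

Section Spans.
Variables (R : realType) (V : normedModType R[i]).
Implicit Types (X M L : set V).

Lemma closed_span_subspace X : closed_subspace (closed_span X).
Proof.
split.
- by move=> L [].
- by move=> k x y hx hy L cL XL; have [_ Ll _] := cL; apply: Ll; [apply: hx|apply: hy].
- apply/closed_epsP => x hx L cL XL; have [_ _ /closed_epsP] := cL; apply=> e e0.
  by have [y hy xy] := hx e e0; exists y => //; apply: hy.
Qed.

Lemma closed_span_sub X : X `<=` closed_span X.
Proof. by move=> x Xx L _; apply. Qed.

Definition closure_eps M : set V :=
  [set x | forall e : R, 0 < e -> exists2 y, M y & nr (x - y) < e].

Lemma closure_eps_subspace M : M 0 ->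
  (forall k x y, M x -> M y -> M (k *: x + y)) -> closed_subspace (closure_eps M).
Proof.
move=> M0 Ml; split.
- by move=> e e0; exists 0 => //; rewrite subr0 nr0.
- move=> k x y hx hy e e0; have k0 := cn_ge0 k.
  have [x' Mx xx] := hx (e / (2 * (cn k + 1))) ltac:(apply: divr_gt0; lra).
  have [y' My yy] := hy (e / 2) ltac:(lra).
  exists (k *: x' + y'); first exact: Ml.
  have -> : k *: x + y - (k *: x' + y') = k *: (x - x') + (y - y') by lmod.
  have := nrD (k *: (x - x')) (y - y'); rewrite nrZ.
  move: xx; rewrite ltr_pdivlMr; last by lra.
  by have := nr_ge0 (x - x'); nra.
- apply/closed_epsP => x hx e e0.
  have [y hy xy] := hx (e / 2) ltac:(lra); have [z Mz yz] := hy (e / 2) ltac:(lra).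
  by exists z => //; have := nr_tri y x z; lra.
Qed.

Lemma closed_span_dense X M : M 0 ->
  (forall k x y, M x -> M y -> M (k *: x + y)) -> X `<=` M ->
  closed_span X = setT -> forall x, closure_eps M x.
Proof.
move=> M0 Ml XM Xt x; have : closed_span X x by rewrite Xt.
apply; first exact: closure_eps_subspace.
by move=> y /XM My e e0; exists y => //; rewrite subrr nr0.
Qed.

Lemma dense_closed_span X : (forall x, closure_eps X x) -> closed_span X = setT.
Proof.
move=> h; apply/seteqP; split=> // x _ L cL XL.
have [_ _ /closed_epsP] := cL; apply=> e e0; have [y Xy xy] := h x e e0.
by exists y => //; apply: XL.
Qed.

End Spans.

Section Adjoint.
Variables (R : realType) (V : lmodType R[i]) (H K : hilbert R).
Variables (iota : V -> H) (T : V -> K) (C : R).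

(** The operator in question is $\iota x\mapsto Tx$ on a dense subspace. It is given through [V], so
    neither its well-definedness nor its extension to [H] has to be discussed. *)
Lemma exists_adjoint :
  (forall k x y, iota (k *: x + y) = k *: iota x + iota y) ->
  (forall h (e : R), 0 < e -> exists x, nr (h - iota x) < e) ->
  (forall k x y, T (k *: x + y) = k *: T x + T y) ->
  0 <= C -> (forall x, nr (T x) <= C * nr (iota x)) ->
  exists S : K -> H, [/\ forall k x y, S (k *: x + y) = k *: S x + S y,
    forall k x, ip (S k) (iota x) = ip k (T x) & forall k, nr (S k) <= C * nr k].
Proof.
move=> ilin idense Tlin C0 TC.
have ex k : {w : H | (forall x, ip w (iota x) = ip k (T x)) /\ nr w <= C * nr k}.
  apply: cid; have [||||||w [h hC _]] := @riesz R H V setT iota (fun x => ip k (T x)) (C * nr k).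
  - by [].
  - by [].
  - by move=> c x y _ _; exact: ilin.
  - by move=> c x y _ _; rewrite Tlin (siDr (ip_si K)) (siZr (ip_si K)).
  - by rewrite mulr_ge0 ?nr_ge0.
  - move=> x _; apply: le_trans (ip_cs _ _) _; rewrite -mulrA mulrCA.
    by apply: ler_wpM2l; [exact: nr_ge0|rewrite TC].
  by exists w; split=> // x; rewrite h.
pose S k := sval (ex k).
have S1 k x : ip (S k) (iota x) = ip k (T x) by rewrite /S; case: (ex k) => ? [].
have S2 k : nr (S k) <= C * nr k by rewrite /S; case: (ex k) => ? [].
exists S; split=> // c k k'; set w := S _; set w' := _ + S k'.
have e x : ip (w - w') (iota x) = 0.
  rewrite (siDl (ip_si H)) (siNl (ip_si H)) /w /w' S1 (siDl (ip_si H)) (siZl (ip_si H)).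
  by rewrite !S1 (siDl (ip_si K)) (siZl (ip_si K)) subrr.
apply/eqP; rewrite -subr_eq0; apply/eqP/nr_eq0/le_anti; rewrite nr_ge0 andbT.
apply/ler_addgt0Pr => d d0; rewrite add0r.
have [x xd] := idense (w - w') d d0.
have : ip (w - w') (w - w') = ip (w - w') (w - w' - iota x).
  by rewrite [RHS](siDr (ip_si H)) (siNr (ip_si H)) e subr0.
rewrite ip_norm => /(congr1 (@cn R)); rewrite cnR ger0_norm ?sqr_ge0// => E.
have := ip_cs (w - w') (w - w' - iota x); rewrite -E => h.
have := nr_ge0 (w - w'); have := nr_ge0 (w - w' - iota x).
by have [//|h1] := lerP (nr (w - w')) d; nra.
Qed.
End Adjoint.

Lemma ip_dense_ext (R : realType) (H : hilbert R) (X : set H) (x y : H) :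
  (forall h, closure_eps X h) -> (forall z, X z -> ip x z = ip y z) -> x = y.
Proof.
move=> Xd h; apply/eqP; rewrite -subr_eq0; apply/eqP/nr_eq0/le_anti.
rewrite nr_ge0 andbT; apply/ler_addgt0Pr => d d0; rewrite add0r.
have [z Xz zd] := Xd (x - y) d d0.
have : ip (x - y) (x - y) = ip (x - y) (x - y - z).
  rewrite [RHS](siDr (ip_si H)) (siNr (ip_si H)) (_ : ip _ z = 0) ?subr0//.
  by rewrite (siDl (ip_si H)) (siNl (ip_si H)) h// subrr.
rewrite ip_norm => /(congr1 (@cn R)); rewrite cnR ger0_norm ?sqr_ge0// => E.
have := ip_cs (x - y) (x - y - z); rewrite -E => h'.
have := nr_ge0 (x - y); have := nr_ge0 (x - y - z).
by have [//|h1] := lerP (nr (x - y)) d; nra.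
Qed.

Section Reps.
Variables (R : realType) (A : cstarAlg R).
Implicit Types (a b c : A) (rho sigma : rep A).

Lemma rep_action rho : star_action (@ip R (rep_space rho)) rho.
Proof. by case: rho => H r /=. Qed.

Lemma rep_contraction rho a h : nr (rho a h) <= nr a * nr h.
Proof.
apply: le_sqr_le; first by rewrite mulr_ge0 ?nr_ge0.
rewrite exprMn -(ip_sq h) -(ip_sq (rho a h)).
exact: (action_contraction (ip_si _) (rep_action rho)).
Qed.

Lemma rep_adj rho a h h' : ip (rho a h) h' = ip h (rho (cstar a) h').
Proof. by case: (rep_action rho). Qed.

Lemma repM rho a b h : rho (cmul a b) h = rho a (rho b h).
Proof. by case: (rep_action rho). Qed.

Lemma rep_linl rho k a b h : rho (k *: a + b) h = k *: rho a h + rho b h.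
Proof. by case: (rep_action rho). Qed.

Lemma rep_linr rho k a h h' : rho a (k *: h + h') = k *: rho a h + rho a h'.
Proof. by case: (rep_action rho). Qed.

Definition repE rho := actE (rep_action rho).

Lemma cyclic_dense rho (xi : rep_space rho) :
  closed_span (range (fun a => rho a xi)) = setT ->
  forall h (e : R), 0 < e -> exists a, nr (h - rho a xi) < e.
Proof.
move=> cyc h e e0.
have [|||_ [a _ <-] ha] := closed_span_dense (M := range (fun a => rho a xi)) _ _ _ cyc h e0.
- by exists 0 => //; rewrite repE.
- by move=> k _ _ [a _ <-] [b _ <-]; exists (k *: a + b) => //; rewrite rep_linl.
- by [].
by exists a.
Qed.

Lemma dense_cyclic rho (xi : rep_space rho) :
  (forall h (e : R), 0 < e -> exists a, nr (h - rho a xi) < e) ->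
  closed_span (range (fun a => rho a xi)) = setT.
Proof.
move=> d; apply: dense_closed_span => h e e0; have [a ha] := d h e e0.
by exists (rho a xi) => //; exists a.
Qed.

Lemma cyclic_ext rho (xi x y : rep_space rho) :
  closed_span (range (fun a => rho a xi)) = setT ->
  (forall a, ip x (rho a xi) = ip y (rho a xi)) -> x = y.
Proof.
move=> cyc h; apply: (@ip_dense_ext _ _ (range (fun a => rho a xi))).
  move=> k e e0; have [a ka] := cyclic_dense cyc k e0.
  by exists (rho a xi) => //; exists a.
by move=> _ [a _ <-].
Qed.

Section Functional.
Variable f : A -> R[i]^o.

Definition fform a b : R[i] := f (cmul (cstar a) b).

Hypothesis f_pos : positive_functional f.

Lemma flin k a b : f (k *: a + b) = k * f a + f b.
Proof. by case: f_pos => l _; apply: l. Qed.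
Lemma f0 : f 0 = 0.
Proof. by have := flin (-1) 0 0; rewrite scaler0 addr0 mulN1r addNr. Qed.
Lemma fD a b : f (a + b) = f a + f b.
Proof. by have := flin 1 a b; rewrite scale1r mul1r. Qed.
Lemma fZ k a : f (k *: a) = k * f a.
Proof. by have := flin k a 0; rewrite f0 !addr0. Qed.
Lemma fN a : f (- a) = - f a.
Proof. by rewrite -scaleN1r fZ mulN1r. Qed.

Lemma fform_si : semi_inner fform.
Proof.
split=> [k x y z|k x y z|x]; rewrite /fform.
- by rewrite !cmulE flin.
- by rewrite !cstarE !cmulE flin.
- by case: f_pos => _; apply.
Qed.

Lemma fform_action : star_action fform (@cmul R A).
Proof.
split=> [k a b v|k a v w|a b v|a v w]; rewrite ?cmulE//.
by rewrite /fform !cstarE !cmulE.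
Qed.

Hypothesis f_le : forall a, cn (f a) <= nr a.

Lemma approx_left a (e : R) : 0 < e ->
  exists v, [/\ self_adjoint v, nr v <= 1 & nr (a - cmul v a) < e].
Proof.
move=> e0; have [v [_ sv v1 hv]] := approx_right (full_ideal A) (a := cstar a) I e0.
by exists v; split=> //; rewrite nr_cn_star_sub.
Qed.

(** A contraction [v] with $va\approx a$ takes the place of the unit in the Cauchy-Schwarz
    inequality. *)
Lemma f_cs a : cn (f a) ^+ 2 <= Re (f (cmul (cstar a) a)).
Proof.
have s0 : 0 <= Re (f (cmul (cstar a) a)) by exact: (sq_ge0 fform_si a).
suff h : forall e : R, 0 < e -> cn (f a) <= Num.sqrt (Re (f (cmul (cstar a) a))) + e.
  rewrite -(sqr_sqrtr s0); apply: lerXn2r; rewrite ?nnegrE ?cn_ge0 ?sqrtr_ge0//.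
  by apply/ler_addgt0Pr.
move=> e e0; have [v [sv v1 hv]] := approx_left a e0.
have -> : f a = f (cmul v a) + f (a - cmul v a) by rewrite -fD addrC subrK.
apply: le_trans (cnD _ _) _; apply: lerD; last by apply: ltW; apply: le_lt_trans (f_le _) hv.
apply: le_sqr_le; first exact: sqrtr_ge0.
rewrite (sqr_sqrtr s0).
have := cauchy_schwarz fform_si v a; rewrite /fform sv => h; apply: le_trans h _.
rewrite -[sq _ a]/(Re (f (cmul (cstar a) a))) ler_piMl//.
rewrite -[sq _ v]/(Re (f (cmul (cstar v) v))).
apply: le_trans (ler_norm _) _; apply: le_trans (cn_Re _) _; apply: le_trans (f_le _) _.
by rewrite cnorm_sq expr_le1 ?nr_ge0.
Qed.

Lemma gns_exists : exists rho (xi : rep_space rho), (forall a, f a = ip xi (rho a xi)) /\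
  closed_span (range (fun a => rho a xi)) = setT.
Proof.
pose s_si := fform_si; pose H := completion_hilbert s_si.
have contr a x : sqrtq fform (cmul a x) <= nr a * sqrtq fform x.
  apply: le_sqr_le; first by rewrite mulr_ge0 ?nr_ge0 ?sqrtq_ge0.
  rewrite exprMn !(sqrtq_sq s_si).
  exact: (action_contraction s_si fform_action).
have reps a u phi : represents fform u phi ->
    represents fform (fun n => cmul a (u n)) (fun b => phi (cmul (cstar a) b)).
  move=> [cu hu]; split=> [e e0|b].
    have a0 := nr_ge0 a.
    have [N hN] := cu (e / (nr a + 1)) ltac:(apply: divr_gt0; lra).
    exists N => m n hm hn; have := hN m n hm hn; rewrite ltr_pdivlMr; last by lra.
    rewrite -cmulNr -cmulDr => h; apply: le_lt_trans (contr _ _) _.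
    by have := sqrtq_ge0 fform (u m - u n); nra.
  apply: ctends_ext (hu (cmul (cstar a) b)) => n.
  by rewrite (act_adj fform_action) cstarK.
(* The action on functionals is the transpose $(ax)(b)=x(a^*b)$ of multiplication, which maps
   representing sequences [u] to $au$. *)
have actP a (x : H) : (fun b => cval x (cmul (cstar a) b)) \in completion_pred fform.
  by apply/asboolP; exists (fun n => cmul a (cseq x n)); apply: reps; exact: cseqP.
pose act a (x : H) : H := Completion (actP a x).
have cval_conj (x : H) k b c : cval x (k *: b + c) = cj k * cval x b + cval x c.
  have h := proj2 (cseqP x); apply: ctends_uniq (h _) _.
  apply: (@ctends_ext _ (fun n => cj k * fform b (cseq x n) + fform c (cseq x n))).
    by move=> n; rewrite (siDl s_si) (siZl s_si).
  by apply: ctendsD => //; apply: ctendsZ.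
have actl k a b (h : H) : act (k *: a + b) h = k *: act a h + act b h.
  apply: val_inj; apply: funext => x /=; rewrite !cstarE !cmulE cval_conj conjCK.
  by [].
have actr k a (h h' : H) : act a (k *: h + h') = k *: act a h + act a h'.
  by apply: val_inj; apply: funext => x.
have actm a b (h : H) : act (cmul a b) h = act a (act b h).
  by apply: val_inj; apply: funext => x /=; rewrite !cstarE !cmulE.
have act_rep a (h : H) : represents fform (fun n => cmul a (cseq h n)) (cval (act a h)).
  by apply: reps; exact: cseqP.
have acta a (h h' : H) : ip (act a h) h' = ip h (act (cstar a) h').
  have l1 := cip_lim s_si (act_rep a h) (cseqP h').
  have l2 := cip_lim s_si (cseqP h) (act_rep (cstar a) h').
  apply: ctends_uniq l1 _; apply: ctends_ext l2 => n.
  by rewrite [RHS](act_adj fform_action).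
have actb a : exists M : R[i], forall h : H, `|act a h| <= M * `|h|.
  exists (nr a)%:C => h; rewrite !nrE -rmorphM lecR; apply: le_sqr_le.
    by rewrite mulr_ge0 ?nr_ge0.
  rewrite exprMn -!ip_sq; apply: (@action_contraction R H _ (ip_si H) A act).
  by split=> *; [exact: actl|exact: actr|exact: actm|exact: acta].
pose rho : rep A := @Rep R A H act actl actr actm acta actb.
(* Without a unit in [A] the cyclic vector is not the class of an element; it is the Riesz vector of
   [f], which is bounded by [f_cs]. *)
have [|||||xi [hxi _ _]] := @riesz R H A setT (embed s_si) f 1 I.
- by [].
- by move=> k x y _ _; exact: embed_lin.
- by move=> k x y _ _; exact: flin.
- by [].
- move=> x _; rewrite mul1r; apply: le_sqr_le; first exact: nr_ge0.
  have -> : nr (embed s_si x : H) ^+ 2 = sq fform x.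
    by rewrite -ip_sq /sq -[ip _ _]/(cip s_si _ _) cip_embed.
  exact: f_cs.
have act_embed a b : act a (embed s_si b) = embed s_si (cmul a b).
  apply: val_inj; apply: funext => x /=; by rewrite (act_adj fform_action) cstarK.
have act_xi a : act a xi = embed s_si a.
  apply: (@ip_dense_ext R H (range (fun v => embed s_si v : H))).
    move=> h e e0; have [v hv] := embed_dense s_si h e0.
    by exists (embed s_si v) => //; exists v.
  move=> _ [b _ <-]; rewrite acta act_embed -hxi//.
  by rewrite -[ip _ _]/(cip s_si _ _) cip_embed.
exists rho, xi; split=> [a|].
  by rewrite [rho a xi]act_xi hxi.
apply: dense_cyclic => h e e0; have [v hv] := embed_dense s_si h e0.
by exists v; rewrite [rho v xi]act_xi.
Qed.
End Functional.

Lemma state_le f : @state R A f -> forall a, cn (f a) <= nr a.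
Proof. by move=> [_ h _] a; have := h a; rewrite cnE nrE lecR. Qed.

(** * Commutants of GNS representations of pure states *)

Section Pure.
Variables (f : A -> R[i]^o) (rho : rep A) (xi : rep_space rho).
Hypothesis f_pure : pure_states f.
Hypothesis f_xi : forall a, f a = ip xi (rho a xi).
Hypothesis xi_cyc : closed_span (range (fun a => rho a xi)) = setT.
Local Notation H := (rep_space rho).

(** The functional $a\mapsto\langle\xi|T\varrho(a)\xi\rangle$ is positive and dominated by [f],
    hence a multiple of [f]. This fixes [T] on the dense subspace $A\xi$; boundedness of [T] follows
    from $0\le T\le1$ by Cauchy-Schwarz. *)
Lemma pure_commutant (T : H -> H) :
  (forall k x y, T (k *: x + y) = k *: T x + T y) ->
  (forall a h, T (rho a h) = rho a (T h)) ->
  (forall h, 0 <= ip h (T h)) -> (forall h, Re (ip h (T h)) <= nr h ^+ 2) ->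
  exists2 k : R, 0 <= k & forall h, T h = k%:C *: h.
Proof.
move=> Tlin Tcom Tge0 Tle1.
have si : semi_inner (fun x y : H => ip x (T y)).
  split=> // [k x y z|k x y z].
    by rewrite Tlin (siDr (ip_si H)) (siZr (ip_si H)).
  by rewrite (siDl (ip_si H)) (siZl (ip_si H)).
have Tb h : nr (T h) <= nr h.
  have := cauchy_schwarz si (T h) h; rewrite ip_norm cnR ger0_norm ?sqr_ge0// => c.
  have a1 : sq (fun x y : H => ip x (T y)) (T h) <= nr (T h) ^+ 2 := Tle1 (T h).
  have a2 : sq (fun x y : H => ip x (T y)) h <= nr h ^+ 2 := Tle1 h.
  have a3 := sq_ge0 si (T h); have a4 := sq_ge0 si h.
  have n1 := nr_ge0 (T h); have n2 := nr_ge0 h.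
  rewrite leNgt; apply/negP => lt.
  have : nr (T h) ^+ 2 ^+ 2 <= nr (T h) ^+ 2 * nr h ^+ 2.
    by apply: le_trans c _; apply: ler_pM.
  by rewrite expr2 ler_pM2l; nra.
pose g a : R[i]^o := ip xi (T (rho a xi)).
have gg a b : g (cmul (cstar b) a) = ip (rho b xi) (T (rho a xi)).
  by rewrite /g repM Tcom rep_adj.
have ff a b : f (cmul (cstar b) a) = ip (rho b xi) (rho a xi).
  by rewrite f_xi repM rep_adj.
have glin : linear g.
  by move=> k a b; rewrite /g rep_linl Tlin (siDr (ip_si H)) (siZr (ip_si H)).
have [_ pure] := f_pure.
have [||k [/andP[k0 k1] gk]] := pure g.
- by split=> // a; rewrite gg.
- split.
    move=> k a b; rewrite glin flin; last by case: f_pure => [[]].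
    by rewrite scalerBr opprD addrACA.
  move=> a; rewrite ff gg ip_norm [ip _ (T _)]ge0C// -rmorphB ler0c subr_ge0.
  exact: Tle1.
exists (Re k); first by move: k0; rewrite lecE => /andP[].
have dense_eq a : T (rho a xi) = (Re k)%:C *: rho a xi.
  apply: (cyclic_ext xi_cyc) => b.
  rewrite (ip_herm (rho b xi) (T _)) -gg gk ff {1}[k]ge0C// rmorphM /=.
  by rewrite (siZl (ip_si H)) -ip_herm.
move=> h; apply/eqP; rewrite -subr_eq0; apply/eqP/nr_small => e e0.
have kk : 0 <= Re k by move: k0; rewrite lecE => /andP[].
have [a ha] := cyclic_dense xi_cyc h (e := e / (2 * (Re k + 1))) ltac:(apply: divr_gt0; lra).
have TB : T (h - rho a xi) = T h - T (rho a xi).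
  by rewrite addrC -scaleN1r Tlin scaleN1r addrC.
have -> : T h - (Re k)%:C *: h = T (h - rho a xi) - (Re k)%:C *: (h - rho a xi).
  by rewrite TB dense_eq; lmod.
have := nrD (T (h - rho a xi)) (- ((Re k)%:C *: (h - rho a xi))).
rewrite nrN nrZR//; have := Tb (h - rho a xi); move: ha; rewrite ltr_pdivlMr; last by lra.
by have := nr_ge0 (h - rho a xi); nra.
Qed.

Lemma invariant_projection (L : set H) : closed_subspace L ->
  (forall a h, L h -> L (rho a h)) -> exists P : H -> H,
  [/\ forall k x y, P (k *: x + y) = k *: P x + P y, forall x, L (P x),
      forall x y, L y -> ip (P x) y = ip x y, forall x, L x -> P x = x &
      (forall a h, P (rho a h) = rho a (P h))].
Proof.
move=> cL inv; have [P [Plin PL Pip]] := exists_projection cL.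
have Pid x : L x -> P x = x.
  move=> Lx; apply/eqP; rewrite -subr_eq0; apply/eqP/nr_eq0.
  have LB : L (P x - x) by apply: subspaceB.
  have : ip (P x - x) (P x - x) = 0.
    by rewrite {1}(siDl (ip_si H)) (siNl (ip_si H)) Pip// subrr.
  by rewrite ip_norm => /complexI/eqP; rewrite sqrf_eq0 => /eqP.
have Psa x y : ip (P x) y = ip x (P y).
  by rewrite -(Pip x (P y))// ip_herm -(Pip y (P x))// -ip_herm.
exists P; split=> // a h; apply: ip_ext => z.
by rewrite Psa rep_adj -(Pip h)//; [rewrite -rep_adj -Psa Pid//; apply: inv|apply: inv].
Qed.

Lemma gns_nonzero : exists a h, rho a h <> 0.
Proof.
have [[_ _ f1] _] := f_pure.
apply: contrapT => h.
have z a : f a = 0.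
  rewrite f_xi (_ : rho a xi = 0) ?(si0r (ip_si H))//.
  by apply: contrapT => hh; apply: h; exists a, xi.
have : (1 : R[i]) <= 0 by apply: f1 => a; rewrite z normr0 mul0r.
by rewrite ler10.
Qed.

Lemma pure_irreducible : irreducible rho.
Proof.
split; first exact: gns_nonzero.
move=> L cL inv; have [P [Plin PL Pip Pid Pcom]] := invariant_projection cL inv.
have Pnorm h : ip h (P h) = ip (P h) (P h) by rewrite -(Pip h).
have Ple h : nr (P h) <= nr h.
  have := ip_cs h (P h); rewrite Pnorm ip_norm cnR ger0_norm ?sqr_ge0//.
  have := nr_ge0 (P h); rewrite le_eqVlt => /orP[/eqP <- _|p0]; first exact: nr_ge0.
  by rewrite expr2 ler_pM2r.
have [||k k0 Pk] := pure_commutant Plin Pcom.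
- by move=> h; rewrite Pnorm; exact: si_ge0 (ip_si H) _.
- move=> h; rewrite Pnorm ip_norm /=; apply: lerXn2r; rewrite ?nnegrE ?nr_ge0//.
have [[x [Lx x0]]|no] := pselect (exists x, L x /\ x <> 0).
  right; apply/seteqP; split=> // h _.
  have k1 : k%:C = 1 :> R[i].
    have : (k%:C - 1) *: x = 0.
      by rewrite scalerBl scale1r -Pk Pid// subrr.
    by move/eqP; rewrite scaler_eq0 => /orP[|/eqP //]; rewrite subr_eq0 => /eqP.
  by rewrite -[h]scale1r -k1 -Pk.
left; apply/seteqP; split=> x; last by move=> ->; case: cL.
by move=> Lx; apply: contrapT => x0; apply: no; exists x.
Qed.
End Pure.
End Reps.

(** * Irreducible representations have pure vector states *)

Section SqrtOperator.
Variables (R : realType) (H : hilbert R) (K : H -> H).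
Hypothesis Klin : forall k x y, K (k *: x + y) = k *: K x + K y.
Hypothesis Ksa : forall x y, ip (K x) y = ip x (K y).
Hypothesis Kle : forall x, nr (K x) <= nr x.

Lemma linB (T : H -> H) : (forall k x y, T (k *: x + y) = k *: T x + T y) ->
  forall x y, T (x - y) = T x - T y.
Proof. by move=> h x y; rewrite addrC -scaleN1r h scaleN1r addrC. Qed.

Lemma lin0 (T : H -> H) : (forall k x y, T (k *: x + y) = k *: T x + T y) -> T 0 = 0.
Proof. by move=> h; have := linB h 0 0; rewrite !subrr. Qed.

Lemma linZ (T : H -> H) : (forall k x y, T (k *: x + y) = k *: T x + T y) ->
  forall k x, T (k *: x) = k *: T x.
Proof.
by move=> h k x; have := h k x 0; rewrite (lin0 h) !addr0.
Qed.

Lemma linD (T : H -> H) : (forall k x y, T (k *: x + y) = k *: T x + T y) ->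
  forall x y, T (x + y) = T x + T y.
Proof. by move=> h x y; have := h 1 x y; rewrite !scale1r. Qed.

(** [P] is the absolute value $|K|=1-Y$, where [Y] is the limit of the iteration for $X=1-K^2$. It
    commutes with everything that commutes with [K] because the iterates are polynomials in
    $K^2$. *)
Lemma sqrt_operator : exists P : H -> H,
  [/\ forall k x y, P (k *: x + y) = k *: P x + P y,
      forall x, 0 <= Re (ip x (P x)), forall x, P (P x) = K (K x),
      forall x, nr (P x) <= 2 * nr x &
      forall (T : H -> H) (C : R), (forall k x y, T (k *: x + y) = k *: T x + T y) ->
        (forall x, nr (T x) <= C * nr x) -> (forall x, T (K x) = K (T x)) ->
        forall x, T (P x) = P (T x)].
Proof.
pose X h := h - K (K h).
have Xlin k x y : X (k *: x + y) = k *: X x + X y by rewrite /X !Klin; lmod.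
have Xle x : nr (X x) <= nr x.
  apply: le_sqr_le; first exact: nr_ge0.
  rewrite -!ip_sq /X (sqD (ip_si H)) (sqN (ip_si H)) (siNr (ip_si H)) -Ksa ip_norm.
  have : nr (K (K x)) ^+ 2 <= nr (K x) ^+ 2.
    by apply: lerXn2r; rewrite ?nnegrE ?nr_ge0//.
  by rewrite !ip_sq /=; have := sqr_ge0 (nr (K x)); lra.
have inc x n : nr (sq_op X n.+1 x - sq_op X n x) <=
    sqr_it R n.+1 * nr x - sqr_it R n * nr x.
  by rewrite -mulrBl; exact: sq_op_inc Xlin Xle n x.
have ex x : {y | tends (fun n => sq_op X n x) y}.
  apply: cid; apply: (increments_tends (M := nr x) (inc x)) => n.
  by have /andP[r0 r1] := sqr_it_bd R n; rewrite ler_piMl ?nr_ge0.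
pose Y x := sval (ex x).
have Ylim x : tends (fun n => sq_op X n x) (Y x) by rewrite /Y; case: (ex x).
have Ylin k x y : Y (k *: x + y) = k *: Y x + Y y.
  apply: tends_uniq (Ylim _) _; under eq_fun do rewrite (sq_op_lin Xlin).
  by apply: tendsD => //; apply: tendsZ.
have sqle n x : nr (sq_op X n x) <= nr x.
  apply: le_trans (sq_op_bd Xle n x) _.
  by have /andP[r0 r1] := sqr_it_bd R n; rewrite ler_piMl ?nr_ge0.
have Yle x : nr (Y x) <= nr x by apply: tends_ge (Ylim x) _ => n.
have YY x : tends (fun n => sq_op X n (sq_op X n x)) (Y (Y x)).
  move=> e e0.
  have [N hN] := Ylim x (e / 2) ltac:(lra); have [N' hN'] := Ylim (Y x) (e / 2) ltac:(lra).
  exists (maxn N N') => n; rewrite geq_max => /andP[/hN h1 /hN' h2].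
  have -> : sq_op X n (sq_op X n x) - Y (Y x) =
      sq_op X n (sq_op X n x - Y x) + (sq_op X n (Y x) - Y (Y x)).
    by rewrite (linB (sq_op_lin Xlin n)) addrA subrK.
  have := nrD (sq_op X n (sq_op X n x - Y x)) (sq_op X n (Y x) - Y (Y x)).
  by have := sqle n (sq_op X n x - Y x); lra.
have Yeq x : 2 *: Y x = X x + Y (Y x).
  apply: tends_uniq (tendsZ 2 (tends_shift (Ylim x))) _.
  have -> : (fun n => 2 *: sq_op X n.+1 x) = (fun n => X x + sq_op X n (sq_op X n x)).
    by apply: funext => n /=; lmod.
  by apply: tendsD => //; exact: tends_cst.
exists (fun x => x - Y x); split.
- by move=> k x y; rewrite Ylin; lmod.
- move=> x; rewrite (siDr (ip_si H)) (siNr (ip_si H)) ip_norm.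
  have := cn_Re (ip x (Y x)); have := ler_norm (Re (ip x (Y x))).
  have := ip_cs x (Y x); have := Yle x; have := nr_ge0 x.
  by case: (ip x (Y x)) => a b /=; nra.
- move=> x; rewrite (linB Ylin).
  have -> : x - Y x - (Y x - Y (Y x)) = x - 2 *: Y x + Y (Y x) by lmod.
  by rewrite Yeq /X; lmod.
- by move=> x; have := nrD x (- Y x); rewrite nrN; have := Yle x; lra.
move=> T C Tlin Tle TK x; rewrite (linB Tlin); congr (_ - _).
have Tsq n z : T (sq_op X n z) = sq_op X n (T z).
  elim: n z => [|n IH] z /=; first exact: lin0.
  by rewrite (linZ Tlin) (linD Tlin) !IH /X (linB Tlin) !TK.
have h := @tends_lip R H H T C _ _ _ (Ylim x); apply: tends_uniq (h _) _.
  by move=> u v; rewrite -(linB Tlin).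
by apply: (fun a b => eq_ind _ (fun g => tends g _) a _ b) (Ylim (T x)) _; apply: funext => n /=.
Qed.
End SqrtOperator.

Section Schur.
Variables (R : realType) (A : cstarAlg R) (rho : rep A).
Hypothesis rho_irr : irreducible rho.
Local Notation H := (rep_space rho).

Lemma irreducible_cyclic (xi : H) : xi <> 0 ->
  closed_span (range (fun a => rho a xi)) = setT.
Proof.
move=> xi0; have [[a0 [h0 r0]] irr] := rho_irr.
pose M := range (fun a => rho a xi).
have M0 : M 0 by exists 0 => //; rewrite repE.
have Ml k x y : M x -> M y -> M (k *: x + y).
  by move=> [a _ <-] [b _ <-]; exists (k *: a + b) => //; rewrite rep_linl.
have cM := closure_eps_subspace M0 Ml.
have [|c|c] := irr _ cM.
- move=> a h hh e e0; have a0' := nr_ge0 a.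
  have [_ [b _ <-] hb] := hh (e / (nr a + 1)) ltac:(apply: divr_gt0; lra).
  exists (rho (cmul a b) xi); first by exists (cmul a b).
  have -> : rho a h - rho (cmul a b) xi = rho a (h - rho b xi).
    by rewrite repM repE repE.
  apply: le_lt_trans (rep_contraction _ _) _; move: hb; rewrite ltr_pdivlMr; last by lra.
  by have := nr_ge0 (h - rho b xi); nra.
(* If $A\xi=0$, then [xi] belongs to the invariant subspace of all vectors annihilated by [A]. It
   would have to be 0 or everything, against [xi <> 0] or the nontriviality of [rho]. *)
- exfalso.
  have N0 : closed_subspace [set h : H | forall a, rho a h = 0].
    split=> /= [a|k x y hx hy a|]; first by rewrite repE.
      by rewrite rep_linr hx hy scaler0 addr0.
    apply/closed_epsP => x hx a; apply: nr_small => e e0; have a0' := nr_ge0 a.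
    have [y /= hy xy] := hx (e / (nr a + 1)) ltac:(apply: divr_gt0; lra).
    have -> : rho a x = rho a (x - y) by rewrite repE repE hy subr0.
    apply: le_trans (rep_contraction _ _) _; move: xy; rewrite ltr_pdivlMr; last by lra.
    by have := nr_ge0 (x - y); nra.
  have xiN : forall a, rho a xi = 0.
    move=> a; have : closure_eps M (rho a xi).
      by move=> e e0; exists (rho a xi); [exists a|rewrite subrr nr0].
    by rewrite c.
  have [|c'|c'] := irr _ N0.
  + by move=> a h /= hh b; rewrite -repM hh.
  + by have : [set h : H | forall a, rho a h = 0] xi by []; rewrite c'.
  + have : [set h : H | forall a, rho a h = 0] h0 by rewrite c'.
    by move/(_ a0).
- apply: dense_closed_span => h; have : closure_eps M h by rewrite c.
  by [].
Qed.

(** For each real $l$ put $K=(T-l)/2$. The kernel of $|K|+K$ is invariant. If it is 0, then $K=|K|$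
    because $(|K|+K)(K-|K|)=0$; if it is everything, then $K=-|K|$. So $T\ge l$ or $T\le l$ for
    every $l$, and [T] is the supremum of the lower bounds. *)
Lemma schur (T : H -> H) :
  (forall k x y, T (k *: x + y) = k *: T x + T y) ->
  (forall x y, ip (T x) y = ip x (T y)) -> (forall x, nr (T x) <= nr x) ->
  (forall a h, T (rho a h) = rho a (T h)) ->
  exists l : R, forall h, T h = l%:C *: h.
Proof.
move=> Tlin Tsa Tle Tcom.
have dich (l : R) : `|l| <= 1 -> (forall h, Re (ip h (T h)) <= l * nr h ^+ 2) \/
    (forall h, l * nr h ^+ 2 <= Re (ip h (T h))).
  move=> l1; pose K h := (2^-1 : R)%:C *: (T h - l%:C *: h).
  have Klin k x y : K (k *: x + y) = k *: K x + K y by rewrite /K Tlin; lmod.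
  have Ksa x y : ip (K x) y = ip x (K y).
    rewrite /K (siZl (ip_si H)) (siZr (ip_si H)) cjR (siDl (ip_si H)) (siDr (ip_si H)).
    by rewrite (siNl (ip_si H)) (siNr (ip_si H)) Tsa (siZl (ip_si H)) (siZr (ip_si H)) cjR.
  have Kle x : nr (K x) <= nr x.
    rewrite /K nrZR ?invr_ge0//; have := nrD (T x) (- (l%:C *: x)).
    rewrite nrN nrZ cnR; have := Tle x; have := nr_ge0 x; nra.
  have [P [Plin Pge PP Ple Pcom]] := sqrt_operator Klin Ksa Kle.
  have Kr a h : K (rho a h) = rho a (K h).
    by rewrite /K Tcom !repE.
  have Pr a h : P (rho a h) = rho a (P h).
    by rewrite (Pcom (rho a) (nr a)) // => [k x y|x]; [exact: rep_linr|exact: rep_contraction].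
  have PK h : P (K h) = K (P h).
    by rewrite (Pcom K 1) // => x; rewrite mul1r.
  have cN : closed_subspace [set h : H | P h + K h = 0].
    split=> /= [|k x y hx hy|].
    - by rewrite (lin0 Plin) (lin0 Klin) addr0.
    - by rewrite Plin Klin addrACA -scalerDr hx hy scaler0 addr0.
    apply/closed_epsP => x hx; apply: nr_small => e e0.
    have [y /= hy xy] := hx (e / 3) ltac:(lra).
    have -> : P x + K x = P (x - y) + K (x - y).
      by rewrite (linB Plin) (linB Klin) addrACA -opprD hy subr0.
    have := nrD (P (x - y)) (K (x - y)); have := Ple (x - y); have := Kle (x - y); lra.
  have ReK h : Re (ip h (K h)) = (Re (ip h (T h)) - l * nr h ^+ 2) / 2.
    rewrite /K (siZr (ip_si H)) (siDr (ip_si H)) (siNr (ip_si H)) (siZr (ip_si H)) ip_norm.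
    by case: (ip h (T h)) => x y /=; field.
  have [_ irr] := rho_irr.
  have [|c|c] := irr _ cN.
  - by move=> a h /= hh; rewrite Pr Kr -(actDr (rep_action rho)) hh repE.
  - right=> h; have e : K h = P h.
      have : [set h : H | P h + K h = 0] (K h - P h).
        by rewrite /= (linB Plin) (linB Klin) PP PK; lmod.
      by rewrite c /= => /eqP; rewrite subr_eq0 => /eqP.
    by have := ReK h; rewrite e; have := Pge h; lra.
  - left=> h; have e : K h = - P h.
      have : [set h : H | P h + K h = 0] h by rewrite c.
      by move=> /= /eqP; rewrite addrC addr_eq0 => /eqP.
    have := ReK h; rewrite e (siNr (ip_si H)); have := Pge h.
    by case: (ip h (P h)) => x y /=; lra.
have bd h : `|Re (ip h (T h))| <= nr h ^+ 2.
  apply: le_trans (cn_Re _) _; apply: le_trans (ip_cs _ _) _.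
  by rewrite expr2; apply: ler_wpM2l; [exact: nr_ge0|exact: Tle].
pose S := [set l : R | l <= 1 /\ forall h, l * nr h ^+ 2 <= Re (ip h (T h))].
have S1 : S (-1).
  by split=> [|h]; [lra|have := bd h; rewrite ler_norml mulN1r => /andP[]].
have hs : has_sup S by split; [exists (-1)|exists 1 => l []].
set m := sup S.
have m1 : -1 <= m by apply: ub_le_sup => //; case: hs.
have m2 : m <= 1 by apply: ge_sup => [|l []//]; exists (-1).
have low h : m * nr h ^+ 2 <= Re (ip h (T h)).
  apply/ler_addgt0Pr => e e0; have h0 := sqr_ge0 (nr h).
  have [l [l1 lS] lm] := sup_adherent (E := S) (divS_gt0 e0 h0) hs.
  have := lS h; move: lm; rewrite ltrBlDr -/m => lm hl.
  have d := divS_mul_le e0 h0.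
  by have := ler_wpM2r h0 (ltW lm); move: hl d; clear; lra.
have up h : Re (ip h (T h)) <= m * nr h ^+ 2.
  apply/ler_addgt0Pr => e e0; have h0 := sqr_ge0 (nr h).
  have [mm|mm] := lerP 1 m.
    have : m = 1 by lra.
    by move=> ->; have := bd h; rewrite ler_norml => /andP[]; lra.
  pose d := Num.min (1 - m) (e / (nr h ^+ 2 + 1)).
  have d0 : 0 < d by rewrite lt_min subr_gt0 mm divS_gt0.
  have d1 : d <= 1 - m by rewrite ge_min lexx.
  have d2 : d * nr h ^+ 2 <= e.
    apply: le_trans (_ : e / (nr h ^+ 2 + 1) * nr h ^+ 2 <= _).
      by apply: ler_wpM2r => //; rewrite ge_min lexx orbT.
    exact: divS_mul_le.
  have [|/(_ h)|lo] := dich (m + d); first by rewrite ler_norml; lra.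
    by lra.
  have : m + d <= m by apply: ub_le_sup; [case: hs|split=> //; lra].
  by lra.
exists m => h.
have imT x : Im (ip x (T x)) = 0.
  have := ip_herm x (T x); rewrite Tsa.
  by case: (ip x (T x)) => u v [] /=; lra.
have zero x : ip x (T x - m%:C *: x) = 0.
  rewrite (siDr (ip_si H)) (siNr (ip_si H)) (siZr (ip_si H)) ip_norm.
  have := low x; have := up x; have := imT x.
  case: (ip x (T x)) => u v /= -> h1 h2; apply/eqP; rewrite eq_complex /=.
  by apply/andP; split; apply/eqP; lra.
have si : semi_inner (fun x y : H => ip x (T y - m%:C *: y)).
  split=> [k x y z|k x y z|x]; last by rewrite zero.
    rewrite -(siZr (ip_si H)) -(siDr (ip_si H)) Tlin; congr ip; by lmod.
  by rewrite (siDl (ip_si H)) (siZl (ip_si H)).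
apply/eqP; rewrite -subr_eq0; apply/eqP/ip_ext => z.
rewrite (si0l (ip_si H)) ip_herm.
have /= -> := @sq_eq0_l _ _ _ si z h; first by rewrite rmorph0.
by rewrite /sq zero.
Qed.

Variable xi : H.
Hypothesis xi1 : nr xi = 1.
Definition vector_state : A -> R[i]^o := fun a => ip xi (rho a xi).

Lemma unit_nonzero : xi <> 0.
Proof. by move=> x0; move: xi1; rewrite x0 nr0 => /esym/eqP; rewrite oner_eq0. Qed.

Lemma vector_form a b : vector_state (cmul (cstar a) b) = ip (rho a xi) (rho b xi).
Proof. by rewrite /vector_state repM rep_adj. Qed.

Lemma vector_positive : positive_functional vector_state.
Proof.
split=> [k a b|a]; last by rewrite vector_form; exact: si_ge0 (ip_si H) _.
by rewrite /vector_state rep_linl (siDr (ip_si H)) (siZr (ip_si H)).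
Qed.

Lemma vector_gns : gns_rep vector_state rho.
Proof. by exists xi; split=> //; apply: irreducible_cyclic; exact: unit_nonzero. Qed.

Lemma vector_state_state : state vector_state.
Proof.
split; first exact: vector_positive.
- move=> a; rewrite cnE nrE lecR; apply: le_trans (ip_cs _ _) _.
  by rewrite xi1 mul1r; have := rep_contraction a xi; rewrite xi1 mulr1.
move=> M hM.
have cyc := irreducible_cyclic unit_nonzero.
have key (e : R) : 0 < e -> exists v, nr v <= 1 /\ nr (xi - rho v xi) <= e.
  move=> e0; have [a ha] := cyclic_dense cyc xi (e := e / 3) ltac:(lra).
  have [v [_ v1 hv]] := approx_left a (e := e / 3) ltac:(lra).
  exists v; split=> //.
  have -> : xi - rho v xi = (xi - rho a xi) + (rho (a - cmul v a) xi - rho v (xi - rho a xi)).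
    by rewrite !repE; lmod.
  have := nrD (xi - rho a xi) (rho (a - cmul v a) xi - rho v (xi - rho a xi)).
  have := nrD (rho (a - cmul v a) xi) (- rho v (xi - rho a xi)); rewrite nrN.
  have := rep_contraction (a - cmul v a) xi; rewrite xi1.
  have := rep_contraction v (xi - rho a xi).
  by have := nr_ge0 (xi - rho a xi); nra.
have low v (e : R) : nr (xi - rho v xi) <= e -> 1 - e <= cn (vector_state v).
  move=> h; have : ip xi xi = vector_state v + ip xi (xi - rho v xi).
    by rewrite /vector_state -(siDr (ip_si H)) addrC subrK.
  rewrite ip_norm xi1 expr1n => /(congr1 (@cn R)); rewrite cnR normr1 => E.
  have := cnD (vector_state v) (ip xi (xi - rho v xi)); rewrite -E.
  by have := ip_cs xi (xi - rho v xi); rewrite xi1; lra.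
have [v [v1 hv]] := key (2^-1) ltac:(lra).
have v0 : 0 < nr v.
  rewrite lt_def nr_ge0 andbT; apply/eqP => /nr_eq0 v0; move: hv.
  by rewrite v0 repE subr0 xi1; lra.
have M0 : 0 <= M.
  have := hM v; rewrite cnE nrE => h; have : 0 <= M * (nr v)%:C.
    by apply: le_trans h; rewrite ler0c cn_ge0.
  by rewrite pmulr_lge0// ltcR.
rewrite [M]ge0C// -(rmorph1 (real_complex R)) lecR; apply/ler_addgt0Pr => e e0.
have [w [w1 hw]] := key e e0; have := low w e hw; have := hM w.
rewrite cnE nrE [M]ge0C// -rmorphM lecR.
have : 0 <= Re M by move: M0; rewrite lecE => /andP[].
by have := nr_ge0 w; nra.
Qed.

(** A positive functional below the vector state has the form $g(a^*b)=\langle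
    T\varrho(a)\xi|\varrho(b)\xi\rangle$ with [T] in the commutant, and Schur's lemma makes [T] a
    scalar. *)
Lemma vector_state_pure : pure_states vector_state.
Proof.
split; first exact: vector_state_state.
move=> g gpos fgpos; have cyc := irreducible_cyclic unit_nonzero.
have gle a : 0 <= g (cmul (cstar a) a) /\
    Re (g (cmul (cstar a) a)) <= nr (rho a xi) ^+ 2.
  split; first by case: gpos.
  case: fgpos => _ /(_ a); rewrite vector_form ip_norm lecE => /andP[_].
  by case: (g _) => u v /=; lra.
have gsi := fform_si gpos.
have gb a b : cn (g (cmul (cstar a) b)) <= nr (rho a xi) * nr (rho b xi).
  apply: le_sqr_le; first by rewrite mulr_ge0 ?nr_ge0.
  apply: le_trans (cauchy_schwarz gsi a b) _; rewrite exprMn.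
  by apply: ler_pM; rewrite ?(sq_ge0 gsi)//; [case: (gle a)|case: (gle b)].
have exw a : {w : H | (forall b, g (cmul (cstar a) b) = ip w (rho b xi)) /\
    nr w <= 1 * nr (rho a xi)}.
  apply: cid; have [|||||w [h hC _]] := @riesz R H A setT (fun b => rho b xi)
      (fun b => g (cmul (cstar a) b)) (1 * nr (rho a xi)) I.
  - by [].
  - by move=> k b c _ _; exact: rep_linl.
  - by move=> k b c _ _; rewrite !cmulE (flin gpos).
  - by rewrite mul1r nr_ge0.
  - by move=> b _; rewrite mul1r.
  by exists w; split=> // b; exact: h.
pose w a := sval (exw a).
have wE a b : g (cmul (cstar a) b) = ip (w a) (rho b xi).
  by rewrite /w; case: (exw a) => ? [].
have wle a : nr (w a) <= 1 * nr (rho a xi) by rewrite /w; case: (exw a) => ? [].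
have wlin k a b : w (k *: a + b) = k *: w a + w b.
  apply: (cyclic_ext cyc) => c.
  by rewrite -wE !cstarE !cmulE (flin gpos) (siDl (ip_si H)) (siZl (ip_si H)) -!wE.
have [|||||T [Tlin Tw Tle]] := @exists_adjoint R A H H (fun a => rho a xi) w 1.
- by move=> k x y; exact: rep_linl.
- exact: cyclic_dense cyc.
- exact: wlin.
- by [].
- exact: wle.
have Tr a h : T (rho a h) = rho a (T h).
  apply: (cyclic_ext cyc) => b.
  rewrite Tw !rep_adj -repM Tw; congr ip; apply: (cyclic_ext cyc) => c.
  by rewrite rep_adj cstarK -repM -!wE !cstarE !cmulE.
have Tx a : T (rho a xi) = w a.
  apply: (cyclic_ext cyc) => b.
  by rewrite Tw -wE ip_herm -wE -(si_herm gsi).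
have Tsa x y : ip (T x) y = ip x (T y).
  suff h a : ip (T x) (rho a xi) = ip x (T (rho a xi)).
    have [S [Slin Sx _]] : exists S : H -> H, [/\ forall k x y, S (k *: x + y) = k *: S x + S y,
       forall k x, ip (S k) x = ip k (T x) & forall k, nr (S k) <= 1 * nr k].
      have [|||||S [S1 S2 S3]] := @exists_adjoint R H H H id T 1.
      + by [].
      + by move=> z e e0; exists z; rewrite subrr nr0.
      + exact: Tlin.
      + by [].
      + exact: Tle.
      by exists S.
    by rewrite -Sx; congr ip; apply: (cyclic_ext cyc) => a; rewrite h Sx.
  by rewrite Tw Tx.
have [|l Tl] := schur Tlin Tsa _ Tr; first by move=> x; rewrite -[nr x]mul1r.
have gprod a b : g (cmul (cstar a) b) = l%:C * vector_state (cmul (cstar a) b).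
  by rewrite wE -Tx Tl (siZl (ip_si H)) cjR vector_form.
have vp := vector_positive.
(* So far the two functionals agree only on products. Self-adjoint elements are differences of
   squares, and a general element is $x+iy$ with self-adjoint parts. *)
have gf a : g a = l%:C * vector_state a.
  have sa h : self_adjoint h -> g h = l%:C * vector_state h.
    move=> sh; have [r [s [sr ss -> _]]] := sa_jordan sh.
    rewrite (fD gpos) (fN gpos) (fD vp) (fN vp) mulrBr.
    by rewrite -{1}sr -{1}ss !gprod sr ss.
  pose x := (2^-1 : R)%:C *: (a + cstar a).
  pose y := (2^-1 : R)%:C *: (- 'i *: (a - cstar a)).
  have aE : a = x + 'i *: y.
    rewrite /x /y !scalerA (_ : 'i * (2^-1)%:C * - 'i = (2^-1)%:C); first by lmod; field.
    by rewrite mulrAC mulrN mulii opprK mul1r.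
  have sy : self_adjoint y.
    by rewrite /self_adjoint /y !cstarE cjR rmorphN /= cji opprK; lmod.
  have sx : self_adjoint x by rewrite /self_adjoint /x !cstarE cjR addrC.
  by clearbody x y; rewrite aE (fD gpos) (fZ gpos) (fD vp) (fZ vp) (sa x)// (sa y)//; ring.
exists l%:C; split=> //.
have [a ha] : exists a, rho a xi <> 0.
  apply: contrapT => h; have := cyclic_dense cyc xi (e := 1) ltac:(lra).
  move=> [a]; rewrite (_ : rho a xi = 0) ?subr0 ?xi1 ?ltxx//.
  by apply: contrapT => ha; apply: h; exists a.
have n0 : 0 < nr (rho a xi) ^+ 2.
  by rewrite exprn_gt0// lt_def nr_ge0 andbT; apply/eqP => /nr_eq0.
have [h1 h2] := gle a.
rewrite gf vector_form ip_norm -rmorphM ler0c pmulr_lge0// in h1.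
rewrite gf vector_form ip_norm -rmorphM /= ger_pMl// in h2.
by rewrite ler0c h1 /= -(rmorph1 (real_complex R)) lecR.
Qed.
End Schur.

(** * Convolution of sections supported on bisections *)

Section Groupoid.
Variable G : etale_groupoid.
Implicit Types (g h k l : G).

Lemma gsrc_one x : gsrc (gone x : G) = x. Proof. by case: G x. Qed.
Lemma grng_one x : grng (gone x : G) = x. Proof. by case: G x. Qed.
Lemma gsrc_mul g h : gsrc g = grng h -> gsrc (gmul g h) = gsrc h.
Proof. by case: G g h. Qed.
Lemma grng_mul g h : gsrc g = grng h -> grng (gmul g h) = grng g.
Proof. by case: G g h. Qed.
Lemma gmulA g h k : gsrc g = grng h -> gsrc h = grng k ->
  gmul g (gmul h k) = gmul (gmul g h) k.
Proof. by case: G g h k. Qed.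
Lemma gone_mul g : gmul (gone (grng g)) g = g. Proof. by case: G g. Qed.
Lemma gmul_one g : gmul g (gone (gsrc g)) = g. Proof. by case: G g. Qed.
Lemma gsrc_inv g : gsrc (ginv g) = grng g. Proof. by case: G g. Qed.
Lemma grng_inv g : grng (ginv g) = gsrc g. Proof. by case: G g. Qed.
Lemma ginv_mul g : gmul (ginv g) g = gone (gsrc g). Proof. by case: G g. Qed.
Lemma gmul_inv g : gmul g (ginv g) = gone (grng g). Proof. by case: G g. Qed.
Lemma gone_continuous : continuous (@gone G). Proof. by case: G. Qed.
Lemma ginv_continuous : continuous (@ginv G). Proof. by case: G. Qed.
Lemma gmul_continuous :
  {within [set p : G * G | gsrc p.1 = grng p.2], continuous (fun p : G * G => gmul p.1 p.2)}.
Proof. by case: G. Qed.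
Lemma gsrc_local : local_homeomorphism (@gsrc G). Proof. by case: G. Qed.
Lemma grng_local : local_homeomorphism (@grng G). Proof. by case: G. Qed.

Lemma gmulKV g h : gsrc g = grng h -> gmul (ginv g) (gmul g h) = h.
Proof.
by move=> gh; rewrite gmulA ?gsrc_inv// ginv_mul gh gone_mul.
Qed.
Lemma gmulVK g h : grng g = grng h -> gmul g (gmul (ginv g) h) = h.
Proof.
by move=> gh; rewrite gmulA ?gsrc_inv ?grng_inv// gmul_inv gh gone_mul.
Qed.
Lemma gmul_invK g h : gsrc g = grng h -> gmul (gmul g h) (ginv h) = g.
Proof.
by move=> gh; rewrite -gmulA ?grng_inv// gmul_inv -gh gmul_one.
Qed.
Lemma gmulV_K g h : gsrc g = gsrc h -> gmul (gmul g (ginv h)) h = g.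
Proof.
by move=> gh; rewrite -gmulA ?grng_inv ?gsrc_inv// ginv_mul -gh gmul_one.
Qed.
Lemma ginvK g : ginv (ginv g) = g.
Proof.
by rewrite -[LHS]gmul_one gsrc_inv grng_inv -ginv_mul gmulKV// gsrc_inv.
Qed.
Lemma ginvM g h : gsrc g = grng h -> ginv (gmul g h) = gmul (ginv h) (ginv g).
Proof.
move=> gh.
have c1 : gsrc (ginv h) = grng (ginv g) by rewrite gsrc_inv grng_inv.
have c2 : gsrc (gmul g h) = grng (ginv h) by rewrite gsrc_mul// grng_inv.
have pq : gmul (gmul g h) (gmul (ginv h) (ginv g)) = gone (grng g).
  by rewrite gmulA// gmul_invK// gmul_inv.
rewrite -[LHS]gmul_one gsrc_inv grng_mul// -pq gmulKV//.
by rewrite grng_mul.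
Qed.
End Groupoid.

Lemma total_ptK (R : realType) (T : topologicalType) (b : usc_bundle R T) :
  cancel (@total_pt R T b) (@total_val R T b).
Proof. by case: b. Qed.
Lemma total_valK (R : realType) (T : topologicalType) (b : usc_bundle R T) :
  cancel (@total_val R T b) (@total_pt R T b).
Proof. by case: b. Qed.

(** * Fibres of a Fell bundle *)

Section Fibres.
Variables (R : realType) (G : etale_groupoid) (F : fell_bundle R G).
Implicit Types (g h k l : G).

Lemma pt_total g h (a : fib F g) (b : fib F h) :
  pt a = pt b -> existT (fun g => fib F g : Type) g a = existT _ h b.
Proof. exact: (can_inj (@total_ptK _ _ F)). Qed.

Lemma pt_idx g h (a : fib F g) (b : fib F h) : pt a = pt b -> g = h.
Proof. by move/pt_total/(congr1 (@projT1 _ _)). Qed.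

Lemma pt_inj g (a b : fib F g) : pt a = pt b -> a = b.
Proof.
move/pt_total => e.
have [p] : {p : g = g | eq_rect g (fun g => fib F g : Type) a g p = b}.
  by exists (projT1_eq e); exact: (projT2_eq e).
by rewrite (Prop_irrelevance p erefl).
Qed.

Lemma pt_nr g h (a : fib F g) (b : fib F h) : pt a = pt b -> nr a = nr b.
Proof.
move/pt_total/(congr1 (fun e : {g : G & fib F g} => nr (projT2 e : fib F (projT1 e)))).
by [].
Qed.

Lemma pt_cast g h (a : fib F g) : g = h -> pt (fibre_cast h a) = pt a.
Proof.
move=> e; subst h; rewrite /fibre_cast; case: pselect => // e.
by rewrite (Prop_irrelevance e erefl).
Qed.

Lemma fibre_cast0 g h : fibre_cast h (0 : fib F g) = 0.
Proof.
by rewrite /fibre_cast; case: pselect => // e; subst h.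
Qed.

Lemma pt0_eq0 g h (a : fib F g) : pt a = pt (0 : fib F h) -> a = 0.
Proof. by move/pt_nr; rewrite nr0 => /nr_eq0. Qed.

Lemma pt_mul g h g' h' (a : fib F g) (b : fib F h) (a' : fib F g') (b' : fib F h') :
  pt a = pt a' -> pt b = pt b' -> pt (fmul a b) = pt (fmul a' b').
Proof.
move=> ea eb; have eg := pt_idx ea; have eh := pt_idx eb; subst g' h'.
by rewrite (pt_inj ea) (pt_inj eb).
Qed.

Lemma pt_star g g' (a : fib F g) (a' : fib F g') :
  pt a = pt a' -> pt (fstar a) = pt (fstar a').
Proof. by move=> ea; have eg := pt_idx ea; subst g'; rewrite (pt_inj ea). Qed.

Lemma pt_lin g g' c (a b : fib F g) (a' b' : fib F g') :
  pt a = pt a' -> pt b = pt b' -> pt (c *: a + b) = pt (c *: a' + b').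
Proof.
move=> ea eb; have eg := pt_idx ea; subst g'.
by rewrite (pt_inj ea) (pt_inj eb).
Qed.

Lemma fmul_linl g h c (a b : fib F g) (d : fib F h) : gsrc g = grng h ->
  fmul (c *: a + b) d = c *: fmul a d + fmul b d.
Proof. by case: F a b d => ? ? ? hL * /=; apply: (hL). Qed.
Lemma fmul_linr g h c (a : fib F g) (b d : fib F h) : gsrc g = grng h ->
  fmul a (c *: b + d) = c *: fmul a b + fmul a d.
Proof. by case: F a b d => ? ? ? ? hL * /=; apply: (hL). Qed.
Lemma fmulA g h l (a : fib F g) (b : fib F h) (d : fib F l) :
  gsrc g = grng h -> gsrc h = grng l ->
  pt (fmul a (fmul b d)) = pt (fmul (fmul a b) d).
Proof. by case: F a b d => ? ? ? ? ? hA * /=; apply: (hA). Qed.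
Lemma fstar_lin g c (a b : fib F g) : fstar (c *: a + b) = cj c *: fstar a + fstar b.
Proof. by case: F a b => ? ? ? ? ? ? hL * /=; apply: (hL). Qed.
Lemma fstarK g (a : fib F g) : pt (fstar (fstar a)) = pt a.
Proof. by case: F a => ? ? ? ? ? ? ? hL * /=; apply: (hL). Qed.
Lemma fstarM g h (a : fib F g) (b : fib F h) : gsrc g = grng h ->
  pt (fstar (fmul a b)) = pt (fmul (fstar b) (fstar a)).
Proof. by case: F a b => ? ? ? ? ? ? ? ? hM * /=; apply: (hM). Qed.
Lemma fnormM g h (a : fib F g) (b : fib F h) : gsrc g = grng h ->
  nr (fmul a b) <= nr a * nr b.
Proof.
move=> gh; have e : `|fmul a b| <= `|a| * `|b|.
  by case: F a b => ? ? ? ? ? ? ? ? ? hL * /=; apply: (hL).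
by move: e; rewrite !nrE -rmorphM lecR.
Qed.
Lemma fnorm_sq g (a : fib F g) : nr (fmul (fstar a) a) = nr a ^+ 2.
Proof.
have e : `|fmul (fstar a) a| = `|a| ^+ 2.
  by case: F a => ? ? ? ? ? ? ? ? ? ? hL * /=; apply: (hL).
by apply: complexI; rewrite -nrE e nrE rmorphXn.
Qed.

Lemma fmul0l g h (b : fib F h) : gsrc g = grng h -> fmul (0 : fib F g) b = 0.
Proof.
by move=> gh; have := fmul_linl (-1) 0 0 b gh; rewrite scaler0 addr0 scaleN1r addNr.
Qed.
Lemma fmul0r g h (a : fib F g) : gsrc g = grng h -> fmul a (0 : fib F h) = 0.
Proof.
by move=> gh; have := fmul_linr (-1) a 0 0 gh; rewrite scaler0 addr0 scaleN1r addNr.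
Qed.
Lemma fstar0 g : fstar (0 : fib F g) = 0.
Proof.
have := fstar_lin (-1) (0 : fib F g) 0.
by rewrite scaler0 addr0 rmorphN rmorph1 scaleN1r addNr.
Qed.

Lemma nr_fstar g (a : fib F g) : nr (fstar a) = nr a.
Proof.
have h g' (b : fib F g') : nr b <= nr (fstar b).
  have := fnormM (fstar b) b; rewrite fnorm_sq gsrc_inv => /(_ erefl).
  have := nr_ge0 b; rewrite le_eqVlt => /orP[/eqP <- _|b0]; first exact: nr_ge0.
  by rewrite expr2 ler_pM2r.
by apply/le_anti; rewrite h andbT -(pt_nr (fstarK a)) h.
Qed.

Lemma fnorm_sq' g (a : fib F g) : nr (fmul a (fstar a)) = nr a ^+ 2.
Proof.
rewrite -nr_fstar -(nr_fstar a) -fnorm_sq; apply: pt_nr.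
by rewrite -(fstarM _ _ (esym (grng_inv _))).

Qed.
End Fibres.

Section Convolution.
Variables (R : realType) (G : etale_groupoid) (F : fell_bundle R G).
Implicit Types (x y z : section F) (g h k : G) (U V W : set G).

Definition supp U x : Prop := forall g, ~ U g -> x g = 0.

Lemma section_ext x y : (forall g, pt (x g) = pt (y g)) -> x = y.
Proof. by move=> h; apply: functional_extensionality_dep => g; exact: pt_inj. Qed.

Lemma sec_pt x g h : g = h -> pt (x g) = pt (x h).
Proof. by move=> ->. Qed.

Lemma conv_single x y g h : grng h = grng g ->
  (forall h', grng h' = grng g -> h' <> h -> fmul (x h') (y (gmul (ginv h') g)) = 0) ->
  pt (conv x y g) = pt (fmul (x h) (y (gmul (ginv h) g))).
Proof.
move=> hg z; rewrite /conv -(@fsbig_widen _ _ _ _ [set h]).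
- by rewrite fsbig_set1 pt_cast// gmulVK.
- by move=> _ ->.
- by move=> h' [/= hr hn]; rewrite z ?fibre_cast0.
Qed.

Lemma conv_eq0 x y g :
  (forall h', grng h' = grng g -> fmul (x h') (y (gmul (ginv h') g)) = 0) ->
  conv x y g = 0.
Proof. by move=> z; rewrite /conv fsbig1// => h hg; rewrite z ?fibre_cast0. Qed.

Lemma inv_comp g h : grng h = grng g -> gsrc h = grng (gmul (ginv h) g).
Proof. by move=> hg; rewrite grng_mul ?grng_inv ?gsrc_inv. Qed.

Lemma conv_left U x y g h : set_inj U (@grng G) -> supp U x -> U h ->
  grng h = grng g -> pt (conv x y g) = pt (fmul (x h) (y (gmul (ginv h) g))).
Proof.
move=> iU sx Uh hg; apply: conv_single => // h' hg' nh.
rewrite sx ?fmul0l//; first exact: inv_comp.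
by move=> Uh'; apply: nh; apply: iU; rewrite ?inE// hg' hg.
Qed.

Lemma conv_left0 U x y g : supp U x -> (forall h, U h -> grng h <> grng g) ->
  conv x y g = 0.
Proof.
move=> sx nU; apply: conv_eq0 => h hg; rewrite sx ?fmul0l//; first exact: inv_comp.
by move=> Uh; apply: nU hg.
Qed.

Lemma conv_right V x y g k : set_inj V (@gsrc G) -> supp V y -> V k ->
  gsrc k = gsrc g -> pt (conv x y g) = pt (fmul (x (gmul g (ginv k))) (y k)).
Proof.
move=> iV sy Vk kg.
have c : gsrc g = grng (ginv k) by rewrite grng_inv.
have e : gmul (ginv (gmul g (ginv k))) g = k.
  by rewrite ginvM// ginvK gmulV_K// kg gsrc_inv.
rewrite (@conv_single x y g (gmul g (ginv k))).
- by apply: pt_mul => //; apply: sec_pt.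
- by rewrite grng_mul.
- move=> h' hg' nh; rewrite sy ?fmul0r//; first exact: inv_comp.
  move=> Vh; apply: nh.
  have kh : gmul (ginv h') g = k.
    by apply: iV; rewrite ?inE// gsrc_mul ?gsrc_inv.
  by rewrite -kh ginvM ?gsrc_inv// ginvK gmulVK.
Qed.

Lemma conv_right0 V x y g : supp V y -> (forall k, V k -> gsrc k <> gsrc g) ->
  conv x y g = 0.
Proof.
move=> sy nV; apply: conv_eq0 => h hg; rewrite sy ?fmul0r//; first exact: inv_comp.
by move=> Vh; apply: (nV _ Vh); rewrite gsrc_mul ?gsrc_inv.
Qed.

(** At [g] both sides reduce to the single term $x(h)\,y(h^{-1}gk^{-1})\,z(k)$, where $h\in U$ has
    the range and $k\in W$ the source of [g]. Thus only the outer factors carry support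
    conditions. *)
Lemma conv_assoc U W x y z : set_inj U (@grng G) -> set_inj W (@gsrc G) ->
  supp U x -> supp W z -> conv (conv x y) z = conv x (conv y z).
Proof.
move=> iU iW sx sz; apply: section_ext => g.
have [[h [Uh hg]]|nU] := pselect (exists h, U h /\ grng h = grng g); last first.
  rewrite [conv x _ g](conv_left0 _ sx); last by move=> h Uh hg; apply: nU; exists h.
  congr pt; apply: conv_eq0 => h hg.
  rewrite (conv_left0 _ sx) ?fmul0l//; first exact: inv_comp.
  by move=> k Uk kh; apply: nU; exists k; rewrite kh.
have [[k [Wk kg]]|nW] := pselect (exists k, W k /\ gsrc k = gsrc g); last first.
  rewrite [conv _ z g](conv_right0 _ sz); last by move=> k Wk kg; apply: nW; exists k.
  congr pt; apply/esym; apply: conv_eq0 => h' hg'.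
  rewrite (conv_right0 _ sz) ?fmul0r//; first exact: inv_comp.
  by move=> k Wk kg; apply: nW; exists k; rewrite kg gsrc_mul ?gsrc_inv.
have c1 : gsrc g = grng (ginv k) by rewrite grng_inv.
have c2 : gsrc (ginv h) = grng g by rewrite gsrc_inv.
rewrite (conv_right _ iW sz Wk kg) (conv_left _ iU sx Uh hg).
have e1 : pt (conv x y (gmul g (ginv k))) =
    pt (fmul (x h) (y (gmul (ginv h) (gmul g (ginv k))))).
  by apply: conv_left Uh _ => //; rewrite grng_mul.
have e2 : pt (conv y z (gmul (ginv h) g)) =
    pt (fmul (y (gmul (gmul (ginv h) g) (ginv k))) (z k)).
  by apply: conv_right Wk _ => //; rewrite gsrc_mul.
rewrite (pt_mul e1 (erefl (pt (z k)))) (pt_mul (erefl (pt (x h))) e2).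
rewrite -fmulA.
- by apply: pt_mul => //; apply: pt_mul => //; apply: sec_pt; rewrite gmulA.
- by rewrite grng_mul ?grng_inv// gsrc_inv grng_mul.
- by rewrite gsrc_mul ?gsrc_mul ?gsrc_inv ?grng_mul.
Qed.

Lemma sec_starE x g : pt (sec_star x g) = pt (fstar (x (ginv g))).
Proof. by rewrite /sec_star pt_cast ?ginvK. Qed.

Lemma sec_starK x : sec_star (sec_star x) = x.
Proof.
apply: section_ext => g; rewrite sec_starE (pt_star (sec_starE x (ginv g))) fstarK.
by apply: sec_pt; rewrite ginvK.
Qed.

Definition invset U : set G := [set g | U (ginv g)].

Lemma supp_star U x : supp U x -> supp (invset U) (sec_star x).
Proof.
by move=> sx g Ug; apply: (@pt0_eq0 _ _ _ _ (ginv (ginv g))); rewrite sec_starE sx// fstar0.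
Qed.
End Convolution.

Section ConvAlgebra.
Variables (R : realType) (G : etale_groupoid) (F : fell_bundle R G).
Implicit Types (x y z : section F) (g h k : G) (U V W : set G).

Definition setmul U V : set G :=
  [set g | exists h k, [/\ U h, V k, gsrc h = grng k & g = gmul h k]].

(** The algebraic half of the notion of a bisection; openness is carried separately, for questions
    of continuity. *)
Definition bis U : Prop := set_inj U (@gsrc G) /\ set_inj U (@grng G).

Lemma bis_inv U : bis U -> bis (invset U).
Proof.
move=> [i1 i2]; split=> g h; rewrite !inE => Ug Uh e.
  by rewrite -(ginvK g) -(ginvK h); congr ginv; apply: i2; rewrite ?inE// !grng_inv.
by rewrite -(ginvK g) -(ginvK h); congr ginv; apply: i1; rewrite ?inE// !gsrc_inv.
Qed.

Lemma conv_star U x y : set_inj U (@grng G) -> supp U x ->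
  sec_star (conv x y) = conv (sec_star y) (sec_star x).
Proof.
move=> iU sx; apply: section_ext => g; rewrite sec_starE.
have sx' := supp_star sx.
have [[h [Uh hg]]|nU] := pselect (exists h, U h /\ grng h = gsrc g); last first.
  rewrite [conv x y _](conv_left0 _ sx); last first.
    by move=> h Uh; rewrite grng_inv => hg; apply: nU; exists h.
  rewrite [conv _ _ g](conv_right0 _ sx'); last first.
    move=> k Uk kg; apply: nU; exists (ginv k); split=> //.
    by rewrite grng_inv.
  by rewrite fstar0 ginvK.
have hg' : grng h = grng (ginv g) by rewrite grng_inv.
rewrite (pt_star (conv_left _ iU sx Uh hg')) fstarM; last exact: inv_comp.
have Vk : invset U (ginv h) by rewrite /invset /= ginvK.
have iV : set_inj (invset U) (@gsrc G).
  move=> a b; rewrite !inE => Ua Ub e; rewrite -(ginvK a) -(ginvK b); congr ginv.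
  by apply: iU; rewrite ?inE// !grng_inv.
rewrite (conv_right _ iV sx' Vk); last by rewrite gsrc_inv.
apply: pt_mul.
  rewrite sec_starE; apply: pt_star; apply: sec_pt.
  by rewrite ginvK ginvM ?hg.
by rewrite sec_starE; apply: pt_star; apply: sec_pt; rewrite ginvK.
Qed.

Lemma supp_lin U c x y : supp U x -> supp U y -> supp U (sec_lin c x y).
Proof. by move=> sx sy g Ug; rewrite /sec_lin sx// sy// scaler0 addr0. Qed.

Lemma supp_sub U V x : U `<=` V -> supp U x -> supp V x.
Proof. by move=> UV sx g Vg; apply: sx => /UV. Qed.

Lemma supp_conv U V x y : set_inj U (@grng G) -> supp U x -> supp V y ->
  supp (setmul U V) (conv x y).
Proof.
move=> iU sx sy g ng.
apply: conv_eq0 => h hg.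
have [Uh|nU] := pselect (U h); last by rewrite sx ?fmul0l//; exact: inv_comp.
have [Vk|nV] := pselect (V (gmul (ginv h) g)); last first.
  by rewrite sy ?fmul0r//; exact: inv_comp.
by exfalso; apply: ng; exists h, (gmul (ginv h) g); split=> //; [exact: inv_comp|rewrite gmulVK].
Qed.

Lemma conv_linl U c x x' y : set_inj U (@grng G) -> supp U x -> supp U x' ->
  conv (sec_lin c x x') y = sec_lin c (conv x y) (conv x' y).
Proof.
move=> iU sx sx'; apply: section_ext => g; rewrite /sec_lin.
have [[h [Uh hg]]|nU] := pselect (exists h, U h /\ grng h = grng g); last first.
  rewrite !(@conv_left0 _ _ _ U) ?scaler0 ?addr0//;
    try by move=> h Uh hg; apply: nU; exists h.
  exact: supp_lin.
rewrite (conv_left _ iU _ Uh hg); last exact: supp_lin.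
have := pt_lin c (conv_left y iU sx Uh hg) (conv_left y iU sx' Uh hg) => ->.
by rewrite /sec_lin fmul_linl//; exact: inv_comp.
Qed.

Lemma conv_linr U c x y y' : set_inj U (@grng G) -> supp U x ->
  conv x (sec_lin c y y') = sec_lin c (conv x y) (conv x y').
Proof.
move=> iU sx; apply: section_ext => g; rewrite /sec_lin.
have [[h [Uh hg]]|nU] := pselect (exists h, U h /\ grng h = grng g); last first.
  by rewrite !(@conv_left0 _ _ _ U) ?scaler0 ?addr0//;
    move=> h Uh hg; apply: nU; exists h.
rewrite (conv_left _ iU _ Uh hg)//.
have := pt_lin c (conv_left y iU sx Uh hg) (conv_left y' iU sx Uh hg) => ->.
by rewrite /sec_lin fmul_linr//; exact: inv_comp.
Qed.

Lemma sec_star_lin c x y :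
  sec_star (sec_lin c x y) = sec_lin (cj c) (sec_star x) (sec_star y).
Proof.
apply: section_ext => g; rewrite sec_starE /sec_lin fstar_lin.
by apply: pt_lin; rewrite sec_starE.
Qed.

Lemma nr_sec_star x g : nr (sec_star x g) = nr (x (ginv g)).
Proof. by rewrite (pt_nr (sec_starE x g)) nr_fstar. Qed.

Lemma nr_conv_diag U x g : set_inj U (@grng G) -> supp U x -> U g ->
  nr (conv x (sec_star x) (gone (grng g))) = nr (x g) ^+ 2.
Proof.
move=> iU sx Ug; rewrite -fnorm_sq'; apply: pt_nr.
rewrite (conv_left _ iU sx Ug) ?grng_one//; apply: pt_mul => //.
rewrite sec_starE; apply: pt_star; apply: sec_pt.
by rewrite -(gsrc_inv g) gmul_one ginvK.
Qed.

Definition units : set G := range (@gone G).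

Lemma bis_units : bis units.
Proof.
by split=> g h; rewrite !inE => -[a _ <-] [b _ <-]; rewrite ?gsrc_one ?grng_one => ->.
Qed.
End ConvAlgebra.

(** * Continuous sections *)

Section LocalHomeo.
Variables (S T : topologicalType) (f : S -> T).
Hypothesis fl : local_homeomorphism f.

Lemma local_homeo_open (U : set S) h0 : nbhs h0 U -> nbhs (f h0) (f @` U).
Proof.
rewrite nbhsE => -[U' [oU' Uh] UU].
have [V [oV Vh iV cV op]] := fl h0.
rewrite nbhsE; exists (f @` (U' `&` V)).
  split; last by exists h0.
  by apply: op => [|s []//]; exact: openI.
by move=> _ [s [/UU Us _] <-]; exists s.
Qed.

Lemma local_homeo_continuous : continuous f.
Proof.
move=> s; have [V [oV Vs iV cV op]] := fl s.
move: cV; rewrite continuous_open_subspace// => /(_ s); apply.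
by rewrite inE.
Qed.
End LocalHomeo.

Lemma continuous_within_comp (T X Y : topologicalType) (S : set X) (f : X -> Y)
    (p : T -> X) (x0 : T) : {within S, continuous f} ->
  p x @[x --> x0] --> p x0 -> (\forall x \near x0, S (p x)) ->
  f (p x) @[x --> x0] --> f (p x0).
Proof.
move=> /subspace_continuousP fc pc Sp W Wf.
have h := fc _ (nbhs_singleton Sp) W Wf.
have := pc _ h; rewrite /= !nbhs_simpl /= => h2.
by apply: filterS2 Sp h2 => x Sx; apply.
Qed.

Section Bundle.
Variables (R : realType) (T : topologicalType) (b : usc_bundle R T).

Lemma bundle_add : {within [set p : total b * total b | pr p.1 = pr p.2],
  continuous (fun p : total b * total b => pt (el p.1 + fibre_cast (pr p.1) (el p.2)))}.
Proof. by case: b => ? ? ? ? ? ? ? h1 h2 h3 h4 h5 h6 h7 h8; exact: h6. Qed.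
Lemma bundle_scale : continuous (fun p : R[i]^o * total b => pt (p.1 *: el p.2)).
Proof. by case: b => ? ? ? ? ? ? ? h1 h2 h3 h4 h5 h6 h7 h8; exact: h7. Qed.
Lemma bundle_usc (eps : R[i]) : 0 < eps -> open [set w : total b | `|el w| < eps].
Proof. by case: b => ? ? ? ? ? ? ? h1 h2 h3 h4 h5 h6 h7 h8; exact: h5. Qed.
Lemma bundle_zero (g : T) (W : set (total b)) : open W -> W (pt (0 : fib b g)) ->
  exists (V : set T) (eps : R[i]), [/\ open V, V g, 0 < eps &
    [set e | V (pr e) /\ `|el e| < eps] `<=` W].
Proof. by case: b g W => ? ? ? ? ? ? ? h1 h2 h3 h4 h5 h6 h7 h8 g W; exact: h8. Qed.
End Bundle.

Section Topology.
Variables (R : realType) (G : etale_groupoid) (F : fell_bundle R G).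
Hypothesis X_hausdorff : hausdorff_space (gunits G).
Implicit Types (x y z : section F) (g h k : G) (U V W : set G).

Lemma gsrc_continuous : continuous (@gsrc G).
Proof. exact: local_homeo_continuous (@gsrc_local G). Qed.
Lemma grng_continuous : continuous (@grng G).
Proof. exact: local_homeo_continuous (@grng_local G). Qed.

(** An arrow [g] near a unit and the unit at its source lie in a common set on which the source map
    is injective, so they coincide. *)
Lemma open_units : open (units (G := G)).
Proof.
rewrite openE => _ [a _ <-]; rewrite /interior.
have [V [oV Va iV _ _]] := gsrc_local (gone a).
have n1 : \forall g \near gone a, V g by apply: open_nbhs_nbhs.
have n2 : \forall g \near gone a, V (gone (gsrc g)).
  have : \forall b \near gsrc (gone a), V (gone b).
    by rewrite gsrc_one; apply: (gone_continuous (x := a)); exact: open_nbhs_nbhs.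
  exact: (@gsrc_continuous (gone a)).
apply: filterS2 n1 n2 => g Vg Vs; exists (gsrc g) => //.
by apply: iV; rewrite ?inE// gsrc_one.
Qed.

Lemma pt_el (e : total F) : pt (el e) = e.
Proof. by rewrite /pt /el /pr -sigT_eta total_valK. Qed.

Lemma pr_pt g (a : fib F g) : pr (pt a) = g.
Proof. by rewrite /pr /pt total_ptK. Qed.

Lemma el_nr g (a : fib F g) : nr (el (pt a)) = nr a.
Proof. by apply: pt_nr; rewrite pt_el. Qed.

Section Continuity.
Variables (T : topologicalType) (x0 : T).
Implicit Types u v : T -> total F.

Lemma cvg_fmul u v : u t @[t --> x0] --> u x0 -> v t @[t --> x0] --> v x0 ->
  (\forall t \near x0, gsrc (pr (u t)) = grng (pr (v t))) ->
  pt (fmul (el (u t)) (el (v t))) @[t --> x0] --> pt (fmul (el (u x0)) (el (v x0))).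
Proof.
move=> cu cv near_comp.
have hc : {within [set p : total F * total F | gsrc (pr p.1) = grng (pr p.2)],
        continuous (fun p : total F * total F => pt (fmul (el p.1) (el p.2)))}.
  by case: F.
exact: (continuous_within_comp hc (p := fun t => (u t, v t)) (cvg_pair cu cv)).
Qed.

Lemma cvg_fadd u v : u t @[t --> x0] --> u x0 -> v t @[t --> x0] --> v x0 ->
  (\forall t \near x0, pr (u t) = pr (v t)) ->
  pt (el (u t) + fibre_cast (pr (u t)) (el (v t))) @[t --> x0] -->
  pt (el (u x0) + fibre_cast (pr (u x0)) (el (v x0))).
Proof.
move=> cu cv near_comp.
have hc : {within [set p : total F * total F | pr p.1 = pr p.2],
        continuous (fun p : total F * total F =>
          pt (el p.1 + fibre_cast (pr p.1) (el p.2)))}.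
  exact: bundle_add.
exact: (continuous_within_comp hc (p := fun t => (u t, v t)) (cvg_pair cu cv)).
Qed.

Lemma cvg_fscale (c : R[i]) u : u t @[t --> x0] --> u x0 ->
  pt (c *: el (u t)) @[t --> x0] --> pt (c *: el (u x0)).
Proof.
move=> cu.
have hc := @bundle_scale R G F.
exact: (cvg_comp _ _ (cvg_pair (cvg_cst (c : R[i]^o)) cu) (hc (c, u x0))).
Qed.

Lemma cvg_fstar u : u t @[t --> x0] --> u x0 ->
  pt (fstar (el (u t))) @[t --> x0] --> pt (fstar (el (u x0))).
Proof.
move=> cu.
have hc : continuous (fun e : total F => pt (fstar (el e))).
  by case: F u cu => ? ? ? ? ? ? ? ? ? ? ? ? ? h.
exact: (cvg_comp _ _ cu (hc (u x0))).
Qed.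
End Continuity.

Lemma usc_norm (e : R) : 0 < e -> open [set w : total F | nr (el w) < e].
Proof.
move=> e0.
have hc := @bundle_usc R G F.
have := hc e%:C; rewrite ltcR => /(_ e0).
by rewrite (_ : [set w | `|el w| < e%:C] = [set w | nr (el w) < e])//;
  apply/seteqP; split=> w /=; rewrite nrE ltcR.
Qed.

Lemma zero_nbhs g (W : set (total F)) : open W -> W (pt (0 : fib F g)) ->
  exists (V : set G) (e : R), [/\ open V, V g, 0 < e &
    forall g' (a : fib F g'), V g' -> nr a < e -> W (pt a)].
Proof.
move=> oW Wg.
have hc := @bundle_zero R G F.
have [V [eps [oV Vg e0 VW]]] := hc g W oW Wg.
exists V, (Re eps); split=> //; first by move: e0; rewrite ltcE => /andP[].
move=> g' a Vg' ae; apply: VW; split=> /=; first by rewrite pr_pt.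
by rewrite nrE el_nr [eps]ge0C ?(ltW e0)// ltcR.
Qed.

Definition csec x g : Prop := pt (x g') @[g' --> g] --> pt (x g).

Lemma csec_lin c x y g : csec x g -> csec y g -> csec (sec_lin c x y) g.
Proof.
move=> cx cy; rewrite /csec.
have h1 := cvg_fscale (c := c) (u := fun g => pt (x g)) cx.
have h2 := cvg_fadd h1 cy; rewrite /= in h2.
have e g' : pt (el (pt (c *: el (pt (x g')))) +
    fibre_cast (pr (pt (c *: el (pt (x g'))))) (el (pt (y g')))) = pt (sec_lin c x y g').
  have e1 : pt (el (pt (c *: el (pt (x g'))))) = pt (c *: x g').
    rewrite pt_el; have := @pt_lin _ _ F _ _ c _ 0 _ 0 (pt_el (pt (x g'))).
    rewrite !addr0; apply; rewrite pr_pt //.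
  have e2 : pt (fibre_cast (pr (pt (c *: el (pt (x g'))))) (el (pt (y g')))) = pt (y g').
    by rewrite pt_cast ?pt_el// !pr_pt.
  by have := pt_lin 1 e1 e2; rewrite !scale1r.
rewrite -e; under eq_fun do rewrite -e; apply: h2.
by near=> t; rewrite !pr_pt.
Unshelve. all: by end_near. Qed.

Lemma C0P U x : open U -> C0 U x <-> [/\ supp U x, (forall g, U g -> csec x g) &
  forall e : R, 0 < e -> exists K : set G,
    [/\ compact K, K `<=` U & forall g, ~ K g -> nr (x g) < e]].
Proof.
move=> oU; rewrite /C0 /= continuous_open_subspace//; split=> -[h1 h2 h3]; split=> //.
- by move=> g Ug; apply: h2; rewrite inE.
- move=> e e0; have := h3 e%:C; rewrite ltcR => /(_ e0)[K [cK KU hK]].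
  by exists K; split=> // g /hK; rewrite nrE ltcR.
- by move=> g; rewrite inE => /h2.
- move=> eps e0; have [K [cK KU hK]] := h3 (Re eps) (proj2 (andP (etrans (esym (ltcE _ _)) e0))).
  by exists K; split=> // g /hK; rewrite nrE [eps]ge0C ?(ltW e0)// ltcR.
Qed.

Lemma C0_bounded U x : open U -> C0 U x -> exists M : R, forall g, nr (x g) <= M.
Proof.
move=> oU /(C0P _ oU)[sx cx kx]; have [K [cK KU hK]] := kx 1 ltr01.
have /compact_near_coveringP/(_ nat \oo (fun n g => nr (x g) < n%:R)) := cK.
case=> [g Kg|N _ hN].
  have [n hn] : exists n : nat, nr (x g) < n%:R.
    by exists (Num.truncn (nr (x g))).+1; exact: truncnS_gt.
  have n0 : 0 < n%:R :> R by apply: le_lt_trans (nr_ge0 _) hn.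
  have o := usc_norm n0.
  have : \forall g' \near g, nr (x g') < n%:R.
    have nb : nbhs (pt (x g)) [set w : total F | nr (el w) < n%:R].
      by apply: open_nbhs_nbhs; split=> //=; rewrite el_nr.
    have h : \forall g' \near g, nr (el (pt (x g'))) < n%:R := cx g (KU g Kg) _ nb.
    by apply: filterS h => g'; rewrite el_nr.
  move=> h; exists ([set g' | nr (x g') < n%:R], [set m | (n <= m)%N]).
    by split=> //=; exists n.
  by move=> [g' m] /= [h1 h2]; apply: lt_le_trans h1 _; rewrite ler_nat.
exists (N%:R + 1) => g; have [Kg|nK] := pselect (K g).
  by have := hN N (leqnn N) g Kg; have := ler0n R 1; lra.
by have := hK g nK; have := ler0n R N; lra.
Qed.

Lemma C0_lin U c x y : open U -> C0 U x -> C0 U y -> C0 U (sec_lin c x y).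
Proof.
move=> oU /(C0P _ oU)[sx cx kx] /(C0P _ oU)[sy cy ky]; apply/C0P => //; split.
- exact: supp_lin.
- by move=> g Ug; apply: csec_lin; [apply: cx|apply: cy].
move=> e e0; have c0 := cn_ge0 c.
have [K [cK KU hK]] := kx (e / (2 * (cn c + 1))) ltac:(apply: divr_gt0; lra).
have [K' [cK' KU' hK']] := ky (e / 2) ltac:(lra).
exists (K `|` K'); split=> [||g].
- exact: compactU.
- by move=> g [/KU|/KU'].
move=> /not_orP[/hK h1 /hK' h2]; rewrite /sec_lin.
have := nrD (c *: x g) (y g); rewrite nrZ; move: h1; rewrite ltr_pdivlMr; last by lra.
by have := nr_ge0 (x g); nra.
Qed.

Lemma C0_0 U : open U -> C0 U (sec0 F).
Proof.
move=> oU; split=> //; last first.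
  by move=> e e0; exists set0; split=> //; [exact: compact0|move=> g _; rewrite normr0].
rewrite continuous_open_subspace// => g Ug W.
rewrite /sec0 nbhsE => -[W' [oW' W'g] WW].
have [V [e [oV Vg e0 VW]]] := zero_nbhs oW' W'g.
rewrite nbhs_simpl /=; apply: (filterS (P := V)); last exact: open_nbhs_nbhs.
by move=> g' Vg'; apply: WW; apply: VW => //; rewrite nr0.
Qed.

(** Continuity of the addition at a pair $(a,0)$, with the neighbourhood of 0 expressed by the norm.
    This is what lets continuity pass to uniform limits of sections. *)
Lemma add_nbhs g (a : fib F g) (W : set (total F)) : open W -> W (pt a) ->
  exists (P : set (total F)) (V : set G) (e : R), [/\ open P /\ P (pt a), open V, V g,
    0 < e & forall g' (b c : fib F g'), P (pt b) -> V g' -> nr c < e -> W (pt (b + c))].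
Proof.
move=> oW Wa.
pose addp (p : total F * total F) := pt (el p.1 + fibre_cast (pr p.1) (el p.2)).
have addE g' (b c : fib F g') : addp (pt b, pt c) = pt (b + c).
  have e2 : pt (fibre_cast (pr (pt b)) (el (pt c))) = pt c by rewrite pt_cast ?pt_el// !pr_pt.
  by have := pt_lin 1 (pt_el (pt b)) e2; rewrite /addp !scale1r.
pose S := [set p : total F * total F | pr p.1 = pr p.2].
have /subspace_continuousP hc : {within S, continuous addp} := @bundle_add R G F.
have S0 : S (pt a, pt (0 : fib F g)) by rewrite /S /= !pr_pt.
have W0 : nbhs (addp (pt a, pt (0 : fib F g))) W.
  by rewrite addE addr0; exact: open_nbhs_nbhs.
have [[P Q] /= [nP nQ] PQ] := hc _ S0 _ W0.
move: nP nQ; rewrite !nbhsE => -[P' [oP' P'g] PP] [Q' [oQ' Q'g] QQ].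
have [V [e [oV Vg e0 VQ]]] := zero_nbhs oQ' Q'g.
exists P', V, e; split=> // g' b c Pb Vg' ce; rewrite -addE; apply: PQ.
  by split; [apply: PP|apply: QQ; apply: VQ].
by rewrite /S /= !pr_pt.
Qed.

Lemma C0_closed U x : open U ->
  (forall e : R, 0 < e -> exists2 y, C0 U y & forall g, nr (x g - y g) <= e) -> C0 U x.
Proof.
move=> oU h; apply/C0P => //; split.
- move=> g Ug; apply: nr_eq0; apply/eqP; rewrite eq_le nr_ge0 andbT.
  apply/ler_addgt0Pr => e e0; rewrite add0r; have [y [sy _ _] xy] := h e e0.
  by have := xy g; rewrite sy// subr0.
- move=> g Ug W; rewrite nbhsE => -[W' [oW' W'g] WW].
  have [P' [V [e [[oP' P'g] oV Vg e0 key]]]] := add_nbhs oW' W'g.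
  (* The second application, to [P'], ensures that the value at [g] of a close approximant [y] lies
     in [P']. *)
  have [P2 [V' [e' [[_ P2g] _ Vg' e'0 key']]]] := add_nbhs oP' P'g.
  have VQ' (b : fib F g) : nr b < e' -> P' (pt (x g + b)) by move=> be; apply: key'.
  have [y /(C0P _ oU)[sy cy ky] xy] := h (Num.min e e' / 2) ltac:(by rewrite divr_gt0// lt_min e0).
  have m1 : Num.min e e' / 2 < e.
    by have h1 : Num.min e e' <= e; [rewrite ge_min lexx|lra].
  have m2 : Num.min e e' / 2 < e'.
    by have h2 : Num.min e e' <= e'; [rewrite ge_min lexx orbT|lra].
  have Py : P' (pt (y g)).
    have -> : y g = x g + (y g - x g) by rewrite addrC subrK.
    by apply: VQ'; rewrite nrB; apply: le_lt_trans (xy g) m2.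
  have ny := cy g Ug P' (open_nbhs_nbhs (conj oP' Py)).
  rewrite nbhs_simpl /= in ny *; apply: filterS2 ny (open_nbhs_nbhs (conj oV Vg)) => g' P'y Vg2.
  apply: WW; have -> : x g' = y g' + (x g' - y g') by rewrite addrC subrK.
  by apply: key => //; apply: le_lt_trans (xy g') m1.
move=> e e0; have [y /(C0P _ oU)[sy cy ky] xy] := h (e / 2) ltac:(lra).
have [K [cK KU hK]] := ky (e / 2) ltac:(lra).
exists K; split=> // g /hK h1; have := nr_le (x g) (y g); have := xy g; lra.
Qed.

Lemma C0_star U x : open U -> C0 U x -> C0 (invset U) (sec_star x).
Proof.
move=> oU /(C0P _ oU)[sx cx kx].
have oV : open (invset U) by apply: open_comp => // g _; exact: ginv_continuous.
apply/C0P => //; split; first exact: supp_star.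
  move=> g Ug; rewrite /csec.
  have h1 : pt (x (ginv g')) @[g' --> g] --> pt (x (ginv g)).
    exact: (cvg_comp _ _ (@ginv_continuous G g) (cx _ Ug)).
  have := cvg_fstar h1.
  have e g' : pt (fstar (el (pt (x (ginv g'))))) = pt (sec_star x g').
    by rewrite sec_starE; apply: pt_star; rewrite pt_el.
  by rewrite e; under eq_fun do rewrite e.
move=> e e0; have [K [cK KU hK]] := kx e e0; exists (@ginv G @` K); split.
- by apply: continuous_compact => //; apply: continuous_subspaceT; exact: ginv_continuous.
- by move=> _ [g /KU Ug <-]; rewrite /invset /= ginvK.
move=> g ng; rewrite nr_sec_star; apply: hK => Kg; apply: ng; exists (ginv g) => //.
exact: ginvK.
Qed.

(** Continuity at a unit outside [V] uses that the unit space is Hausdorff: [x] is small outside a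
    compact set [K], whose image under the source map is closed in the unit space. [K] itself need
    not be closed in [G]. *)
Lemma C0_units V x : open V -> V `<=` units (G := G) -> C0 V x -> unit_sections x.
Proof.
move=> oV VU /(C0P _ oV)[sx cx kx]; apply/C0P; first exact: open_units; split.
- exact: supp_sub sx.
- move=> g Ug; have [Vg|nV] := pselect (V g); first exact: cx.
  move=> W; rewrite nbhsE => -[W' [oW' W'g] WW].
  have xg0 : x g = 0 by apply: sx.
  rewrite xg0 in W'g; have [V' [e [oV' V'g e0 VW]]] := zero_nbhs oW' W'g.
  have [K [cK KV hK]] := kx e e0.
  have csK : closed (@gsrc G @` K).
    apply: compact_closed => //; apply: continuous_compact => //.
    by apply: continuous_subspaceT; exact: gsrc_continuous.
  have n1 : \forall g' \near g, ~ (@gsrc G @` K) (gsrc g').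
    have : \forall a \near gsrc g, ~ (@gsrc G @` K) a.
      apply: open_nbhs_nbhs; split; first by rewrite openC.
      move=> [k Kk ks]; apply: nV; suff -> : g = k by apply: KV.
      have [iU _] := @bis_units G; apply: iU; rewrite ?inE//.
      by apply: VU; apply: KV.
    exact: (@gsrc_continuous g).
  have n2 : \forall g' \near g, V' g' by apply: open_nbhs_nbhs.
  rewrite nbhs_simpl /=; apply: filterS2 n1 n2 => g' nK V'g'.
  apply: WW; apply: VW => //; apply: hK => Kg'; apply: nK; by exists g'.
by move=> e e0; have [K [cK KV hK]] := kx e e0; exists K; split=> // g /KV/VU.
Qed.

(** [r] is the range map followed by the local inverse of its restriction to [U]; it selects the
    left factor in [U] of an arrow near [g]. *)
Lemma local_left U g h : open U -> set_inj U (@grng G) -> U h -> grng h = grng g ->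
  exists r : G -> G, [/\ r g = h, r g' @[g' --> g] --> r g &
    \forall g' \near g, U (r g') /\ grng (r g') = grng g'].
Proof.
move=> oU iU Uh hg.
pose r g' := xget h [set h' | U h' /\ grng h' = grng g'].
have rP g' h' : U h' -> grng h' = grng g' -> r g' = h'.
  move=> Uh' hg'; rewrite /r; have [/= U1 e1] : [set h' | U h' /\ grng h' = grng g'] (r g').
    by apply: (xgetI _ (x := h')).
  by apply: iU; rewrite ?inE// hg'.
have near_g (N : set G) : nbhs h N ->
    \forall g' \near g, exists h', [/\ N h', U h' & grng h' = grng g'].
  move=> nN; have nNU : nbhs h (N `&` U) by apply: filterI => //; exact: open_nbhs_nbhs.
  have := local_homeo_open (@grng_local G) nNU; rewrite hg => n1.
  have n2 : \forall g' \near g, (@grng G @` (N `&` U)) (grng g') := @grng_continuous g _ n1.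
  by apply: filterS n2 => g' [h' [Nh' Uh'] e]; exists h'.
have rg : r g = h by apply: rP.
exists r; split=> //.
  rewrite rg => N nN; rewrite nbhs_simpl /=; apply: filterS (near_g N nN) => g' [h' [Nh' Uh' e]].
  by rewrite /= (rP g' h').
apply: filterS (near_g setT filterT) => g' [h' [_ Uh' e]].
by rewrite (rP g' h').
Qed.

Lemma near_left U V g : open U -> open V -> set_inj U (@grng G) ->
  setmul U V g -> exists r : G -> G, [/\ r g' @[g' --> g] --> r g,
    gmul (ginv (r g')) g' @[g' --> g] --> gmul (ginv (r g)) g &
    \forall g' \near g, [/\ U (r g'), grng (r g') = grng g' & V (gmul (ginv (r g')) g')]].
Proof.
move=> oU oV iU [h [k [Uh Vk hk ->]]].
have hg : grng h = grng (gmul h k) by rewrite grng_mul.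
have [r [rg rc near_r]] := local_left oU iU Uh hg.
exists r; have c2 : gmul (ginv (r g')) g' @[g' --> gmul h k] -->
    gmul (ginv (r (gmul h k))) (gmul h k).
  have ci : ginv (r g') @[g' --> gmul h k] --> ginv (r (gmul h k)).
    exact: (cvg_comp _ _ rc (@ginv_continuous G _)).
  apply: (continuous_within_comp (@gmul_continuous G) (p := fun g' => (ginv (r g'), g'))
     (cvg_pair ci cvg_id)).
  by apply: filterS near_r => g' [_ e] /=; rewrite gsrc_inv.
split=> //.
have nV : \forall g' \near gmul h k, V (gmul (ginv (r g')) g').
  by apply: c2; rewrite rg gmulKV//; exact: open_nbhs_nbhs.
by apply: filterS2 near_r nV => g' [].
Qed.

Lemma open_setmul U V : open U -> open V -> set_inj U (@grng G) -> open (setmul U V).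
Proof.
move=> oU oV iU; rewrite openE => g gUV; rewrite /interior.
have [r [_ _ near_r]] := near_left oU oV iU gUV.
apply: filterS near_r => g' [Ur e Vk]; exists (r g'), (gmul (ginv (r g')) g').
by split=> //; [exact: inv_comp|rewrite gmulVK].
Qed.

Lemma bis_setmul U V : bis U -> bis V -> bis (setmul U V).
Proof.
move=> [iU1 iU2] [iV1 iV2]; split=> g g'; rewrite !inE;
  move=> [h [k [Uh Vk hk ->]]] [h' [k' [Uh' Vk' hk' ->]]].
  rewrite !gsrc_mul// => e; have ek : k = k' by apply: iV1; rewrite ?inE.
  by subst k'; have -> : h = h' by apply: iU1; rewrite ?inE// hk hk'.
rewrite !grng_mul// => e; have ek : h = h' by apply: iU2; rewrite ?inE.
by subst h'; have -> : k = k' by apply: iV2; rewrite ?inE// -hk hk'.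
Qed.

Lemma C0_conv U V x y : open U -> open V -> bis U -> bis V -> C0 U x -> C0 V y ->
  C0 (setmul U V) (conv x y).
Proof.
move=> oU oV bU bV Cx Cy; have [Mx hMx] := C0_bounded oU Cx.
have [My hMy] := C0_bounded oV Cy; move: Cx Cy.
move=> /(C0P _ oU)[sx cx kx] /(C0P _ oV)[sy cy ky].
have [iU1 iU2] := bU; have oUV := open_setmul oU oV iU2.
have convE g h k : U h -> gsrc h = grng k -> g = gmul h k ->
    pt (conv x y g) = pt (fmul (x h) (y k)).
  move=> Uh hk ->; rewrite (conv_left _ iU2 sx Uh) ?grng_mul//.
  by apply: pt_mul => //; apply: sec_pt; rewrite gmulKV.
apply/C0P => //; split; first exact: supp_conv.
- move=> g gUV; have [r [rc kc near_r]] := near_left oU oV iU2 gUV.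
  have [Ur re Vk] := nbhs_singleton near_r.
  have c1 : pt (x (r g')) @[g' --> g] --> pt (x (r g)) := cvg_comp _ _ rc (cx _ Ur).
  have c2 : pt (y (gmul (ginv (r g')) g')) @[g' --> g] --> pt (y (gmul (ginv (r g)) g)).
    exact: (cvg_comp _ _ kc (cy _ Vk)).
  have := cvg_fmul c1 c2.
  have near_c : \forall t \near g, gsrc (pr (pt (x (r t)))) =
      grng (pr (pt (y (gmul (ginv (r t)) t)))).
    by apply: filterS near_r => t [_ e _]; rewrite !pr_pt; exact: inv_comp.
  move=> /(_ near_c) c3.
  have e t : U (r t) -> grng (r t) = grng t ->
      pt (fmul (el (pt (x (r t)))) (el (pt (y (gmul (ginv (r t)) t))))) = pt (conv x y t).
    move=> Ut et; rewrite (conv_left _ iU2 sx Ut et); apply: pt_mul; exact: pt_el.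
  rewrite /csec -(e g)//; apply: cvg_trans c3; apply: near_eq_cvg.
  by apply: filterS near_r => t [Ut et _]; rewrite e.
move=> eps e0.
have M0 : 0 < `|Mx| + `|My| + 1 by have := normr_ge0 Mx; have := normr_ge0 My; lra.
have [K [cK KU hK]] := kx (eps / (`|Mx| + `|My| + 1)) ltac:(exact: divr_gt0).
have [K' [cK' KV hK']] := ky (eps / (`|Mx| + `|My| + 1)) ltac:(exact: divr_gt0).
pose D := [set p : G * G | gsrc p.1 = grng p.2].
(* The composable pairs are closed in [G * G] because the unit space is Hausdorff. *)
have cD : compact ((K `*` K') `&` D).
  apply: compact_closedI; first exact: compact_setX.
  move=> p pc; apply: X_hausdorff => P Q nP nQ.
  have n1 : \forall p' \near p, P (gsrc p'.1).
    exact: (cvg_comp _ _ (@cvg_fst _ _ (nbhs p.1) (nbhs p.2) _) (@gsrc_continuous p.1)).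
  have n2 : \forall p' \near p, Q (grng p'.2).
    exact: (cvg_comp _ _ (@cvg_snd _ _ (nbhs p.1) (nbhs p.2) _) (@grng_continuous p.2)).
  have [p' [Dp' [h1 h2]]] := pc _ (filterI n1 n2).
  by exists (gsrc p'.1); split=> //; rewrite Dp'.
exists ((fun p : G * G => gmul p.1 p.2) @` ((K `*` K') `&` D)); split.
- apply: continuous_compact => //.
  by apply: continuous_subspaceW (@gmul_continuous G) => p [].
- move=> _ [[h k] [[/= /KU Uh /KV Vk] hk] <-]; by exists h, k.
move=> g ng.
have [gUV|nUV] := pselect (setmul U V g); last by rewrite (supp_conv iU2 sx sy)// nr0.
have [h [k [Uh Vk hk ge]]] := gUV.
rewrite (pt_nr (convE g h k Uh hk ge)); apply: le_lt_trans (fnormM _ _ hk) _.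
have hx := hMx h; have hy := hMy k; have lx := ler_norm Mx; have ly := ler_norm My.
have x0 := nr_ge0 (x h); have y0 := nr_ge0 (y k).
have [Kh|nKh] := pselect (K h).
  have : ~ K' k by move=> Kk; apply: ng; exists (h, k).
  move=> /hK'; rewrite ltr_pdivlMr// => l; have := normr_ge0 My; nra.
by have := hK h nKh; rewrite ltr_pdivlMr// => l; have := normr_ge0 Mx; nra.
Qed.
End Topology.

(** * Closed subspaces and ideals given by closure conditions *)

Lemma preimage_subspace (R : realType) (V W : normedModType R[i]) (f : V -> W) (M : R) (L : set W) :
  (forall k x y, f (k *: x + y) = k *: f x + f y) -> 0 <= M ->
  (forall x, nr (f x) <= M * nr x) -> closed_subspace L -> closed_subspace [set x | L (f x)].
Proof.
move=> fl M0 fM cL; have [L0 Ll /closed_epsP Lc] := cL.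
have f0 : f 0 = 0 by have := fl (-1) 0 0; rewrite scaler0 addr0 scaleN1r addNr.
split; first by rewrite /= f0.
  by move=> k x y hx hy; rewrite /= fl; apply: Ll.
apply/closed_epsP => x hx /=; apply: Lc => e e0.
have [y Ly xy] := hx (e / (M + 1)) ltac:(apply: divr_gt0; lra).
exists (f y) => //; have -> : f x - f y = f (x - y).
  by rewrite [x - y]addrC -[- y]scaleN1r fl scaleN1r addrC.
apply: le_lt_trans (fM _) _; move: xy; rewrite ltr_pdivlMr; last by lra.
by have := nr_ge0 (x - y); nra.
Qed.

Section Ideals.
Variables (R : realType) (A : cstarAlg R).
Lemma ideal_generated_closed (X : set A) : closed_ideal (ideal_generated X).
Proof.
split.
- split.
  + by move=> J [[J0 _ _] _ _].
  + move=> k a b ha hb J cJ XJ; have [[_ Jl _] _ _] := cJ.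
    by apply: Jl; [exact: ha|exact: hb].
  + apply/closed_epsP => a ha J cJ XJ; have [[_ _ /closed_epsP Jc] _ _] := cJ.
    by apply: Jc => e e0; have [b hb ab] := ha e e0; exists b => //; apply: hb.
- by move=> a b hb J cJ XJ; have [_ Jl _] := cJ; apply: Jl; exact: hb.
- by move=> a b hb J cJ XJ; have [_ _ Jr] := cJ; apply: Jr; exact: hb.
Qed.

Lemma closed_span_ideal (X : set A) :
  (forall a x, X x -> X (cmul a x)) -> (forall a x, X x -> X (cmul x a)) ->
  closed_ideal (closed_span X).
Proof.
move=> Xl Xr; have cL := closed_span_subspace X; split=> //.
- move=> a x /(_ [set x | closed_span X (cmul a x)]); apply.
    apply: (preimage_subspace (M := nr a)) => //; [by move=> *; rewrite cmul_linr|exact: nr_ge0|].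
    exact: cnormM.
  by move=> y Xy; apply: closed_span_sub; apply: Xl.
- move=> a x /(_ [set x | closed_span X (cmul x a)]); apply.
    apply: (preimage_subspace (f := fun x => cmul x a) (M := nr a)) => //.
    + by move=> *; rewrite cmul_linl.
    + exact: nr_ge0.
    + by move=> y; rewrite mulrC; exact: cnormM.
  by move=> y Xy; apply: closed_span_sub; apply: Xr.
Qed.
End Ideals.

(** * The inverse semigroup of Hilbert subbimodules *)

Section Semigroup.
Variables (R : realType) (G : etale_groupoid) (F : fell_bundle R G).
Hypothesis X_hausdorff : hausdorff_space (gunits G).
Variable A : unit_algebra F.
Implicit Types (x y z : section F) (g h : G) (k : R[i]) (U V W : set G) (t u v : set (section F)).
Implicit Types (a b c : A) (L X : set (section F)).
Local Notation one := (@unit_sections R G F).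

Lemma sec_injective : injective (@sec R G F A). Proof. by case: A. Qed.
Lemma sec_range : range (@sec R G F A) = one. Proof. by case: A. Qed.
Lemma sec_linear k a b : sec (k *: a + b) = sec_lin k (sec a) (sec b).
Proof. by case: A a b. Qed.
Lemma secM a b : sec (cmul a b) = conv (sec a) (sec b). Proof. by case: A a b. Qed.
Lemma secS a : sec (cstar a) = sec_star (sec a). Proof. by case: A a. Qed.
Lemma sec_norm a (M : R) : 0 <= M -> nr a <= M <-> forall g, nr (sec a g) <= M.
Proof.
move=> M0.
have h : `|a| <= M%:C <-> forall g, `|sec a g| <= M%:C.
  have M0' : 0 <= M%:C :> R[i] by rewrite ler0c.
  by case: A a => ? ? ? ? ? ? ? hn a; apply: (hn).
split=> [aM g|aM].
  by have := (h.1 _ g); rewrite !nrE !lecR; apply.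
by have := h.2; rewrite nrE lecR; apply=> g; rewrite nrE lecR.
Qed.

Lemma sec_one a : one (sec a).
Proof. by rewrite -sec_range; exists a. Qed.

Lemma to_A_sec a : to_A A (sec a) = a.
Proof.
have h : sec (to_A A (sec a)) = sec a.
  by rewrite /to_A; apply: (xgetI 0 (P := [set b : A | sec b = sec a]) (x := a)).
exact: sec_injective.
Qed.

Lemma sec_to_A z : one z -> sec (to_A A z) = z.
Proof. by rewrite -sec_range => -[a _ <-]; rewrite to_A_sec. Qed.

Lemma one_supp z : one z -> supp (units (G := G)) z.
Proof. by case. Qed.

Lemma secB a b : sec (a - b) = sec_lin (-1) (sec b) (sec a).
Proof. by rewrite -sec_linear scaleN1r addrC. Qed.

Lemma sec_nr_le a g : nr (sec a g) <= nr a.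
Proof. by have := (@sec_norm a (nr a) (nr_ge0 a)).1 (lexx _) g. Qed.

Lemma ulim L x : uclosed_subspace L ->
  (forall e : R, 0 < e -> exists2 y, L y & forall g, nr (x g - y g) <= e) -> L x.
Proof.
move=> [_ _ h] hx; apply: h => eps e0.
have [y Ly xy] := hx (Re eps) (proj2 (andP (etrans (esym (ltcE _ _)) e0))).
by exists y => // g; rewrite nrE [eps]ge0C ?(ltW e0)// lecR.
Qed.

Lemma uclosedI L : L (sec0 F) -> (forall k x y, L x -> L y -> L (sec_lin k x y)) ->
  (forall x, (forall e : R, 0 < e -> exists2 y, L y & forall g, nr (x g - y g) <= e) -> L x) ->
  uclosed_subspace L.
Proof.
move=> L0 Ll h; split=> // x hx; apply: h => e e0.
have [|y Ly xy] := hx e%:C; first by rewrite ltcR.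
by exists y => // g; have := xy g; rewrite nrE lecR.
Qed.

Lemma C0_uclosed U : open U -> uclosed_subspace (C0 (F := F) U).
Proof.
move=> oU; apply: uclosedI; first exact: C0_0.
  by move=> k x y; exact: C0_lin.
by move=> x; exact: C0_closed.
Qed.

Lemma uspan_uclosed X : uclosed_subspace (uclosed_span (F := F) X).
Proof.
split.
- by move=> L [].
- by move=> k x y hx hy L cL XL; have [_ Ll _] := cL; apply: Ll; [exact: hx|exact: hy].
- move=> x hx L cL XL; have [_ _ h] := cL; apply: h => e e0.
  by have [y hy xy] := hx e e0; exists y => //; apply: hy.
Qed.

Lemma uspan_sub X : X `<=` uclosed_span (F := F) X.
Proof. by move=> x Xx L _; apply. Qed.

Lemma uspan_min X L : uclosed_subspace L -> X `<=` L -> uclosed_span X `<=` L.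
Proof. by move=> cL XL x; apply. Qed.

Lemma bisectionP U : bisection (G := G) U <-> open U /\ bis U.
Proof. by split=> [[oU i1 i2]|[oU [i1 i2]]]. Qed.

Lemma in_SP t : in_S t <-> [/\ exists U, [/\ open U, bis U & t `<=` C0 U],
  uclosed_subspace t, (forall a x, t x -> t (conv (sec a) x)) &
  (forall a x, t x -> t (conv x (sec a)))].
Proof.
split=> [[[U /bisectionP[oU bU] tU] [ct tl tr]]|[[U [oU bU tU]] ct tl tr]].
  by split=> //; [exists U|move=> a x; apply: tl; exact: sec_one|
    move=> a x; apply: tr; exact: sec_one].
split; first by exists U => //; apply/bisectionP.
by split=> // a x; rewrite -sec_range => -[b _ <-]; [exact: tl|exact: tr].
Qed.

Definition bsupp x : Prop := exists2 U, bis U & supp U x.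

Lemma in_S_bsupp t x : in_S t -> t x -> bsupp x.
Proof. by move=> /in_SP[[U [_ bU tU]] _ _ _] /tU[sx _ _]; exists U. Qed.

Lemma sec_bsupp a : bsupp (sec a).
Proof. by exists (units (G := G)); [exact: bis_units|exact: one_supp (sec_one a)]. Qed.

Lemma star_bsupp x : bsupp x -> bsupp (sec_star x).
Proof. by move=> [U bU sx]; exists (invset U); [exact: bis_inv|exact: supp_star]. Qed.

Lemma convA x y z : bsupp x -> bsupp z -> conv (conv x y) z = conv x (conv y z).
Proof. by move=> [U [_ iU] sx] [W [iW _] sz]; apply: (conv_assoc _ iU iW sx sz). Qed.

Lemma conv_starE x y : bsupp x -> sec_star (conv x y) = conv (sec_star y) (sec_star x).
Proof. by move=> [U [_ iU] sx]; apply: conv_star sx. Qed.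

Lemma conv_lin_r k x y y' : bsupp x ->
  conv x (sec_lin k y y') = sec_lin k (conv x y) (conv x y').
Proof. by move=> [U [_ iU] sx]; apply: conv_linr sx. Qed.

Lemma conv_lin_l k t x x' y : in_S t -> t x -> t x' ->
  conv (sec_lin k x x') y = sec_lin k (conv x y) (conv x' y).
Proof.
by move=> /in_SP[[U [_ [_ iU] tU]] _ _ _] /tU[sx _ _] /tU[sx' _ _]; apply: conv_linl sx sx'.
Qed.

Lemma nr_conv x y (M N : R) : bsupp x -> (forall g, nr (x g) <= M) ->
  (forall g, nr (y g) <= N) -> forall g, nr (conv x y g) <= M * N.
Proof.
move=> [U [_ iU] sx] xM yN g.
have M0 : 0 <= M := le_trans (nr_ge0 _) (xM g).
have N0 : 0 <= N := le_trans (nr_ge0 _) (yN g).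
have [[h [Uh hg]]|nU] := pselect (exists h, U h /\ grng h = grng g); last first.
  rewrite (conv_left0 _ sx) ?nr0 ?mulr_ge0// => h Uh hg.
  by apply: nU; exists h.
rewrite (pt_nr (conv_left _ iU sx Uh hg)); apply: le_trans (fnormM _ _ (inv_comp hg)) _.
by apply: ler_pM; rewrite ?nr_ge0.
Qed.

Lemma one_in_S : in_S one.
Proof.
apply/in_SP; split.
- by exists (units (G := G)); split=> //; [exact: open_units|exact: bis_units].
- by apply: C0_uclosed; exact: open_units.
- by move=> a x; rewrite -sec_range => -[b _ <-]; exists (cmul a b) => //; rewrite secM.
- by move=> a x; rewrite -sec_range => -[b _ <-]; exists (cmul b a) => //; rewrite secM.
Qed.

Section Element.
Variable t : set (section F).
Hypothesis t_S : in_S t.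

Lemma S_uclosed : uclosed_subspace t. Proof. by case/in_SP: t_S. Qed.
Lemma S_lin k x y : t x -> t y -> t (sec_lin k x y).
Proof. by case: S_uclosed => _ h _; apply: h. Qed.
Lemma S_left a x : t x -> t (conv (sec a) x). Proof. by case/in_SP: t_S => _ _ h _; apply: h. Qed.
Lemma S_right a x : t x -> t (conv x (sec a)). Proof. by case/in_SP: t_S => _ _ _ h; apply: h. Qed.
Lemma S_bsupp x : t x -> bsupp x. Proof. exact: in_S_bsupp. Qed.

Lemma inner_right x y : t x -> t y -> one (conv (sec_star x) y).
Proof.
move=> tx ty; have /in_SP[[U [oU bU tU]] _ _ _] := t_S.
have oV : open (invset U) by apply: open_comp => // g _; exact: ginv_continuous.
have bV := bis_inv bU.
apply: (C0_units X_hausdorff (V := setmul (invset U) U)).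
- by apply: open_setmul => //; case: bV.
- move=> _ [h [k [Uh Uk hk ->]]].
  have e : ginv h = k.
    by case: bU => _ iU; apply: iU; rewrite ?inE//; rewrite grng_inv.
  by exists (gsrc k) => //; rewrite -e gsrc_inv -gmul_inv.
- by apply: C0_conv => //; [apply: C0_star => //; exact: tU|exact: tU].
Qed.

Lemma inner_left x y : t x -> t y -> one (conv x (sec_star y)).
Proof.
move=> tx ty; have /in_SP[[U [oU bU tU]] _ _ _] := t_S.
have oV : open (invset U) by apply: open_comp => // g _; exact: ginv_continuous.
have bV := bis_inv bU.
apply: (C0_units X_hausdorff (V := setmul U (invset U))).
- by apply: open_setmul => //; case: bU.
- move=> _ [h [k [Uh Uk hk ->]]].
  have e : ginv k = h.
    by case: bU => iU _; apply: iU; rewrite ?inE//; rewrite gsrc_inv.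
  by exists (grng h) => //; rewrite -e grng_inv ginv_mul.
- by apply: C0_conv => //; [exact: tU|apply: C0_star => //; exact: tU].
Qed.

Lemma S_bounded x : t x -> exists M : R, forall g, nr (x g) <= M.
Proof.
have /in_SP[[U [oU bU tU]] _ _ _] := t_S.
by move=> /tU; exact: C0_bounded.
Qed.

(** With $c=xx^*\in A$ and $y=x-vx$ one gets $yy^*=(1-v)c(1-v)$, and the norm of [y] at an arrow is
    read off from $yy^*$ at its range. *)
Lemma approx_left_sec x (e : R) : t x -> 0 < e -> exists v : A,
  [/\ self_adjoint v, nr v <= 1 & forall g, nr (x g - conv (sec v) x g) <= e].
Proof.
move=> tx e0; pose c := to_A A (conv x (sec_star x)).
have cE : sec c = conv x (sec_star x) by apply: sec_to_A; apply: inner_left.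
have [v [sv v1 hv]] := approx_left c (e := e ^+ 2 / 2) ltac:(by nra).
exists v; split=> // g.
pose y := sec_lin (-1) (conv (sec v) x) x.
have yE : x g - conv (sec v) x g = y g by rewrite /y /sec_lin scaleN1r addrC.
have tvx : t (conv (sec v) x) by apply: S_left.
have ty : t y by apply: S_lin.
pose d := (c - cmul v c) - cmul (c - cmul v c) v.
have dE : sec d = conv y (sec_star y).
  have bx := S_bsupp tx; have bv := sec_bsupp v; have bxs := star_bsupp bx.
  have DE : sec (c - cmul v c) = conv y (sec_star x).
    by rewrite secB secM cE /y (conv_lin_l _ _ t_S)// (convA _ bv bxs).
  have yS : sec_star y = sec_lin (-1) (conv (sec_star x) (sec v)) (sec_star x).
    by rewrite /y sec_star_lin rmorphN rmorph1 (conv_starE _ bv) -secS sv.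
  have by_ := S_bsupp ty.
  by rewrite /d secB secM DE yS (conv_lin_r _ _ _ by_) (convA _ by_ bv).
have nd : nr d <= e ^+ 2.
  have := nrD (c - cmul v c) (- cmul (c - cmul v c) v); rewrite nrN -/d.
  have := cnormM (c - cmul v c) v; have := nr_ge0 (c - cmul v c).
  by nra.
rewrite yE; apply: le_sqr_le; first exact: ltW.
have /in_SP[[U [oU bU tU]] _ _ _] := t_S; have [sy _ _] := tU _ ty.
have [Ug|nUg] := pselect (U g); last by rewrite sy// nr0 expr0n sqr_ge0.
case: bU => _ iU; rewrite -(nr_conv_diag iU sy Ug) -dE.
by apply: le_trans (sec_nr_le _ _) nd.
Qed.

Lemma S_mul_1l : S_mul one t = t.
Proof.
apply/seteqP; split.
  apply: uspan_min; first exact: S_uclosed.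
  by move=> _ [a [x [oa tx ->]]]; rewrite -(sec_to_A oa); apply: S_left.
move=> x tx; apply: ulim; first exact: uspan_uclosed.
move=> e e0; have [v [_ _ hv]] := approx_left_sec tx e0.
exists (conv (sec v) x) => //; apply: uspan_sub.
by exists (sec v), x; split=> //; exact: sec_one.
Qed.

(** The inverse of [t] in the inverse semigroup. *)
Definition star_set : set (section F) := [set x | t (sec_star x)].

Lemma in_S_star : in_S star_set.
Proof.
have /in_SP[[U [oU bU tU]] ct tl tr] := t_S; apply/in_SP; split.
- exists (invset U); split.
  + by apply: open_comp => // g _; exact: ginv_continuous.
  + exact: bis_inv.
  + by move=> x /tU/(C0_star oU); rewrite sec_starK.
- apply: uclosedI.
  + have -> : sec0 F = sec_star (sec0 F).
      apply: section_ext => g; rewrite sec_starE /sec0 fstar0 ginvK //.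
    by rewrite /star_set /= sec_starK; case: ct.
  + by move=> k x y tx ty; rewrite /star_set /= sec_star_lin; apply: S_lin.
  + move=> x hx; apply: (ulim (L := t)) => [|e e0]; first exact: S_uclosed.
    have [y ty xy] := hx e e0; exists (sec_star y) => // g; have := xy (ginv g).
    rewrite -nr_fstar; congr (_ <= _); apply: pt_nr.
    have -> : x (ginv g) - y (ginv g) = -1 *: y (ginv g) + x (ginv g) by rewrite scaleN1r addrC.
    rewrite fstar_lin rmorphN rmorph1.
    have -> : sec_star x g - sec_star y g = -1 *: sec_star y g + sec_star x g by rewrite scaleN1r addrC.
    by apply: pt_lin; rewrite sec_starE.
- move=> a x tx; rewrite /star_set /= conv_starE; last exact: sec_bsupp.
  by rewrite -secS; apply: S_right.
- move=> a x tx; rewrite /star_set /= conv_starE; first by rewrite -secS; apply: S_left.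
  by rewrite -(sec_starK x); apply: star_bsupp; exact: S_bsupp tx.
Qed.
End Element.

Lemma approx_right_sec t x (e : R) : in_S t -> t x -> 0 < e -> exists v : A,
  [/\ self_adjoint v, nr v <= 1 & forall g, nr (x g - conv x (sec v) g) <= e].
Proof.
move=> tS tx e0.
have [|v [sv v1 hv]] := approx_left_sec (in_S_star tS) (x := sec_star x) _ e0.
  by rewrite /star_set /= sec_starK.
exists v; split=> // g; have := hv (ginv g).
rewrite -nr_fstar; congr (_ <= _); apply: pt_nr.
have -> : sec_star x (ginv g) - conv (sec v) (sec_star x) (ginv g) =
    -1 *: conv (sec v) (sec_star x) (ginv g) + sec_star x (ginv g) by rewrite scaleN1r addrC.
have -> : x g - conv x (sec v) g = -1 *: conv x (sec v) g + x g by rewrite scaleN1r addrC.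
rewrite fstar_lin rmorphN rmorph1.
have bx := S_bsupp tS tx.
apply: pt_lin; rewrite -sec_starE.
  by rewrite conv_starE ?sec_starK -?secS ?sv//; exact: sec_bsupp.
by rewrite sec_starK.
Qed.

Lemma S_mul_1r t : in_S t -> S_mul t one = t.
Proof.
move=> tS; apply/seteqP; split.
  apply: uspan_min; first exact: S_uclosed.
  by move=> _ [x [a [tx oa ->]]]; rewrite -(sec_to_A oa); apply: S_right.
move=> x tx; apply: ulim; first exact: uspan_uclosed.
move=> e e0; have [v [_ _ hv]] := approx_right_sec tS tx e0.
exists (conv x (sec v)) => //; apply: uspan_sub.
by exists x, (sec v); split=> //; exact: sec_one.
Qed.

Lemma in_S_mul t u : in_S t -> in_S u -> in_S (S_mul t u).
Proof.
move=> tS uS; have /in_SP[[U [oU bU tU]] _ _ _] := tS.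
have /in_SP[[V [oV bV uV]] _ _ _] := uS.
have oUV : open (setmul U V) by apply: open_setmul => //; case: bU.
have bUV := bis_setmul bU bV.
have sub : S_mul t u `<=` C0 (setmul U V).
  apply: uspan_min; first exact: C0_uclosed.
  by move=> _ [x [y [tx uy ->]]]; apply: C0_conv => //; [exact: tU|exact: uV].
apply/in_SP; split=> //; first by exists (setmul U V); split.
- exact: uspan_uclosed.
- move=> a z Zz; have : (S_mul t u `&` [set z | S_mul t u (conv (sec a) z)]) z.
    apply: Zz.
      have [Z0 Zl _] := uspan_uclosed [set z | exists x y, [/\ t x, u y & z = conv x y]].
      apply: uclosedI.
      + split=> //=; suff -> : conv (sec a) (sec0 F) = sec0 F by [].
        by apply: section_ext => g; congr pt; apply: conv_eq0 => h hg; rewrite fmul0r//; exact: inv_comp.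
      + move=> k x y [Zx Zax] [Zy Zay]; split; first exact: Zl.
        by rewrite /= conv_lin_r; [exact: Zl|exact: sec_bsupp].
      + move=> x hx; split; apply: (ulim (L := S_mul t u)); try exact: uspan_uclosed.
          by move=> e e0; have [y [Zy _] xy] := hx e e0; exists y.
        move=> e e0; have a0 := nr_ge0 a.
        have [y [Zy Zay] xy] := hx (e / (nr a + 1)) ltac:(apply: divr_gt0; lra).
        exists (conv (sec a) y) => // g.
        have -> : conv (sec a) x g - conv (sec a) y g = conv (sec a) (sec_lin (-1) y x) g.
          by rewrite conv_lin_r; [rewrite /sec_lin scaleN1r addrC|exact: sec_bsupp].
        apply: le_trans (@nr_conv (sec a) (sec_lin (-1) y x) (nr a) (e / (nr a + 1)) _ _ _ g) _.
        * exact: sec_bsupp.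
        * exact: sec_nr_le.
        * by move=> g'; rewrite /sec_lin scaleN1r addrC.
        by rewrite mulrC mulrAC ler_pdivrMr; nra.
    move=> _ [x [y [tx uy ->]]]; split=> /=.
      by apply: uspan_sub; exists x, y.
    rewrite -(convA _ (sec_bsupp a) (S_bsupp uS uy)).
    by apply: uspan_sub; exists (conv (sec a) x), y; split=> //; apply: S_left.
  by case.
(* The intersection with [S_mul t u] supplies a common bisection for the supports, which linearity
   of [conv] in its left argument requires. *)
- move=> a z Zz; have : (S_mul t u `&` [set z | S_mul t u (conv z (sec a))]) z.
    apply: Zz.
      have [Z0 Zl _] := uspan_uclosed [set z | exists x y, [/\ t x, u y & z = conv x y]].
      have cl (c : R[i]) z1 z2 : S_mul t u z1 -> S_mul t u z2 ->
          conv (sec_lin c z1 z2) (sec a) = sec_lin c (conv z1 (sec a)) (conv z2 (sec a)).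
        by move=> /sub[s1 _ _] /sub[s2 _ _]; apply: conv_linl s1 s2; case: bUV.
      apply: uclosedI.
      + split=> //=; suff -> : conv (sec0 F) (sec a) = sec0 F by [].
        by apply: section_ext => g; congr pt; apply: conv_eq0 => h hg; rewrite fmul0l//; exact: inv_comp.
      + move=> k x y [Zx Zax] [Zy Zay]; split; first exact: Zl.
        by rewrite /= cl//; exact: Zl.
      + move=> x hx.
        have Zx : S_mul t u x.
          apply: ulim; first exact: uspan_uclosed.
          by move=> e e0; have [y [Zy _] xy] := hx e e0; exists y.
        split=> //; apply: (ulim (L := S_mul t u)); first exact: uspan_uclosed.
        move=> e e0; have a0 := nr_ge0 a.
        have [y [Zy Zay] xy] := hx (e / (nr a + 1)) ltac:(apply: divr_gt0; lra).
        exists (conv y (sec a)) => // g.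
        have Zd : S_mul t u (sec_lin (-1) y x) by apply: Zl.
        have -> : conv x (sec a) g - conv y (sec a) g = conv (sec_lin (-1) y x) (sec a) g.
          by rewrite cl// /sec_lin scaleN1r addrC.
        apply: le_trans (@nr_conv (sec_lin (-1) y x) (sec a) (e / (nr a + 1)) (nr a) _ _ _ g) _.
        * by exists (setmul U V) => //; case: (sub _ Zd).
        * by move=> g'; rewrite /sec_lin scaleN1r addrC.
        * exact: sec_nr_le.
        by rewrite mulrAC ler_pdivrMr; nra.
    move=> _ [x [y [tx uy ->]]]; split=> /=.
      by apply: uspan_sub; exists x, y.
    rewrite (convA _ (S_bsupp tS tx) (sec_bsupp a)).
    by apply: uspan_sub; exists x, (conv y (sec a)); split=> //; apply: S_right.
  by case.
Qed.

Lemma in_S_cap t u : in_S t -> in_S u -> in_S (t `&` u).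
Proof.
move=> tS uS; have /in_SP[[U [oU bU tU]] ct tl tr] := tS.
have /in_SP[_ cu ul ur] := uS; apply/in_SP; split.
- by exists U; split=> // x [/tU].
- apply: uclosedI.
  + by split; [case: ct|case: cu].
  + by move=> k x y [tx ux] [ty uy]; split; apply: S_lin.
  + by move=> x hx; split; apply: ulim => // e e0; have [y [ty uy] xy] := hx e e0; exists y.
- by move=> a x [tx ux]; split; [exact: tl|exact: ul].
- by move=> a x [tx ux]; split; [exact: tr|exact: ur].
Qed.

Definition section_ideal v : set A := [set a | v (sec a)].

Lemma section_ideal_closed v : in_S v -> closed_ideal (section_ideal v).
Proof.
move=> vS; have /in_SP[_ cv vl vr] := vS; split=> /=.
- split.
  + rewrite /section_ideal /=; have -> : sec (0 : A) = sec0 F; last by case: cv.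
    have := sec_linear (-1) (0 : A) 0; rewrite scaler0 addr0 => ->.
    by apply: section_ext => g; rewrite /sec_lin /sec0 scaleN1r addNr.
  + by move=> k a b va vb; rewrite /section_ideal /= sec_linear; apply: S_lin.
  + apply/closed_epsP => a ha; apply: ulim => // e e0; have [b vb ab] := ha e e0.
    exists (sec b) => // g.
    have -> : sec a g - sec b g = sec (a - b) g by rewrite secB /sec_lin scaleN1r addrC.
    by apply: le_trans (sec_nr_le _ _) (ltW ab).
- by move=> a b vb; rewrite /section_ideal /= secM; apply: vl.
- by move=> a b vb; rewrite /section_ideal /= secM; apply: vr.
Qed.

(** With [s_ideal_sup] below, it shows that an ideal of [A] is its own source ideal. *)
Lemma s_ideal_sub v a : in_S v -> v `<=` one -> s_ideal v a -> v (sec a).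
Proof.
move=> vS v1 /(_ (section_ideal v)); apply=> [|b [x [y [vx vy bE]]]].
  exact: section_ideal_closed.
rewrite /section_ideal /= bE -(sec_to_A (v1 _ vx)) -secS.
by apply: S_left.
Qed.

Lemma s_ideal_closed v : closed_ideal (s_ideal (A := A) v).
Proof. exact: ideal_generated_closed. Qed.

Lemma s_ideal_inner v x y a : v x -> v y -> sec a = conv (sec_star x) y -> s_ideal v a.
Proof. by move=> vx vy aE J _; apply; exists x, y. Qed.

Lemma s_ideal_sup v a : in_S v -> v (sec a) -> s_ideal v a.
Proof.
move=> vS va; have cJ := section_ideal_closed vS.
have [[_ _ /closed_epsP h] _ _] := s_ideal_closed v; apply: h => e e0.
have [w [Jw _ _ aw]] := approx_right cJ va e0; exists (cmul a w) => //.
apply: (s_ideal_inner (x := sec (cstar a)) (y := sec w)) => //.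
  exact: (ideal_star cJ va).
by rewrite -secS cstarK secM.
Qed.

(** For $x\in t$ and $w=w^*\in v\subseteq t$ the product $xw$ is a left inner product of [t], hence
    in [A]. So $xwy\in v$, and $wy\approx y$ for a suitable [w]. *)
Lemma S_mul_ideal t v : in_S t -> in_S v -> v `<=` t -> v `<=` one -> S_mul t v = v.
Proof.
move=> tS vS vt v1; have cJ := section_ideal_closed vS.
have app y (e : R) : v y -> 0 < e -> exists w : A, [/\ v (sec w), self_adjoint w &
    forall g, nr (y g - conv (sec w) y g) <= e].
  move=> vy e0; have yE := sec_to_A (v1 _ vy); set c := to_A A y in yE.
  have Jc : section_ideal v (cstar c) by apply: ideal_star => //; rewrite /section_ideal /= yE.
  have [w [Jw sw _ cw]] := approx_right cJ Jc e0; exists w; split=> // g.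
  have -> : y g - conv (sec w) y g = sec (c - cmul w c) g.
    by rewrite secB secM yE /sec_lin scaleN1r addrC.
  apply: le_trans (sec_nr_le _ _) _; rewrite nr_cn_star_sub//; exact: ltW.
apply/seteqP; split.
  apply: uspan_min; first exact: S_uclosed.
  move=> _ [x [y [tx vy ->]]]; apply: ulim; first exact: S_uclosed.
  move=> e e0; have [M hM] := S_bounded tS tx.
  have M0 : 0 < `|M| + 1 by have := normr_ge0 M; lra.
  have [w [vw sw hw]] := app y (e / (`|M| + 1)) vy ltac:(exact: divr_gt0).
  have bx := S_bsupp tS tx; have bw := sec_bsupp w.
  exists (conv x (conv (sec w) y)).
    rewrite -(convA _ bx (S_bsupp vS vy)).
    have oxw : one (conv x (sec w)).
      by rewrite -sw secS; apply: (inner_left tS) => //; apply: vt.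
    by rewrite -(sec_to_A oxw); apply: S_left.
  move=> g.
  have -> : conv x y g - conv x (conv (sec w) y) g =
      conv x (sec_lin (-1) (conv (sec w) y) y) g.
    by rewrite conv_lin_r// /sec_lin scaleN1r addrC.
  apply: le_trans (@nr_conv x (sec_lin (-1) (conv (sec w) y) y) (`|M| + 1)
    (e / (`|M| + 1)) bx _ _ g) _.
  - by move=> g'; have := hM g'; have := ler_norm M; lra.
  - by move=> g'; rewrite /sec_lin scaleN1r addrC.
  by rewrite mulrC divfK ?gt_eqF.
move=> y vy; apply: ulim; first exact: uspan_uclosed.
move=> e e0; have [w [vw sw hw]] := app y e vy e0.
exists (conv (sec w) y) => //; apply: uspan_sub; exists (sec w), y; split=> //.
exact: vt.
Qed.
End Semigroup.

(** * Representations of the inverse semigroup *)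

Section BimoduleRep.
Variables (R : realType) (G : etale_groupoid) (F : fell_bundle R G).
Hypothesis X_hausdorff : hausdorff_space (gunits G).
Variable A : unit_algebra F.
Variables (D : cstarAlg R) (p : set (section F) -> section F -> D).
Hypothesis p_rep : bimodule_rep p.
Implicit Types (x y z : section F) (t u v : set (section F)) (a b c : A) (k : R[i]).
Local Notation one := (@unit_sections R G F).
Let oneS := one_in_S A.
Let hX := X_hausdorff.

Lemma bim_lin t k x y : in_S t -> t x -> t y ->
  p t (sec_lin k x y) = k *: p t x + p t y.
Proof. by case: p_rep => h _ _ _; apply: (h). Qed.
Lemma bim_mul t u x y : in_S t -> in_S u -> t x -> u y ->
  cmul (p t x) (p u y) = p (S_mul t u) (conv x y).
Proof. by case: p_rep => _ h _ _; apply: (h). Qed.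
Lemma bim_inner t x y : in_S t -> t x -> t y ->
  cmul (cstar (p t x)) (p t y) = p one (conv (sec_star x) y).
Proof. by case: p_rep => _ _ h _; apply: (h). Qed.
Lemma bim_outer t x y : in_S t -> t x -> t y ->
  cmul (p t x) (cstar (p t y)) = p one (conv x (sec_star y)).
Proof. by case: p_rep => _ _ _ h; apply: (h). Qed.

Definition unit_coef a : D := p one (sec a).

Lemma cmul_star_eq0 (r : D) : cmul r (cstar r) = 0 -> r = 0.
Proof.
move=> h; rewrite -(cstarK r).
have -> : cstar r = 0; last by rewrite cstar0.
apply: nr_eq0; apply/eqP; rewrite -sqrf_eq0 -cnorm_sq cstarK h nr0 //.
Qed.

(** Compatibility with adjoints is not among the relations of [bimodule_rep]. For the difference [r]
    of the images of $a^*$ and the adjoint of the image of [a], they give $rr^*=0$. *)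
Lemma coef_hom : star_hom unit_coef.
Proof.
have lin k a b : unit_coef (k *: a + b) = k *: unit_coef a + unit_coef b.
  by rewrite /unit_coef sec_linear bim_lin//; exact: sec_one.
have mul a b : unit_coef (cmul a b) = cmul (unit_coef a) (unit_coef b).
  by rewrite /unit_coef secM bim_mul ?(S_mul_1l hX A)//; exact: sec_one.
split=> // a.
have inn b c : cmul (cstar (unit_coef b)) (unit_coef c) = unit_coef (cmul (cstar b) c).
  by rewrite /unit_coef bim_inner ?secM ?secS//; exact: sec_one.
have out b c : cmul (unit_coef b) (cstar (unit_coef c)) = unit_coef (cmul b (cstar c)).
  by rewrite /unit_coef bim_outer ?secM ?secS//; exact: sec_one.
apply/eqP; rewrite -subr_eq0; apply/eqP/cmul_star_eq0.
have e : cstar (cmul (unit_coef (cstar a)) (unit_coef a)) = cmul (unit_coef (cstar a)) (unit_coef a).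
  by rewrite -mul -inn cstarM cstarK.
by rewrite !cstarE !cmulE out cstarK inn -cstarM e -mul; lmod.
Qed.

Lemma bim_left t a x : in_S t -> t x -> cmul (unit_coef a) (p t x) = p t (conv (sec a) x).
Proof. by move=> tS tx; rewrite bim_mul ?(S_mul_1l hX A)//; exact: sec_one. Qed.

Lemma bim_right t a x : in_S t -> t x -> cmul (p t x) (unit_coef a) = p t (conv x (sec a)).
Proof. by move=> tS tx; rewrite bim_mul ?(S_mul_1r hX A)//; exact: sec_one. Qed.

Lemma bim_star_coef t x y : in_S t -> t x -> t y ->
  cmul (cstar (p t x)) (p t y) = unit_coef (to_A A (conv (sec_star x) y)).
Proof. by move=> tS tx ty; rewrite /unit_coef bim_inner// sec_to_A//; apply: (inner_right hX A tS). Qed.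

Lemma nr_inner t x (M : R) : in_S t -> t x -> 0 <= M -> (forall g, nr (x g) <= M) ->
  nr (to_A A (conv (sec_star x) x)) <= M ^+ 2.
Proof.
move=> tS tx M0 xM; apply/sec_norm; first exact: sqr_ge0.
rewrite sec_to_A; last by apply: (inner_right hX A tS).
move=> g; rewrite expr2; apply: (nr_conv (star_bsupp (S_bsupp A tS tx))) => // h.
by rewrite nr_sec_star.
Qed.

Lemma bim_norm t x (M : R) : in_S t -> t x -> 0 <= M -> (forall g, nr (x g) <= M) ->
  nr (p t x) <= M.
Proof.
move=> tS tx M0 xM; apply: le_sqr_le => //.
rewrite -cnorm_sq bim_star_coef//; apply: le_trans (nr_inner tS tx M0 xM).
exact: hom_contraction coef_hom _.
Qed.

Lemma bim_sub t x y : in_S t -> t x -> t y -> p t (sec_lin (-1) y x) = p t x - p t y.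
Proof. by move=> tS tx ty; rewrite bim_lin// scaleN1r addrC. Qed.

Lemma bim_close t x y (e : R) : in_S t -> t x -> t y -> 0 <= e ->
  (forall g, nr (x g - y g) <= e) -> nr (p t x - p t y) <= e.
Proof.
move=> tS tx ty e0 xy; rewrite -bim_sub//; apply: bim_norm => //; first exact: (S_lin A tS).
by move=> g; rewrite /sec_lin scaleN1r addrC.
Qed.

(* With d_a = p_v(a) - p_1(a) one has d_a p_v(b) = 0 and d_c^* p_v(a) = - d_{c^* a},
   so that d vanishes on triple products. *)
Lemma bim_ideal v a : in_S v -> v `<=` one -> v (sec a) -> p v (sec a) = unit_coef a.
Proof.
move=> vS v1 va; have cJ := section_ideal_closed A vS; have ch := coef_hom.
have vM b c : v (sec c) -> v (sec (cmul b c)) by case: cJ => _ h _; apply: (h).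
have vMr b c : v (sec b) -> v (sec (cmul b c)) by case: cJ => _ _ h; apply: (h).
have vSt b : v (sec b) -> v (sec (cstar b)) by exact: (ideal_star cJ).
have vv : S_mul v v = v by apply: (S_mul_ideal hX A).
have mulv b c : v (sec b) -> v (sec c) -> cmul (p v (sec b)) (p v (sec c)) = p v (sec (cmul b c)).
  by move=> vb vc; rewrite bim_mul// vv secM.
have left b c : v (sec c) -> cmul (unit_coef b) (p v (sec c)) = p v (sec (cmul b c)).
  by move=> vc; rewrite bim_left// secM.
pose d b := p v (sec b) - unit_coef b.
have d1 b c : v (sec b) -> v (sec c) -> cmul (d b) (p v (sec c)) = 0.
  by move=> vb vc; rewrite /d !cmulE mulv// left// subrr.
have d2 b c : v (sec b) -> v (sec c) ->
    cmul (cstar (d c)) (p v (sec b)) = - d (cmul (cstar c) b).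
  move=> vb vc; rewrite /d !cstarE !cmulE bim_inner// -(homS ch) left// -secS -secM.
  by rewrite opprB.
have d3 b c b' : v (sec b) -> v (sec c) -> v (sec b') -> d (cmul (cmul c b) b') = 0.
  move=> vb vc vb'; rewrite -[c]cstarK -cmulA; apply: oppr_inj; rewrite oppr0.
  rewrite -d2 -?mulv//; [|exact: vMr|exact: vSt].
  by rewrite cmulA d2//; [rewrite cmulNl d1 ?oppr0//; apply: vM|exact: vSt].
apply/eqP; rewrite -subr_eq0; apply/eqP; apply: nr_small => e e0.
have [w [vw sw w1 hw]] := approx_right cJ (vSt _ va) (e := e / 4) ltac:(lra).
have aw : nr (a - cmul w a) < e / 4 by rewrite nr_cn_star_sub.
have aww : nr (a - cmul (cmul w w) a) <= e / 2.
  have -> : a - cmul (cmul w w) a = (a - cmul w a) + cmul w (a - cmul w a).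
    by rewrite !cmulE; lmod.
  have := nrD (a - cmul w a) (cmul w (a - cmul w a)); have := cnormM w (a - cmul w a).
  by have := nr_ge0 (a - cmul w a); nra.
have vwwa : v (sec (cmul (cmul w w) a)) by apply: vM.
have -> : p v (sec a) - unit_coef a =
    (p v (sec a) - p v (sec (cmul (cmul w w) a))) - unit_coef (a - cmul (cmul w w) a).
  have := d3 w w a vw vw va; rewrite /d (homD ch) (homN ch) => /eqP; rewrite subr_eq0 => /eqP ->.
  by lmod.
have h1 : nr (p v (sec a) - p v (sec (cmul (cmul w w) a))) <= e / 2.
  apply: bim_close => //; first lra.
  move=> g; have -> : sec a g - sec (cmul (cmul w w) a) g = sec (a - cmul (cmul w w) a) g.
    by rewrite secB /sec_lin scaleN1r addrC.
  exact: le_trans (sec_nr_le _ _) aww.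
have h2 := hom_contraction ch (a - cmul (cmul w w) a).
have := nrD (p v (sec a) - p v (sec (cmul (cmul w w) a))) (- unit_coef (a - cmul (cmul w w) a)).
by rewrite nrN; lra.
Qed.

Lemma bim_ideal_sec v x : in_S v -> v `<=` one -> v x -> p v x = p one x.
Proof.
move=> vS v1 vx; have xE := sec_to_A A (v1 _ vx); rewrite -xE; apply: bim_ideal => //.
by rewrite xE.
Qed.

(** This links [p t] to [A]: the product with an element of an ideal $v\subseteq t$ of [A] falls
    into the image of [A], where an extension of a state is known. *)
Lemma bim_cross t v x c : in_S t -> in_S v -> v `<=` t -> v `<=` one -> t x -> v (sec c) ->
  cmul (p t x) (unit_coef c) = unit_coef (to_A A (conv x (sec c))) /\ v (conv x (sec c)).
Proof.
move=> tS vS vt v1 tx vc; have e := S_mul_ideal hX A tS vS vt v1.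
have vxc : v (conv x (sec c)) by rewrite -e; apply: uspan_sub; exists x, (sec c).
split=> //; rewrite -(bim_ideal vS)// bim_mul// e bim_ideal_sec// /unit_coef sec_to_A//.
exact: v1.
Qed.

(** As in [coef_hom], the difference [r] of the two sides satisfies $rr^*=0$. The product of
    [star_set t] with [t] is an ideal of [A], so [p] of it agrees with [p] of the unit there. *)
Lemma bim_star t x : in_S t -> t x -> cstar (p t x) = p (star_set t) (sec_star x).
Proof.
move=> tS tx; have sS := in_S_star A tS.
have sx : star_set t (sec_star x) by rewrite /star_set /= sec_starK.
have ch := coef_hom; pose e := S_mul (star_set t) t.
have e1 : e `<=` one.
  apply: uspan_min; first exact: (S_uclosed A oneS).
  by move=> _ [y [z [ty tz ->]]]; rewrite -[y]sec_starK; apply: (inner_right hX A tS).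
have eS : in_S e by apply: in_S_mul.
have h : cmul (p (star_set t) (sec_star x)) (p t x) = p one (conv (sec_star x) x).
  rewrite bim_mul// bim_ideal_sec//; apply: uspan_sub; by exists (sec_star x), x.
have h1 := bim_inner tS tx tx; have h2 := bim_outer sS sx sx; rewrite sec_starK in h2.
apply/eqP; rewrite -subr_eq0; apply/eqP/cmul_star_eq0.
by rewrite !cstarE !cmulE -cstarM h h1 h2 -h1 cstarM cstarK; lmod.
Qed.
End BimoduleRep.

Section DenseSpan.
Variables (R : realType) (G : etale_groupoid) (F : fell_bundle R G).
Hypothesis X_hausdorff : hausdorff_space (gunits G).
Variable A : unit_algebra F.
Variables (D : cstarAlg R) (p : set (section F) -> section F -> D).
Hypothesis p_full : full_crossed_product p.

(** The generators are closed under products and, by [bim_star], under adjoints, so their closed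
    span is already a C*-subalgebra. *)
Lemma span_full : closed_span [set b | exists t x, [/\ in_S t, t x & b = p t x]] = setT.
Proof.
have [p_rep gen _] := p_full; set X := [set b | _].
have cL := closed_span_subspace X.
have mulX b c : X b -> X c -> X (cmul b c).
  move=> [t [x [tS tx ->]]] [u [y [uS uy ->]]].
  exists (S_mul t u), (conv x y); split; last by case: p_rep => _ h _ _; apply: (h).
    exact: (in_S_mul X_hausdorff A).
  by apply: uspan_sub; exists x, y.
apply: gen; last by move=> t x tS tx; apply: closed_span_sub; exists t, x.
split=> //.
- have h1 b : X b -> forall c, closed_span X c -> closed_span X (cmul b c).
    move=> Xb c /(_ [set c | closed_span X (cmul b c)]); apply.
      apply: (preimage_subspace (M := nr b)) => //; [by move=> *; rewrite cmul_linr|exact: nr_ge0|].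
      exact: cnormM.
    by move=> d Xd; apply: closed_span_sub; apply: mulX.
  move=> b c hb hc; move: hb => /(_ [set b | closed_span X (cmul b c)]); apply.
    apply: (preimage_subspace (f := fun b => cmul b c) (M := nr c)) => //.
    + by move=> *; rewrite cmul_linl.
    + exact: nr_ge0.
    + by move=> x; rewrite mulrC; exact: cnormM.
  by move=> d Xd; apply: h1.
- have [L0 Ll /closed_epsP Lc] := cL.
  move=> b /(_ [set b | closed_span X (cstar b)]); apply.
    split=> /=; first by rewrite cstar0.
      by move=> k x y hx hy; rewrite /= cstar_lin; apply: Ll.
    apply/closed_epsP => x hx; apply: Lc => e e0; have [y hy xy] := hx e e0.
    by exists (cstar y) => //; rewrite -cstarN -cstarD nr_cstar.
  move=> _ [t [x [tS tx ->]]]; apply: closed_span_sub.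
  exists (star_set t), (sec_star x); split; first exact: in_S_star A _ tS.
    by rewrite /star_set /= sec_starK.
  exact: (bim_star X_hausdorff A p_rep tS tx).
Qed.
End DenseSpan.

(** * Extending states by the canonical expectation *)

Lemma filter_limit (R : realType) (T : Type) (W : set_system T) (g : T -> R[i]^o) (m l : R[i]^o) :
  ProperFilter W -> g u @[u --> W] --> m ->
  (forall e : R, 0 < e -> W [set u | cn (g u - l) <= e]) -> m = l.
Proof.
move=> pW gm h; apply/eqP; rewrite -subr_eq0; apply/eqP/cn_small => e e0.
have e2 : 0 < e / 2 by lra.
have n1 : W [set u | nr (m - g u) < e / 2].
  by apply: (gm [set z | nr (m - z) < e / 2]); apply: (@nr_near R R[i]^o m _).2; exists (e / 2).
have [u [/= h1 h2]] := filter_ex (filterI n1 (h (e / 2) e2)).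
have -> : m - l = (m - g u) + (g u - l) by rewrite addrA subrK.
have h1' : cn (m - g u) < e / 2 := h1.
by apply: le_trans (cnD _ _) _; lra.
Qed.

Section Functionals.
Variables (R : realType) (A : cstarAlg R).

Lemma bounded_functional_le (f : A -> R[i]^o) : linear f ->
  (forall a, cn (f a) <= nr a) -> bounded_functional f.
Proof.
move=> fl fle; split=> // x U /nr_near[e e0 hU]; apply/nr_near; exists e => // y xy.
apply: hU; apply: le_lt_trans xy.
have -> : f x - f y = f (x - y).
  by rewrite [x - y]addrC -[- y]scaleN1r fl scaleN1r addrC.
exact: fle.
Qed.

Lemma state_bounded_functional (f : A -> R[i]^o) : state f -> bounded_functional f.
Proof. by move=> fs; apply: bounded_functional_le; [case: fs => -[]|exact: state_le]. Qed.

Lemma state_nonzero (f : A -> R[i]^o) : state f -> exists a, f a <> 0.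
Proof.
move=> [_ _ f1]; apply: contrapT => /forallNP h.
have : (1 : R[i]) <= 0; last by rewrite ler10.
by apply: f1 => a; rewrite mul0r; have /contrapT -> := h a; rewrite normr0.
Qed.
End Functionals.

Lemma comp_hom (R : realType) (A B D : cstarAlg R) (g : A -> B) (h : B -> D) :
  star_hom g -> star_hom h -> star_hom (fun a => h (g a)).
Proof.
move=> hg hh; split.
- by move=> k a b; rewrite (hom_linear hg) (hom_linear hh).
- by move=> a b; rewrite (homM hg) (homM hh).
- by move=> a; rewrite (homS hg) (homS hh).
Qed.

Section Expectation.
Variables (R : realType) (G : etale_groupoid) (F : fell_bundle R G).
Hypothesis X_hausdorff : hausdorff_space (gunits G).
Variable A : unit_algebra F.
Variables (Cf Cr B : cstarAlg R) (p : set (section F) -> section F -> Cf).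
Hypothesis p_rep : bimodule_rep p.
Variable E : Cf -> (A -> R[i]^o) -> R[i]^o.
Hypothesis E_exp : canonical_expectation p E.
Variables (L : Cf -> Cr) (q : Cf -> B) (q' : B -> Cr).
Hypothesis L_red : reduced_quotient E L.
Hypothesis q_hom : star_hom q.
Hypothesis q_surj : set_surj setT setT q.
Hypothesis q'q : forall b, q' (q b) = L b.
Implicit Types (x y z : section F) (t u v : set (section F)) (a : A) (k : R[i]).
Local Notation one := (@unit_sections R G F).
Local Notation coef := (@unit_coef R G F A Cf p).
Let j a : B := q (coef a).

Lemma I1_closed t : closed_ideal (I1 (A := A) t).
Proof.
apply: closed_span_ideal => a b [v [vS vt v1 Jb]]; exists v; split=> //;
  have [_ Jl Jr] := s_ideal_closed A v; [exact: Jl|exact: Jr].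
Qed.

Lemma I1_one a : I1 one a.
Proof.
by apply: closed_span_sub; exists one; split=> //; try exact: (one_in_S A);
  apply: s_ideal_sup; [exact: (one_in_S A)|exact: sec_one].
Qed.

Lemma quot_lift (b : B) : exists c, q c = b.
Proof. by have [c _ <-] := q_surj (t := b) I; exists c. Qed.

Lemma inclusion_hom : star_hom j.
Proof. exact (comp_hom (coef_hom X_hausdorff A p_rep) q_hom). Qed.

Variable f : A -> R[i]^o.
Hypothesis f_state : state f.
Let f_bdd := state_bounded_functional f_state.

(** [E] lives on [Cf], so an arbitrary preimage under [q] is inserted. The choice is irrelevant
    because the kernel of [q] lies in that of [L] and hence in that of [E]. *)
Definition expected : B -> R[i]^o := fun b => E (xget 0 [set c | q c = b]) f.

Lemma E_lin k (c d : Cf) : E (k *: c + d) f = k * E c f + E d f.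
Proof. by case: E_exp => -[_ h] _ _ _; apply: (h). Qed.

Lemma expectedE c : expected (q c) = E c f.
Proof.
rewrite /expected; set d := xget _ _.
have qd : q d = q c.
  by apply: (xgetPex 0 (P := [set d | q d = q c])); exists c.
have [Lh _ Lk _] := L_red.
have : bidual_kernel E (d - c).
  apply: Lk => /=; rewrite (homD Lh) (homN Lh) -!q'q qd subrr //.
move=> /(_ f f_bdd); rewrite addrC -scaleN1r E_lin mulN1r addrC => /eqP.
by rewrite subr_eq0 => /eqP.
Qed.

Lemma expected_positive : positive_functional expected.
Proof.
split=> [k b d|b].
  have [c <-] := quot_lift b; have [c' <-] := quot_lift d.
  by rewrite -(hom_linear q_hom) !expectedE E_lin.
have [c <-] := quot_lift b; rewrite -(homS q_hom) -(homM q_hom) expectedE.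
have [_ _ cp _] := E_exp.
have := cp 1%N (fun _ _ => c) (fun _ _ => f); rewrite !big_ord1; apply=> // a.
by rewrite !big_ord1; case: f_state => -[_ h] _ _; apply: (h).
Qed.

Lemma E_contractive c : cn (E c f) <= nr c.
Proof.
have [_ ct _ _] := E_exp; have := ct c f 1 f_bdd ler01.
rewrite mul1r cnE nrE lecR; apply => a; rewrite mul1r.
by case: f_state.
Qed.

(** Contractivity of [E] only bounds the value by the norm of a preimage in [Cf]. The norm in the
    quotient [B] enters through left multiplication by [b]: writing $\psi$ for [expected],
    $\psi(v^*b^*bv)\le\|b\|^2\psi(v^*v)\le\|b\|^2$, with [v] from an approximate unit of [Cf]. *)
Lemma expected_le b : cn (expected b) <= nr b.
Proof.
have [c qc] := quot_lift b.
pose phi : Cf -> R[i]^o := fun c => E c f.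
have phi_pos : positive_functional phi.
  split=> [k d d'|d]; first exact: E_lin.
  by rewrite /phi -expectedE (homM q_hom) (homS q_hom); case: expected_positive => _; apply.
have qpos := expected_positive.
have key : Re (expected (cmul (cstar b) b)) <= nr b ^+ 2.
  apply/ler_addgt0Pr => e e0.
  have [d dE] : exists d, d = cmul (cstar c) c by eexists.
  have sa : cstar d = d by rewrite dE !cstarE.
  have [v [sv v1 hv]] := approx_left d (e := e / 2) ltac:(lra).
  have av : nr (d - cmul (cmul v d) v) <= e.
    have -> : d - cmul (cmul v d) v = cstar (d - cmul v d) + cmul (d - cmul v d) v.
      by rewrite !cstarE sa sv !cmulE; lmod.
    have := nrD (cstar (d - cmul v d)) (cmul (d - cmul v d) v); rewrite nr_cstar.
    have := cnormM (d - cmul v d) v; have := nr_ge0 (d - cmul v d).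
    by nra.
  have h1 : Re (phi (cmul (cmul v d) v)) <= nr b ^+ 2.
    have := action_contraction (fform_si qpos) (fform_action expected) b (q v).
    have -> : sq (fform expected) (cmul b (q v)) = Re (phi (cmul (cmul v d) v)).
      rewrite /sq /fform /phi -expectedE -qc dE !(homM q_hom) !(homS q_hom).
      by rewrite !cstarE -{3}sv (homS q_hom) !cmulE.
    have : sq (fform expected) (q v) <= 1.
      rewrite /sq /fform -(homS q_hom) -(homM q_hom) expectedE.
      have := E_contractive (cmul (cstar v) v); rewrite cnorm_sq.
      have := cn_Re (E (cmul (cstar v) v) f); have := ler_norm (Re (E (cmul (cstar v) v) f)).
      have := nr_ge0 v; nra.
    by have := sqr_ge0 (nr b); nra.
  have h2 : Re (phi d) - Re (phi (cmul (cmul v d) v)) <= e.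
    have := E_contractive (d - cmul (cmul v d) v).
    rewrite -/(phi _) (fD phi_pos) (fN phi_pos).
    have := cn_Re (phi d - phi (cmul (cmul v d) v)).
    have := ler_norm (Re (phi d - phi (cmul (cmul v d) v))).
    by rewrite raddfB /=; lra.
  have -> : expected (cmul (cstar b) b) = phi d.
    by rewrite -qc -(homS q_hom) -(homM q_hom) expectedE dE.
  lra.
apply: le_sqr_le (nr_ge0 _) _; apply: le_trans key.
rewrite -qc -(homS q_hom) -(homM q_hom) !expectedE.
exact: f_cs phi_pos E_contractive c.
Qed.

Lemma E_limit t x (l : R[i]^o) : in_S t -> t x ->
  (forall e : R, 0 < e -> forall W, approximate_unit (I1 t) W ->
     W [set u : A | cn (f (to_A A (conv x (sec u))) - l) <= e]) -> E (p t x) f = l.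
Proof.
move=> tS tx h; have [W hW] := exists_approximate_unit (I1_closed t).
have [_ _ _ lim] := E_exp; have pW : ProperFilter W by case: hW.
apply: (@filter_limit R A W (fun u : A => f (to_A A (conv x (sec u)))) _ l pW).
  exact: lim.
by move=> e e0; exact: h.
Qed.

Lemma expected_j a : expected (j a) = f a.
Proof.
rewrite expectedE; apply: E_limit; [exact: (one_in_S A)|exact: sec_one|].
move=> e e0 W [pW _ hW]; have [h _] := hW a (I1_one a).
have n1 : W [set u | nr (a - cmul a u) < e].
  by apply: (h [set z | nr (a - z) < e]); apply: (@nr_near R A a _).2; exists e.
apply: filterS n1 => u /=; rewrite -secM to_A_sec => hu.
have fp : positive_functional f by case: f_state.
rewrite -cnN opprB -(fN fp) -(fD fp); apply: le_trans (state_le f_state _) (ltW hu).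
Qed.

Lemma extension_state (psi : B -> R[i]^o) : positive_functional psi ->
  (forall b, cn (psi b) <= nr b) -> (forall a, psi (j a) = f a) -> state psi.
Proof.
move=> psi_pos psi_le psi_j; split=> // [b|M hM]; first by rewrite cnE nrE lecR.
have [a0 fa0] := state_nonzero f_state.
have M0 : 0 < M.
  have h := hM (j a0); rewrite psi_j in h.
  have : 0 < M * `|j a0| by apply: lt_le_trans h; rewrite normr_gt0; apply/eqP.
  have : 0 <= `|j a0| by [].
  rewrite le_eqVlt => /predU1P[<-|h0]; first by rewrite mulr0 ltxx.
  by rewrite pmulr_lgt0.
case: f_state => _ _; apply=> a; rewrite -psi_j; apply: le_trans (hM _) _.
rewrite ler_wpM2l ?(ltW M0)// !nrE lecR.
exact: hom_contraction inclusion_hom _.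
Qed.

Lemma expected_state : state expected.
Proof. exact: extension_state expected_positive expected_le expected_j. Qed.

(** For [u] in [I1 t] the product $xu$ lies in [A] and is a limit of sums of elements of ideals
    $v\subseteq t\cap A$, on which [f] vanishes. So the net that defines the expectation is zero. *)
Lemma expected_eq0 t x : in_S t -> t x ->
  (forall v b, in_S v -> v `<=` t -> v `<=` one -> v (sec b) -> f b = 0) ->
  expected (q (p t x)) = 0.
Proof.
move=> tS tx fv; have fp : positive_functional f by case: f_state.
have bx := S_bsupp A tS tx.
have [M xM] := S_bounded A tS tx.
have M0 : 0 < `|M| + 1 by have := normr_ge0 M; lra.
have xM' g : nr (x g) <= `|M| + 1 by have := xM g; have := ler_norm M; lra.
have key : forall b : A, I1 t b -> exists2 a, sec a = conv x (sec b) & f a = 0.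
  move=> b /(_ [set b : A | exists2 a : A, sec a = conv x (sec b) & f a = 0]); apply.
    split=> /=.
    - exists 0; last exact: (f0 fp).
      have s0 : sec (0 : A) = sec0 F.
        have := sec_linear (-1) (0 : A) 0; rewrite scaler0 addr0 => ->.
        by apply: section_ext => g; rewrite /sec_lin /sec0 scaleN1r addNr.
      rewrite s0; apply: section_ext => g; congr pt; apply/esym.
      by apply: conv_eq0 => h hg; rewrite ?s0; apply: fmul0r; exact: inv_comp.
    - move=> k b1 b' [a aE fa] [a' aE' fa']; exists (k *: a + a').
        by rewrite !sec_linear conv_lin_r// aE aE'.
      by rewrite (flin fp) fa fa' mulr0 addr0.
    - apply/closed_epsP => c hc.
      have near_c (e : R) : 0 < e -> exists a, [/\ one (sec a), f a = 0 &
          forall g, nr (conv x (sec c) g - sec a g) <= e].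
        clear b; move=> e0; have [b [a aE fa] bc] := hc (e / (`|M| + 1)) ltac:(exact: divr_gt0).
        exists a; split=> //; first exact: sec_one.
        move=> g; rewrite aE.
        have -> : conv x (sec c) g - conv x (sec b) g = conv x (sec (c - b)) g.
          by rewrite secB conv_lin_r// /sec_lin scaleN1r addrC.
        have -> : e = (`|M| + 1) * (e / (`|M| + 1)) by rewrite mulrC divfK ?gt_eqF.
        apply: nr_conv => // h; exact: le_trans (sec_nr_le _ _) (ltW bc).
      have oc : one (conv x (sec c)).
        apply: ulim => [|e e0]; first exact: (S_uclosed A (one_in_S A)).
        by have [a [oa _ ha]] := near_c e e0; exists (sec a).
      exists (to_A A (conv x (sec c))); first by rewrite sec_to_A.
      apply: cn_small => e e0; have [a [oa fa ha]] := near_c e e0.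
      rewrite -[f _]subr0 -fa -(fN fp) -(fD fp); apply: le_trans (state_le f_state _) _.
      apply/sec_norm; first exact: ltW.
      move=> g; rewrite secB sec_to_A// /sec_lin scaleN1r addrC; exact: ha.
  move=> b' [v [vS vt v1 Jb]]; have vb := s_ideal_sub vS v1 Jb.
  have [_ vxb] := bim_cross X_hausdorff p_rep tS vS vt v1 tx vb.
  exists (to_A A (conv x (sec b'))); first by rewrite sec_to_A//; exact: v1.
  by apply: (fv v) => //; rewrite sec_to_A//; exact: v1.
rewrite expectedE; apply: E_limit => // e e0 W [pW hu _].
apply: filterS hu => u [/key[a aE fa] _ _] /=.
by rewrite -aE to_A_sec fa subrr cn0 (ltW e0).
Qed.
End Expectation.

(** * The spectrum and germs *)

Section Classes.
Variables (R : realType) (A : cstarAlg R).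
Implicit Types (rho sigma tau : rep A) (x : spectrum A) (J : set A).

Lemma equivalent_refl rho : unitarily_equivalent rho rho.
Proof. by exists id; split=> // k; exists k. Qed.

Lemma equivalent_sym rho sigma : unitarily_equivalent rho sigma -> unitarily_equivalent sigma rho.
Proof.
move=> [V [Vl Vi Vs Va]].
have inj h h' : V h = V h' -> h = h'.
  by move=> e; apply: ip_ext => z; rewrite -!Vi e.
have [W hW] : exists W : rep_space sigma -> rep_space rho, forall k, V (W k) = k.
  by exists (fun k => xget 0 [set h | V h = k]) => k; have [h hk] := Vs k;
    apply: (xgetPex 0 (P := [set h | V h = k])); exists h.
exists W; split.
- by move=> k h h'; apply: inj; rewrite Vl !hW.
- by move=> h h'; rewrite -Vi !hW.
- by move=> k; exists (V k); apply: inj; rewrite hW.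
- by move=> a h; apply: inj; rewrite Va !hW.
Qed.

Lemma equivalent_trans rho sigma tau : unitarily_equivalent rho sigma ->
  unitarily_equivalent sigma tau -> unitarily_equivalent rho tau.
Proof.
move=> [V [Vl Vi Vs Va]] [W [Wl Wi Ws Wa]]; exists (W \o V); split=> /=.
- by move=> k h h' /=; rewrite Vl Wl.
- by move=> h h'; rewrite Wi Vi.
- by move=> k; have [h <-] := Ws k; have [h' <-] := Vs h; exists h'.
- by move=> a h; rewrite Va Wa.
Qed.

Lemma class_equivalent x rho sigma : in_class x rho -> in_class x sigma ->
  unitarily_equivalent rho sigma.
Proof.
case: x => c [r [ir ce]]; rewrite /in_class /= ce => h1 h2.
exact: equivalent_trans (equivalent_sym h1) h2.
Qed.

Lemma class_rep x : exists2 rho, irreducible rho & in_class x rho.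
Proof.
case: x => c [r [ir ce]]; exists r => //; rewrite /in_class /= ce.
exact: equivalent_refl.
Qed.

Lemma equivalent_nonzero rho sigma J : unitarily_equivalent rho sigma ->
  nonzero_on sigma J -> nonzero_on rho J.
Proof.
move=> [V [Vl Vi Vs Va]] [a [h [Ja n0]]]; have [k kh] := Vs h.
exists a, k; split=> // r0; apply: n0; rewrite -kh -Va r0.
by have := Vl (-1) 0 0; rewrite scaler0 addr0 scaleN1r addNr.
Qed.

Lemma hatP x rho J : in_class x rho -> hat J x <-> nonzero_on rho J.
Proof.
move=> xr; split=> [[s [xs]]|h]; last by exists rho.
by apply: equivalent_nonzero; apply: class_equivalent xr xs.
Qed.

Lemma exists_class rho : irreducible rho -> exists x, in_class x rho.
Proof.
move=> ir; exists (exist _ (unitarily_equivalent rho) (ex_intro _ rho (conj ir erefl))).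
exact: equivalent_refl.
Qed.

Lemma equivalent_invariant rho sigma : unitarily_equivalent rho sigma ->
  irreducible rho -> irreducible sigma.
Proof.
move=> [V [Vl Vi Vs Va]] [[a [h n0]] inv].
have V0 : V 0 = 0 by have := Vl (-1) 0 0; rewrite scaler0 addr0 scaleN1r addNr.
have Vn h' : nr (V h') <= 1 * nr h'.
  by rewrite mul1r; apply: le_sqr_le; rewrite ?nr_ge0// -!ip_sq /sq Vi.
split.
  exists a, (V h); rewrite -Va -[X in _ <> X]V0 => e; apply: n0.
  by apply: ip_ext => z; rewrite -!Vi e.
move=> L cL iL; have [|||] := inv [set h | L (V h)].
- exact: preimage_subspace Vl ler01 Vn cL.
- by move=> a' h' /= Lh; rewrite Va; apply: iL.
- move=> e; left; apply/seteqP; split=> [k Lk|_ ->]; last by case: cL.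
  have [h' h'k] := Vs k; have : [set h | L (V h)] h' by rewrite /= h'k.
  by rewrite e /= => h0; rewrite -h'k h0 V0.
- move=> e; right; apply/seteqP; split=> // k _; have [h' <-] := Vs k.
  by have : [set h | L (V h)] h' by rewrite e.
Qed.

Lemma class_irreducible x rho : in_class x rho -> irreducible rho.
Proof.
move=> xr; have [s ir xs] := class_rep x.
by apply: equivalent_invariant ir; apply: class_equivalent xs xr.
Qed.

Lemma rep_kernel_ideal rho : closed_ideal [set a | forall h, rho a h = 0].
Proof.
split=> /=.
- split=> /=.
  + by move=> h; rewrite repE.
  + by move=> k a b ha hb h; rewrite rep_linl ha hb scaler0 addr0.
  + apply/closed_epsP => a ha h; apply: nr_small => e e0.
    have h0 := nr_ge0 h.
    have [b /= hb ab] := ha (e / (nr h + 1)) (divS_gt0 e0 h0).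
    have -> : rho a h = rho (a - b) h by rewrite !repE hb subr0.
    apply: le_trans (rep_contraction _ _) _.
    by rewrite mulrC; exact: ltW (mul_divS_lt h0 (nr_ge0 _) ab).
- by move=> a b hb h; rewrite repM hb repE.
- by move=> a b hb h; rewrite repM hb.
Qed.

(* The vectors annihilated by X form an invariant subspace. *)
Lemma irreducible_action rho (X : set A) : irreducible rho ->
  (forall a c, X c -> X (cmul c a)) -> nonzero_on rho X ->
  forall k, k <> 0 -> exists2 c, X c & rho c k <> 0.
Proof.
move=> [_ inv] Xr [c0 [h0 [Xc0 n0]]] k k0; apply: contrapT => /forallPNP nk.
have [|||] := inv [set h | forall c, X c -> rho c h = 0].
- split=> /=.
  + by move=> c _; rewrite repE.
  + by move=> l h h' Lh Lh' c Xc; rewrite rep_linr Lh// Lh'// scaler0 addr0.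
  + apply/closed_epsP => h hh c Xc; apply: nr_small => e e0.
    have c00 := nr_ge0 c.
    have [h' /= Lh' hh'] := hh (e / (nr c + 1)) (divS_gt0 e0 c00).
    have -> : rho c h = rho c (h - h') by rewrite !repE Lh'// subr0.
    apply: le_trans (rep_contraction _ _) _.
    exact: ltW (mul_divS_lt c00 (nr_ge0 _) hh').
- by move=> a h Lh c Xc /=; rewrite -repM; apply: Lh; apply: Xr.
- move=> e; apply: k0.
  have : [set h | forall c, X c -> rho c h = 0] k.
    by move=> c Xc; apply: contrapT; exact: nk.
  by rewrite e.
- move=> e; apply: n0.
  have : [set h | forall c, X c -> rho c h = 0] h0 by rewrite e.
  by apply.
Qed.
End Classes.

Section Germs.
Variables (R : realType) (G : etale_groupoid) (F : fell_bundle R G).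
Hypothesis X_hausdorff : hausdorff_space (gunits G).
Variable A : unit_algebra F.
Implicit Types (y z : section F) (t u v w : set (section F)) (a b c : A) (x : spectrum A).
Implicit Types (rho : rep A).
Local Notation one := (@unit_sections R G F).
Let hX := X_hausdorff.

Definition inner_set t : set A :=
  [set a | exists y z, [/\ t y, t z & sec a = conv (sec_star y) z]].

Lemma hat_inner rho t : nonzero_on rho (s_ideal t) -> nonzero_on rho (inner_set t).
Proof.
move=> [a [h [sa n0]]]; apply: contrapT => nz; apply: n0.
apply: (sa [set a | forall h, rho a h = 0]); first exact: rep_kernel_ideal.
by move=> b Xb k; apply: contrapT => n0; apply: nz; exists b, k.
Qed.

Lemma inner_set_right t a c : in_S t -> inner_set t c -> inner_set t (cmul c a).
Proof.
move=> tS [y [z [ty tz cE]]]; exists y, (conv z (sec a)); split=> //.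
  exact: (S_right tS).
by rewrite secM cE convA//; [exact: star_bsupp (S_bsupp A tS ty)|exact: sec_bsupp].
Qed.

Lemma nonzero_cap rho t v w : irreducible rho -> in_S t -> in_S v -> in_S w ->
  v `<=` t -> w `<=` t -> nonzero_on rho (s_ideal v) -> nonzero_on rho (s_ideal w) ->
  nonzero_on rho (s_ideal (v `&` w)).
Proof.
move=> ir tS vS wS vt wt /hat_inner nv /hat_inner nw.
have [k k0] : exists k : rep_space rho, k <> 0.
  by case: nv => a [h [_ n0]]; exists (rho a h).
have [c [w1 [w2 [ww1 ww2 cE]]] n1] :=
  irreducible_action ir (fun a c => @inner_set_right w a c wS) nw k0.
have [b [y1 [y2 [vy1 vy2 bE]]] n2] :=
  irreducible_action ir (fun a c => @inner_set_right v a c vS) nv n1.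
have [d [w3 [w4 [ww3 ww4 dE]]] n3] :=
  irreducible_action ir (fun a c => @inner_set_right w a c wS) nw n2.
have cap y (e : A) z1 z2 : v y -> w z1 -> w z2 -> sec e = conv (sec_star z1) z2 ->
    (v `&` w) (conv y (sec e)).
  move=> vy wz1 wz2 eE; split; first exact: (S_right vS).
  have b1 := S_bsupp A vS vy; have b2 := S_bsupp A wS wz2.
  rewrite eE -(convA _ b1 b2).
  have o : one (conv y (sec_star z1)).
    by apply: (inner_left hX A tS); [exact: vt|exact: wt].
  by rewrite -(sec_to_A A o); apply: (S_left wS).
exists (cmul d (cmul b c)), k; split; last by rewrite !repM.
have dS : sec (cstar d) = conv (sec_star w4) w3.
  by rewrite secS dE (conv_starE _ (star_bsupp (S_bsupp A wS ww3))) sec_starK.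
apply: (s_ideal_inner (x := conv y1 (sec (cstar d))) (y := conv y2 (sec c))).
- exact: cap dS.
- exact: cap cE.
have by1 := S_bsupp A vS vy1; have by2 := S_bsupp A vS vy2.
have bc := sec_bsupp c; have bd := sec_bsupp d; have bys := star_bsupp by1.
have b2c : bsupp (conv y2 (sec c)) by apply: (S_bsupp A vS); exact: (S_right vS).
by rewrite (conv_starE _ by1) -secS cstarK !secM bE (convA _ bys bc) (convA _ bd b2c).
Qed.

Lemma germ_eq x t u : in_S t -> in_S u -> germ x t u -> germ x u = germ x t.
Proof.
move=> tS uS [_ hu [v [vS vt vu hv]]].
have [rho ir xr] := class_rep x.
apply/seteqP; split=> r [rS hr [w [wS w1 w2 hw]]]; split=> //;
  exists (v `&` w); split.
- exact: in_S_cap.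
- by move=> y [/vt].
- by move=> y [_ /w2].
- apply/(hatP _ xr); move: hv hw => /(hatP _ xr) nv /(hatP _ xr) nw.
  exact: (nonzero_cap ir uS).
- exact: in_S_cap.
- by move=> y [/vu].
- by move=> y [_ /w2].
- apply/(hatP _ xr); move: hv hw => /(hatP _ xr) nv /(hatP _ xr) nw.
  exact: (nonzero_cap ir tS).
Qed.

Lemma hat_mono x u v : in_S u -> in_S v -> v `<=` u -> hat (s_ideal (A := A) v) x ->
  hat (s_ideal (A := A) u) x.
Proof.
move=> uS vS vu [rho [xr [a [h [sa n0]]]]]; exists rho; split=> //; exists a, h; split=> //.
by move=> J cJ XJ; apply: sa => // b [y [z [vy vz bE]]]; apply: XJ; exists y, z; split=> //; exact: vu.
Qed.
End Germs.

(** * Unique extension implies trivial isotropy *)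

Section SpanLemmas.
Variables (R : realType).

Lemma span_ip_ext (H : hilbert R) (X : set H) (u v : H) : closed_span X = setT ->
  (forall z, X z -> ip u z = ip v z) -> u = v.
Proof.
move=> Xt h; apply: ip_ext => z.
have lin := ip_si H.
have : closed_span X z by rewrite Xt.
move=> /(_ [set z | ip u z = ip v z]); apply => //.
have key a : ip u a = ip v a <-> ip (u - v) a = 0.
  by rewrite (siDl lin) (siNl lin); split=> [->|h0]; [exact: subrr|exact: subr0_eq].
split=> /=.
- by rewrite !(si0r lin).
- by move=> k x y hx hy; rewrite !(siDr lin) !(siZr lin) hx hy.
- apply/closed_epsP => x hx; apply/key/cn_small => e e0.
  have n0 := nr_ge0 (u - v).
  have [y /key hy xy] := hx (e / (nr (u - v) + 1)) (divS_gt0 e0 n0).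
  have -> : ip (u - v) x = ip (u - v) (x - y).
    by rewrite (siDr lin) (siNr lin) hy subr0.
  exact: le_trans (ip_cs _ _) (ltW (mul_divS_lt n0 (nr_ge0 _) xy)).
Qed.

Lemma ip_limit2 (H K : hilbert R) (w : nat -> H) (u : nat -> K) (w0 : H) (u0 : K)
    (P : H -> H) (Q : K -> K) : tends w w0 -> tends u u0 ->
  tends (fun n => P (w n)) (P w0) -> tends (fun n => Q (u n)) (Q u0) ->
  (forall m n, ip (w m) (P (w n)) = ip (u m) (Q (u n))) -> ip w0 (P w0) = ip u0 (Q u0).
Proof.
move=> ww uu Pw Qu h.
have h1 m : ip (w m) (P w0) = ip (u m) (Q u0).
  apply: ctends_uniq (ip_tendsr (w m) Pw) _.
  by apply: ctends_ext (ip_tendsr (u m) Qu) => n; rewrite h.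
apply: (can_inj (@conjCK _)); rewrite -!ip_herm.
apply: ctends_uniq (ip_tendsr (P w0) ww) _.
by apply: ctends_ext (ip_tendsr (Q u0) uu) => n; rewrite ip_herm -h1 -ip_herm.
Qed.

Lemma tends_rep (A : cstarAlg R) (rho : rep A) a (w : nat -> rep_space rho) w0 :
  tends w w0 -> tends (fun n => rho a (w n)) (rho a w0).
Proof.
move=> ww e e0; have a0 := nr_ge0 a.
have [N hN] := ww (e / (nr a + 1)) (divS_gt0 e0 a0).
exists N => n /hN h.
have -> : rho a (w n) - rho a w0 = rho a (w n - w0) by rewrite !repE.
exact: le_lt_trans (rep_contraction _ _) (mul_divS_lt a0 (nr_ge0 _) h).
Qed.

Lemma cyclic_approx_unit (A : cstarAlg R) (rho : rep A) (xi : rep_space rho) (e : R) :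
  closed_span (range (fun a => rho a xi)) = setT -> 0 < e ->
  exists v, [/\ self_adjoint v, nr v <= 1 & nr (xi - rho v xi) < e].
Proof.
move=> cyc e0; have e4 : 0 < e / 4 by lra.
have [a ha] := cyclic_dense cyc xi e4; have n0 := nr_ge0 xi.
have [v [sv v1 hv]] := approx_left a (e := e / 4 / (nr xi + 1)) (divS_gt0 e4 n0).
exists v; split=> //.
have -> : xi - rho v xi = (xi - rho a xi) + (rho (a - cmul v a) xi - rho v (xi - rho a xi)).
  by rewrite !repE; lmod.
have h1 : nr (rho (a - cmul v a) xi) <= e / 4.
  apply: le_trans (rep_contraction _ _) _; rewrite mulrC.
  exact: ltW (mul_divS_lt n0 (nr_ge0 _) hv).
have h2 : nr (rho v (xi - rho a xi)) <= e / 4.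
  apply: le_trans (rep_contraction _ _) _.
  exact: le_trans (ler_piMl (nr_ge0 _) v1) (ltW ha).
have := nrD (xi - rho a xi) (rho (a - cmul v a) xi - rho v (xi - rho a xi)).
have := nrD (rho (a - cmul v a) xi) (- rho v (xi - rho a xi)); rewrite nrN.
by move: e0 ha h1 h2; clear; lra.
Qed.

Lemma cyclic_norm_le1 (A : cstarAlg R) (rho : rep A) (xi : rep_space rho) :
  closed_span (range (fun a => rho a xi)) = setT ->
  (forall a, cn (ip xi (rho a xi)) <= nr a) -> nr xi <= 1.
Proof.
move=> cyc h; apply: le_sqr_le => //; rewrite expr1n; apply/ler_addgt0Pr => e e0.
have n0 := nr_ge0 xi.
have [v [sv v1 hv]] := cyclic_approx_unit cyc (divS_gt0 e0 n0).
have : ip xi xi = ip xi (xi - rho v xi) + ip xi (rho v xi).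
  by rewrite (siDr (ip_si _)) (siNr (ip_si _)) subrK.
rewrite ip_norm => /(congr1 (@cn R)); rewrite cnR ger0_norm ?sqr_ge0// => ->.
apply: le_trans (cnD _ _) _; have := le_lt_trans (ip_cs xi _) (mul_divS_lt n0 (nr_ge0 _) hv).
by move: (h v) v1; clear; lra.
Qed.

Lemma state_vector_ge1 (A : cstarAlg R) (rho : rep A) (f : A -> R[i]^o) (xi : rep_space rho) :
  state f -> (forall a, f a = ip xi (rho a xi)) -> 1 <= nr xi ^+ 2.
Proof.
move=> [_ _ f1] f_xi; rewrite -lecR; apply: f1 => a.
rewrite cnE nrE -rmorphM lecR f_xi; apply: le_trans (ip_cs _ _) _.
have := rep_contraction a xi; have := nr_ge0 xi; clear; nra.
Qed.
End SpanLemmas.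

(** * Induced representations *)

Section Induced.
Variables (R : realType) (G : etale_groupoid) (F : fell_bundle R G).
Hypothesis X_hausdorff : hausdorff_space (gunits G).
Variable A : unit_algebra F.
Implicit Types (x y z : section F) (t u v : set (section F)) (a b c : A) (k : R[i]).
Implicit Types rho sigma : rep A.
Let hX := X_hausdorff.

Lemma induced_transport t rho rho1 sigma1 sigma : unitarily_equivalent rho rho1 ->
  unitarily_equivalent sigma1 sigma -> induced_rep t rho1 sigma1 ->
  induced_rep t rho sigma.
Proof.
move=> [V [Vl Vi Vs Va]] [W [Wl Wi Ws Wa]] [T [Tl1 Tl2 Ti Tc Ta]].
have Wn h : nr (W h) <= 1 * nr h.
  by rewrite mul1r; apply: le_sqr_le; rewrite ?nr_ge0// -!ip_sq /sq Wi.
exists (fun x h => W (T x (V h))); split.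
- by move=> k x y h tx ty; rewrite Tl1// Wl.
- by move=> k x h h' tx; rewrite Vl Tl2// Wl.
- by move=> x y h h' tx ty; rewrite Wi Ti// -Va Vi.
- apply/seteqP; split=> // k _ L cL XL; have [h <-] := Ws k.
  have : closed_span [set w | exists x h, t x /\ w = T x h] h by rewrite Tc.
  move=> /(_ [set h | L (W h)]); apply; first exact: preimage_subspace Wl ler01 Wn cL.
  move=> _ [x [h' [tx ->]]] /=; have [h2 <-] := Vs h'.
  by apply: XL; exists x, h2.
- by move=> a x h tx; rewrite -Wa Ta.
Qed.

Section InducedSelf.
Variables (t : set (section F)) (rho sigma : rep A).
Variable T : section F -> rep_space rho -> rep_space sigma.
Hypothesis tS : in_S t.
Hypothesis T_lin : forall k x y h, t x -> t y -> T (sec_lin k x y) h = k *: T x h + T y h.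
Hypothesis T_linr : forall k x h h', t x -> T x (k *: h + h') = k *: T x h + T x h'.
Hypothesis T_ip : forall x y h h', t x -> t y ->
  ip (T x h) (T y h') = ip h (rho (to_A A (conv (sec_star x) y)) h').
Hypothesis T_span : closed_span [set w | exists x h, t x /\ w = T x h] = setT.

(** That the tensors are balanced over [A] is not demanded in [induced_rep]. It follows from the
    formula for their inner products, tested against the total set of all tensors. *)
Lemma induced_right x a h : t x -> T (conv x (sec a)) h = T x (rho a h).
Proof.
move=> tx; have txa := S_right tS a tx; have bx := S_bsupp A tS tx.
apply: (span_ip_ext T_span) => _ [y [k [ty ->]]]; have b_y := S_bsupp A tS ty.
rewrite !T_ip// rep_adj -repM; congr (ip _ (rho _ _)); apply: sec_injective.
have o1 := inner_right hX A tS tx ty; have o2 := inner_right hX A tS txa ty.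
rewrite secM !sec_to_A// (conv_starE _ bx) -secS (convA _ (sec_bsupp _) b_y) //.
Qed.

Lemma induced_bounded x : t x -> exists2 M : R, 0 <= M & forall h, nr (T x h) <= M * nr h.
Proof.
move=> tx; set c := to_A A (conv (sec_star x) x).
exists (nr c + 1) => [|h]; first by have := nr_ge0 c; lra.
have n0 := nr_ge0 c; have h0 := nr_ge0 h.
apply: le_sqr_le; first nra.
have e : (nr (T x h) ^+ 2)%:C = ip h (rho c h) by rewrite -ip_norm T_ip.
have : `|nr (T x h) ^+ 2| <= nr h * (nr c * nr h).
  rewrite -cnR e; apply: le_trans (ip_cs _ _) _.
  by rewrite ler_wpM2l// rep_contraction.
rewrite ger0_norm ?sqr_ge0// => l; apply: le_trans l _; rewrite exprMn.
by have := sqr_ge0 (nr h); rewrite mulrCA -expr2 => ?; nra.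
Qed.

(** As $x\otimes\varrho(a)\xi=xa\otimes\xi$, the tensors with second leg [xi] approximate all
    others, and they form a subspace. *)
Lemma induced_cyclic (xi : rep_space rho) :
  closed_span (range (fun a => rho a xi)) = setT ->
  forall (k : rep_space sigma) (e : R), 0 < e -> exists2 x, t x & nr (k - T x xi) < e.
Proof.
move=> cyc k e e0.
pose M := [set k | exists2 x, t x & k = T x xi].
have t0 : t (sec0 F) by case: (S_uclosed A tS).
have M0 : M 0.
  exists (sec0 F) => //.
  have := T_lin (-1) xi t0 t0; rewrite scaleN1r addNr => <-.
  by congr T; apply: section_ext => g; rewrite /sec_lin /sec0 scaleN1r addNr.
have Ml l h h' : M h -> M h' -> M (l *: h + h').
  move=> [x tx ->] [y ty ->]; exists (sec_lin l x y); first exact: (S_lin A tS).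
  by rewrite T_lin.
have cL := closure_eps_subspace M0 Ml.
have : closure_eps M k.
  have : closed_span [set w | exists x h, t x /\ w = T x h] k by rewrite T_span.
  move=> /(_ (closure_eps M) cL); apply => _ [x [h [tx ->]]] d d0.
  have [N N0 hN] := induced_bounded tx.
  have [a ha] := cyclic_dense cyc h (divS_gt0 d0 N0).
  exists (T x (rho a xi)).
    by exists (conv x (sec a)); [exact: (S_right tS)|rewrite induced_right].
  have -> : T x h - T x (rho a xi) = T x (h - rho a xi).
    by rewrite [h - _]addrC -[- rho a xi]scaleN1r T_linr// scaleN1r addrC.
  exact: le_lt_trans (hN _) (mul_divS_lt N0 (nr_ge0 _) ha).
by move=> /(_ e e0)[_ [x tx ->] xk]; exists x.
Qed.
End InducedSelf.
End Induced.

Lemma opp_eq0 (R : realType) (u : R[i]) : u = - u -> u = 0.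
Proof.
by case: u => a b /eqP; rewrite eq_complex /= => /andP[/eqP h1 /eqP h2]; congr Complex; lra.
Qed.

Lemma half_eq (R : realType) (z w : R[i]) : (2^-1 : R)%:C * z = w <-> z = w + w.
Proof.
case: z w => a b [c d]; split=> /eqP; rewrite !eq_complex /= => /andP[/eqP h1 /eqP h2];
  by apply/eqP; rewrite eq_complex /=; apply/andP; split; apply/eqP; lra.
Qed.

Section UniqueExtension.
Variables (R : realType) (G : etale_groupoid) (F : fell_bundle R G).
Hypothesis X_hausdorff : hausdorff_space (gunits G).
Variable A : unit_algebra F.
Variables (Cf B : cstarAlg R) (p : set (section F) -> section F -> Cf).
Hypothesis p_rep : bimodule_rep p.
Variable q : Cf -> B.
Hypothesis q_hom : star_hom q.
Implicit Types (x y z : section F) (a : A) (k : R[i]).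
Local Notation one := (@unit_sections R G F).
Local Notation coef := (@unit_coef R G F A Cf p).
Let hX := X_hausdorff.

Variables (f : A -> R[i]^o) (rho : rep A) (xi : rep_space rho).
Hypothesis f_state : state f.
Hypothesis f_xi : forall a, f a = ip xi (rho a xi).
Hypothesis xi_cyc : closed_span (range (fun a => rho a xi)) = setT.
Variables (t : set (section F)) (T : section F -> rep_space rho -> rep_space rho).
Hypothesis tS : in_S t.
Hypothesis T_lin : forall k x y h, t x -> t y -> T (sec_lin k x y) h = k *: T x h + T y h.
Hypothesis T_linr : forall k x h h', t x -> T x (k *: h + h') = k *: T x h + T x h'.
Hypothesis T_ip : forall x y h h', t x -> t y ->
  ip (T x h) (T y h') = ip h (rho (to_A A (conv (sec_star x) y)) h').
Hypothesis T_span : closed_span [set w | exists x h, t x /\ w = T x h] = setT.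
Hypothesis T_left : forall a x h, t x -> rho a (T x h) = T (conv (sec a) x) h.
Variable psi : B -> R[i]^o.
Hypothesis psi_state : state psi.
Hypothesis psi_j : forall a, psi (q (coef a)) = f a.
Hypothesis psi_t : forall x, t x -> psi (q (p t x)) = 0.

Lemma orthogonal_extension : exists2 psi', state psi' &
  (forall a, psi' (q (coef a)) = f a) /\ psi' <> psi.
Proof.
have psi_pos : positive_functional psi by case: psi_state.
have [Pi [zeta [psi_z z_cyc]]] := gns_exists psi_pos (state_le psi_state).
pose W x := Pi (q (p t x)) zeta.
have W_lin k x y : t x -> t y -> W (sec_lin k x y) = k *: W x + W y.
  by move=> tx ty; rewrite /W (bim_lin p_rep)// (hom_linear q_hom) rep_linl.
have W_ip x y : t x -> t y -> ip (W x) (W y) = ip (T x xi) (T y xi).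
  move=> tx ty; rewrite /W rep_adj -repM -psi_z -(homS q_hom) -(homM q_hom).
  by rewrite (bim_star_coef hX A p_rep)// psi_j f_xi T_ip.
have W_left a x : t x -> Pi (q (coef a)) (W x) = W (conv (sec a) x).
  by move=> tx; rewrite /W -repM -(homM q_hom) (bim_left hX p_rep).
have W_orth a x : t x -> ip (Pi (q (coef a)) zeta) (W x) = 0.
  move=> tx; rewrite rep_adj -(homS q_hom) -(homS (coef_hom hX A p_rep)) W_left//.
  by rewrite /W -psi_z psi_t//; exact: (S_left tS).
have W_nr x : t x -> nr (W x) = nr (T x xi).
  move=> tx; apply/eqP; rewrite -(eqrXn2 (n := 2)) ?nr_ge0//; apply/eqP.
  by rewrite -!ip_sq /sq W_ip.
have [xs txs xs_lim] : exists2 xs : nat -> section F, (forall n, t (xs n)) &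
    tends (fun n => T (xs n) xi) xi.
  have h n : exists x, t x /\ nr (xi - T x xi) < n.+1%:R^-1.
    have n0 : 0 < n.+1%:R^-1 :> R by rewrite invr_gt0 ltr0n.
    have [x tx hx] := induced_cyclic hX tS T_lin T_linr T_ip T_span xi_cyc xi n0.
    by exists x.
  have /choice[xs hxs] := h; exists xs => [n|e e0]; first by case: (hxs n).
  have [N hN] := inv_small e0.
  by exists N => n Nn; have [_ hn] := hxs n; rewrite nrB; apply: lt_trans hn (hN _ Nn).
(* The vectors [W x] have the same inner products as [T x xi], so [W (xs n)] is Cauchy along with
   the convergent [T (xs n) xi]. *)
have [w w_lim] : exists w, tends (fun n => W (xs n)) w.
  apply: rcauchy_tends => e e0; have [N hN] := tends_cauchy xs_lim e0.
  exists N => m n hm hn; have := hN m n hm hn; congr (_ < _).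
  have tmn : t (sec_lin (-1) (xs n) (xs m)) by apply: (S_lin A tS).
  rewrite [T _ _ - _]addrC -scaleN1r -T_lin// -W_nr// W_lin// scaleN1r addrC //.
have w_j a : ip w (Pi (q (coef a)) w) = f a.
  rewrite f_xi; apply: (ip_limit2 w_lim xs_lim (tends_rep _ w_lim) (tends_rep _ xs_lim)).
  move=> m n; rewrite W_left// T_left// W_ip//; exact: (S_left tS).
have w_xi : ip w w = ip xi xi.
  by apply: (ip_limit2 (P := id) (Q := id) w_lim xs_lim w_lim xs_lim) => m n; exact: W_ip.
have w_orth a : ip (Pi (q (coef a)) zeta) w = 0.
  apply: ctends_uniq (ip_tendsr _ w_lim) _.
  by apply: ctends_ext (ctends_cst 0) => n; rewrite W_orth.
have w_zeta : ip zeta w = 0.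
  apply: ctends_uniq (ip_tendsr _ w_lim) _.
  by apply: ctends_ext (ctends_cst 0) => n; rewrite /W -psi_z psi_t.
have si := ip_si (rep_space Pi).
have z1 : nr zeta <= 1.
  by apply: cyclic_norm_le1 z_cyc _ => b; rewrite -psi_z; exact: state_le.
have w1 : nr w <= 1.
  have -> : nr w = nr xi.
    apply/eqP; rewrite -(eqrXn2 (n := 2)) ?nr_ge0//; apply/eqP.
    by rewrite -!ip_sq /sq w_xi.
  by apply: cyclic_norm_le1 xi_cyc _ => b; rewrite -f_xi; exact: state_le.
(* Superpositions with a phase [l] of modulus 1. On [A] the cross terms vanish because [w] is
   orthogonal to $A\zeta$, so every phase extends [f]. *)
pose eta l := zeta + l *: w.
pose phi l : B -> R[i]^o := fun b => (2^-1 : R)%:C * ip (eta l) (Pi b (eta l)).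
have phiE l b : phi l b = (2^-1 : R)%:C * (psi b + l * ip zeta (Pi b w) +
    cj l * ip w (Pi b zeta) + l * cj l * ip w (Pi b w)).
  rewrite /phi /eta psi_z !repE !(siE si); ring.
have phi_j l a : l * cj l = 1 -> phi l (q (coef a)) = f a.
  move=> ll; rewrite phiE ll mul1r w_j psi_j.
  have -> : ip zeta (Pi (q (coef a)) w) = 0.
    rewrite -[a]cstarK (homS (coef_hom hX A p_rep)) (homS q_hom) -rep_adj; exact: w_orth.
  have -> : ip w (Pi (q (coef a)) zeta) = 0 by rewrite ip_herm w_orth rmorph0.
  by rewrite !mulr0 !addr0; apply/half_eq.
have phi_state l : l * cj l = 1 -> state (phi l).
  move=> ll; have half : 0 <= (2^-1 : R)%:C :> R[i] by rewrite ler0c; lra.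
  have cnl : cn l = 1.
    have := congr1 (@cn R) ll; rewrite cnM cn_conj cn1 => h; have := cn_ge0 l; nra.
  have phi_pos : positive_functional (phi l).
    split=> [k b c|b]; first by rewrite /phi rep_linl (siDr si) (siZr si) mulrDr mulrCA.
    rewrite /phi repM; apply: mulr_ge0 => //.
    by rewrite -[b in Pi (cstar b)]cstarK cstarK -rep_adj; exact: si_ge0 si _.
  apply: (extension_state hX p_rep q_hom f_state phi_pos).
    move=> b; rewrite /phi cnM cnR ger0_norm; last by lra.
    have n0 := nr_ge0 (eta l).
    have e2 : nr (eta l) ^+ 2 <= 2.
      rewrite -ip_sq /eta (sqD si) (siZr si) w_zeta mulr0 (sqZ si) cnl !ip_sq.
      have := nr_ge0 w; have := nr_ge0 zeta; rewrite /=; nra.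
    have := ip_cs (eta l) (Pi b (eta l)); have := rep_contraction b (eta l).
    have := nr_ge0 b; move: n0 e2.
    by move: (nr (eta l)) (nr (Pi b (eta l))) (cn _) (nr b) => r1 r2 r3 r4; nra.
  by move=> a; exact: phi_j.
apply: contrapT => nex.
have uniq l : l * cj l = 1 -> phi l = psi.
  move=> ll; apply: contrapT => ne; apply: nex; exists (phi l); first exact: phi_state.
  by split=> // a; apply: phi_j.
have cj1 : cj (1 : R[i]) = 1 by rewrite rmorph1.
have cjN1 : cj (-1 : R[i]) = -1 by rewrite rmorphN rmorph1.
have c1 : (1 : R[i]) * cj (1 : R[i]) = 1 by rewrite cj1 mulr1.
have c2 : (-1 : R[i]) * cj (-1 : R[i]) = 1 by rewrite cjN1 mulrNN mulr1.
have c3 : ('i : R[i]) * cj 'i = 1 by rewrite cji mulrN mulii opprK.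
have cNi : cj (- ('i : R[i])) = 'i by apply/eqP; rewrite eq_complex /= ?oppr0 ?opprK !eqxx.
have c4 : (- ('i : R[i])) * cj (- ('i : R[i])) = 1 by rewrite cNi mulNr mulii opprK.
(* If all these extensions equal [psi], then comparing the phases $\pm1$ and $\pm i$ separates the
   two cross terms, and [w] is orthogonal to the cyclic subspace of [zeta]. Its length is that of
   [xi], a contradiction. *)
have w0 : w = 0.
  apply: (cyclic_ext z_cyc) => b; rewrite (si0l si).
  have h l : l * cj l = 1 -> l * ip zeta (Pi b w) + cj l * ip w (Pi b zeta) =
      psi b - ip w (Pi b w).
    move=> ll; have := congr1 (fun g => g b) (uniq l ll); rewrite /= phiE ll mul1r => e.
    move/half_eq: e => e; apply: (@addrI _ (psi b + ip w (Pi b w))).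
    by rewrite [RHS]addrACA subrr addr0 -e; ring.
  have := h _ c1; rewrite -(h _ c2) cj1 cjN1 !mul1r !mulN1r => e1.
  have := h _ c3; rewrite -(h _ c4) cNi cji !mulNr => e2.
  move: e1 e2; set u := ip zeta _; set v := ip w _ => e1 e2.
  have uv : u = - v.
    have : u + v = 0 by apply: opp_eq0; rewrite opprD.
    by move/eqP; rewrite addr_eq0 => /eqP.
  have ss : 'i * v + 'i * v = 0.
    by apply: opp_eq0; rewrite opprD; move: e2; rewrite uv mulrN opprK => <-.
  have /eqP : 'i * v = 0 by apply: opp_eq0; apply/eqP; rewrite -addr_eq0 ss.
  rewrite mulf_eq0 => /orP[/eqP i0|/eqP //].
  by move: c3; rewrite i0 mul0r => /eqP; rewrite eq_sym oner_eq0.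
have [a fa] := state_nonzero f_state; apply: fa.
have x0 : xi = 0.
  apply: nr_eq0; apply/eqP; rewrite -sqrf_eq0 -ip_sq /sq -w_xi w0 (si0r si) //.
by rewrite f_xi x0 repE (si0r (ip_si _)).
Qed.
End UniqueExtension.

(** * Trivial isotropy implies unique extension *)

Lemma ip_self_eq0 (R : realType) (H : hilbert R) (x : H) : ip x x = 0 -> x = 0.
Proof.
rewrite ip_norm => h; apply: nr_eq0; apply/eqP; rewrite -sqrf_eq0; apply/eqP.
exact: complexI h.
Qed.

Section Intertwiner.
Variables (R : realType) (A B : cstarAlg R) (j : A -> B).
Hypothesis j_hom : star_hom j.
Variables (rho : rep A) (xi : rep_space rho) (Pi : rep B) (zeta : rep_space Pi).
Hypothesis xi_cyc : closed_span (range (fun a => rho a xi)) = setT.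
Hypothesis same : forall a, ip zeta (Pi (j a) zeta) = ip xi (rho a xi).
Implicit Types (a b : A).

Lemma same_ip a b : ip (Pi (j a) zeta) (Pi (j b) zeta) = ip (rho a xi) (rho b xi).
Proof. by rewrite !rep_adj -!repM -(homS j_hom) -(homM j_hom) same. Qed.

(** [V] is the isometry $\varrho(a)\xi\mapsto\Pi(j(a))\zeta$. Its adjoint [U] comes first, from
    Riesz representation on the dense subspace, and [V] is then the adjoint of [U]. *)
Lemma exists_intertwiner : exists U V,
  [/\ (forall k x y, U (k *: x + y) = k *: U x + U y),
      (forall k x y, V (k *: x + y) = k *: V x + V y),
      (forall h k, ip (V h) k = ip h (U k)),
      (forall h, U (V h) = h) &
      [/\ (forall k, nr (U k) <= nr k), U zeta = xi,
          (forall a k, U (Pi (j a) k) = rho a (U k)) &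
          (forall a h, V (rho a h) = Pi (j a) (V h))]].
Proof.
have same_nr a : nr (Pi (j a) zeta) <= 1 * nr (rho a xi).
  by rewrite mul1r; apply: le_sqr_le; rewrite ?nr_ge0// -!ip_sq /sq same_ip.
have [|||U [Ul Ui Un]] := exists_adjoint (iota := fun a => rho a xi)
    (T := fun a => Pi (j a) zeta) _ _ _ ler01 same_nr.
- by move=> k a b; rewrite rep_linl.
- by move=> h e e0; apply: cyclic_dense.
- by move=> k a b; rewrite (hom_linear j_hom) rep_linl.
have [||V [Vl Vi Vn]] := exists_adjoint (iota := @id (rep_space Pi)) (T := U) _ _ Ul ler01 Un.
- by [].
- by move=> h e e0; exists h; rewrite subrr nr0.
have UPi a : U (Pi (j a) zeta) = rho a xi.
  by apply: (cyclic_ext xi_cyc) => b; rewrite Ui same_ip.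
have Urho a k : U (Pi (j a) k) = rho a (U k).
  apply: (cyclic_ext xi_cyc) => b; rewrite Ui !rep_adj -!repM -(homS j_hom) -(homM j_hom) Ui //.
exists U, V; split=> //.
- move=> h; apply: (cyclic_ext xi_cyc) => b; rewrite Ui Vi UPi //.
split=> //; first by move=> k; have := Un k; rewrite mul1r.
- by apply: (cyclic_ext xi_cyc) => b; rewrite Ui same.
- by move=> a h; apply: ip_ext => k; rewrite Vi !rep_adj -(homS j_hom) Vi Urho.
Qed.
End Intertwiner.

Section Dichotomy.
Variables (R : realType) (G : etale_groupoid) (F : fell_bundle R G).
Hypothesis X_hausdorff : hausdorff_space (gunits G).
Variable A : unit_algebra F.
Variables (Cf B : cstarAlg R) (p : set (section F) -> section F -> Cf).
Hypothesis p_rep : bimodule_rep p.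
Variable q : Cf -> B.
Hypothesis q_hom : star_hom q.
Implicit Types (x y z : section F) (a : A).
Local Notation one := (@unit_sections R G F).
Local Notation coef := (@unit_coef R G F A Cf p).
Let hX := X_hausdorff.
Variables (f : A -> R[i]^o) (rho : rep A) (xi : rep_space rho).
Hypothesis f_pure : pure_states f.
Hypothesis f_xi : forall a, f a = ip xi (rho a xi).
Hypothesis xi_cyc : closed_span (range (fun a => rho a xi)) = setT.
Let rho_irr : irreducible rho := pure_irreducible f_pure f_xi xi_cyc.
Variables (t : set (section F)) (psi : B -> R[i]^o).
Hypothesis tS : in_S t.
Hypothesis psi_state : state psi.
Hypothesis psi_j : forall a, psi (q (coef a)) = f a.

(* Let V be the isometry from the space of rho to the GNS space of psi and U its
   adjoint. The compression of the projection onto the closed span K of p_t(x)Vh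
   is a scalar because f is pure; U is injective on K because rho is irreducible.
   Hence x (x) h |-> U p_t(x) V h is a multiple of a unitary from E_t (x) rho to
   rho, unless it vanishes. *)
Lemma extension_dichotomy : (forall x, t x -> psi (q (p t x)) = 0) \/
  (induced_rep t rho rho /\ nonzero_on rho (s_ideal t)).
Proof.
have ch := coef_hom hX A p_rep; have jh := inclusion_hom hX A p_rep q_hom.
have psi_pos : positive_functional psi by case: psi_state.
have [Pi [zeta [psi_z z_cyc]]] := gns_exists psi_pos (state_le psi_state).
have same a : ip zeta (Pi (q (coef a)) zeta) = ip xi (rho a xi).
  by rewrite -psi_z psi_j f_xi.
have [U [V [Ul Vl VU UV [Un Uz Urho Vrho]]]] := exists_intertwiner jh xi_cyc same.
have siK := ip_si (rep_space Pi); have siH := ip_si (rep_space rho).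
pose P_ x := Pi (q (p t x)).
pose Q x h := U (P_ x (V h)).
have V_ip h h' : ip (V h) (V h') = ip h h' by rewrite VU UV.
have P_right x a h : t x -> P_ x (V (rho a h)) = P_ (conv x (sec a)) (V h).
  by move=> tx; rewrite Vrho /P_ -repM -(homM q_hom) (bim_right hX p_rep).
have P_left x a k : t x -> Pi (q (coef a)) (P_ x k) = P_ (conv (sec a) x) k.
  by move=> tx; rewrite /P_ -repM -(homM q_hom) (bim_left hX p_rep).
have P_lin l x y k : t x -> t y -> P_ (sec_lin l x y) k = l *: P_ x k + P_ y k.
  by move=> tx ty; rewrite /P_ (bim_lin p_rep)// (hom_linear q_hom) rep_linl.
have P_ip x y k k' : t x -> t y ->
    ip (P_ x k) (P_ y k') = ip k (Pi (q (coef (to_A A (conv (sec_star x) y)))) k').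
  move=> tx ty; rewrite /P_ rep_adj -repM -(homS q_hom) -(homM q_hom).
  by rewrite (bim_star_coef hX A p_rep).
have U0 : U 0 = 0 by have := Ul (-1) 0 0; rewrite scaler0 addr0 scaleN1r addNr.
have V0 : V 0 = 0 by have := Vl (-1) 0 0; rewrite scaler0 addr0 scaleN1r addNr.
have Q_lin x l h h' : Q x (l *: h + h') = l *: Q x h + Q x h'.
  by rewrite /Q Vl /P_ rep_linr Ul.
have Qx0 x : Q x 0 = 0.
  by have := Q_lin x (-1) 0 0; rewrite scaler0 addr0 scaleN1r addNr.
have [Q0|Qn] := pselect (forall x h, t x -> Q x h = 0).
  left=> x tx.
  (* $\|V\xi-\zeta\|^2=\|\zeta\|^2-\|\xi\|^2\le0$, because $U\zeta=\xi$ and both functionals have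
     norm 1. *)
  have Vxi : V xi = zeta.
    have z1 : nr zeta <= 1.
      by apply: cyclic_norm_le1 z_cyc _ => b; rewrite -psi_z; exact: state_le.
    have x1 := state_vector_ge1 f_pure.1 f_xi.
    apply/eqP; rewrite -subr_eq0; apply/eqP/nr_eq0/eqP; rewrite -sqrf_eq0; apply/eqP.
    apply/le_anti; rewrite sqr_ge0 andbT -ip_sq (sqD siK) (siNr siK) VU Uz.
    rewrite ip_norm !ip_sq nrN.
    have -> : nr (V xi) ^+ 2 = nr xi ^+ 2 by rewrite -!ip_sq /sq V_ip.
    by move: (nr_ge0 zeta) z1 x1; rewrite raddfN /=; nra.
  by rewrite psi_z -{1}Vxi VU -Vxi -/(P_ x) -/(Q x xi) Q0// (si0r siH).
right; move/existsNP: Qn => [y0 /existsNP[h0 /not_implyP[ty0 Qy0]]].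
pose X := [set w | exists x h, t x /\ w = P_ x (V h)].
pose K := closed_span X; have cK : closed_subspace K := closed_span_subspace X.
have XK : X `<=` K := closed_span_sub (X := X).
have PK x h : t x -> K (P_ x (V h)) by move=> tx; apply: XK; exists x, h.
have K_min L : closed_subspace L -> (forall x h, t x -> L (P_ x (V h))) -> K `<=` L.
  by move=> cL hL w; apply => // _ [x [h [tx ->]]]; exact: hL.
have K_inv a k : K k -> K (Pi (q (coef a)) k).
  apply: (K_min [set k | K (Pi (q (coef a)) k)]).
    apply: (preimage_subspace (M := nr (q (coef a)))) => //.
    - by move=> *; rewrite rep_linr.
    - exact: nr_ge0.
    - by move=> x; exact: rep_contraction.
  by move=> x h tx /=; rewrite P_left//; apply: PK; exact: (S_left tS).
have K_orth u : (forall k, K k -> ip u k = 0) -> K u -> u = 0.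
  by move=> uo /uo; exact: ip_self_eq0.
have K_sub u v : K u -> K v -> K (u - v) by move=> Ku Kv; exact: (subspaceB cK Ku Kv).
have [P [Pl PinK Pi_]] := exists_projection cK.
have P_com a k : P (Pi (q (coef a)) k) = Pi (q (coef a)) (P k).
  apply/eqP; rewrite -subr_eq0; apply/eqP/K_orth => [k' Kk'|]; last first.
    by apply: K_sub; [exact: PinK|apply: K_inv; exact: PinK].
  rewrite (siDl siK) (siNl siK) Pi_// !rep_adj Pi_ ?subrr//.
  by rewrite -(homS q_hom) -(homS ch); exact: K_inv.
have PP u v : ip u (P v) = ip (P u) (P v) by rewrite -Pi_.
have [kap kap0 hkap] : exists2 k : R, 0 <= k & forall h, U (P (V h)) = k%:C *: h.
  apply: (pure_commutant f_pure f_xi xi_cyc).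
  - by move=> k h h'; rewrite Vl Pl Ul.
  - by move=> a h; rewrite Vrho P_com Urho.
  - by move=> h; rewrite -VU PP; exact: si_ge0 siK _.
  - move=> h; rewrite -VU PP -/(sq (@ip _ _) _) ip_sq.
    have -> : nr h ^+ 2 = nr (V h) ^+ 2 by rewrite -!ip_sq /sq V_ip.
    have e : (nr (P (V h)) ^+ 2)%:C = ip (V h) (P (V h)) by rewrite -ip_norm [RHS]PP.
    have : nr (P (V h)) ^+ 2 <= nr (V h) * nr (P (V h)).
      by rewrite -(ger0_norm (sqr_ge0 (nr (P (V h))))) -cnR e; exact: ip_cs.
    exact: sqr_le_mul (nr_ge0 _) (nr_ge0 _).
(* The common kernel of the operators [Q x] is invariant under [rho] and does not contain [h0]. *)
have N0 h : (forall x, t x -> Q x h = 0) -> h = 0.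
  have [|||] := rho_irr.2 [set h | forall x, t x -> Q x h = 0].
  - split=> /=.
    + by move=> x _; exact: Qx0.
    + by move=> k u v hu hv x tx; rewrite Q_lin hu// hv// scaler0 addr0.
    + apply/closed_epsP => u hu x tx; apply: nr_small => e e0.
      have n0 := nr_ge0 (q (p t x)).
      have [v /= hv uv] := hu (e / (nr (q (p t x)) + 1)) (divS_gt0 e0 n0).
      have -> : Q x u = Q x (u - v).
        by rewrite addrC -scaleN1r Q_lin hv// scaler0 add0r.
      apply: le_trans (Un _) _; apply: le_trans (rep_contraction _ _) _.
      have -> : nr (V (u - v)) = nr (u - v).
        by apply/eqP; rewrite -(eqrXn2 (n := 2)) ?nr_ge0// -!ip_sq /sq V_ip.
      exact: ltW (mul_divS_lt n0 (nr_ge0 _) uv).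
  - by move=> a u hu x tx /=; rewrite /Q P_right//; apply: hu; exact: (S_right tS).
  - by move=> e hh; have : [set h | forall x, t x -> Q x h = 0] h by []; rewrite e.
  - move=> e _; exfalso; apply: Qy0.
    have : [set h | forall x, t x -> Q x h = 0] h0 by rewrite e.
    by move=> /(_ y0 ty0).
(* Injectivity of [U] on [K]: the adjoint of $p_t(z)$ maps [K] into the range of [V], because
   $p_t(z)^*p_t(x)Vh=V\varrho(z^*x)h$. If $Uk=0$, then $Up_t(x)p_t(z)^*k=\varrho(xz^{*})Uk=0$ for
   all [x], so $p_t(z)^*k=0$ by [N0]. Hence [k] is orthogonal to [K]. *)
have K0 k : K k -> U k = 0 -> k = 0.
  move=> Kk Uk; apply: K_orth => // k' Kk'; move: k' Kk'.
  have adj_range z : t z -> forall u, K u -> V (U (Pi (cstar (q (p t z))) u)) = Pi (cstar (q (p t z))) u.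
    move=> tz; apply: (K_min [set u | V (U (Pi (cstar (q (p t z))) u)) = Pi (cstar (q (p t z))) u]).
      have cL := @preimage_subspace R (rep_space Pi) (rep_space Pi)
        (fun u => V (U (Pi (cstar (q (p t z))) u)) - Pi (cstar (q (p t z))) u)
        (2 * nr (cstar (q (p t z)))) [set 0].
      have -> : [set u | V (U (Pi (cstar (q (p t z))) u)) = Pi (cstar (q (p t z))) u] =
        [set u | [set 0] (V (U (Pi (cstar (q (p t z))) u)) - Pi (cstar (q (p t z))) u)].
        apply/seteqP; split=> u /=; first by move=> ->; rewrite subrr.
        by move/eqP; rewrite subr_eq0 => /eqP.
      apply: cL.
      - by move=> l u v; rewrite rep_linr Ul Vl; lmod.
      - by rewrite mulr_ge0 ?nr_ge0.
      - move=> u; set r := cstar _; have h1 := rep_contraction r u.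
        have h2 : nr (V (U (Pi r u))) <= nr (Pi r u).
          have -> : nr (V (U (Pi r u))) = nr (U (Pi r u)).
            by apply/eqP; rewrite -(eqrXn2 (n := 2)) ?nr_ge0// -!ip_sq /sq V_ip.
          exact: Un.
        by have := nrD (V (U (Pi r u))) (- Pi r u); rewrite nrN; move: h1 h2; lra.
      - by split=> //= [l u v -> ->|]; [rewrite scaler0 addr0|
          apply/closed_epsP => u hu; apply: nr_small => e e0; have [_ -> ] := hu e e0; rewrite subr0 => /ltW].
    move=> x h tx /=; rewrite /P_ -repM -(homS q_hom) -(homM q_hom) (bim_star_coef hX A p_rep)//.
    by rewrite -Vrho UV.
  have adj0 z : t z -> Pi (cstar (q (p t z))) k = 0.
    move=> tz; rewrite -(adj_range z tz k Kk).
    have -> : U (Pi (cstar (q (p t z))) k) = 0; last exact: V0.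
    apply: N0 => x tx; rewrite /Q adj_range// /P_ -repM -(homS q_hom) -(homM q_hom).
    have -> : cmul (p t x) (cstar (p t z)) = coef (to_A A (conv x (sec_star z))).
      by rewrite (bim_outer p_rep)// /unit_coef sec_to_A//; exact: (inner_left hX A tS).
    by rewrite Urho Uk repE.
  apply: (K_min [set k' | ip k k' = 0]).
    split=> /=; first by rewrite (si0r siK).
      by move=> l u v hu hv; rewrite (siDr siK) (siZr siK) hu hv mulr0 addr0.
    apply/closed_epsP => u hu; apply: cn_small => e e0; have n0 := nr_ge0 k.
    have [v /= hv uv] := hu (e / (nr k + 1)) (divS_gt0 e0 n0).
    have -> : ip k u = ip k (u - v) by rewrite (siDr siK) (siNr siK) hv subr0.
    exact: le_trans (ip_cs _ _) (ltW (mul_divS_lt n0 (nr_ge0 _) uv)).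
  by move=> x h tx /=; rewrite /P_ -[p t x]cstarK (homS q_hom) -rep_adj (homS q_hom) adj0// (si0l siK).
(* Both sides lie in [K] and have the same image under the injective [U]. *)
have PVU k : K k -> P (V (U k)) = kap%:C *: k.
  move=> Kk; apply/eqP; rewrite -subr_eq0; apply/eqP/K0.
    by apply: K_sub; [exact: PinK|exact: (subspaceZ _ cK)].
  have UB u v : U (u - v) = U u - U v by rewrite [u - v]addrC -[- v]scaleN1r Ul scaleN1r addrC.
  have UZ l u : U (l *: u) = l *: U u.
    by have := Ul l u 0; rewrite U0 !addr0.
  by rewrite UB UZ hkap subrr.
have Q_ip x y h h' : t x -> t y ->
    ip (Q x h) (Q y h') = kap%:C * ip h (rho (to_A A (conv (sec_star x) y)) h').
  move=> tx ty; rewrite /Q -VU -Pi_; last exact: PK.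
  rewrite PVU; last exact: PK.
  by rewrite (siZl siK) cjR P_ip// -Vrho V_ip.
have kap1 : 0 < kap.
  rewrite lt_neqAle kap0 andbT; apply/eqP => k0; apply: Qy0; apply: ip_self_eq0.
  by rewrite Q_ip// -k0 mul0r.
(* [Q] scales inner products by [kap]; division by its square root turns it into a unitary. *)
pose c : R := (Num.sqrt kap)^-1.
have ckap : c ^+ 2 * kap = 1.
  by rewrite /c exprVn sqr_sqrtr ?ltW// mulVf ?gt_eqF.
have c0 : c != 0 by rewrite /c invr_eq0 sqrtr_eq0 -ltNge.
have Q_left a x h : t x -> rho a (Q x h) = Q (conv (sec a) x) h.
  by move=> tx; rewrite /Q -Urho P_left.
split; last first.
  have ty := ty0; exists (to_A A (conv (sec_star y0) y0)), h0; split.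
    by apply: (s_ideal_inner ty0 ty0); rewrite sec_to_A//; exact: (inner_right hX A tS).
  move=> z0; apply: Qy0; apply: ip_self_eq0.
  by rewrite Q_ip// z0 (si0r siH) mulr0.
exists (fun x h => c%:C *: Q x h); split.
- move=> l x y h tx ty; rewrite /Q P_lin// Ul; lmod.
- move=> l x h h' tx; rewrite Q_lin; lmod.
- move=> x y h h' tx ty; rewrite (siZl siH) (siZr siH) cjR Q_ip// !mulrA -!rmorphM.
  by rewrite -expr2 ckap mul1r.
- have cL := closed_span_subspace [set w | exists x h, t x /\ w = c%:C *: Q x h].
  have [||] := rho_irr.2 _ cL.
  + move=> a h /(_ [set h | closed_span [set w | exists x h, t x /\ w = c%:C *: Q x h] (rho a h)]).
    apply.
      apply: (preimage_subspace (M := nr a)) => //; [by move=> *; rewrite rep_linr|exact: nr_ge0|].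
      by move=> u; exact: rep_contraction.
    move=> _ [x [h' [tx ->]]] /=; apply: closed_span_sub.
    exists (conv (sec a) x), h'; split; first exact: (S_left tS).
    by rewrite -Q_left// repE.
  + move=> e; have : closed_span [set w | exists x h, t x /\ w = c%:C *: Q x h] (c%:C *: Q y0 h0).
      by apply: closed_span_sub; exists y0, h0.
    rewrite e => /eqP; rewrite scaler_eq0 => /orP[/eqP|/eqP //].
    by move=> c00; move: c0; rewrite -(inj_eq (@complexI R)) c00 eqxx.
  + by [].
- by move=> a x h tx; rewrite -Q_left// repE.
Qed.
End Dichotomy.

(** * Pure states with unique extensions *)

Section VectorLemmas.
Variables (R : realType) (A : cstarAlg R) (rho : rep A).

Lemma ideal_dense (J : set A) (xi : rep_space rho) : irreducible rho -> closed_ideal J ->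
  nonzero_on rho J -> xi <> 0 ->
  forall h (e : R), 0 < e -> exists2 c, J c & nr (h - rho c xi) < e.
Proof.
move=> ir cJ nJ xi0 h e e0; have [[J0 Jlin _] Jl Jr] := cJ.
pose M := [set h | exists2 c, J c & h = rho c xi].
have M0 : M 0 by exists 0; rewrite ?repE.
have Ml k u v : M u -> M v -> M (k *: u + v).
  by move=> [a Ja ->] [b Jb ->]; exists (k *: a + b); [exact: Jlin|rewrite rep_linl].
have Mt : closed_span M = setT.
  have cL := closed_span_subspace M; have [||] := ir.2 _ cL.
  - move=> a u /(_ [set u | closed_span M (rho a u)]); apply.
      apply: (preimage_subspace (M := nr a)) => //; [by move=> *; rewrite rep_linr|exact: nr_ge0|].
      by move=> z; exact: rep_contraction.
    move=> _ [c Jc ->]; apply: closed_span_sub.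
    by exists (cmul a c); [exact: Jl|rewrite repM].
  - have [c Jc n0] := irreducible_action ir (fun a c => Jr a c) nJ xi0.
    move=> e'; have : closed_span M (rho c xi) by apply: closed_span_sub; exists c.
    by rewrite e'.
  - by [].
by have [_ [c Jc ->] hc] := closed_span_dense M0 Ml (fun _ => id) Mt h e0; exists c.
Qed.

Lemma unit_vector_neq0 (f : A -> R[i]^o) (xi : rep_space rho) : state f ->
  (forall a, f a = ip xi (rho a xi)) -> xi <> 0.
Proof.
by move=> fs f_xi x0; have := state_vector_ge1 fs f_xi; rewrite x0 nr0 expr0n ler10.
Qed.
End VectorLemmas.

Section Corollary.
Variables (R : realType) (G : etale_groupoid) (F : fell_bundle R G).
Hypothesis X_hausdorff : hausdorff_space (gunits G).
Variable A : unit_algebra F.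
Variables (Cf Cr B : cstarAlg R) (p : set (section F) -> section F -> Cf).
Hypothesis Cf_full : full_crossed_product p.
Variable E : Cf -> (A -> R[i]^o) -> R[i]^o.
Hypothesis E_exp : canonical_expectation p E.
Variables (L : Cf -> Cr) (q : Cf -> B) (q' : B -> Cr).
Hypothesis L_red : reduced_quotient E L.
Hypothesis q_hom : star_hom q.
Hypothesis q_surj : set_surj setT setT q.
Hypothesis q'q : forall b, q' (q b) = L b.
Implicit Types (y z : section F) (t u v : set (section F)) (a c : A) (x : spectrum A).
Local Notation one := (@unit_sections R G F).
Local Notation coef := (@unit_coef R G F A Cf p).
Let j a : B := q (coef a).
Let hX := X_hausdorff.
Let p_rep : bimodule_rep p := let: And3 h _ _ := Cf_full in h.

Let psi_state f (fs : state f) : state (expected E q f) :=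
  expected_state hX p_rep E_exp L_red q_hom q_surj q'q fs.
Let psi_j f (fs : state f) : forall a, expected E q f (q (coef a)) = f a :=
  expected_j E_exp L_red q'q fs.

(** Replacing $\zeta$ by $j(c)\zeta$ turns $\psi(p_t(y))$ into $\psi(p_t(y)j(c))=f(yc)$, a value
    that does not depend on [psi]. The error is controlled by
    $\|\zeta-j(c)\zeta\|\le\|\xi-\varrho(c)\xi\|$, where $\|\zeta\|\le1\le\|\xi\|$ enters. *)
Lemma near_value f (rho : rep A) (xi : rep_space rho) psi t v y c : state f ->
  (forall a, f a = ip xi (rho a xi)) -> state psi -> (forall a, psi (j a) = f a) ->
  in_S t -> t y -> in_S v -> v `<=` t -> v `<=` one -> v (sec c) ->
  cn (psi (q (p t y)) - f (to_A A (conv y (sec c)))) <= nr (q (p t y)) * nr (xi - rho c xi).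
Proof.
move=> fs f_xi ps pj tS ty vS vt v1 vc; set b := q (p t y).
have jh := inclusion_hom hX A p_rep q_hom.
have pp : positive_functional psi by case: ps.
have [Pi [zeta [psi_z z_cyc]]] := gns_exists pp (state_le ps).
have same a : ip zeta (Pi (j a) zeta) = ip xi (rho a xi) by rewrite -psi_z pj f_xi.
have z1 : nr zeta <= 1.
  by apply: cyclic_norm_le1 z_cyc _ => d; rewrite -psi_z; exact: state_le.
have x1 := state_vector_ge1 fs f_xi.
have zx : nr (zeta - Pi (j c) zeta) <= nr (xi - rho c xi).
  apply: le_sqr_le; rewrite ?nr_ge0// -!ip_sq !(sqD (ip_si _)) !(siNr (ip_si _)) same.
  rewrite !(sqN (ip_si _)).
  have -> : sq (@ip _ _) (Pi (j c) zeta) = sq (@ip _ _) (rho c xi) by rewrite /sq (same_ip jh same).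
  by rewrite !ip_sq; have := nr_ge0 zeta; nra.
have -> : f (to_A A (conv y (sec c))) = psi (cmul b (j c)).
  have [h _] := bim_cross hX p_rep tS vS vt v1 ty vc.
  by rewrite /j -(homM q_hom) h pj.
have -> : psi b - psi (cmul b (j c)) = ip zeta (Pi b (zeta - Pi (j c) zeta)).
  by rewrite !psi_z !repE (siDr (ip_si _)) (siNr (ip_si _)).
apply: le_trans (ip_cs _ _) _; have P0 := nr_ge0 (Pi b (zeta - Pi (j c) zeta)).
apply: le_trans (ler_piMl P0 z1) _; apply: le_trans (rep_contraction _ _) _.
by rewrite ler_wpM2l// nr_ge0.
Qed.

Lemma unique_trivial_isotropy f x : uniquely_extendible j f -> gns_class f x ->
  trivial_isotropy x.
Proof.
move=> [f_pure [psi0 [_ uniq]]] [rho [xr [xi [f_xi cyc]]]] g gx.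
have fs : state f by case: f_pure.
have inS : exists t0, [/\ in_S t0, hat (s_ideal t0) x & dual_germ g = germ x t0].
  by case: g gx => s gm gP /= <-.
move: inS => [t0 [t0S ht0 gE]] [t [rho1 [sigma1 [gt r1 s1 ind]]]].
split=> //; rewrite gx in r1.
have [tS ht _] : germ x t0 t by rewrite -gE.
have [T [Tl Tlr Tip Tspan Tleft]] := induced_transport (class_equivalent xr r1)
  (class_equivalent s1 xr) ind.
have oS := one_in_S A.
(* Otherwise [f] vanishes on every ideal $v\subseteq t\cap A$, so the extension through [E] vanishes
   on [t], and [orthogonal_extension] yields a second extension. *)
have [v [vS vt v1 hv]] : exists v, [/\ in_S v, v `<=` t, v `<=` one & hat (s_ideal (A := A) v) x].
  apply: contrapT => nv.
  have fv v c : in_S v -> v `<=` t -> v `<=` one -> v (sec c) -> f c = 0.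
    move=> vS vt v1 vc; rewrite f_xi.
    have -> : rho c xi = 0; last by rewrite (si0r (ip_si _)).
    apply: contrapT => n0; apply: nv; exists v; split=> //; apply/(hatP _ xr).
    by exists c, xi; split=> //; apply: s_ideal_sup.
  have [psi' ps' [pj' ne]] := orthogonal_extension hX p_rep q_hom fs f_xi cyc tS Tl Tlr Tip
    Tspan Tleft (psi_state fs) (psi_j fs)
    (fun y ty => expected_eq0 hX p_rep E_exp L_red q'q fs tS ty fv).
  apply: ne; rewrite -(uniq psi')//; apply: uniq; split; [exact: psi_state|exact: psi_j].
have t1 : germ x t one.
  by split=> //; [apply: hat_mono v1 hv|exists v; split].
by rewrite gE (germ_eq hX tS oS t1) -(germ_eq hX t0S tS) // -gE.
Qed.

Lemma trivial_isotropy_unique f x : pure_states f -> gns_class f x ->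
  trivial_isotropy x -> uniquely_extendible j f.
Proof.
move=> f_pure [rho [xr [xi [f_xi cyc]]]] triv; split=> //.
have fs : state f by case: f_pure.
have ir := pure_irreducible f_pure f_xi cyc.
have oS := one_in_S A; have jh := inclusion_hom hX A p_rep q_hom.
exists (expected E q f); split; first by split; [exact: psi_state|exact: psi_j].
suff uniq psi psi' : state psi -> (forall a, psi (j a) = f a) ->
    state psi' -> (forall a, psi' (j a) = f a) -> forall b, psi b = psi' b.
  by move=> psi [ps pj]; apply/funext => b; apply: uniq => //; [exact: psi_state|exact: psi_j].
move=> ps pj ps' pj'.
have key t y : in_S t -> t y -> psi (q (p t y)) = psi' (q (p t y)).
  move=> tS ty.
  (* Here the germ of [t] is an isotropy arrow, hence a unit, which yields an ideal $v\subseteq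
     t\cap A$ not killed by [rho]. Elements [c] of it with $c\xi\approx\xi$ tie both extensions to
     the same number $f(yc)$. *)
  have vcase : induced_rep t rho rho -> nonzero_on rho (s_ideal t) ->
      psi (q (p t y)) = psi' (q (p t y)).
    move=> ind nt; have ht : hat (s_ideal t) x by apply/(hatP _ xr).
    have tt : germ x t t by split=> //; exists t; split.
    pose g := @DualArrow _ _ _ A x (germ x t)
      (ex_intro _ t (And3 tS ht (erefl (germ x t)))).
    have [|_ /= gE] := triv g erefl; first by exists t, rho, rho; split.
    move: tt; rewrite gE => -[_ _ [v [vS v1 vt /(hatP _ xr) nv]]].
    have cJ := section_ideal_closed A vS.
    have nJ : nonzero_on rho (section_ideal v).
      by case: nv => c [h [Jc n0]]; exists c, h; split=> //; exact: s_ideal_sub Jc.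
    apply/eqP; rewrite -subr_eq0; apply/eqP/cn_small => e e0; set b := q (p t y).
    have b0 := nr_ge0 b; have e2 : 0 < e / 2 by move: e0; lra.
    have [c Jc hc] := ideal_dense ir cJ nJ (unit_vector_neq0 fs f_xi) xi
      (divS_gt0 e2 b0).
    have h1 := near_value fs f_xi ps pj tS ty vS vt v1 Jc.
    have h2 := near_value fs f_xi ps' pj' tS ty vS vt v1 Jc.
    move: h1 h2; set l := f _ => h1 h2.
    have -> : psi b - psi' b = (psi b - l) - (psi' b - l) by ring.
    apply: le_trans (cnD _ _) _; rewrite cnN.
    by have := mul_divS_lt b0 (nr_ge0 _) hc; move: h1 h2; lra.
  have [d1|[ind ht]] := extension_dichotomy hX p_rep q_hom f_pure f_xi cyc tS ps pj.
    have [d2|[ind ht]] := extension_dichotomy hX p_rep q_hom f_pure f_xi cyc tS ps' pj'.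
      by rewrite d1// d2.
    exact: vcase.
  exact: vcase.
have pp : positive_functional psi by case: ps.
have pp' : positive_functional psi' by case: ps'.
move=> b; have [c <-] := quot_lift q_surj b.
have : closed_span [set b | exists t y, [/\ in_S t, t y & b = p t y]] c.
  by rewrite (span_full hX A Cf_full).
move=> /(_ [set c | psi (q c) = psi' (q c)]); apply; last first.
  by move=> _ [t [y [tS ty ->]]]; exact: key.
split=> /=.
- by rewrite (hom0 q_hom) (f0 pp) (f0 pp').
- by move=> k d d' h h'; rewrite (hom_linear q_hom) (flin pp) (flin pp') h h'.
- apply/closed_epsP => d hd; apply/eqP; rewrite -subr_eq0; apply/eqP/cn_small => e e0.
  have [d' /= h dd] := hd (e / 2) ltac:(lra).
  have -> : psi (q d) - psi' (q d) = psi (q (d - d')) - psi' (q (d - d')).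
    rewrite (homD q_hom) (homN q_hom) (fD pp) (fD pp') (fN pp) (fN pp') h; ring.
  have h1 := state_le ps (q (d - d')); have h2 := state_le ps' (q (d - d')).
  have h3 := hom_contraction q_hom (d - d').
  by have := cnD (psi (q (d - d'))) (- psi' (q (d - d'))); rewrite cnN; move: h1 h2 h3 dd; lra.
Qed.

Lemma spectrum_pure x (J : set A) : hat J x -> exists rho (xi : rep_space rho) b,
  [/\ in_class x rho, nr xi = 1, J b & rho b xi <> 0].
Proof.
move=> [rho [xr [b [h [Jb n0]]]]].
have h0 : nr h != 0 by apply/eqP => /nr_eq0 e; apply: n0; rewrite e repE.
have h1 : 0 < nr h by rewrite lt_neqAle eq_sym h0 nr_ge0.
exists rho, ((nr h)^-1%:C *: h), b; split=> //.
  by rewrite nrZR ?invr_ge0 ?ltW// mulVf.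
rewrite repE => /eqP; rewrite scaler_eq0 => /orP[/eqP|/eqP //].
by rewrite (_ : 0 = (0 : R)%:C)// => /complexI /eqP; rewrite invr_eq0 (negbTE h0).
Qed.

Lemma pure_class f : pure_states f -> exists x, gns_class f x.
Proof.
move=> f_pure; have f_pos : positive_functional f by case: f_pure => -[].
have [rho [xi [f_xi cyc]]] := gns_exists f_pos (state_le f_pure.1).
have [x xr] := exists_class (pure_irreducible f_pure f_xi cyc).
by exists x, rho; split=> //; exists xi.
Qed.

Lemma extension_property_principal : extension_property j <-> dual_principal A.
Proof.
split=> [ext x|princ].
  have [rho ir xr] := class_rep x.
  have [b [h n0]] := ir.1.
  have [|rho1 [xi [c [xr1 xi1 _ _]]]] := @spectrum_pure x setT.
    by exists rho; split=> //; exists b, h.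
  have ir1 := class_irreducible xr1.
  apply: (@unique_trivial_isotropy (vector_state xi)).
    by rewrite ext; exact: vector_state_pure.
  by exists rho1; split=> //; exact: vector_gns.
apply/seteqP; split=> f; first by case.
move=> f_pure; have [x fx] := pure_class f_pure.
exact: trivial_isotropy_unique fx (princ x).
Qed.

Lemma ptws_value (b : A) (f : A -> R[i]^o) : f b <> 0 ->
  nbhs (f : {ptws A -> R[i]^o}) [set g : {ptws A -> R[i]^o} | g b <> 0].
Proof.
move=> fb; have := @proj_continuous A (fun=> R[i]^o) b f.
move=> /(_ [set z | z <> 0]); apply.
apply: open_nbhs_nbhs; split=> //.
have -> : [set z : R[i]^o | z <> 0] = ~` [set 0] by [].
apply: closed_openC; apply/(@closed_epsP R R[i]^o [set 0]) => z hz /=.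
by apply: (@nr_small R R[i]^o) => e e0; have [_ ->] := hz e e0; rewrite subr0 => /ltW.
Qed.

(** An open set of the spectrum given by an ideal [J] contains the GNS classes of all pure states
    that do not vanish at some fixed $b^*b$ with $b\in J$; these form a neighbourhood for pointwise
    convergence. *)
Lemma almost_extension_topologically_principal : almost_extension_property j ->
  dual_topologically_principal A.
Proof.
move=> dense O [J [cJ OJ]] [x0 /OJ/spectrum_pure[rho [xi [b [xr xi1 Jb n0]]]]].
have ir := class_irreducible xr.
have fb : vector_state xi (cmul (cstar b) b) <> 0.
  by rewrite vector_form => /ip_self_eq0.
have [g [[g_pure g_uniq] /= gb]] := dense _ (vector_state_pure ir xi1) _ (ptws_value fb).
have [x gx] := pure_class g_pure; exists x; split; last first.
  by apply: unique_trivial_isotropy gx; split.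
apply/OJ; have [sigma [xs [eta [g_eta _]]]] := gx.
exists sigma; split=> //; exists (cmul (cstar b) b), eta; split.
  by have [_ Jl _] := cJ; apply: Jl.
by move=> e; apply: gb; rewrite g_eta e (si0r (ip_si _)).
Qed.
End Corollary.

(** * Sublinear functionals *)

Section Sublinear.
Variables (R : realType) (V : lmodType R[i]).
Implicit Types (p : V -> R) (x y w : V) (r s c : R).

Definition sublinear p : Prop := (forall x y, p (x + y) <= p x + p y) /\
  (forall c x, 0 <= c -> p (c%:C *: x) = c * p x).

Lemma sublinear0 p : sublinear p -> p 0 = 0.
Proof. by move=> [_ h]; have := h 0 0 (lexx _); rewrite scaler0 mul0r. Qed.

Lemma sublinear_opp p x : sublinear p -> 0 <= p x + p (- x).
Proof. by move=> sp; rewrite -(sublinear0 sp) -(subrr x); case: sp. Qed.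

(** [p' w] is the infimum of $p(w+x)-r$ over the cone [K], bounded below by $-p(-w)$. A ray as cone
    yields additivity of minimal sublinear functionals; the graph of a functional yields its
    extension. *)
Lemma cone_infimum p (K : V -> R -> Prop) : sublinear p -> K 0 0 ->
  (forall x y r s, K x r -> K y s -> K (x + y) (r + s)) ->
  (forall c x r, 0 <= c -> K x r -> K (c%:C *: x) (c * r)) ->
  (forall x r, K x r -> r <= p x) ->
  exists p', [/\ sublinear p', (forall w, p' w <= p w) &
    forall x r w, K x r -> p' w <= p (w + x) - r].
Proof.
move=> sp K0 KD KZ Kp; have [pD pZ] := sp.
pose S w := [set z | exists x r, K x r /\ z = p (w + x) - r].
have S0 w : S w (p w) by exists 0, 0; rewrite addr0 subr0.
have Slb w z : S w z -> - p (- w) <= z.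
  move=> [x [r [Kxr ->]]]; have := Kp _ _ Kxr.
  have := pD (w + x) (- w); rewrite addrAC subrr add0r; lra.
have Sinf w : has_inf (S w) by split; [exists (p w)|exists (- p (- w)) => z /Slb].
have infS w z : S w z -> inf (S w) <= z by move=> Sz; apply: ge_inf => //; case: (Sinf w).
have Zle c w : 0 < c -> inf (S (c%:C *: w)) <= c * inf (S w).
  move=> c0; rewrite -ler_pdivrMl//; apply: lb_le_inf; first by exists (p w).
  move=> _ [x [r [Kxr ->]]]; rewrite ler_pdivrMl//.
  apply: infS; exists (c%:C *: x), (c * r); split; first exact: KZ (ltW c0) Kxr.
  by rewrite -scalerDr pZ ?ltW// mulrBr.
exists (fun w => inf (S w)); split.
- split=> [w v|c w c0].
    apply/ler_addgt0Pr => e e0; have e2 : 0 < e / 2 by lra.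
    have [_ [x [r [Kx ->]]] h1] := inf_adherent e2 (Sinf w).
    have [_ [y [s [Ky ->]]] h2] := inf_adherent e2 (Sinf v).
    have h : inf (S (w + v)) <= p (w + v + (x + y)) - (r + s).
      by apply: infS; exists (x + y), (r + s); split=> //; exact: KD.
    have := pD (w + x) (v + y); rewrite addrACA; lra.
  have [->|cn0] := eqVneq c 0.
    rewrite scale0r mul0r; apply/eqP; rewrite eq_le; apply/andP; split.
      by rewrite -(sublinear0 sp); exact: infS.
    apply: lb_le_inf; first by exists (p 0).
    by move=> z /Slb; rewrite oppr0 (sublinear0 sp) oppr0.
  have c1 : 0 < c by rewrite lt_neqAle eq_sym cn0.
  apply/eqP; rewrite eq_le Zle//=.
  have := Zle c^-1 (c%:C *: w); rewrite invr_gt0 => /(_ c1).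
  by rewrite scalerA -rmorphM mulVf// scale1r ler_pdivlMl.
- by move=> w; exact: infS.
- by move=> x r w Kxr; apply: infS; exists x, r.
Qed.

Definition real_linear (Phi : V -> R) : Prop :=
  (forall x y, Phi (x + y) = Phi x + Phi y) /\ (forall c x, Phi (c%:C *: x) = c * Phi x).

(** Zorn's lemma applies because sublinear functionals below [p] are bounded below by $-p(-w)$, so
    that chains have pointwise infima. *)
Lemma minimal_sublinear p : sublinear p -> exists m, [/\ sublinear m,
  (forall w, m w <= p w) &
  forall m', sublinear m' -> (forall w, m' w <= m w) -> m' = m].
Proof.
move=> sp; pose T := {m : V -> R | sublinear m /\ forall w, m w <= p w}.
pose rel (m m' : T) := `[< forall w, sval m' w <= sval m w >].
have [||||m hm] := @Zorn T rel.
- by move=> t; apply/asboolP.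
- move=> r s t /asboolP h1 /asboolP h2; apply/asboolP => w; exact: le_trans (h2 w) (h1 w).
- move=> [s hs] [t ht] /asboolP /= h1 /asboolP /= h2.
  have e : s = t by apply/funext => w; apply/le_anti/andP.
  by subst t; congr exist; exact: Prop_irrelevance.
- move=> C tot; have [[m0 Cm0]|C0] := pselect (exists m, C m); last first.
    by exists (exist _ p (conj sp (fun w => lexx _))) => s Cs; case: C0; exists s.
  pose S w := [set z | exists2 m : T, C m & z = sval m w].
  have S0 w : S w (sval m0 w) by exists m0.
  have Slb w z : S w z -> - p (- w) <= z.
    move=> [[m [sm mp]] Cm ->] /=; have := sublinear_opp w sm; have := mp (- w); lra.
  have Sinf w : has_inf (S w) by split; [exists (sval m0 w)|exists (- p (- w)) => z /Slb].
  have infS w z : S w z -> inf (S w) <= z by move=> Sz; apply: ge_inf => //; case: (Sinf w).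
  have sm : sublinear (fun w => inf (S w)).
    split=> [w v|c w c0].
      apply/ler_addgt0Pr => e e0; have e2 : 0 < e / 2 by lra.
      have [_ [m1 C1 ->] h1] := inf_adherent e2 (Sinf w).
      have [_ [m2 C2 ->] h2] := inf_adherent e2 (Sinf v).
      have [m [Cm l1 l2]] : exists m : T, [/\ C m, sval m w <= sval m1 w & sval m v <= sval m2 v].
        by have [/asboolP h|/asboolP h] := tot m1 m2 C1 C2; [exists m2|exists m1]; split.
      have h : inf (S (w + v)) <= sval m (w + v) by apply: infS; exists m.
      have := (svalP m).1.1 w v; lra.
    have [->|cn0] := eqVneq c 0.
      rewrite scale0r mul0r; apply/eqP; rewrite eq_le; apply/andP; split.
        by rewrite -(sublinear0 (svalP m0).1); exact: infS.
      apply: lb_le_inf; first by exists (sval m0 0).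
      by move=> _ [m Cm ->]; rewrite (sublinear0 (svalP m).1).
    have c1 : 0 < c by rewrite lt_neqAle eq_sym cn0.
    apply/eqP; rewrite eq_le; apply/andP; split.
      rewrite -ler_pdivrMl//; apply: lb_le_inf; first by exists (sval m0 w).
      move=> _ [m Cm ->]; rewrite ler_pdivrMl//; apply: infS; exists m => //.
      by rewrite (svalP m).1.2.
    apply: lb_le_inf; first by exists (sval m0 (c%:C *: w)).
    move=> _ [m Cm ->]; rewrite (svalP m).1.2// ler_pM2l//; apply: infS; exists m => //.
  have mp w : inf (S w) <= p w by apply: le_trans (infS _ _ (S0 w)) ((svalP m0).2 w).
  exists (exist (fun m : V -> R => sublinear m /\ forall w, m w <= p w) _ (conj sm mp)) => m Cm; apply/asboolP => w /=.
  by apply: infS; exists m.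
exists (sval m); split; [exact: (svalP m).1|exact: (svalP m).2|] => m' sm' m'm.
have mp' w : m' w <= p w := le_trans (m'm w) ((svalP m).2 w).
have := hm (exist _ m' (conj sm' mp')) _.
by move=> /(_ ltac:(exact/asboolP)) /(congr1 sval).
Qed.

(* A minimal sublinear functional m is dominated by
   inf_(c >= 0) m (w + c x) - c m x, hence equal to it; so it is additive. *)
Lemma sublinear_dominates_linear p : sublinear p ->
  exists2 Phi, real_linear Phi & forall w, Phi w <= p w.
Proof.
move=> sp; have [m [sm mp min]] := minimal_sublinear sp; have [mD mZ] := sm.
have add x w : m (w + x) = m w + m x.
  apply/eqP; rewrite eq_le mD /=.
  pose K y r := exists c, [/\ 0 <= c, y = c%:C *: x & r = c * m x].
  have [||||p' [sp' p'm p'K]] := @cone_infimum m K sm.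
  - by exists 0; rewrite scale0r mul0r.
  - move=> _ _ _ _ [c [c0 -> ->]] [d [d0 -> ->]]; exists (c + d).
    by rewrite addr_ge0// rmorphD scalerDl mulrDl.
  - move=> c _ _ c0 [d [d0 -> ->]]; exists (c * d).
    by rewrite mulr_ge0// rmorphM scalerA mulrA.
  - by move=> _ _ [c [c0 -> ->]]; rewrite mZ.
  have := p'K x (m x) w; rewrite (min p')//; rewrite lerBrDr; apply.
  by exists 1; rewrite scale1r mul1r.
have mN x : m (- x) = - m x.
  have := add (- x) x; rewrite subrr (sublinear0 sm); lra.
exists m => //; split=> [x y|c x]; first exact: add.
have [c0|c0] := leP 0 c; first exact: mZ.
have : m ((- c)%:C *: x) = - c * m x by apply: mZ; lra.
rewrite rmorphN scaleNr mN mulNr; lra.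
Qed.

(** The graph of [f] along [d] as cone gives $p'(d(a))\le f(a)$. A linear functional below [p'] then
    takes the value $f(a)$ at $d(a)$, by oddness. *)
Lemma hahn_banach (W : lmodType R[i]) (d : W -> V) (f : W -> R) p : sublinear p ->
  (forall a b, d (a + b) = d a + d b) -> (forall c a, d (c%:C *: a) = c%:C *: d a) ->
  (forall a b, f (a + b) = f a + f b) -> (forall c a, f (c%:C *: a) = c * f a) ->
  (forall a, f a <= p (d a)) ->
  exists Phi, [/\ real_linear Phi, (forall w, Phi w <= p w) & forall a, Phi (d a) = f a].
Proof.
move=> sp dD dZ fD fZ fp.
pose K y r := exists a, y = d a /\ r = f a.
have d0 : d 0 = 0 by have := dZ 0 0; rewrite !scale0r.
have f0 : f 0 = 0 by have := fZ 0 0; rewrite scale0r mul0r.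
have [||||p' [sp' p'p p'K]] := @cone_infimum p K sp.
- by exists 0; rewrite d0 f0.
- by move=> _ _ _ _ [a [-> ->]] [b [-> ->]]; exists (a + b).
- by move=> c _ _ c0 [a [-> ->]]; exists (c%:C *: a).
- by move=> _ _ [a [-> ->]].
have [Phi [PD PZ] Pp] := sublinear_dominates_linear sp'.
have fN a : f (- a) = - f a by have := fD a (- a); rewrite subrr f0; lra.
have Pm a : Phi (d a) <= f a.
  have := p'K _ _ (d a) (ex_intro _ (- a) (conj erefl erefl)).
  rewrite -dD subrr d0 (sublinear0 sp) fN opprK add0r.
  exact: le_trans (Pp _).
exists Phi; split=> // [w|a]; first exact: le_trans (Pp w) (p'p w).
apply/eqP; rewrite eq_le Pm /=.
have P0 : Phi 0 = 0 by have := PZ 0 0; rewrite scale0r mul0r.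
have := PD (d a) (d (- a)); rewrite -dD subrr d0 P0.
have := Pm (- a); rewrite fN; lra.
Qed.
End Sublinear.

Lemma sup_sublinear (R : realType) (V : lmodType R[i]) (S : set (V -> R)) :
  (forall s, S s -> real_linear s) -> S !=set0 ->
  (forall w, exists M, forall s, S s -> s w <= M) ->
  sublinear (fun w => sup [set s w | s in S]).
Proof.
move=> lin [s0 Ss0] bd.
have hs w : has_sup [set s w | s in S].
  split; first by exists (s0 w), s0.
  by have [M hM] := bd w; exists M => _ [s Ss <-]; exact: hM.
have ub s w : S s -> s w <= sup [set s w | s in S].
  by move=> Ss; apply: ub_le_sup; [case: (hs w)|exists s].
split=> [x y|c x c0].
  apply: ge_sup; first by exists (s0 (x + y)), s0.
  move=> _ [s Ss <-]; rewrite (lin _ Ss).1; apply: lerD; exact: ub.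
have -> : [set s (c%:C *: x) | s in S] = [set c * z | z in [set s x | s in S]].
  apply/seteqP; split=> [_ [s Ss <-]|_ [_ [s Ss <-] <-]].
    by exists (s x); [exists s|rewrite (lin _ Ss).2].
  by exists s => //; rewrite (lin _ Ss).2.
have [->|cn0] := eqVneq c 0.
  rewrite mul0r; have -> : [set 0 * z | z in [set s x | s in S]] = [set 0 : R].
    apply/seteqP; split=> [_ [z _ <-]|_ ->] /=; first by rewrite mul0r.
    by exists (s0 x); [exists s0|rewrite mul0r].
  exact: sup1.
have c1 : 0 < c by rewrite lt_neqAle eq_sym cn0.
apply/eqP; rewrite eq_le; apply/andP; split.
  apply: ge_sup; first by exists (c * s0 x), (s0 x) => //; exists s0.
  by move=> _ [_ [s Ss <-] <-]; rewrite ler_pM2l//; exact: ub.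
rewrite -ler_pdivlMl//; apply: ge_sup; first by exists (s0 x), s0.
move=> _ [s Ss <-]; rewrite ler_pdivlMl//; apply: ub_le_sup.
  have [_ [M hM]] := hs x; exists (c * M) => _ [z zS <-].
  by rewrite ler_pM2l//; exact: hM.
by exists (s x) => //; exists s.
Qed.

(** * Weak density of vector states *)

Section Density.
Variables (R : realType) (A : cstarAlg R).
Implicit Types (a b y h r s v : A) (f : A -> R[i]^o) (Q : set (A -> R[i]^o)) (x z : spectrum A).

Section Dense.
Variable D : spectrum A -> Prop.
Hypothesis D_dense : spectrum_dense D.

(** Write $y=r^2-s^2$ with $r^2s^2=0$. Negativity of [y] over [D] forces $r^2$ to act by zero there.
    By density the open set of the ideal generated by $r^2$ is empty, so that $y$ acts as $-s^2$
    everywhere. *)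
Lemma dense_negative y : self_adjoint y ->
  (forall x rho, D x -> in_class x rho -> forall eta, Re (ip eta (rho y eta)) <= 0) ->
  forall x rho, in_class x rho -> forall eta, Re (ip eta (rho y eta)) <= 0.
Proof.
move=> sy hD x rho xr eta; have [r [s [sr ss yE rs]]] := sa_jordan sy.
have sP : cstar (cmul r r) = cmul r r by rewrite cstarM sr.
have sS : cstar (cmul s s) = cmul s s by rewrite cstarM ss.
have sPs : cmul (cmul s s) (cmul r r) = 0 by rewrite -sS -sP -cstarM rs cstar0.
pose J := ideal_generated [set cmul r r].
(* For $k=r^2\theta$ one has $\langle k|yk\rangle=\langle k|r^2k\rangle=\|rk\|^2$, which is both
   nonnegative and at most zero. *)
have killed z sigma : D z -> in_class z sigma -> forall th, sigma (cmul r r) th = 0.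
  move=> Dz zs th; set k := sigma _ th.
  have e1 : sigma y k = sigma (cmul r r) k.
    by rewrite /k -!repM yE cmulDl cmulNl sPs subr0.
  have e2 : ip k (sigma (cmul r r) k) = ip (sigma r k) (sigma r k).
    by rewrite repM rep_adj sr.
  have rk : sigma r k = 0.
    apply: nr_eq0; apply/eqP; rewrite -sqrf_eq0 eq_le sqr_ge0 andbT.
    by have := hD _ _ Dz zs k; rewrite e1 e2 ip_norm.
  apply: ip_self_eq0; rewrite {2}/k -[X in ip _ (sigma X _)]sP -rep_adj repM rk repE.
  exact: si0l (ip_si _) _.
have nJ : ~ hat J x.
  move=> hx; have [|z [[sigma [zs [a [h [Ja n0]]]]] Dz]] := D_dense (O := hat J) _ (ex_intro _ x hx).
    by exists J; split=> //; exact: ideal_generated_closed.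
  apply: n0; apply: (Ja [set a | forall k : rep_space sigma, sigma a k = 0]); first exact: rep_kernel_ideal.
  by move=> _ -> th; exact: killed Dz zs th.
have r0 : rho (cmul r r) eta = 0.
  apply: contrapT => n0; apply: nJ; exists rho; split=> //; exists (cmul r r), eta; split=> //.
  by move=> K _; apply.
rewrite repM in r0; rewrite yE !repE r0 add0r (siNr (ip_si _)) raddfN /= oppr_le0.
have -> : ip eta (rho s (rho s eta)) = ip (rho s eta) (rho s eta) by rewrite rep_adj ss.
by rewrite ip_norm; exact: sqr_ge0.
Qed.

Lemma dense_dominated f (rho : rep A) (xi : rep_space rho) x a (M : R) :
  state f -> in_class x rho -> (forall b, f b = ip xi (rho b xi)) -> nr xi <= 1 -> 0 <= M ->
  (forall z sigma, D z -> in_class z sigma ->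
     forall eta, Re (ip eta (sigma a eta)) <= M * nr eta ^+ 2) ->
  Re (f a) <= M.
Proof.
move=> fs xr f_xi x1 M0 hD.
have fp : positive_functional f by case: fs.
have [h hE] : exists h, h = (2^-1 : R)%:C *: (a + cstar a) by eexists.
have sh : self_adjoint h.
  by rewrite /self_adjoint hE !cstarE cjR addrC.
have Reh sigma (eta : rep_space sigma) : Re (ip eta (sigma h eta)) = Re (ip eta (sigma a eta)).
  rewrite hE !repE (siZr (ip_si _)) (siDr (ip_si _)).
  have -> : ip eta (sigma (cstar a) eta) = cj (ip eta (sigma a eta)).
    by rewrite -rep_adj -ip_herm.
  by case: (ip eta _) => u w /=; lra.
have -> : Re (f a) = Re (f h) by rewrite !f_xi Reh.
apply/ler_addgt0Pr => e e0.
have [v [sv v1 hv]] := approx_left h (e := e / 2) ltac:(lra).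
(* A substitute for $h-M$ that lies in [A]: compress by an element [v] of an approximate unit. *)
pose y := cmul (cmul v h) v - M%:C *: cmul v v.
have sy : self_adjoint y by rewrite /self_adjoint /y !cstarE sv sh cjR !cmulE.
have Rey sigma (eta : rep_space sigma) : Re (ip eta (sigma y eta)) =
    Re (ip (sigma v eta) (sigma h (sigma v eta))) - M * nr (sigma v eta) ^+ 2.
  have -> : ip eta (sigma y eta) =
      ip (sigma v eta) (sigma h (sigma v eta)) - M%:C * ip (sigma v eta) (sigma v eta).
    by rewrite /y !repE (siDr (ip_si _)) (siNr (ip_si _)) (siZr (ip_si _)) !rep_adj sv.
  by rewrite ip_norm -rmorphM raddfB.
have neg : Re (ip xi (rho y xi)) <= 0.
  apply: (dense_negative sy _ xr) => z sigma Dz zs eta.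
  by rewrite Rey Reh subr_le0; exact: hD Dz zs _.
have vx : nr (rho v xi) ^+ 2 <= 1.
  rewrite exprn_ile1 ?nr_ge0//; apply: le_trans (rep_contraction _ _) _.
  by rewrite mulr_ile1 ?nr_ge0.
have dist : nr (h - cmul (cmul v h) v) <= e.
  have -> : h - cmul (cmul v h) v = cstar (h - cmul v h) + cmul (h - cmul v h) v.
    by rewrite !cstarE sh sv !cmulE; lmod.
  have := nrD (cstar (h - cmul v h)) (cmul (h - cmul v h) v); rewrite nr_cstar.
  have := cnormM (h - cmul v h) v; have := nr_ge0 (h - cmul v h).
  by move: hv v1; clear; nra.
have fd : Re (f h) - Re (f (cmul (cmul v h) v)) <= e.
  have := state_le fs (h - cmul (cmul v h) v); rewrite (fD fp) (fN fp).
  have := cn_Re (f h - f (cmul (cmul v h) v)).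
  have := ler_norm (Re (f h - f (cmul (cmul v h) v))).
  by rewrite raddfB /=; move: dist; clear; lra.
have -> : Re (f h) = (Re (f h) - Re (f (cmul (cmul v h) v))) + Re (f (cmul (cmul v h) v)).
  by rewrite subrK.
have : Re (f (cmul (cmul v h) v)) <= M * nr (rho v xi) ^+ 2.
  rewrite f_xi; move: neg; rewrite Rey subr_le0; congr (Re _ <= _).
  by rewrite !repE rep_adj sv.
by move: fd vx M0; clear; nra.
Qed.
End Dense.
End Density.

(** * Separating a pure state from a set of states *)

Section Separation.
Variables (R : realType) (A : cstarAlg R).
Implicit Types (a b h u : A) (f : A -> R[i]^o) (Q : set (A -> R[i]^o)).

(** By Hahn-Banach this expresses that [f] lies in the weakly closed convex hull of [Q] and the zero
    functional; the latter accounts for the restriction to nonnegative [M]. *)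
Definition dominated f Q : Prop :=
  forall a (M : R), 0 <= M -> (forall g, Q g -> Re (g a) <= M) -> Re (f a) <= M.

Definition far h f (e : R) : set (A -> R[i]^o) := [set g | Re (f h) + e <= Re (g h)].

Lemma pairD (U W : nmodType) (a b : U) (c d : W) : (a, c) + (b, d) = (a + b, c + d).
Proof. by []. Qed.

Lemma pairZ (U W : lmodType R[i]) (k : R[i]) (a : U) (c : W) : k *: (a, c) = (k *: a, k *: c).
Proof. by []. Qed.

(* The zero functional, the functionals of Q1 on the first copy of A and those of
   Q2 on the second one, with a slack variable for each copy. *)
Lemma split_functional f Q1 Q2 :
  (forall g, Q1 g \/ Q2 g -> state g) -> positive_functional f ->
  dominated f [set g | Q1 g \/ Q2 g] ->
  exists (g1 g2 : A -> R) (c1 c2 : R),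
  [/\ (forall a b, g1 (a + b) = g1 a + g1 b) /\ (forall c a, g1 (c%:C *: a) = c * g1 a),
      forall a, g1 a + g2 a = Re (f a) &
      forall a1 a2 (l1 l2 M : R), 0 <= M -> (forall g, Q1 g -> Re (g a1) + l1 <= M) ->
        (forall g, Q2 g -> Re (g a2) + l2 <= M) ->
        g1 a1 + g2 a2 + l1 * c1 + l2 * c2 <= M].
Proof.
move=> Qs fp dom.
pose V := ((A * A) * (R[i]^o * R[i]^o))%type.
pose S : set (V -> R) := [set s | [\/ s = (fun=> 0),
  exists2 g, Q1 g & s = fun w => Re (g w.1.1) + Re w.2.1 |
  exists2 g, Q2 g & s = fun w => Re (g w.1.2) + Re w.2.2]].
have ReD (u v : R[i]) : Re (u + v) = Re u + Re v by case: u v => ? ? [].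
have ReZ (c : R) (u : R[i]) : Re (c%:C * u) = c * Re u by case: u => u v /=; lra.
have Slin s : S s -> real_linear s.
  move=> [->|[g Qg ->]|[g Qg ->]]; first by split=> *; rewrite ?addr0 ?mulr0.
    have [gp _ _] := Qs _ (or_introl Qg); split=> [x y|c x] /=.
      by rewrite (fD gp) !ReD addrACA.
    by rewrite (fZ gp) !ReZ -mulrDr.
  have [gp _ _] := Qs _ (or_intror Qg); split=> [x y|c x] /=.
    by rewrite (fD gp) !ReD addrACA.
  by rewrite (fZ gp) !ReZ -mulrDr.
have S0 : S !=set0 by exists (fun=> 0); constructor 1.
have Re_le g (a : A) : state g -> Re (g a) <= nr a.
  move=> gs; apply: le_trans (ler_norm _) _; apply: le_trans (cn_Re _) _.
  exact: state_le.
have Sbd w : exists M, forall s, S s -> s w <= M.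
  exists (nr w.1.1 + nr w.1.2 + `|Re w.2.1| + `|Re w.2.2|) => s.
  have n1 := nr_ge0 w.1.1; have n2 := nr_ge0 w.1.2.
  have n3 := normr_ge0 (Re w.2.1); have n4 := normr_ge0 (Re w.2.2).
  have n5 := ler_norm (Re w.2.1); have n6 := ler_norm (Re w.2.2).
  move=> [->|[g Qg ->]|[g Qg ->]]; first by move: n1 n2 n3 n4; clear; lra.
    by move: (Re_le g w.1.1 (Qs _ (or_introl Qg))) n1 n2 n3 n4 n5 n6; clear; lra.
  by move: (Re_le g w.1.2 (Qs _ (or_intror Qg))) n1 n2 n3 n4 n5 n6; clear; lra.
have sp := sup_sublinear Slin S0 Sbd; set p := fun w => _ in sp.
have p_ub s w : S s -> s w <= p w.
  move=> Ss; apply: ub_le_sup; last by exists s.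
  by have [M hM] := Sbd w; exists M => _ [s' Ss' <-]; exact: hM.
have p_le w M : (forall s, S s -> s w <= M) -> p w <= M.
  move=> h; apply: ge_sup; first by case: S0 => s Ss; exists (s w), s.
  by move=> _ [s Ss <-]; exact: h.
have [||||a|Phi [[PD PZ] Pp Pd]] := @hahn_banach R V A (fun a => ((a, a), (0, 0)))
    (fun a => Re (f a)) p sp.
- by move=> a b; rewrite !pairD !addr0.
- by move=> c a; rewrite !pairZ !scaler0.
- by move=> a b; rewrite (fD fp) ReD.
- by move=> c a; rewrite (fZ fp) ReZ.
- apply: dom => [|g [Qg|Qg]].
  + by apply: (p_ub (fun=> 0)); constructor 1.
  + have := p_ub _ ((a, a), (0, 0)) (Or32 _ _ (ex_intro2 _ _ g Qg erefl)).
    by rewrite /= addr0.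
  + have := p_ub _ ((a, a), (0, 0)) (Or33 _ _ (ex_intro2 _ _ g Qg erefl)).
    by rewrite /= addr0.
pose i1 a : V := ((a, 0), (0, 0)); pose i2 a : V := ((0, a), (0, 0)).
pose e1 : V := ((0, 0), (1, 0)); pose e2 : V := ((0, 0), (0, 1)).
have dec a1 a2 (l1 l2 : R) : (((a1, a2), (l1%:C, l2%:C)) : V) =
    i1 a1 + i2 a2 + l1%:C *: e1 + l2%:C *: e2.
  rewrite /i1 /i2 /e1 /e2 !pairZ !pairD !scaler0 !addr0 !add0r.
  by congr (_, (_, _)); rewrite /= [_ *: _]mulr1.
have Pdec a1 a2 (l1 l2 : R) : Phi ((a1, a2), (l1%:C, l2%:C)) =
    Phi (i1 a1) + Phi (i2 a2) + l1 * Phi e1 + l2 * Phi e2.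
  by rewrite dec !PD !PZ.
exists (fun a => Phi (i1 a)), (fun a => Phi (i2 a)), (Phi e1), (Phi e2); split.
- split=> [a b|c a]; first by rewrite -PD /i1 !pairD !addr0.
  by rewrite -PZ /i1 !pairZ !scaler0.
- move=> a; rewrite -Pd; have := Pdec a a 0 0; rewrite !mul0r !addr0 => <- //.
- move=> a1 a2 l1 l2 M M0 h1 h2; rewrite -Pdec; apply: le_trans (Pp _) _.
  apply: p_le => s [->|[g Qg ->]|[g Qg ->]] //=; [exact: h1|exact: h2].
Qed.

Lemma state_near1 f (e : R) : state f -> 0 < e ->
  exists u, nr u <= 1 /\ 1 - e <= Re (f u).
Proof.
move=> fs e0; have fp : positive_functional f by case: fs.
have [rho [xi [f_xi cyc]]] := gns_exists fp (state_le fs).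
have x1 := state_vector_ge1 fs f_xi.
have x2 : nr xi <= 1 by apply: cyclic_norm_le1 cyc _ => b; rewrite -f_xi; exact: state_le.
have [v [sv v1 hv]] := cyclic_approx_unit cyc e0; exists v; split=> //.
have : ip xi (xi - rho v xi) = (nr xi ^+ 2)%:C - f v.
  by rewrite (siDr (ip_si _)) (siNr (ip_si _)) ip_norm f_xi.
move=> h; have := ip_cs xi (xi - rho v xi); rewrite h.
have := cn_Re ((nr xi ^+ 2)%:C - f v).
have := ler_norm (Re ((nr xi ^+ 2)%:C - f v)); rewrite raddfB /=.
by move: x1 x2 hv (nr_ge0 xi) (nr_ge0 (xi - rho v xi)); clear; nra.
Qed.

(* Hahn-Banach splits f as g1 + g2; as f is pure, g1 = t f and g2 = (1 - t) f, and
   f has norm 1, so that the slack variables have weights t and 1 - t. *)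
Lemma dominated_split f Q h (e : R) : pure_states f -> (forall g, Q g -> state g) ->
  0 < e -> dominated f Q -> dominated f [set g | Q g /\ ~ far h f e g].
Proof.
move=> [fs pure] Qs e0 dom; have fp : positive_functional f by case: fs.
pose Q1 := [set g | Q g /\ far h f e g]; pose Q2 := [set g | Q g /\ ~ far h f e g].
have Qz g : Q g -> g 0 = 0 by move=> /Qs[gp _ _]; exact: f0 gp.
have Qs' g : Q1 g \/ Q2 g -> state g by move=> [[/Qs]|[/Qs]].
have dom' : dominated f [set g | Q1 g \/ Q2 g].
  move=> a M M0 hM; apply: dom => // g Qg; apply: hM.
  by have [fg|fg] := pselect (far h f e g); [left|right].
have [g1 [g2 [c1 [c2 [[g1D g1Z] g12 up]]]]] := split_functional Qs' fp dom'.
have pos g (b : A) : state g -> g (cmul (cstar b) b) = (Re (g (cmul (cstar b) b)))%:C.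
  by move=> [[_ gp] _ _]; apply: ge0C; exact: gp.
have pos0 g (b : A) : state g -> 0 <= Re (g (cmul (cstar b) b)).
  by move=> [[_ gp] _ _]; have := gp b; rewrite lecE => /andP[].
have g1N a : g1 (- a) = - g1 a by have := g1Z (-1) a; rewrite rmorphN rmorph1 scaleN1r mulN1r.
have g10 : g1 0 = 0 by have := g1Z 0 0; rewrite scale0r mul0r.
have g20 : g2 0 = 0 by have := g12 0; rewrite g10 (f0 fp) /= add0r.
have g2E a : g2 a = Re (f a) - g1 a by have := g12 a; lra.
have upper1 a : (forall g, state g -> Re (g a) <= 0) -> g1 a <= 0.
  move=> ha; have := up a 0 0 0 0 (lexx _); rewrite g20 !mul0r !addr0; apply=> g [Qg _].
    by rewrite addr0; apply: ha; exact: Qs.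
  by rewrite addr0 (Qz _ Qg).
have upper2 a : (forall g, state g -> Re (g a) <= 0) -> g2 a <= 0.
  move=> ha; have := up 0 a 0 0 0 (lexx _); rewrite g10 !mul0r !addr0 add0r; apply=> g [Qg _].
    by rewrite addr0 (Qz _ Qg).
  by rewrite addr0; apply: ha; exact: Qs.
have gN g (a : A) : state g -> g (- a) = - g a by move=> [gp _ _]; exact: fN gp _.
have ge1 b : 0 <= g1 (cmul (cstar b) b).
  rewrite -oppr_le0 -g1N; apply: upper1 => g gs; rewrite gN// raddfN oppr_le0; exact: pos0.
have ge2 b : g1 (cmul (cstar b) b) <= Re (f (cmul (cstar b) b)).
  have : g2 (- cmul (cstar b) b) <= 0.
    by apply: upper2 => g gs; rewrite gN// raddfN oppr_le0; exact: pos0.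
  by rewrite g2E g1N gN// raddfN; lra.
have gi b : g1 ('i *: cmul (cstar b) b) = 0.
  have z g : state g -> Re (g ('i *: cmul (cstar b) b)) = 0.
    move=> gs; have [gp _ _] := gs; rewrite (fZ gp) pos//=; lra.
  apply/eqP; rewrite eq_le upper1 => [|g gs]; last by rewrite z.
  rewrite -oppr_le0 -g1N upper1// => g gs.
  by rewrite gN// raddfN /= z// oppr0.
(* The complex-linear functional with real part [g1]. By [gi] it is real on elements $b^*b$. *)
pose g a : R[i]^o := Complex (g1 a) (- g1 ('i *: a)).
have g_lin : linear g.
  move=> k a b; case: k => u v.
  have kE c : (Complex u v) *: c = u%:C *: c + v%:C *: ('i *: c).
    by rewrite scalerA -scalerDl; congr (_ *: _); apply/eqP; rewrite eq_complex /=; apply/andP; split; apply/eqP; lra.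
  have iE c : 'i *: (Complex u v *: c) = u%:C *: ('i *: c) - v%:C *: c.
    rewrite !scalerA -scaleNr -scalerDl; congr (_ *: _).
    by apply/eqP; rewrite eq_complex /=; apply/andP; split; apply/eqP; lra.
  rewrite /g scalerDr iE kE !g1D g1N !g1Z.
  apply/eqP; rewrite eq_complex /=; apply/andP; split; apply/eqP; lra.
have [||k [/andP[k0 k1] gk]] := pure g.
- split=> // a; rewrite /g gi oppr0 -[Complex _ 0]/((g1 _)%:C) ler0c; exact: ge1.
- split=> [k a b|a].
    by rewrite g_lin (flin fp) scalerBr opprD addrACA.
  by rewrite /g gi oppr0 pos// -[Complex _ 0]/((g1 _)%:C) -rmorphB ler0c subr_ge0.
pose t := Re k.
have kt : k = t%:C by exact: ge0C.
have g1f a : g1 a = t * Re (f a).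
  have := congr1 (@complex.Re R) (gk a); rewrite /= kt; case: (f a) => u v /=; lra.
have t0 : 0 <= t by move: k0; rewrite kt ler0c.
have c12 : c1 + c2 <= 1.
  have := up 0 0 1 1 1 ler01; rewrite g10 g20 !mul1r !add0r; apply=> d [Qd _];
    by rewrite (Qz _ Qd) add0r.
have Re_le d (a : A) : state d -> Re (d a) <= nr a.
  move=> ds; apply: le_trans (ler_norm _) _; apply: le_trans (cn_Re _) _.
  exact: state_le.
(* Testing with a contraction [u] such that $f(u)\approx1$ and slack $-1$ shows that the slack
   weight is at least the mass of [g1]. The same for [g2], together with $c_1+c_2\le1$, forces
   equality. *)
have tc1 : t <= c1.
  apply/ler_addgt0Pr => d d0.
  have [u [u1 fu]] := state_near1 fs (divS_gt0 d0 t0).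
  have := up u 0 (-1) 0 0 (lexx _); rewrite g20 g1f mulN1r mul0r !addr0 => h1.
  have : t * Re (f u) - c1 <= 0.
    apply: h1 => w [Qw _]; first by move: (Re_le w u (Qs _ Qw)) u1; clear; lra.
    by rewrite (Qz _ Qw) addr0.
  have : t * (1 - d / (t + 1)) <= t * Re (f u) by rewrite ler_wpM2l.
  have : t * (d / (t + 1)) <= d.
    by rewrite mulrC; exact: divS_mul_le d0 t0.
  by clear; lra.
have tc2 : 1 - t <= c2.
  apply/ler_addgt0Pr => d d0.
  have [u [u1 fu]] := state_near1 fs d0.
  have t1 : t <= 1 by move: k1; rewrite kt -[1]/((1 : R)%:C) lecR.
  have := up 0 u 0 (-1) 0 (lexx _); rewrite g10 g2E g1f mulN1r mul0r addr0 add0r => h1.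
  have : Re (f u) - t * Re (f u) - c2 <= 0.
    apply: h1 => w [Qw _]; last by move: (Re_le w u (Qs _ Qw)) u1; clear; lra.
    by rewrite (Qz _ Qw) addr0.
  have : (1 - t) * (1 - d) <= (1 - t) * Re (f u) by rewrite ler_wpM2l// subr_ge0.
  by move: t1 d0 t0; clear; nra.
have ct : c1 = t by move: tc1 tc2 c12; clear; lra.
(* On [Q1] the expression $-g(h)+f(h)+e$ has nonpositive real part. With slack weight [t] this
   yields $te\le0$, so the far half-space carries no mass of [f]. *)
have tz : t = 0.
  have := up (- h) 0 (Re (f h) + e) 0 0 (lexx _); rewrite g20 g1N g1f ct mul0r !addr0 => h1.
  have : - (t * Re (f h)) + (Re (f h) + e) * t <= 0.
    apply: h1 => w [Qw]; last by rewrite (Qz _ Qw) addr0.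
    by rewrite /far /= gN ?raddfN /=; [clear; lra|exact: Qs].
  by move: e0 t0; clear; nra.
move=> a M M0 hM.
have := up 0 a 0 0 M M0; rewrite g10 g2E g1f tz !mul0r subr0 !addr0 add0r; apply=> w Qw.
  by rewrite (Qz _ Qw.1) add0r.
by rewrite addr0; exact: hM.
Qed.

Lemma dominated_finite f Q (hs : seq A) (e : R) : pure_states f -> (forall g, Q g -> state g) ->
  0 < e -> dominated f Q -> exists2 g, Q g & forall h, h \in hs -> ~ far h f e g.
Proof.
move=> f_pure + e0; elim: hs Q => [|h hs IH] Q Qs dom.
  (* If [Q] is empty, domination with $M=0$ makes the real part of [f] nonpositive on all of [A],
     hence [f] zero. *)
  apply: contrapT => nQ; have fs : state f by case: f_pure.
  have fp : positive_functional f by case: fs.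
  have [a fa] := state_nonzero fs; apply: fa.
  have le0 b : Re (f b) <= 0 by apply: dom => // g Qg; case: nQ; exists g.
  have Re0 b : Re (f b) = 0.
    by apply/le_anti; rewrite le0 /=; have := le0 (- b); rewrite (fN fp) raddfN oppr_le0.
  have := Re0 ('i *: a); have := Re0 a; rewrite (fZ fp).
  case: (f a) => u v /= -> h; congr Complex; lra.
have [||g [Qg ng] hg] := IH [set g | Q g /\ ~ far h f e g].
- by move=> g [/Qs].
- exact: dominated_split.
- by exists g => // h'; rewrite inE => /predU1P[->|]; [|exact: hg].
Qed.

Lemma dominated_closure f Q : pure_states f -> (forall g, Q g -> state g) ->
  dominated f Q -> closure (Q : set {ptws A -> R[i]^o}) f.
Proof.
move=> f_pure Qs dom W fW.
pose basic (s : seq A) (e : R) := [set g : A -> R[i]^o |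
  forall a, a \in s -> cn (g a - f a) < e].
pose N : set_system (A -> R[i]^o) := [set W | exists s e, 0 < e /\ basic s e `<=` W].
have NF : Filter N.
  split.
  - by exists [::], 1; split.
  - move=> U U' [s [e [e0 h]]] [s' [e' [e0' h']]]; exists (s ++ s'), (Num.min e e').
    split; first by rewrite lt_min e0.
    move=> g hg; split.
      by apply: h => a sa; have := hg a; rewrite mem_cat sa lt_min => /(_ isT)/andP[].
    by apply: h' => a sa; have := hg a; rewrite mem_cat sa orbT lt_min => /(_ isT)/andP[].
  - by move=> U U' UU [s [e [e0 h]]]; exists s, e; split=> // g /h; exact: UU.
have /(_ W fW) : {ptws, N --> (f : A -> R[i]^o)}.
  apply/pointwise_cvgP => a U /(@nr_near R R[i]^o (f a) U)[e e0 hU].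
  exists [:: a], e; split=> // g hg /=; apply: hU.
  have := hg a; rewrite inE eqxx => /(_ isT); rewrite cnB; exact.
move=> [s [e [e0 sW]]].
(* The multiples of [a] by $\pm1$ and $\pm i$ bound the real and the imaginary part of $g(a)-f(a)$
   on both sides by $e/2$. *)
pose hs := s ++ [seq - a | a <- s] ++ [seq 'i *: a | a <- s] ++ [seq - 'i *: a | a <- s].
have [g Qg hg] := dominated_finite hs (e := e / 2) f_pure Qs ltac:(lra) dom.
exists g; split=> //; apply: sW => a sa; have [gp _ _] := Qs _ Qg.
have fp : positive_functional f by case: f_pure => -[].
have hE h : h \in hs -> Re (g h) - Re (f h) < e / 2.
  by move=> /hg; rewrite /far /= => /negP; rewrite -ltNge; lra.
have h1 : Re (g a) - Re (f a) < e / 2 by apply: hE; rewrite mem_cat sa.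
have h2 : Re (g (- a)) - Re (f (- a)) < e / 2.
  by apply: hE; rewrite !mem_cat map_f ?orbT.
have h3 : Re (g ('i *: a)) - Re (f ('i *: a)) < e / 2.
  by apply: hE; rewrite !mem_cat (map_f (fun a => 'i *: a)) ?orbT.
have h4 : Re (g (- 'i *: a)) - Re (f (- 'i *: a)) < e / 2.
  by apply: hE; rewrite !mem_cat (map_f (fun a => - 'i *: a)) ?orbT.
move: h1 h2 h3 h4; rewrite !(fN gp) !(fN fp) !(fZ gp) !(fZ fp).
case: (g a) => u v; case: (f a) => u' v' /= h1 h2 h3 h4.
have n1 : `|u - u'| < e / 2.
  by rewrite ltr_norml; apply/andP; split; move: h1 h2; clear; lra.
have n2 : `|v - v'| < e / 2.
  by rewrite ltr_norml; apply/andP; split; move: h3 h4; clear; lra.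
by apply: le_lt_trans (cn_le _) _ => /=; move: n1 n2; clear; lra.
Qed.
End Separation.

(** * From dense trivial isotropy to the almost extension property *)

Section TopologicallyPrincipal.
Variables (R : realType) (G : etale_groupoid) (F : fell_bundle R G).
Hypothesis X_hausdorff : hausdorff_space (gunits G).
Variable A : unit_algebra F.
Variables (Cf Cr B : cstarAlg R) (p : set (section F) -> section F -> Cf).
Hypothesis Cf_full : full_crossed_product p.
Variable E : Cf -> (A -> R[i]^o) -> R[i]^o.
Hypothesis E_exp : canonical_expectation p E.
Variables (L : Cf -> Cr) (q : Cf -> B) (q' : B -> Cr).
Hypothesis L_red : reduced_quotient E L.
Hypothesis q_hom : star_hom q.
Hypothesis q_surj : set_surj setT setT q.
Hypothesis q'q : forall b, q' (q b) = L b.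
Let j (a : A) : B := q (p (@unit_sections R G F) (sec a)).

Lemma topologically_principal_almost_extension :
  dual_topologically_principal A -> almost_extension_property j.
Proof.
move=> D_dense f f_pure; have fs : state f by case: f_pure.
have [x [rho [xr [xi [f_xi cyc]]]]] := pure_class f_pure.
have x1 : nr xi <= 1 by apply: cyclic_norm_le1 cyc _ => b; rewrite -f_xi; exact: state_le.
pose Q := [set g : A -> R[i]^o | exists z sigma (eta : rep_space sigma),
  [/\ trivial_isotropy z, in_class z sigma, nr eta = 1 & g = vector_state eta]].
have Q_unique g : Q g -> uniquely_extendible j g.
  move=> [z [sigma [eta [tz zs e1 ->]]]].
  apply: (trivial_isotropy_unique X_hausdorff Cf_full E_exp L_red q_hom q_surj q'q _ _ tz).
    exact: vector_state_pure (class_irreducible zs) _ e1.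
  by exists sigma; split=> //; exact: vector_gns (class_irreducible zs) _ e1.
have Qs g : Q g -> state g by move=> /Q_unique[[]].
have dom : dominated f Q.
  move=> a M M0 hM; apply: (dense_dominated D_dense fs xr f_xi x1 M0) => z sigma tz zs eta.
  have [->|e0] := eqVneq eta 0; first by rewrite (si0l (ip_si _)) nr0 expr0n mulr0.
  have n0 : 0 < nr eta.
    by rewrite lt_neqAle nr_ge0 andbT eq_sym; apply: contra e0 => /eqP/nr_eq0 ->.
  pose c : R := (nr eta)^-1.
  have c1 : nr (c%:C *: eta) = 1 by rewrite nrZR ?invr_ge0 ?(ltW n0)// mulVf ?gt_eqF.
  have := hM (vector_state (c%:C *: eta)).
  have e : vector_state (c%:C *: eta) a = (c ^+ 2)%:C * ip eta (sigma a eta).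
    rewrite /vector_state repE (siZr (ip_si _)) (siZl (ip_si _)) cjR mulrA -rmorphM //.
  rewrite e => h.
  have {}h : Re ((c ^+ 2)%:C * ip eta (sigma a eta)) <= M.
    by apply: h; exists z, sigma, (c%:C *: eta); split.
  have : c ^+ 2 * Re (ip eta (sigma a eta)) <= M.
    by move: h; case: (ip eta _) => u v /=; rewrite mul0r subr0.
  by rewrite exprVn mulrC ler_pdivrMr// exprn_gt0.
move=> W fW; have [g [Qg Wg]] := dominated_closure f_pure Qs dom fW.
by exists g; split=> //; exact: Q_unique.
Qed.
End TopologicallyPrincipal.

Theorem corollary5p12 (R : realType) (G : etale_groupoid) (F : fell_bundle R G)
  (X_hausdorff : hausdorff_space (gunits G))
  (X_locally_compact : locally_compact [set: gunits G])
  (A : unit_algebra F)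
  (* Cf is C*(G, F) and Cr is C*_r(G, F), with quotient map L *)
  (Cf Cr : cstarAlg R)
  (p : set (section F) -> section F -> Cf)
  (Cf_full : full_crossed_product p)
  (E : Cf -> (A -> R[i]^o) -> R[i]^o)
  (E_expectation : canonical_expectation p E)
  (L : Cf -> Cr)
  (Cr_reduced : reduced_quotient E L)
  (B : cstarAlg R) (q : Cf -> B) (q' : B -> Cr)
  (q_hom : star_hom q) (q_surj : set_surj setT setT q)
  (q'_hom : star_hom q') (q'_surj : set_surj setT setT q')
  (q'_q : forall b, q' (q b) = L b) :
  let j : A -> B := fun a => q (p (@unit_sections R G F) (sec a)) in
  [/\ forall f : A -> R[i]^o, pure_states f ->
        (uniquely_extendible j f <->
         exists x : spectrum A, gns_class f x /\ trivial_isotropy x),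
      extension_property j <-> dual_principal A &
      almost_extension_property j <-> dual_topologically_principal A].
Proof.
move=> j; split.
- move=> f f_pure; split=> [fu|[x [fx tx]]].
    have [x fx] := pure_class f_pure; exists x; split=> //.
    by apply: (unique_trivial_isotropy X_hausdorff Cf_full E_expectation Cr_reduced q_hom
      q_surj q'_q) fx.
  by apply: (trivial_isotropy_unique X_hausdorff Cf_full E_expectation Cr_reduced q_hom
    q_surj q'_q) fx tx.
- by apply: (extension_property_principal X_hausdorff Cf_full E_expectation Cr_reduced
    q_hom q_surj q'_q).
- split; first by apply: (almost_extension_topologically_principal X_hausdorff Cf_full
    E_expectation Cr_reduced q_hom q_surj q'_q).
  by apply: (topologically_principal_almost_extension X_hausdorff Cf_full E_expectation
    Cr_reduced q_hom q_surj q'_q).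
Qed.
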